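(* Assume that for every maximal Abelian subalgebra $\mathfrak a\subset\mathfrak p$ and every $\beta\in\mathfrak a$ the function $\mu_{\mathfrak p}^\beta:M\to\mathbb R$ has a unique local maximum. Let $\nu\in\mathscr P(M)$ be a probability measure which is absolutely continuous with respect to a $\mathrm K$-invariant smooth probability measure $\nu_0\in\mathscr P(M)$, and assume that $0$ belongs to the interior $\Omega(\mu_{\mathfrak p})$ in $\mathfrak p$ of the convex hull $E(\mu_{\mathfrak p})$ of $\mu_{\mathfrak p}(M)$. Then $\mathfrak F(\mathrm G\cdot\nu)=\Omega(\mu_{\mathfrak p})$, and the map $F_\nu:\mathrm G\rightarrow\Omega(\mu_{\mathfrak p})$, $F_\nu(g)=\mathfrak F(g\cdot\nu)$, is a smooth fibration with compact connected fibres diffeomorphic to $\mathrm K$.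
   Context: Setting. $(Z,J,\omega)$ is a compact connected Kähler manifold, $\mathrm U$ is a compact connected Lie group with Lie algebra $\mathfrak u$ and complexification $\mathrm U^{\mathbb C}$, with Cartan decomposition $\mathrm U^{\mathbb C}=\mathrm U\exp(i\mathfrak u)$. $\mathrm U^{\mathbb C}$ acts holomorphically on $Z$, and $\mathrm U$ preserves $\omega$ and acts in a Hamiltonian fashion with $\mathrm U$-equivariant momentum mapping $\mu:Z\to\mathfrak u^*\cong\mathfrak u$ (identification via an $\mathrm{Ad}(\mathrm U)$-invariant scalar product). $B$ is a nondegenerate $\mathrm{Ad}(\mathrm U^{\mathbb C})$-invariant symmetric $\mathbb R$-bilinear form on $\mathfrak u^{\mathbb C}=\mathfrak u\oplus i\mathfrak u$, positive definite on $i\mathfrak u$, negative definite on $\mathfrak u$, with $\mathfrak u\perp i\mathfrak u$; $\langle\cdot,\cdot\rangle$ is its restriction to $i\mathfrak u$. $\mathrm G\subseteq\mathrm U^{\mathbb C}$ is a compatible subgroup, i.e. a closed connected subgroup with $\mathrm G=\mathrm K\exp(\mathfrak p)$, where $\mathrm K=\mathrm G\cap\mathrm U$ and $\mathfrak p=\mathfrak g\cap i\mathfrak u$ is $\mathrm K$-stable. The $\mathrm G$-gradient map $\mu_{\mathfrak p}:Z\to\mathfrak p$ is $-i$ times the orthogonal projection of $\mu$ onto $i\mathfrak p\subset\mathfrak u$; it is $\mathrm K$-equivariant, and conventions are normalized so that for every $\beta\in\mathfrak p$ the fundamental vector field $\beta_Z$, $\beta_Z(z)=\frac{d}{dt}|_{t=0}\exp(t\beta)\cdot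 z$, is the gradient of $\mu_{\mathfrak p}^\beta=\langle\mu_{\mathfrak p},\beta\rangle$ for the Kähler metric determined by $\omega$ and $J$. $M\subset Z$ is a compact $\mathrm G$-stable real submanifold, and $\mu_{\mathfrak p}$ also denotes the restriction to $M$. Measures. $\mathscr P(M)$ is the set of Borel probability measures on $M$ with the weak$^*$ topology; $\mathrm G$ acts on it by pushforward, $g\cdot\nu=g_*\nu$. The gradient map is $\mathfrak F:\mathscr P(M)\to\mathfrak p$, $\mathfrak F(\nu)=\int_M\mu_{\mathfrak p}(x)\,d\nu(x)$. A measure on $M$ is smooth if in any chart it has a smooth positive density with respect to the Lebesgue measure of the chart. Conventions. A function has a ''unique local maximum'' if every local maximum of it is a global maximum. Under the stated assumption it is known that $\mu_{\mathfrak a}(M)$ is a (convex) polytope for each maximal Abelian $\mathfrak a\subset\mathfrak p$, where $\mu_{\mathfrak a}$ is $\mu_{\mathfrak p}$ followed by orthogonal projection onto $\mathfrak a$, and that for each $\beta\in\mathfrak a$ the set of $x\in M$ such that $\lim_{t\to+\infty}\exp(t\beta)\cdot x$ lies in the maximum set of $\mu_{\mathfrak p}^\beta$ is open and dense, with complement a finite union of submanifolds of positive codimension. A smooth fibration is a smooth locally trivial fibre bundle. *)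

(* Defs.v *)
From HB Require Import structures.
From mathcomp Require Import all_boot all_order all_algebra.
From mathcomp Require Import all_classical all_reals all_analysis.

Set Implicit Arguments.
Unset Strict Implicit.
Unset Printing Implicit Defensive.

Import Order.TTheory GRing.Theory Num.Theory.
Import numFieldNormedType.Exports.

Local Open Scope classical_set_scope.
Local Open Scope ring_scope.

#[short(type="topGroupType")]
HB.structure Definition TopGroup := {G of Group G & Topological G}.

Section Smoothness.
Context {R : realType}.

(* C^k on an open subset A of a finite-dimensional space V; the library's
   [differentiable] and ['D_v f] are taken in the ambient space. *)
Fixpoint Ck {V W : normedModType R} (k : nat) (A : set V) (f : V -> W) : Prop :=
  match k with
  | 0 => forall x, A x -> {for x, continuous f}
  | k'.+1 => (forall x, A x -> differentiable f x) /\
             (forall v, Ck k' A (fun x => 'D_v f x))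
  end.

Definition Cinfty {V W : normedModType R} (A : set V) (f : V -> W) : Prop :=
  forall k, Ck k A f.

End Smoothness.

(* A manifold is given by an [atlas] selecting one preferred chart at each
   point.  The tangent space at x is the model space E, a tangent vector being
   identified with its coordinates in the preferred chart at x.  The functions
   of a chart are total; only their values on [cdom] and [cimg] matter. *)
Section Manifolds.
Context {R : realType}.

Record chart (X : topologicalType) (E : normedModType R) := Chart {
  cdom : set X;
  cimg : set E;
  cfun : X -> E;
  cinv : E -> X }.

Definition is_chart (X : topologicalType) (E : normedModType R)
    (c : chart X E) : Prop :=
  [/\ open (cdom c) /\ open (cimg c),
      (forall x, cdom c x -> cimg c (cfun c x) /\ cinv c (cfun c x) = x),
      (forall e, cimg c e -> cdom c (cinv c e) /\ cfun c (cinv c e) = e),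
      (forall x, cdom c x -> {for x, continuous (cfun c)}) &
      (forall e, cimg c e -> {for e, continuous (cinv c)})].

Definition atlas (X : topologicalType) (E : normedModType R) := X -> chart X E.

Definition transition_dom X E (a : atlas X E) (x y : X) : set E :=
  cimg (a x) `&` cinv (a x) @^-1` cdom (a y).

Definition transition X E (a : atlas X E) (x y : X) : E -> E :=
  cfun (a y) \o cinv (a x).

Definition is_manifold X E (a : atlas X E) : Prop :=
  [/\ hausdorff_space X, @second_countable X,
      (forall x, is_chart (a x) /\ cdom (a x) x) &
      (forall x y, Cinfty (transition_dom a x y) (transition a x y))].

Definition vec_atlas (E : normedModType R) : atlas E E :=
  fun=> Chart setT setT id id.

Definition prod_atlas X Y (E F : normedModType R) (a : atlas X E)
    (b : atlas Y F) : atlas (X * Y)%type (E * F)%type := fun p =>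
  Chart (cdom (a p.1) `*` cdom (b p.2)) (cimg (a p.1) `*` cimg (b p.2))
    (fun q => (cfun (a p.1) q.1, cfun (b p.2) q.2))
    (fun e => (cinv (a p.1) e.1, cinv (b p.2) e.2)).

Definition in_charts X Y (E F : normedModType R) (a : atlas X E)
    (b : atlas Y F) (f : X -> Y) (x : X) : E -> F :=
  cfun (b (f x)) \o f \o cinv (a x).

Definition smooth_at X Y (E F : normedModType R) (a : atlas X E)
    (b : atlas Y F) (f : X -> Y) (x : X) : Prop :=
  {for x, continuous f} /\
  exists2 V : set E, open V /\ V (cfun (a x) x) & Cinfty V (in_charts a b f x).

Definition tangent X Y (E F : normedModType R) (a : atlas X E)
    (b : atlas Y F) (f : X -> Y) (x : X) : E -> F :=
  'd (in_charts a b f x) (cfun (a x) x).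

(* Smoothness on an arbitrary subset A, in Milnor's sense: local existence of
   smooth extensions.  On an embedded submanifold this is smoothness for the
   intrinsic structure. *)
Definition smooth_on X Y (E F : normedModType R) (a : atlas X E)
    (b : atlas Y F) (A : set X) (f : X -> Y) : Prop :=
  forall x, A x -> exists2 g : X -> Y,
    smooth_at a b g x & \forall y \near x, A y -> g y = f y.

Definition diffeo X Y (E F : normedModType R) (a : atlas X E) (b : atlas Y F)
    (A : set X) (B : set Y) (f : X -> Y) (g : Y -> X) : Prop :=
  [/\ (forall x, A x -> B (f x) /\ g (f x) = x),
      (forall y, B y -> A (g y) /\ f (g y) = y),
      smooth_on a b A f & smooth_on b a B g].

Definition diffeomorphic X Y (E F : normedModType R) (a : atlas X E)
    (b : atlas Y F) (A : set X) (B : set Y) : Prop :=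
  exists f g, diffeo a b A B f g.

(* A k-dimensional chart phi, with inverse psi, of the subset M near M `&` W. *)
Definition submanifold_chart X (E : normedModType R) (a : atlas X E)
    (M : set X) (k : nat) (W : set X) (V : set 'rV[R]_k)
    (phi : X -> 'rV[R]_k) (psi : 'rV[R]_k -> X) : Prop :=
  [/\ open W, open V & diffeo a (@vec_atlas 'rV[R]_k) (M `&` W) V phi psi].

(* Embedded submanifold; distinct components may have distinct dimensions. *)
Definition submanifold X (E : normedModType R) (a : atlas X E) (M : set X) :=
  forall x, M x -> exists k W V phi psi,
    W x /\ @submanifold_chart X E a M k W V phi psi.

(* Smooth locally trivial bundle f : A -> B; near y it is identified over B
   with the product of a neighbourhood of y and the fibre through y. *)
Definition smooth_fibration X Y (E F : normedModType R) (a : atlas X E)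
    (b : atlas Y F) (A : set X) (B : set Y) (f : X -> Y) : Prop :=
  [/\ smooth_on a b A f, f @` A = B &
      forall y, B y -> exists2 O : set Y, open O /\ O y &
        exists (h : X -> X) (g : Y * X -> X),
          diffeo a (prod_atlas b a) (A `&` f @^-1` O)
            ((B `&` O) `*` (A `&` f @^-1` [set y]))
            (fun x => (f x, h x)) g].

End Manifolds.

(* C^d as a real vector space: (x, y) stands for x + iy. *)
Notation Cn R d := ('rV[R]_d * 'rV[R]_d)%type.

Section Complex.
Context {R : realType}.

Definition Ci {d : nat} (v : Cn R d) : Cn R d := (- v.2, v.1).

Definition is_complex_manifold X d (a : atlas X (Cn R d)) : Prop :=
  is_manifold a /\
  forall x y e v, transition_dom a x y e ->
    'd (transition a x y) e (Ci v) = Ci ('d (transition a x y) e v).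

Definition holomorphic X Y (E F : normedModType R) (JE : E -> E) (JF : F -> F)
    (a : atlas X E) (b : atlas Y F) (f : X -> Y) : Prop :=
  (forall x, smooth_at a b f x) /\
  (forall x v, tangent a b f x (JE v) = JF (tangent a b f x v)).

Definition Cprod {d m : nat} (v : Cn R d * Cn R m) : Cn R d * Cn R m :=
  (Ci v.1, Ci v.2).

Definition bilinear_form (V : lmodType R) (b : V -> V -> R) : Prop :=
  (forall x, scalar (b x)) /\ (forall y, scalar (b ^~ y)).

(* A 2-form in the coordinates of the preferred chart at x. *)
Definition form_in_chart X (E : normedModType R) (a : atlas X E)
    (w : X -> E -> E -> R) (x : X) (e u v : E) : R^o :=
  w (cinv (a x) e) (tangent (@vec_atlas R E) a (cinv (a x)) e u)
    (tangent (@vec_atlas R E) a (cinv (a x)) e v).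

Record is_kaehler Z m (a : atlas Z (Cn R m)) (w : Z -> Cn R m -> Cn R m -> R)
    : Prop := IsKaehler {
  kaehler_complex : is_complex_manifold a;
  kaehler_bilinear : forall z, bilinear_form (w z);
  kaehler_alternating : forall z v, w z v v = 0;
  kaehler_smooth : forall z u v,
    Cinfty (cimg (a z)) (fun e => form_in_chart a w z e u v);
  kaehler_closed : forall z e u v t, cimg (a z) e ->
    'D_u (fun e' => form_in_chart a w z e' v t) e
    + 'D_v (fun e' => form_in_chart a w z e' t u) e
    + 'D_t (fun e' => form_in_chart a w z e' u v) e = 0;
  kaehler_invariant : forall z u v, w z (Ci u) (Ci v) = w z u v;
  kaehler_positive : forall z v, v != 0 -> 0 < w z v (Ci v) }.

Definition kaehler_metric Z m (w : Z -> Cn R m -> Cn R m -> R) (z : Z)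
    (u v : Cn R m) : R := w z u (Ci v).

Definition is_gradient Z m (a : atlas Z (Cn R m))
    (w : Z -> Cn R m -> Cn R m -> R) (f : Z -> R) (X : Z -> Cn R m) : Prop :=
  forall z v, tangent a (@vec_atlas R R^o) f z v = kaehler_metric w z (X z) v.

End Complex.

Section LieGroups.
Context {R : realType}.
Local Open Scope group_scope.

Record is_complex_lie_group (H : topGroupType) d (a : atlas H (Cn R d)) : Prop :=
  IsComplexLieGroup {
  lie_manifold : is_complex_manifold a;
  lie_mul : holomorphic Cprod Ci (prod_atlas a a) a (fun p => p.1 * p.2);
  lie_inv : holomorphic Ci Ci a a (fun x => x^-1) }.

Definition subgroup (H : topGroupType) (A : set H) : Prop :=
  [/\ A 1, (forall x y, A x -> A y -> A (x * y)) & (forall x, A x -> A x^-1)].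

Definition subspace_set (V : lmodType R) (A : set V) : Prop :=
  A 0%R /\ forall (c : R) x y, A x -> A y -> A (c *: x + y)%R.

Section LieAlgebra.
Context (H : topGroupType) (d : nat) (a : atlas H (Cn R d)).

(* The Lie algebra of H is its tangent space at 1, that is Cn R d. *)
Definition one_parameter_subgroup (X : Cn R d) (c : R^o -> H) : Prop :=
  [/\ (forall s t, c (s + t)%R = c s * c t),
      (forall t, smooth_at (@vec_atlas R R^o) a c t) &
      tangent (@vec_atlas R R^o) a c 0%R 1%R = X].

Definition lie_exp (X : Cn R d) : H :=
  xget 1 [set h | exists2 c, one_parameter_subgroup X c & h = c 1%R].

Definition Ad (g : H) (X : Cn R d) : Cn R d :=
  tangent a a (fun h => g * h * g^-1) 1 X.

Definition lie_bracket (X Y : Cn R d) : Cn R d :=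
  'D_1 (fun t : R^o => Ad (lie_exp (t *: X)) Y : Cn R d) 0%R.

(* Lie algebra of a closed subgroup A. *)
Definition lie_alg (A : set H) : set (Cn R d) :=
  [set X | forall t : R, A (lie_exp (t *: X))].

Definition abelian_subalgebra (s : set (Cn R d)) : Prop :=
  subspace_set s /\ forall X Y, s X -> s Y -> lie_bracket X Y = 0%R.

Definition maximal_abelian (p s : set (Cn R d)) : Prop :=
  [/\ abelian_subalgebra s, s `<=` p &
      forall s', abelian_subalgebra s' -> s' `<=` p -> s `<=` s' -> s' = s].

(* H is the universal complexification of its subgroup U. *)
Definition is_complexification (U : set H) : Prop :=
  forall (H' : topGroupType) d' (a' : atlas H' (Cn R d')),
    is_complex_lie_group a' ->
    forall f : H -> H', smooth_on a a' U f ->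
      (forall x y, U x -> U y -> f (x * y) = f x * f y) ->
      exists! h : H -> H',
        [/\ holomorphic Ci Ci a a' h, (forall x y, h (x * y) = h x * h y) &
            (forall x, U x -> h x = f x)].

(* The polar map U x iu -> H, (u, X) |-> u exp(X), is a diffeomorphism. *)
Definition cartan_decomposition (U : set H) : Prop :=
  [/\ (forall X, exists x y,
         [/\ lie_alg U x, lie_alg U y & X = (x + Ci y)%R]),
      (forall x, lie_alg U x -> lie_alg U (Ci x) -> x = 0%R) &
      exists f : H -> H * Cn R d,
        diffeo (prod_atlas a (@vec_atlas R (Cn R d))) a
          (U `*` (Ci @` lie_alg U)) setT (fun q => q.1 * lie_exp q.2) f].

Definition gp_p (U G : set H) : set (Cn R d) :=
  lie_alg G `&` (Ci @` lie_alg U).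

(* Here K is G `&` U. *)
Record is_compatible (U G : set H) : Prop := IsCompatible {
  compatible_subgroup : subgroup G;
  compatible_closed : closed G;
  compatible_connected : connected G;
  compatible_polar :
    G = [set q.1 * lie_exp q.2 | q in (G `&` U) `*` gp_p U G];
  compatible_stable : forall k X,
    (G `&` U) k -> gp_p U G X -> gp_p U G (Ad k X) }.

Record is_admissible_form (U : set H) (B : Cn R d -> Cn R d -> R) : Prop :=
  IsAdmissibleForm {
  form_bilinear : bilinear_form B;
  form_symmetric : forall X Y, B X Y = B Y X;
  form_nondegenerate : forall X, (forall Y, B X Y = 0%R) -> X = 0%R;
  form_invariant : forall g X Y, B (Ad g X) (Ad g Y) = B X Y;
  form_positive : forall X, (Ci @` lie_alg U) X -> X <> 0%R -> (0 < B X X)%R;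
  form_negative : forall X, lie_alg U X -> X <> 0%R -> (B X X < 0)%R;
  form_orthogonal : forall X Y,
    lie_alg U X -> (Ci @` lie_alg U) Y -> B X Y = 0%R }.

(* An Ad(U)-invariant scalar product on Lie(U), presented as a bilinear form on
   Lie(H); its values outside Lie(U) play no role. *)
Record is_invariant_product (U : set H) (s : Cn R d -> Cn R d -> R) : Prop :=
  IsInvariantProduct {
  product_bilinear : bilinear_form s;
  product_symmetric : forall X Y, lie_alg U X -> lie_alg U Y -> s X Y = s Y X;
  product_positive : forall X, lie_alg U X -> X <> 0%R -> (0 < s X X)%R;
  product_invariant : forall u X Y, U u -> lie_alg U X -> lie_alg U Y ->
    s (Ad u X) (Ad u Y) = s X Y }.

End LieAlgebra.

Section Actions.
Context (H : topGroupType) (d : nat) (a : atlas H (Cn R d)).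
Context (Z : topologicalType) (m : nat) (b : atlas Z (Cn R m)).
Variable act : H -> Z -> Z.

Record is_holomorphic_action : Prop := IsHolomorphicAction {
  action1 : forall z, act 1 z = z;
  actionM : forall g h z, act (g * h) z = act g (act h z);
  action_holomorphic :
    holomorphic Cprod Ci (prod_atlas a b) b (fun p => act p.1 p.2) }.

Definition fundamental_field (X : Cn R d) (z : Z) : Cn R m :=
  tangent (@vec_atlas R R^o) b (fun t : R^o => act (lie_exp a (t *: X)) z)
    0%R 1%R.

(* mu takes values in Lie(U), identified with its dual by s.  The sign of the
   momentum equation is the one for which -i times the projection of mu has
   gradient beta_Z for the metric w(u, Jv). *)
Record is_momentum_map (w : Z -> Cn R m -> Cn R m -> R) (U : set H)
    (s : Cn R d -> Cn R d -> R) (mu : Z -> Cn R d) : Prop := IsMomentumMap {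
  momentum_in : forall z, lie_alg a U (mu z);
  momentum_smooth : forall z, smooth_at b (@vec_atlas R (Cn R d)) mu z;
  momentum_equivariant : forall u z, U u -> mu (act u z) = Ad a u (mu z);
  momentum_eq : forall X z v, lie_alg a U X ->
    tangent b (@vec_atlas R R^o) (fun z' => s (mu z') X) z v
    = w z v (fundamental_field X z) }.

Definition preserves_form (w : Z -> Cn R m -> Cn R m -> R) (U : set H) : Prop :=
  forall g z u v, U g ->
    w (act g z) (tangent b b (act g) z u) (tangent b b (act g) z v) = w z u v.

End Actions.

Definition orth_proj d (s : Cn R d -> Cn R d -> R) (V : set (Cn R d))
    (X : Cn R d) : Cn R d :=
  xget 0%R [set Y | V Y /\ forall T, V T -> s (X - Y)%R T = 0%R].

(* -i times the s-orthogonal projection of mu onto ip. *)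
Definition gradient_mu Z d (s : Cn R d -> Cn R d -> R) (p : set (Cn R d))
    (mu : Z -> Cn R d) (z : Z) : Cn R d :=
  (- Ci (orth_proj s (Ci @` p) (mu z)))%R.

End LieGroups.

Section Convexity.
Context {R : realType}.

Definition convex_hull (V : lmodType R) (A : set V) : set V :=
  [set x | forall C : set (convex_lmodType V), convex_set C -> A `<=` C -> C x].

(* Interior of A for the topology induced on p. *)
Definition interior_in (T : topologicalType) (p A : set T) : set T :=
  [set x | p x /\ exists2 O : set T, open O /\ O x & O `&` p `<=` A].

Definition unique_local_maximum (T : topologicalType) (M : set T) (f : T -> R) :=
  forall x, M x -> (\forall y \near x, M y -> f y <= f x) ->
    forall y, M y -> f y <= f x.

End Convexity.

Notation borel T := (g_sigma_algebraType (@open T)).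

Section Measures.
Context {R : realType}.
Local Open Scope ereal_scope.

(* Lebesgue measure on the Borel sets of R^k, by iterated integration. *)
Fixpoint lebesgue_rV (k : nat) : set (borel 'rV[R]_k) -> \bar R :=
  match k with
  | 0 => fun A => (\1_A (0%R : 'rV[R]_0))%:E
  | k'.+1 => fun A => \int[lebesgue_measure]_(x in [set: R])
      lebesgue_rV [set v | A (row_mx (x%:M : 'M[R]_1) v)]
  end.

(* Probability measures on a closed subset M of Z are represented by the
   Borel probability measures on Z giving M mass 1. *)
Definition smooth_measure (Z : ptopologicalType) (E : normedModType R) (a : atlas Z E) (M : set Z)
    (nu : set (borel Z) -> \bar R) : Prop :=
  forall k W V phi psi, @submanifold_chart R Z E a M k W V phi psi ->
    exists rho : 'rV[R]_k -> R^o,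
      [/\ Cinfty V rho, (forall x, V x -> (0 < rho x)%R) &
          forall A : set (borel 'rV[R]_k), measurable A -> A `<=` V ->
            nu (psi @` A) = \int[@lebesgue_rV k]_(x in A) (rho x)%:E].

Definition push (Z : ptopologicalType) (g : Z -> Z)
    (nu : set (borel Z) -> \bar R) : set (borel Z) -> \bar R :=
  pushforward nu (g : borel Z -> borel Z).

Definition invariant_measure (H : topologicalType) (Z : ptopologicalType)
    (act : H -> Z -> Z)
    (K : set H) (nu : set (borel Z) -> \bar R) : Prop :=
  forall k A, K k -> measurable A -> push (act k) nu A = nu A.

Definition integral_Cn (Z : ptopologicalType) d (M : set Z) (f : Z -> Cn R d)
    (nu : set (borel Z) -> \bar R) : Cn R d :=
  (\row_j fine (\int[nu]_(x in (M : set (borel Z))) ((f x).1 ord0 j)%:E),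
   \row_j fine (\int[nu]_(x in (M : set (borel Z))) ((f x).2 ord0 j)%:E)).

End Measures.

(* Main.v *)
(* For X in p the derivative of t |-> <F(exp(tX) g), X> is the nu-average of the squared length
   of the fundamental field X_Z, so everything rests on its positivity for X <> 0.  At a zero z0
   of X_Z, averaging a chart over the isotropy group of z0 in the compact group U conjugates the
   flow of exp(tX) near z0 to a linear flow with symmetric generator.  If z0 is not a local
   maximum of f = <mu_p, X> on M, the points of M near z0 whose trajectory keeps f below f(z0)
   satisfy h = 0 for an unstable linear coordinate h with nonzero differential on M, so they are
   null for every smooth measure.  As every local maximum is global, f tends to its maximum
   along almost every trajectory.  Hence the average is positive, F(G) lies in the interior of
   the hull (described by strict support inequalities), and F(k exp(tX)) leaves every compact
   part of that interior uniformly as t grows, so F is proper.  Moreover v |-> F(exp(v) g) is a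
   local diffeomorphism at 0 on p, uniformly for g in a compact set; writing X(g, y) for the
   small solution of F(exp(X) g) = y, the map g |-> exp(X(g, y0)) g trivialises F near y0.
   Openness, properness and convexity of the interior give surjectivity, and by the polar
   decomposition the fibre over 0 is a single coset K g0. *)

(* The linearisation exchanges X and -iX. Only -iX generates a flow inside the compact group, by
   isometries, so only that flow can be averaged; as the averaged chart is holomorphic,
   multiplication by i turns its skew generator into a symmetric one for the gradient flow of X. The
   chart lives on Z, while M is just a real submanifold with no relation to the eigenspaces; what
   survives on M is one unstable coordinate with nonzero differential, and one equation suffices for
   a null set. Positivity of the average needs both X and -X: a typical fixed point would be a
   maximum and a minimum of f on M at once. A second obstacle is that [lie_exp] has a default value
   and Lie(U) and p are mere sets: one-parameter subgroups and linearity must be extracted from the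
   polar decomposition and, for the directions -iX, from 0 being interior. That assumption also
   singles out the fibre over 0, which is K-stable because Ad(K) fixes 0; other fibres are reached
   by carrying the diffeomorphism type along segments. *)
Require Import Defs.
From HB Require Import structures.
From mathcomp Require Import all_boot all_order all_algebra.
From mathcomp Require Import all_classical all_reals all_analysis.
From mathcomp Require Import ring lra.
Set Implicit Arguments.
Unset Strict Implicit.
Unset Printing Implicit Defensive.

Import Order.TTheory GRing.Theory Num.Theory.
Import numFieldNormedType.Exports.

Local Open Scope classical_set_scope.
Local Open Scope ring_scope.

(** * Calculus of smooth maps *)

(* Square-zero extension of R by V: identities in a module become ring
   identities. *)
Definition sqzero (R : realType) (V : lmodType R) : Type := (R * V)%type.

Section SquareZero.
Context {R : realType} {V : lmodType R}.
Implicit Types x y z : sqzero V.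

HB.instance Definition _ := GRing.Zmodule.on (sqzero V).

Definition sqz_mul x y : sqzero V := (x.1 * y.1, x.1 *: y.2 + y.1 *: x.2).
Definition sqz_one : sqzero V := (1, 0).

Lemma sqz_mulA : associative sqz_mul.
Proof.
move=> x y z; rewrite /sqz_mul; apply: injective_projections; rewrite /= ?mulrA //.
by rewrite !scalerDr !scalerA addrA [z.1 * _]mulrC [z.1 * _]mulrC.
Qed.
Lemma sqz_mulC : commutative sqz_mul.
Proof.
by move=> x y; apply: injective_projections; rewrite /= 1?mulrC 1?addrC.
Qed.
Lemma sqz_mul1 : left_id sqz_one sqz_mul.
Proof.
by move=> x; apply: injective_projections; rewrite /= ?mul1r // scale1r scaler0 addr0.
Qed.
Lemma sqz_mulD : left_distributive sqz_mul +%R.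
Proof.
move=> x y z; apply: injective_projections; rewrite /= ?mulrDl //.
by rewrite scalerDl scalerDr addrACA.
Qed.
Lemma sqz_one_neq0 : sqz_one != 0.
Proof. by apply/eqP => -[/eqP]; rewrite oner_eq0. Qed.

HB.instance Definition _ := GRing.Zmodule_isComNzRing.Build (sqzero V)
  sqz_mulA sqz_mulC sqz_mul1 sqz_mulD sqz_one_neq0.

Definition sqz_vec (v : V) : sqzero V := (0, v).
Definition sqz_scal (a : R) : sqzero V := (a, 0).

Lemma sqz_vec_inj v w : sqz_vec v = sqz_vec w -> v = w.
Proof. by case. Qed.
Lemma sqz_vecD v w : sqz_vec (v + w) = sqz_vec v + sqz_vec w.
Proof. by apply: injective_projections; rewrite //= addr0. Qed.
Lemma sqz_vecN v : sqz_vec (- v) = - sqz_vec v.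
Proof. by apply: injective_projections; rewrite //= oppr0. Qed.
Lemma sqz_vec0 : sqz_vec 0 = 0.
Proof. by []. Qed.
Lemma sqz_vecZ a v : sqz_vec (a *: v) = sqz_scal a * sqz_vec v.
Proof. by apply: injective_projections; rewrite /= ?mulr0 // scale0r addr0. Qed.
Lemma sqz_scalD a b : sqz_scal (a + b) = sqz_scal a + sqz_scal b.
Proof. by apply: injective_projections; rewrite //= addr0. Qed.
Lemma sqz_scalN a : sqz_scal (- a) = - sqz_scal a.
Proof. by apply: injective_projections; rewrite //= oppr0. Qed.
Lemma sqz_scalM a b : sqz_scal (a * b) = sqz_scal a * sqz_scal b.
Proof. by apply: injective_projections; rewrite //= !scaler0 addr0. Qed.
Lemma sqz_scal1 : sqz_scal 1 = 1.
Proof. by []. Qed.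
Lemma sqz_scal0 : sqz_scal 0 = 0.
Proof. by []. Qed.
Definition sqzE := (sqz_vecD, sqz_vecN, sqz_vec0, sqz_vecZ, sqz_scalD, sqz_scalN,
  sqz_scalM, sqz_scal1, sqz_scal0).
End SquareZero.

Ltac module := apply: sqz_vec_inj; rewrite ?sqzE; ring.

Definition mklin (R : pzRingType) (V W : lmodType R) (f : V -> W)
    (lf : linear f) : {linear V -> W} :=
  HB.pack f (GRing.isLinear.Build _ _ _ _ f lf).

Section UnbundledLinear.
Context {R : realType} {V W : lmodType R} (L : V -> W) (lL : linear L).

Lemma lin_add x y : L (x + y) = L x + L y.
Proof. exact: (linearD (mklin lL)). Qed.
Lemma lin_zero : L 0 = 0.
Proof. exact: (linear0 (mklin lL)). Qed.
Lemma lin_scale a x : L (a *: x) = a *: L x.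
Proof. by have := lL a x 0; rewrite !addr0 => ->; rewrite lin_zero addr0. Qed.
Lemma lin_opp x : L (- x) = - L x.
Proof. exact: (linearN (mklin lL)). Qed.
Lemma lin_sub x y : L (x - y) = L x - L y.
Proof. exact: (linearB (mklin lL)). Qed.
Lemma linear_sumE n (c : 'I_n -> R) (b : 'I_n -> V) :
  L (\sum_i c i *: b i) = \sum_i c i *: L (b i).
Proof.
transitivity (\sum_i L (c i *: b i)); first exact: (linear_sum (mklin lL)).
by apply: eq_bigr => i _; exact: lin_scale.
Qed.

End UnbundledLinear.

Lemma lin_comp (R : realType) (V W X : lmodType R) (f : V -> W) (g : W -> X) :
  linear f -> linear g -> linear (g \o f).
Proof. by move=> lf lg a x y; rewrite /= lf lg. Qed.

Lemma lin_addf (R : realType) (V W : lmodType R) (f g : V -> W) :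
  linear f -> linear g -> linear (fun x => f x + g x).
Proof. by move=> lf lg a x y; rewrite lf lg scalerDr addrACA. Qed.

Lemma lin_oppf (R : realType) (V W : lmodType R) (f : V -> W) :
  linear f -> linear (fun x => - f x).
Proof. by move=> lf a x y; rewrite lf opprD scalerN. Qed.

Lemma lin_subf (R : realType) (V W : lmodType R) (f g : V -> W) :
  linear f -> linear g -> linear (fun x => f x - g x).
Proof. by move=> lf lg; apply: lin_addf => //; exact: lin_oppf. Qed.

Lemma lin_id (R : realType) (V : lmodType R) : linear (id : V -> V).
Proof. by []. Qed.

Class FinDim {R : realType} (V : normedModType R) : Prop := finDim :
  exists n (b : 'I_n -> V) (l : 'I_n -> V -> R^o),
    [/\ forall j, linear (l j), forall j, continuous (l j) &
        forall v, v = \sum_j l j v *: b j].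

Section Differential.
Context {R : realType}.
Implicit Types V W : normedModType R.

(** The little-o definition as an explicit estimate for an arbitrary linear candidate [L]; this is
    the form used wherever a differential has to be found rather than composed. *)
Lemma diff_epsP V W (f : V -> W) x (L : V -> W) : linear L -> continuous L ->
  (forall e, 0 < e -> \forall h \near (0 : V),
     `|f (h + x) - f x - L h| <= e * `|h|) <->
  differentiable f x /\ 'd f x = L :> (V -> W).
Proof.
move=> lL cL; pose L' := mklin lL; split=> [H|].
  have E : f \o shift x = cst (f x) + L' +o_ 0 id.
    apply/eqaddoP => e e0; have := H e e0; apply: filterS => h /=.
    by rewrite !fctE /= opprD addrA.
  have dE : 'd f x = L' :> (V -> W) by apply: diff_unique.
  split; last by rewrite dE.
  apply/diff_locallyP; rewrite dE; split => //.
case=> df <- e e0; have [_ /eqaddoP/(_ e e0)] := (diff_locallyP _ _).1 df.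
by apply: filterS => h; rewrite !fctE /= opprD addrA.
Qed.

Lemma diff_lin_fun V W (L : V -> W) x : linear L -> continuous L ->
  differentiable L x /\ 'd L x = L :> (V -> W).
Proof.
move=> lL cL; apply/diff_epsP => // e e0; near=> h.
have -> : L (h + x) = L h + L x by have := lL 1 h x; rewrite !scale1r.
by rewrite addrK subrr normr0 mulr_ge0 // ltW.
Unshelve. all: by end_near. Qed.

Lemma near_differentiable V W (f g : V -> W) x :
  (\forall y \near x, f y = g y) -> differentiable f x ->
  differentiable g x /\ 'd g x = 'd f x :> (V -> W).
Proof.
move=> fg df; have cd := diff_continuous df.
have lin : linear ('d f x) by move=> ???; rewrite linearP.
have /diff_epsP H : differentiable f x /\ 'd f x = 'd f x :> (V -> W) by [].
apply/(diff_epsP _ _ lin) => // e e0.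
have fgx := nbhs_singleton fg.
have fgh : \forall h \near (0 : V), f (h + x) = g (h + x).
  by move: fg; rewrite (near_shift (0 : V) x) /=; apply: filterS => h /=; rewrite subr0.
near=> h; rewrite -fgx -(near fgh h) //; near: h.
exact: H.
Unshelve. all: by end_near. Qed.

End Differential.

Section CkTheory.
Context {R : realType}.
Implicit Types V W X : normedModType R.

Lemma derive_lin V W X (L : W -> X) (f : V -> W) x v : linear L ->
  continuous L -> differentiable f x -> 'D_v (L \o f) x = L ('D_v f x).
Proof.
move=> lL cL df; have [dL dLE] := diff_lin_fun (f x) lL cL.
rewrite deriveE; last exact: differentiable_comp.
by rewrite diff_comp // /comp dLE deriveE.
Qed.

Lemma derive_compE V W X (f : V -> W) (g : W -> X) x v :
  differentiable f x -> differentiable g (f x) ->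
  'D_v (g \o f) x = 'D_('D_v f x) g (f x).
Proof.
move=> df dg; rewrite deriveE; last exact: differentiable_comp.
by rewrite diff_comp //= deriveE // deriveE.
Qed.

Lemma scale_bilinear W : bilinear_for
  (GRing.Scale.Law.clone _ _ *:%R _) (GRing.Scale.Law.clone _ _ *:%R _)
  (fun (k : R^o) (w : W) => k *: w).
Proof.
split=> [w | k] /= a x y; first by rewrite scalerDl scalerA.
by rewrite scalerDr !scalerA mulrC.
Qed.

Lemma diff_scale V W (h : V -> R^o) (f : V -> W) x v :
  differentiable h x -> differentiable f x ->
  differentiable (fun y => h y *: f y) x /\
  'D_v (fun y => h y *: f y) x = 'D_v h x *: f x + h x *: 'D_v f x.
Proof.
move=> dh df.
pose bm := bilinear_isBilinear.Build R R^o W W _ _ _ (scale_bilinear W).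
pose sc : {bilinear R^o -> W -> W} := HB.pack (fun (k : R^o) (w : W) => k *: w) bm.
have csc : continuous (fun p : R^o * W => sc p.1 p.2).
  by move=> p; apply: cvgZ; [exact: cvg_fst|exact: cvg_snd].
have dsc : differentiable (fun p : R^o * W => sc p.1 p.2) (h x, f x).
  exact: differentiable_bilin.
have dp : differentiable (fun y => (h y, f y)) x by exact: differentiable_pair.
have dc := @differentiable_comp _ _ _ _ (fun y => (h y, f y))
             (fun p : R^o * W => sc p.1 p.2) x dp dsc.
split; first exact: dc.
rewrite (deriveE _ dc) (@diff_comp _ _ _ _ (fun y => (h y, f y)) _ x dp dsc).
rewrite diff_bilin //= diff_pair //= !deriveE //= addrC.
by [].
Qed.

Lemma Ck_sub V W k (A B : set V) (f : V -> W) :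
  B `<=` A -> Ck k A f -> Ck k B f.
Proof.
move=> BA; elim: k f => [|k IH] f /=; first by move=> H x /BA /H.
by case=> H1 H2; split=> [x /BA /H1 // | v]; apply: IH.
Qed.

Lemma CkW V W k (A : set V) (f : V -> W) : Ck k.+1 A f -> Ck k A f.
Proof.
elim: k f => [|k IH] f [H1 H2]; first by move=> x /H1 /differentiable_continuous.
by split=> // v; apply: IH; apply: H2.
Qed.

Lemma Ck_le V W k l (A : set V) (f : V -> W) : (l <= k)%N -> Ck k A f -> Ck l A f.
Proof.
move=> /subnK <-; elim: (k - l)%N => // n IH; rewrite addSn => /CkW; exact: IH.
Qed.

Lemma Ck_continuous V W k (A : set V) (f : V -> W) : Ck k A f ->
  forall x, A x -> {for x, continuous f}.
Proof. by move/(@Ck_le _ _ k 0 A f (leq0n k)). Qed.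

Lemma open_near (T : topologicalType) (A : set T) (P : T -> Prop) x :
  open A -> A x -> (forall y, A y -> P y) -> \forall y \near x, P y.
Proof. by move=> oA Ax H; move: (open_nbhs_nbhs (conj oA Ax)); apply: filterS. Qed.

Lemma Ck_ext V W k (A : set V) (f g : V -> W) : open A ->
  (forall x, A x -> f x = g x) -> Ck k A f -> Ck k A g.
Proof.
move=> oA; elim: k f g => [|k IH] f g fg /=.
  move=> H x Ax; have fgx := fg _ Ax.
  rewrite /prop_for /continuous_at -fgx; apply: cvg_trans (H x Ax).
  by apply: near_eq_cvg; apply: open_near oA Ax _.
case=> H1 H2; split=> [x Ax|v].
  have fgx : \forall y \near x, f y = g y by exact: open_near oA Ax _.
  by have [] := near_differentiable fgx (H1 x Ax).
apply: IH (H2 v) => x Ax; apply: near_eq_derive.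
exact: open_near oA Ax _.
Qed.

Lemma Ck_cst V W k (A : set V) (c : W) : Ck k A (fun _ : V => c).
Proof.
elim: k c => [|k IH] c /=; first by move=> x _; exact: cvg_cst.
split=> [x _|v]; first exact: differentiable_cst.
rewrite (_ : 'D_v _ = fun _ => 0); first exact: IH.
by apply/funext => x; rewrite derive_cst.
Qed.

Lemma Ck_lin V W k (A : set V) (L : V -> W) : linear L -> continuous L ->
  Ck k A L.
Proof.
move=> lL cL; case: k => [|k] /=; first by move=> x _; exact: cL.
split=> [x _|v]; first by have [] := diff_lin_fun x lL cL.
rewrite (_ : (fun x => _) = fun _ => L v); first exact: Ck_cst.
by apply/funext => x; have [dL dE] := diff_lin_fun x lL cL; rewrite deriveE // dE.
Qed.

Lemma Ck_add V W k (A : set V) (f g : V -> W) : open A ->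
  Ck k A f -> Ck k A g -> Ck k A (fun x => f x + g x).
Proof.
move=> oA; elim: k f g => [|k IH] f g /=.
  by move=> Hf Hg x Ax; apply: cvgD; [exact: Hf|exact: Hg].
case=> f1 f2 [g1 g2]; split=> [x Ax|v].
  by apply: differentiableD; [exact: f1|exact: g1].
apply: (Ck_ext (f := fun x => 'D_v f x + 'D_v g x)) => //; last exact: IH.
by move=> x Ax; rewrite deriveD //; apply: diff_derivable; auto.
Qed.

Lemma Ck_scale V W k (A : set V) (h : V -> R^o) (f : V -> W) : open A ->
  Ck k A h -> Ck k A f -> Ck k A (fun x => h x *: f x).
Proof.
move=> oA; elim: k h f => [|k IH] h f.
  by move=> Hh Hf x Ax; apply: cvgZ; [exact: Hh|exact: Hf].
move=> Hh Hf; have [h1 h2] := Hh; have [f1 f2] := Hf; split=> [x Ax|v].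
  by have [] := diff_scale 0 (h1 x Ax) (f1 x Ax).
apply: (Ck_ext (f := fun x => 'D_v h x *: f x + h x *: 'D_v f x)) => //.
  by move=> x Ax; have [_ ->] := diff_scale v (h1 x Ax) (f1 x Ax).
apply: Ck_add => //; apply: IH; [exact: h2|exact: CkW Hf|exact: CkW Hh|exact: f2].
Qed.

Lemma Ck_lincomp V W X k (A : set V) (L : W -> X) (f : V -> W) : open A ->
  linear L -> continuous L -> Ck k A f -> Ck k A (L \o f).
Proof.
move=> oA lL cL; elim: k f => [|k IH] f /=.
  by move=> H x Ax; apply: continuous_comp; [exact: H|exact: cL].
case=> f1 f2; split=> [x Ax|v].
  apply: differentiable_comp; first exact: f1.
  by have [] := diff_lin_fun (f x) lL cL.
apply: (Ck_ext (f := L \o 'D_v f)) => //; last exact: IH.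
by move=> x Ax; rewrite derive_lin //; exact: f1.
Qed.

Lemma Ck_sum V W k (A : set V) I (r : seq I) (P : pred I) (f : I -> V -> W) :
  open A -> (forall i, Ck k A (f i)) -> Ck k A (fun x => \sum_(i <- r | P i) f i x).
Proof.
move=> oA H; elim: r => [|i r IH].
  rewrite (_ : (fun x => _) = fun _ => 0); first exact: Ck_cst.
  by apply/funext => x; rewrite big_nil.
have [Pi|Pi] := boolP (P i).
  rewrite (_ : (fun x => _) = fun x => f i x + \sum_(i <- r | P i) f i x).
    exact: Ck_add.
  by apply/funext => x; rewrite big_cons Pi.
rewrite (_ : (fun x => _) = fun x => \sum_(i <- r | P i) f i x) //.
by apply/funext => x; rewrite big_cons (negbTE Pi).
Qed.

Lemma pairl_linear V W : linear (fun v : V => (v, 0) : V * W).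
Proof. by move=> a x y; apply: injective_projections => //=; rewrite scaler0 addr0. Qed.
Lemma pairr_linear V W : linear (fun w : W => (0, w) : V * W).
Proof. by move=> a x y; apply: injective_projections => //=; rewrite scaler0 addr0. Qed.
Lemma pairl_continuous V W : continuous (fun v : V => (v, 0) : V * W).
Proof. by move=> x; apply: cvg_pair => /=; [exact: cvg_id|exact: cvg_cst]. Qed.
Lemma pairr_continuous V W : continuous (fun w : W => (0, w) : V * W).
Proof. by move=> x; apply: cvg_pair => /=; [exact: cvg_cst|exact: cvg_id]. Qed.

Lemma Ck_pair V W X k (A : set V) (f : V -> W) (g : V -> X) : open A ->
  Ck k A f -> Ck k A g -> Ck k A (fun x => (f x, g x)).
Proof.
move=> oA Hf Hg.
apply: (Ck_ext (f := fun x => (f x, 0) + (0, g x))) => //.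
  by move=> x _; apply: injective_projections => /=; rewrite ?addr0 ?add0r.
apply: Ck_add => //.
- exact: (Ck_lincomp oA (@pairl_linear W X) (@pairl_continuous W X) Hf).
- exact: (Ck_lincomp oA (@pairr_linear W X) (@pairr_continuous W X) Hg).
Qed.

(** [Ck] controls derivatives in constant directions only, while the chain rule gives the derivative
    of [g] in the moving direction ['D_v f x]. Expanding that direction in finitely many coordinates
    leaves scalar multiples of derivatives in constant directions, hence [FinDim W]. *)
Lemma Ck_comp V W X {fW : FinDim W} k (A : set V) (B : set W)
    (f : V -> W) (g : W -> X) : open A -> open B ->
  (forall x, A x -> B (f x)) -> Ck k A f -> Ck k B g -> Ck k A (g \o f).
Proof.
move=> oA oB AB; have [n [b [l [ll cl lE]]]] := fW.
elim: k g => [|k IH] g.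
  by move=> Hf Hg x Ax; apply: continuous_comp; [exact: Hf|exact: Hg (AB _ Ax)].
move=> Hf Hg; have [f1 f2] := Hf; have [g1 g2] := Hg; split=> [x Ax|v].
  by apply: differentiable_comp; [exact: f1|exact: g1 (AB _ Ax)].
apply: (Ck_ext (f := fun x => \sum_j l j ('D_v f x) *: 'D_(b j) g (f x))) => //.
  move=> x Ax; rewrite derive_compE; [|exact: f1|exact: g1 (AB _ Ax)].
  rewrite [in RHS](lE ('D_v f x)).
  have dg := g1 _ (AB _ Ax).
  rewrite [RHS](deriveE _ dg) linear_sum.
  by apply: eq_bigr => j _; rewrite linearZ (deriveE _ dg).
apply: Ck_sum => // j; apply: Ck_scale => //.
  exact: (Ck_lincomp oA (ll j) (cl j) (f2 v)).
by apply: (IH ('D_(b j) g)); [exact: CkW | exact: g2].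
Qed.

End CkTheory.

Section CinftyTheory.
Context {R : realType}.
Implicit Types V W X : normedModType R.

Lemma Cinfty_diff V W (A : set V) (f : V -> W) x :
  Cinfty A f -> A x -> differentiable f x.
Proof. by move=> /(_ 1%N) [H _]; exact: H. Qed.

Lemma Cinfty_derive V W (A : set V) (f : V -> W) v :
  Cinfty A f -> Cinfty A ('D_v f).
Proof. by move=> H k; have [_ /(_ v)] := H k.+1. Qed.

(** Has the shape of the chart condition in [smooth_at], so that the two convert into each other. *)
Definition smooth_near V W (f : V -> W) (x : V) :=
  exists2 A : set V, open A /\ A x & Cinfty A f.

Lemma smooth_near_diff V W (f : V -> W) x : smooth_near f x -> differentiable f x.
Proof. by case=> A [_ Ax] /Cinfty_diff; apply. Qed.

Lemma smooth_near_cont V W (f : V -> W) x : smooth_near f x -> {for x, continuous f}.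
Proof. by move=> /smooth_near_diff /differentiable_continuous. Qed.

Lemma smooth_near_derive V W (f : V -> W) v x :
  smooth_near f x -> smooth_near ('D_v f) x.
Proof. by case=> A oA /Cinfty_derive H; exists A. Qed.

Lemma smooth_near_near V W (f : V -> W) x :
  smooth_near f x -> \forall y \near x, smooth_near f y.
Proof.
by case=> A [oA Ax] H; apply: (open_near oA Ax) => y Ay; exists A.
Qed.

Lemma near_open (T : topologicalType) (P : T -> Prop) x :
  (\forall y \near x, P y) -> exists2 A : set T, open A /\ A x & A `<=` P.
Proof.
by move=> H; exists (P^°); [split; [exact: open_interior|]|exact: interior_subset].
Qed.

Lemma smooth_near_ext V W (f g : V -> W) x :
  (\forall y \near x, f y = g y) -> smooth_near f x -> smooth_near g x.
Proof.
move=> /near_open [B [oB Bx] fg] [A [oA Ax] H].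
exists (A `&` B) => [|k]; first by split; [exact: openI|].
apply: (Ck_ext (f := f)) => [|y [_ /fg] //|]; first exact: openI.
by apply: Ck_sub (H k) => y [].
Qed.

Lemma smooth_near_cst V W (c : W) (x : V) : smooth_near (fun _ => c) x.
Proof. by exists setT => [|k]; [split=> //; exact: openT|exact: Ck_cst]. Qed.

Lemma smooth_near_lin V W (L : V -> W) x : linear L -> continuous L ->
  smooth_near L x.
Proof.
by move=> lL cL; exists setT => [|k]; [split=> //; exact: openT|exact: Ck_lin].
Qed.

Lemma smooth_near_id V (x : V) : smooth_near id x.
Proof. by apply: smooth_near_lin => //; move=> ?; exact: cvg_id. Qed.

Lemma smooth_near2 V W X (Y : normedModType R) (op : (V -> W) -> (V -> X) -> V -> Y) f g x :
  (forall k A, open A -> Ck k A f -> Ck k A g -> Ck k A (op f g)) ->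
  smooth_near f x -> smooth_near g x -> smooth_near (op f g) x.
Proof.
move=> H [A [oA Ax] HA] [B [oB Bx] HB]; exists (A `&` B) => [|k].
  by split; [exact: openI|].
by apply: H; [exact: openI|apply: Ck_sub (HA k) => y []|apply: Ck_sub (HB k) => y []].
Qed.

Lemma smooth_near_add V W (f g : V -> W) x :
  smooth_near f x -> smooth_near g x -> smooth_near (fun y => f y + g y) x.
Proof. by apply: (smooth_near2 (op := fun f g y => f y + g y)) => *; exact: Ck_add. Qed.

Lemma smooth_near_scale V W (h : V -> R^o) (f : V -> W) x :
  smooth_near h x -> smooth_near f x -> smooth_near (fun y => h y *: f y) x.
Proof.
apply: (smooth_near2 (op := fun (h : V -> R^o) (f : V -> W) y => h y *: f y)).
by move=> *; exact: Ck_scale.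
Qed.

Lemma smooth_near_mul V (h f : V -> R^o) x :
  smooth_near h x -> smooth_near f x -> smooth_near (fun y => (h y * f y) : R^o) x.
Proof. exact: smooth_near_scale. Qed.

Lemma smooth_near_pair V W X (f : V -> W) (g : V -> X) x :
  smooth_near f x -> smooth_near g x -> smooth_near (fun y => (f y, g y)) x.
Proof. by apply: (smooth_near2 (op := fun f g y => (f y, g y))) => *; exact: Ck_pair. Qed.

Lemma smooth_near_sum V W n (f : 'I_n -> V -> W) x :
  (forall i, smooth_near (f i) x) -> smooth_near (fun y => \sum_i f i y) x.
Proof.
elim: n f => [|n IH] f H.
  rewrite (_ : (fun y => _) = fun=> 0); first exact: smooth_near_cst.
  by apply/funext => y; rewrite big_ord0.
rewrite (_ : (fun y => _) = fun y => f ord0 y + \sum_i f (lift ord0 i) y).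
  by apply: smooth_near_add => //; apply: IH.
by apply/funext => y; rewrite big_ord_recl.
Qed.

Lemma smooth_near_comp V W X {fW : FinDim W} (f : V -> W) (g : W -> X) x :
  smooth_near f x -> smooth_near g (f x) -> smooth_near (g \o f) x.
Proof.
move=> [A [oA Ax] HA] [B [oB Bx] HB].
have /near_open [C [oC Cx] CB] : \forall y \near x, B (f y).
  by apply: (Ck_continuous (HA 0%N) Ax); exact: open_nbhs_nbhs.
exists (A `&` C) => [|k]; first by split; [exact: openI|].
apply: (Ck_comp (B := B)) => //; first exact: openI.
- by move=> y [_ /CB].
- by apply: Ck_sub (HA k) => y [].
Qed.

End CinftyTheory.

(** * Finite-dimensional normed spaces *)

Section FinDimInstances.
Context {R : realType}.

Global Instance FinDim_R : FinDim (R^o : normedModType R).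
Proof.
exists 1%N, (fun=> 1), (fun _ x => x); split=> //.
- by move=> _ x; exact: cvg_id.
- by move=> v; rewrite big_ord1 /GRing.scale /= mulr1.
Qed.

Global Instance FinDim_rV n : FinDim ('rV[R]_n : normedModType R).
Proof.
exists n, (delta_mx 0), (fun j (v : 'rV[R]_n) => v 0 j : R^o); split.
- by move=> j a x y; rewrite !mxE.
- by move=> j v; exact: coord_continuous.
- by move=> v; rewrite -row_sum_delta.
Qed.

Global Instance FinDim_prod (V W : normedModType R) (fV : FinDim V)
  (fW : FinDim W) : FinDim (V * W)%type.
Proof.
have [n [b [l [ll cl lE]]]] := fV; have [p [c [m [lm cm mE]]]] := fW.
pose bb (j : 'I_(n + p)) : V * W := match fintype.split j with inl i => (b i, 0) | inr i => (0, c i) end.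
pose ll' (j : 'I_(n + p)) (v : V * W) : R^o := match fintype.split j with inl i => l i v.1 | inr i => m i v.2 end.
exists (n + p)%N, bb, ll'; rewrite /bb /ll'; split.
- by move=> j; case: (fintype.split j) => i a x y /=; [exact: ll|exact: lm].
- move=> j; case: (fintype.split j) => i x.
    by apply: (continuous_comp (g := l i)); [exact: cvg_fst|exact: cl].
  by apply: (continuous_comp (g := m i)); [exact: cvg_snd|exact: cm].
- move=> [v w]; rewrite big_split_ord /=.
  under eq_bigr do rewrite (unsplitK (inl _)) /=.
  under [X in _ + X]eq_bigr do rewrite (unsplitK (inr _)) /=.
  have -> : \sum_(i < n) l i v *: (b i, 0 : W) = (\sum_(i < n) l i v *: b i, 0).
    apply: esym; rewrite -[LHS]/((fun x : V => (x, 0 : W)) _).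
    exact: (linear_sumE (@pairl_linear R V W)).
  have -> : \sum_(i < p) m i w *: (0 : V, c i) = (0, \sum_(i < p) m i w *: c i).
    apply: esym; rewrite -[LHS]/((fun x : W => (0 : V, x)) _).
    exact: (linear_sumE (@pairr_linear R V W)).
  by apply: injective_projections => /=; rewrite ?addr0 ?add0r; [exact: lE|exact: mE].
Qed.

End FinDimInstances.

Section FinDimTheory.
Context {R : realType}.
Implicit Types V W : normedModType R.

Lemma findim_linear_continuous V W {fV : FinDim V} (L : V -> W) :
  linear L -> continuous L.
Proof.
have [n [b [l [ll cl lE]]]] := fV => lL.
have -> : L = fun v => \sum_j l j v *: L (b j).
  by apply/funext => v; rewrite {1}(lE v) linear_sumE.
move=> v; apply: smooth_near_cont; apply: smooth_near_sum => j.
by apply: smooth_near_scale; [exact: smooth_near_lin|exact: smooth_near_cst].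
Qed.

Lemma linear_bound V W {fV : FinDim V} (L : V -> W) : linear L ->
  exists2 k, 0 < k & forall v, `|L v| <= k * `|v|.
Proof.
move=> lL; apply: (@linear_lipschitz _ _ _ (mklin lL)).
exact: findim_linear_continuous.
Qed.

Lemma smooth_near_linear V W {fV : FinDim V} (L : V -> W) x :
  linear L -> smooth_near L x.
Proof. by move=> lL; apply: smooth_near_lin => //; exact: findim_linear_continuous. Qed.

(** [V] is a retract of a space of row vectors; [ofv \o tov] is only a projection, as the
    coordinates given by [FinDim] may be dependent. *)
Lemma findim_coords V {fV : FinDim V} :
  exists n (tov : 'rV[R]_n -> V) (ofv : V -> 'rV[R]_n),
    [/\ linear tov, linear ofv & cancel ofv tov].
Proof.
have [n [b [l [ll cl lE]]]] := fV.
exists n, (fun u : 'rV[R]_n => \sum_j u 0 j *: b j), (fun v => \row_j l j v); split.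
- move=> a x y; rewrite /= scaler_sumr -big_split; apply: eq_bigr => i _ /=.
  by rewrite !mxE scalerDl scalerA.
- by move=> a x y; apply/rowP => j; rewrite !mxE; exact: (linearP (mklin (ll j))).
- by move=> v; rewrite {2}(lE v); apply: eq_bigr => j _; rewrite mxE.
Qed.

Lemma bounded_setP V (A : set V) M : (forall x, A x -> `|x| <= M) -> bounded_set A.
Proof.
move=> H; exists M; split; first exact: num_real.
by move=> N MN x /= /H /le_trans; apply; exact: ltW.
Qed.

(** Heine-Borel for row vectors, carried over by the retraction: [A] is closed in the image under
    [tov] of a large ball. *)
Lemma findim_compact V {fV : FinDim V} (A : set V) M :
  (forall x, A x -> `|x| <= M) -> closed A -> compact A.
Proof.
have [n [tov [ofv [tovl ofvl ofvK]]]] := findim_coords.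
move=> AM0 cA; have [k k0 kE] := linear_bound ofvl.
pose N := `|M| + 1; have N0 : 0 < N by rewrite /N ltr_pwDr.
have AM x : A x -> `|x| <= N.
  by move=> /AM0 h; rewrite (le_trans h) // /N (le_trans (ler_norm M)) // lerDl.
have ctov : continuous tov by exact: findim_linear_continuous.
have cB : compact (closed_ball (0 : 'rV[R]_n) (k * N)).
  apply: bounded_closed_compact; last exact: closed_ball_closed.
  apply: (bounded_setP (M := k * N)) => x.
  by rewrite closed_ballE ?mulr_gt0 // /closed_ball_ /= sub0r normrN.
apply: (@subclosed_compact _ A (tov @` (closed_ball (0 : 'rV[R]_n) (k * N)))) => //.
  by apply: continuous_compact => //; exact: continuous_subspaceT.
move=> x Ax; exists (ofv x); last exact: ofvK.
rewrite closed_ballE ?mulr_gt0 // /closed_ball_ /= sub0r normrN.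
by apply: le_trans (kE _) _; rewrite ler_pM2l //; exact: AM.
Qed.

Lemma findim_closed_ball_compact V {fV : FinDim V} (x : V) r :
  compact (closed_ball x r).
Proof.
have [r0|r0] := ltP 0 r; last first.
  by rewrite closed_ball0 //; exact: compact0.
apply: (findim_compact (M := `|x| + r)); last exact: closed_ball_closed.
move=> y; rewrite closed_ballE // /closed_ball_ /= => xy.
by rewrite -[y](subKr x) (le_trans (ler_normB _ _)) // lerD2l.
Qed.

End FinDimTheory.

(** * The implicit function theorem *)

Section StrictDifferentiability.
Context {R : realType}.
Implicit Types V W : normedModType R.

Lemma mean_value_segment V (f : V -> R^o) x h :
  (forall t : R, 0 <= t <= 1 -> differentiable f (x + t *: h)) ->
  exists2 t : R, 0 <= t <= 1 & f (x + h) - f x = 'd f (x + t *: h) h.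
Proof.
move=> df; pose g (t : R^o) : R^o := f (x + t *: h).
have lg (t : R^o) : is_diff t (fun t : R^o => x + t *: h) (fun t => t *: h).
  have -> : (fun t : R^o => t *: h) = (fun _ => 0) + (fun t : R^o => t *: h).
    by apply/funext => u; rewrite !fctE add0r.
  exact: is_diffD.
have dg (t : R^o) : 0 <= t <= 1 -> differentiable g t /\ 'd g t 1 = 'd f (x + t *: h) h.
  move=> t01; have dft := df _ t01.
  have dlt : differentiable (fun t : R^o => x + t *: h) t by [].
  split; first exact: (differentiable_comp dlt dft).
  rewrite (diff_comp dlt dft) /= diff_val scale1r //.
have [] := @MVT_segment R g (fun t => 'd f (x + t *: h) h) 0 1 ler01.
- move=> t /[!in_itv] /= /andP[t0 t1].
  have t01 : 0 <= t <= 1 by rewrite !ltW.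
  have [dgt E] := dg t t01; split; first exact: diff_derivable.
  by rewrite deriveE.
- apply: derivable_within_continuous => t /[!in_itv] /= t01.
  by apply: diff_derivable; have [] := dg t t01.
move=> t /[!in_itv] /= t01 E; exists t => //.
by move: E; rewrite /g scale1r scale0r addr0 subr0 mulr1.
Qed.

Lemma coord_bound V n (b : 'I_n -> V) (l : 'I_n -> V -> R^o) :
  (forall j, linear (l j)) -> (forall j, continuous (l j)) ->
  exists2 k, 0 < k & forall v, \sum_j `|l j v| <= k * `|v|.
Proof.
move=> ll cl.
have H j : exists k, 0 < k /\ forall v, `|l j v| <= k * `|v|.
  by have [k k0 kE] := linear_lipschitz (f := mklin (ll j)) (cl j); exists k.
have [k kP] := choice H; exists (1 + \sum_j k j).
  by rewrite ltr_pwDl // sumr_ge0 // => j _; rewrite ltW //; case: (kP j).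
move=> v; rewrite mulrDl mul1r mulr_suml ler_wpDl // ler_sum // => j _.
by case: (kP j).
Qed.

Lemma segment_in_ball V (x y x0 : V) (d t : R) : `|x - x0| < d -> `|y - x0| < d ->
  0 <= t <= 1 -> `|x + t *: (y - x) - x0| < d.
Proof.
move=> xd yd /andP[t0 t1].
have -> : x + t *: (y - x) - x0 = (1 - t) *: (x - x0) + t *: (y - x0).
  have -> : y - x = (y - x0) - (x - x0) by rewrite opprB addrA subrK.
  rewrite addrAC scalerBl scale1r; move: (x - x0) (y - x0) => u w.
  by rewrite scalerBr addrA addrAC.
apply: le_lt_trans (ler_normD _ _) _; rewrite !normrZ (ger0_norm t0) ger0_norm ?subr_ge0 //.
have [->|tn0] := eqVneq t 0; first by rewrite subr0 mul1r mul0r addr0.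
have tp : 0 < t by rewrite lt_def tn0.
have -> : d = (1 - t) * d + t * d by ring.
by rewrite ler_ltD // ?ler_wpM2l ?subr_ge0 ?(ltW xd) // ltr_pM2l.
Qed.

(** The increment is the differential at an intermediate point, by the mean value theorem, and near
    [x0] the derivatives along the finitely many [b j] differ from those at [x0] by at most e / k,
    where k bounds the sum of the coordinates. *)
Lemma strict_diff_R V {fV : FinDim V} (f : V -> R^o) (A : set V) x0 e :
  open A -> A x0 -> Ck 1 A f -> 0 < e ->
  exists2 d, 0 < d & forall x y, `|x - x0| < d -> `|y - x0| < d ->
    `|f y - f x - 'd f x0 (y - x)| <= e * `|y - x|.
Proof.
have [n [b [l [ll cl lE]]]] := fV => oA Ax0 [df cf] e0.
have [k k0 kE] := coord_bound b ll cl.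
have ek0 : 0 < e / k by rewrite divr_gt0.
have N : \forall z \near x0, A z /\ forall j, `|'D_(b j) f z - 'D_(b j) f x0| < e / k.
  apply: filterI; first exact: open_nbhs_nbhs.
  apply: filter_forall => j.
  have /cvgrPdist_lt /(_ _ ek0) := cf (b j) x0 Ax0.
  by apply: filterS => z; rewrite distrC.
have [d /= d0 dP] := (nbhs_ballP _ _).1 N.
exists d => // x y xd yd.
have seg (t : R) := segment_in_ball (t := t) xd yd.
have PA z : `|z - x0| < d -> A z /\ forall j, `|'D_(b j) f z - 'D_(b j) f x0| < e / k.
  by move=> h; apply: dP; rewrite -ball_normE /ball_ /= distrC.
have [t t01 E] := @mean_value_segment V f x (y - x) (fun t t01 => df _ (PA _ (seg t t01)).1).
rewrite [x + _]addrC subrK in E; rewrite E.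
have [Az Dz] := PA _ (seg t t01); set z := x + t *: (y - x) in Az Dz *.
have dE z' : differentiable f z' -> 'd f z' (y - x) = \sum_j l j (y - x) *: 'D_(b j) f z'.
  move=> dz'; rewrite {1}(lE (y - x)) linear_sumE; last by move=> ???; rewrite linearP.
  by apply: eq_bigr => j _; rewrite deriveE.
rewrite !dE; [|exact: df|exact: df].
rewrite -sumrB.
apply: le_trans (ler_norm_sum _ _ _) _.
apply: (@le_trans _ _ (\sum_j `|l j (y - x)| * (e / k))).
  by apply: ler_sum => j _; rewrite -scalerBr normrZ ler_wpM2l // ltW.
rewrite -mulr_suml mulrA ler_pdivrMr // mulrC -mulrA ler_wpM2l //; first exact: ltW.
by rewrite mulrC kE.
Qed.

Lemma strict_diff V W {fV : FinDim V} {fW : FinDim W} (f : V -> W) (A : set V) x0 e :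
  open A -> A x0 -> Ck 1 A f -> 0 < e ->
  exists2 d, 0 < d & forall x y, `|x - x0| < d -> `|y - x0| < d ->
    `|f y - f x - 'd f x0 (y - x)| <= e * `|y - x|.
Proof.
have [n [b [l [ll cl lE]]]] := fW => oA Ax0 Hf e0.
pose K := 1 + \sum_j `|b j|.
have K0 : 0 < K by rewrite /K ltr_pwDl // sumr_ge0.
have H j : exists d, 0 < d /\ forall x y, `|x - x0| < d -> `|y - x0| < d ->
    `|l j (f y) - l j (f x) - l j ('d f x0 (y - x))| <= e / K * `|y - x|.
  have eK : 0 < e / K by rewrite divr_gt0.
  have [d d0 dP] := @strict_diff_R V fV (l j \o f) A x0 _ oA Ax0
     (Ck_lincomp oA (ll j) (cl j) Hf) eK.
  exists d; split => // x y xd yd; have := dP x y xd yd.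
  have [dl lE'] := diff_lin_fun (f x0) (ll j) (cl j).
  rewrite diff_comp //; last by have [H1 _] := Hf; exact: H1.
  by rewrite /= lE'.
have [d dP] := choice H.
have dd0 j : 0 < d j by case: (dP j).
have [d' d'0 d'P] : exists2 d', 0 < d' & forall j, d' <= d j.
  elim: n d dd0 {l ll cl lE K K0 H dP b} => [|n IH] d dd0.
    by exists 1 => // -[].
  have [d' d'0 d'P] := IH (fun j => d (lift ord0 j)) (fun j => dd0 _).
  exists (Order.min (d ord0) d'); first by rewrite lt_min dd0.
  move=> j; rewrite ge_min; case: (unliftP ord0 j) => [i|] ->; last by rewrite lexx.
  by rewrite d'P orbT.
exists d' => // x y xd yd.
set w := f y - f x - _.
have lw j : `|l j w| <= e / K * `|y - x|.
  rewrite /w !(lin_sub (ll j)); have [_] := dP j; apply.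
    exact: lt_le_trans xd (d'P j).
  exact: lt_le_trans yd (d'P j).
rewrite (lE w); apply: le_trans (ler_norm_sum _ _ _) _.
apply: (@le_trans _ _ (\sum_j (e / K * `|y - x|) * `|b j|)).
  by apply: ler_sum => j _; rewrite normrZ ler_wpM2r.
rewrite -mulr_sumr mulrAC ler_wpM2r // mulrAC ler_pdivrMr // ler_wpM2l ?ltW //.
by rewrite /K ltrDr.
Qed.

End StrictDifferentiability.

(** * Linear equations depending smoothly on parameters *)

Section LinearInverse.
Context {R : realType}.
Implicit Types V W P : normedModType R.

Lemma mulmx_rowE n (u : 'rV[R]_n) (M : 'M[R]_n) (f : 'rV[R]_n -> 'rV[R]_n) :
  linear f -> (forall i j, M i j = f (delta_mx 0 i) 0 j) -> u *m M = f u.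
Proof.
move=> lf ME; rewrite [in RHS](row_sum_delta u) (linear_sumE lf).
apply/rowP => j; rewrite !mxE summxE; apply: eq_bigr => i _.
by rewrite !mxE ME.
Qed.

Lemma row_inj_unitmx n (M : 'M[R]_n) :
  (forall u : 'rV[R]_n, u *m M = 0 -> u = 0) -> M \in unitmx.
Proof.
move=> H; rewrite -row_free_unit -kermx_eq0; apply/eqP/row_matrixP => i.
by rewrite row0; apply: H; rewrite -row_mul mulmx_ker row0.
Qed.

Lemma Ck_rVP V n k (A : set V) (f : V -> 'rV[R]_n) : open A ->
  (forall j, Ck k A (fun x => f x 0 j : R^o)) -> Ck k A f.
Proof.
move=> oA H; apply: (Ck_ext (f := fun x => \sum_j (f x 0 j : R^o) *: delta_mx 0 j)) => //.
  by move=> x _; rewrite -row_sum_delta.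
by apply: Ck_sum => // j; apply: Ck_scale => //; exact: Ck_cst.
Qed.

Lemma Ck_mul V k (A : set V) (f g : V -> R^o) : open A ->
  Ck k A f -> Ck k A g -> Ck k A (fun x => f x * g x : R^o).
Proof. exact: Ck_scale. Qed.

Lemma Ck_prod V k (A : set V) n (f : 'I_n -> V -> R^o) : open A ->
  (forall i, Ck k A (f i)) -> Ck k A (fun x => \prod_i f i x : R^o).
Proof.
move=> oA; elim: n f => [|n IH] f H.
  rewrite (_ : (fun x => _) = fun _ => 1); first exact: Ck_cst.
  by apply/funext => x; rewrite big_ord0.
rewrite (_ : (fun x => _) = fun x => f ord0 x * \prod_i f (lift ord0 i) x).
  by apply: (Ck_scale (h := f ord0)) => //; apply: IH.
by apply/funext => x; rewrite big_ord_recl.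
Qed.

Lemma Ck_det V k (A : set V) n (M : V -> 'M[R]_n) : open A ->
  (forall i j, Ck k A (fun x => M x i j : R^o)) -> Ck k A (fun x => \det (M x) : R^o).
Proof.
move=> oA H; rewrite /determinant.
apply: Ck_sum => // s.
apply: Ck_mul => //; first exact: Ck_cst.
by apply: (Ck_prod (f := fun i x => M x i (perm.fun_of_perm s i))).
Qed.

Lemma Ck_inv V k (A : set V) (f : V -> R^o) : open A ->
  (forall x, A x -> f x != 0) -> Ck k A f -> Ck k A (fun x => (f x)^-1 : R^o).
Proof.
move=> oA f0 Hf; pose B := [set y : R^o | y != 0].
have oB : open B by exact: open_neq.
apply: (Ck_comp (f := f) (g := fun y : R^o => y^-1 : R^o) (B := B)) => //.
have dB y : B y -> differentiable (fun y : R^o => y^-1 : R^o) y.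
  exact: differentiable_Rinv.
elim: k {Hf} => [|k IH]; first by move=> y /dB /differentiable_continuous.
split=> // v.
apply: (Ck_ext (f := fun y : R^o => ((- v) * y^-1) *: (y^-1 : R^o))) => //.
  move=> y By; rewrite deriveE; last exact: dB.
  rewrite diff_Rinv //= /GRing.scale /= expr2 invfM; ring.
apply: Ck_scale => //.
by apply: (Ck_scale oB (Ck_cst _ _ _) IH).
Qed.

Lemma Ck_invmx V k (A : set V) n (M : V -> 'M[R]_n) : open A ->
  (forall x, A x -> M x \in unitmx) ->
  (forall i j, Ck k A (fun x => M x i j : R^o)) ->
  forall i j, Ck k A (fun x => invmx (M x) i j : R^o).
Proof.
move=> oA uM H i j.
apply: (Ck_ext (f := fun x => ((\det (M x))^-1 : R^o) *: (cofactor (M x) j i : R^o))) => //.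
  by move=> x Ax; rewrite /invmx uM // !mxE.
apply: Ck_scale => //.
  apply: Ck_inv => //; last exact: Ck_det.
  by move=> x /uM; rewrite unitmxE unitfE.
apply: (Ck_scale (h := fun=> _)) => //; first exact: Ck_cst.
apply: Ck_det => // a b.
by rewrite (_ : (fun x => _) = fun x => M x (lift j a) (lift i b)) //; apply/funext => x; rewrite !mxE.
Qed.

(* The coordinates given by [FinDim] need not be independent, hence the matrix
   of [A] is completed by the identity on a complement. *)
Lemma Ck_linear_solve P V {fV : FinDim V} k (A : set P) (L : P -> V -> V)
    (c w : P -> V) : open A ->
  (forall a, A a -> linear (L a)) ->
  (forall a v, A a -> L a v = 0 -> v = 0) ->
  (forall v, Ck k A (L ^~ v)) -> Ck k A c ->
  (forall a, A a -> L a (w a) = c a) -> Ck k A w.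
Proof.
have [n [tov [ofv [tovl ofvl ofvK]]]] := @findim_coords R V fV.
move=> oA linL injL HL Hc E.
have ctov : continuous tov by exact: findim_linear_continuous.
have cofv : continuous ofv by exact: findim_linear_continuous.
pose f a u := ofv (L a (tov u)) + (u - ofv (tov u)).
pose M a : 'M[R]_n := \matrix_(i, j) f a (delta_mx 0 i) 0 j.
have fl a : A a -> linear (f a).
  move=> /linL La; apply: lin_addf; last exact: lin_subf (@lin_id _ _) (lin_comp tovl ofvl).
  exact: lin_comp (lin_comp tovl La) ofvl.
have ME a u : A a -> u *m M a = f a u.
  by move=> Aa; apply: (mulmx_rowE _ (fl a Aa)) => i j; rewrite mxE.
have uM a : A a -> M a \in unitmx.
  move=> Aa; apply: row_inj_unitmx => u; rewrite ME // => fu0.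
  have : tov (f a u) = 0 by rewrite fu0 (lin_zero tovl).
  rewrite /f (lin_add tovl) (lin_sub tovl) !ofvK subrr addr0 => /(injL _ _ Aa) tu0.
  by move: fu0; rewrite /f tu0 (lin_zero (linL _ Aa)) (lin_zero ofvl) subr0 add0r.
have wE a : A a -> w a = tov (ofv (c a) *m invmx (M a)).
  move=> Aa; have -> : ofv (c a) = ofv (w a) *m M a.
    by rewrite ME // /f ofvK E // subrr addr0.
  by rewrite mulmxK ?uM // ofvK.
apply: (Ck_ext (f := tov \o (fun a => ofv (c a) *m invmx (M a)))) => //.
  by move=> a /wE ->.
apply: Ck_lincomp => //; apply: Ck_rVP => // j.
rewrite (_ : (fun x => _) = fun x => \sum_i (ofv (c x) 0 i : R^o) *: (invmx (M x) i j : R^o)).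
  apply: Ck_sum => // i; apply: Ck_scale => //.
    apply: (Ck_lincomp (L := fun v => ofv v 0 i : R^o)) => //.
      by move=> a x y; rewrite ofvl !mxE.
    by apply: findim_linear_continuous => a x y; rewrite ofvl !mxE.
  apply: Ck_invmx => // i' j'.
  have cL : Ck k A ((fun u : 'rV[R]_n => u 0 j' : R^o) \o ofv \o L ^~ (tov (delta_mx 0 i'))).
    apply: Ck_lincomp => //.
      by apply: lin_comp => // a x y; rewrite !mxE.
    by apply: findim_linear_continuous; apply: lin_comp => // a x y; rewrite !mxE.
  have := Ck_add oA cL (Ck_cst k A (((delta_mx 0 i' : 'rV[R]_n) - ofv (tov (delta_mx 0 i'))) 0 j' : R^o)).
  by apply: Ck_ext => // x _; rewrite /= !mxE.
by apply/funext => x; rewrite mxE.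
Qed.

Lemma lin_inverse V {fV : FinDim V} (L : V -> V) : linear L ->
  (forall v, L v = 0 -> v = 0) ->
  exists L' : V -> V, [/\ linear L', cancel L L' & cancel L' L].
Proof.
have [n [tov [ofv [tovl ofvl ofvK]]]] := @findim_coords R V fV.
move=> linL injL.
(* [f] is the identity on the kernel of [tov] and represents [L] on the image of [ofv]; the second
   summand thus makes the matrix invertible without disturbing [L]. *)
pose f u := ofv (L (tov u)) + (u - ofv (tov u)).
pose M : 'M[R]_n := \matrix_(i, j) f (delta_mx 0 i) 0 j.
have fl : linear f.
  apply: lin_addf; last exact: lin_subf (@lin_id _ _) (lin_comp tovl ofvl).
  exact: lin_comp (lin_comp tovl linL) ofvl.
have ME u : u *m M = f u.
  by apply: (mulmx_rowE _ fl) => i j; rewrite mxE.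
have uM : M \in unitmx.
  apply: row_inj_unitmx => u; rewrite ME // => fu0.
  have : tov (f u) = 0 by rewrite fu0 (lin_zero tovl).
  rewrite /f (lin_add tovl) (lin_sub tovl) !ofvK subrr addr0 => /injL tu0.
  by move: fu0; rewrite /f tu0 (lin_zero linL) (lin_zero ofvl) subr0 add0r.
have ofvM v : ofv v *m M = ofv (L v) by rewrite ME /f ofvK subrr addr0.
exists (fun v => tov (ofv v *m invmx M)); split.
- by move=> a x y; rewrite ofvl mulmxDl -scalemxAl tovl.
- by move=> v; rewrite -ofvM mulmxK ?ofvK.
- move=> v; rewrite -[RHS]ofvK -[ofv v in RHS](mulmxKV uM).
  by rewrite ME /f (lin_add tovl) (lin_sub tovl) !ofvK subrr addr0.
Qed.

End LinearInverse.

Lemma choice_on (T U : Type) (D : T -> Prop) (P : T -> U -> Prop) (u0 : U) :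
  (forall a, D a -> exists u, P a u) -> exists f, forall a, D a -> P a (f a).
Proof.
move=> H; have /choice [f Hf] : forall a, exists u, D a -> P a u; last by exists f.
by move=> a; have [/H [u Pu]|nD] := pselect (D a); [exists u|exists u0].
Qed.

Section ContinuousEVT.
Context {R : realType} (T : topologicalType) (f : T -> R^o) (A : set T).
Hypotheses (A0 : A !=set0) (cA : compact A)
  (cf : forall x, A x -> {for x, continuous f}).

Lemma cont_EVT_min : exists2 c, A c & forall t, A t -> f c <= f t.
Proof.
have [|c /set_mem Ac H] := compact_EVT_min A0 cA (f := f).
  by apply: continuous_in_subspaceT => x /set_mem /cf.
by exists c => // t /mem_set /H.
Qed.

Lemma cont_EVT_max : exists2 c, A c & forall t, A t -> f t <= f c.
Proof.
have [|c /set_mem Ac H] := compact_EVT_max A0 cA (f := f).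
  by apply: continuous_in_subspaceT => x /set_mem /cf.
by exists c => // t /mem_set /H.
Qed.

End ContinuousEVT.

Section ImplicitFunction.
Context {R : realType}.
Variables (P V W : normedModType R) (fP : FinDim P) (fV : FinDim V) (fW : FinDim W).

(** [S] inverts the partial differential, so S Phi(a, .) is within half the increment of the
    identity near x0. The solution is found without iteration, as a minimum of |S Phi(a, .)| on a
    compact ball: one Newton step would halve a nonzero minimum. The same estimate gives uniqueness,
    and regularity is then bootstrapped from the linear equation satisfied by the derivative of
    [psi]. *)
Theorem implicit_function (Phi : P * V -> W) a0 x0 (S : W -> V) :
  smooth_near Phi (a0, x0) -> Phi (a0, x0) = 0 -> linear S ->
  (forall v, S ('d Phi (a0, x0) (0, v)) = v) ->
  (forall w, 'd Phi (a0, x0) (0, S w) = w) ->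
  exists r psi, [/\ 0 < r, psi a0 = x0,
    (\forall a \near a0, [/\ `|psi a - x0| < r, Phi (a, psi a) = 0 &
        forall x, `|x - x0| < r -> Phi (a, x) = 0 -> x = psi a]) &
    smooth_near psi a0].
Proof.
move=> [B [oB Bp] HB] Phi0 lS STK TSK; set p0 := (a0, x0) in Bp *.
have [s s0 sE] := linear_bound lS.
have inS w : S w = 0 -> w = 0.
  by move=> Sw; rewrite -[w]TSK Sw -[(0, 0)]/(0 : P * V) linear0.
(* As |S w| is at most s |w|, this precision bounds the error of S Phi against its linearisation by
   half the increment. *)
have [d1 d10 d1P] := @strict_diff R _ _ _ _ Phi B p0 (2 * s)^-1 oB Bp (HB 1%N)
  (ltac:(by rewrite invr_gt0 mulr_gt0)).
have [d2 /= d20 d2P] := (nbhs_ballP _ _).1 (open_nbhs_nbhs (conj oB Bp)).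
pose d := Order.min d1 d2.
have d0 : 0 < d by rewrite lt_min d10.
have pd a x : `|a - a0| < d -> `|x - x0| < d -> `|(a, x) - p0| < d.
  by move=> ad xd; rewrite prod_normE /= gt_max ad xd.
have d1d p : `|p - p0| < d -> `|p - p0| < d1 by rewrite lt_min => /andP[].
have Bd p : `|p - p0| < d -> B p.
  rewrite lt_min => /andP[_ h]; apply: d2P.
  by rewrite -ball_normE /ball_ /= distrC.
have est a x a' x' : `|a - a0| < d -> `|x - x0| < d -> `|a' - a0| < d -> `|x' - x0| < d ->
    `|S (Phi (a', x') - Phi (a, x)) - S ('d Phi p0 (a' - a, 0)) - (x' - x)|
      <= 2^-1 * `|(a', x') - (a, x)|.
  move=> ad xd ad' xd'.
  have := d1P (a, x) (a', x') (d1d _ (pd _ _ ad xd)) (d1d _ (pd _ _ ad' xd')).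
  have -> : (a', x') - (a, x) = (a' - a, 0) + (0, x' - x).
    by apply: injective_projections => /=; rewrite ?addr0 ?add0r.
  rewrite linearD opprD addrA => h.
  have -> : x' - x = S ('d Phi p0 (0, x' - x)) by rewrite STK.
  rewrite -(lin_sub lS) -(lin_sub lS) STK.
  apply: le_trans (sE _) _; rewrite -ler_pdivlMl //.
  by rewrite mulrA -invfM [s * 2]mulrC.
have est0 a x x' : `|a - a0| < d -> `|x - x0| < d -> `|x' - x0| < d ->
    `|S (Phi (a, x') - Phi (a, x)) - (x' - x)| <= 2^-1 * `|x' - x|.
  move=> ad xd xd'; have := est _ _ _ _ ad xd ad xd'.
  rewrite subrr -[(0, 0)]/(0 : P * V) linear0 (lin_zero lS) subr0.
  rewrite [`|(a, x') - _|]prod_normE /= subrr normr0.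
  by rewrite (max_idPr (normr_ge0 _)).
have uniq a x x' : `|a - a0| < d -> `|x - x0| < d -> `|x' - x0| < d ->
    Phi (a, x) = 0 -> Phi (a, x') = 0 -> x = x'.
  move=> ad xd xd' p1 p2; have := est0 _ _ _ ad xd xd'.
  rewrite p1 p2 subrr (lin_zero lS) sub0r normrN => h.
  apply/eqP; rewrite eq_sym -subr_eq0 -normr_le0.
  by rewrite -(ler_pM2l (_ : 0 < 2^-1 :> R)) ?invr_gt0 // mulr0; lra.
pose rho := d / 2.
have rho0 : 0 < rho by rewrite divr_gt0.
have rhod : rho < d by rewrite /rho; lra.
have cPhi p : `|p - p0| < d -> {for p, continuous Phi}.
  by move=> /Bd; apply: Ck_continuous (HB 0%N) _.
have N1 : \forall a \near a0, `|S (Phi (a, x0))| <= rho / 2.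
  have c1 : {for a0, continuous (fun a => S (Phi (a, x0)))}.
    apply: (continuous_comp (f := fun a => Phi (a, x0))).
      apply: (continuous_comp (f := fun a => (a, x0))).
        by apply: cvg_pair; [exact: cvg_id|exact: cvg_cst].
      by apply: cPhi; rewrite -/p0 subrr normr0.
    exact: findim_linear_continuous.
  have /cvgrPdist_le /(_ (rho / 2)) := c1.
  rewrite -/p0 Phi0 (lin_zero lS) => /(_ (ltac:(by rewrite divr_gt0))).
  by apply: filterS => a; rewrite sub0r normrN.
have N2 : \forall a \near a0, `|a - a0| < d.
  by apply/nbhs_ballP; exists d => // a; rewrite -ball_normE /ball_ /= distrC.
have [d3 /= d30 d3P] := (nbhs_ballP _ _).1 (filterI N1 N2).
have aP a : `|a - a0| < d3 -> `|S (Phi (a, x0))| <= rho / 2 /\ `|a - a0| < d.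
  by move=> h; apply: d3P; rewrite -ball_normE /ball_ /= distrC.
have ex a : `|a - a0| < d3 -> exists x, `|x - x0| <= rho /\ Phi (a, x) = 0.
  move=> /aP [Sa ad].
  have cb : closed_ball x0 rho = [set x | `|x - x0| <= rho].
    rewrite closed_ballE // /closed_ball_.
    by apply/funext => x /=; rewrite distrC.
  have cg x : closed_ball x0 rho x -> {for x, continuous (fun x => `|S (Phi (a, x))| : R^o)}.
    rewrite cb => xr.
    apply: (continuous_comp (f := fun x => S (Phi (a, x)))); last exact: norm_continuous.
    apply: (continuous_comp (f := fun x => Phi (a, x))); last exact: findim_linear_continuous.
    apply: (continuous_comp (f := fun x => (a, x))).
      by apply: cvg_pair; [exact: cvg_cst|exact: cvg_id].
    by apply: cPhi; apply: pd => //; exact: le_lt_trans xr rhod.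
  have cb0 : closed_ball x0 rho !=set0 by exists x0; exact: closed_ballxx.
  have [x] := cont_EVT_min cb0 (@findim_closed_ball_compact _ _ fV x0 rho) cg.
  rewrite cb /= => xr xmin.
  exists x; split => //; apply: inS.
  have xd : `|x - x0| < d := le_lt_trans xr rhod.
  have x0d : `|x0 - x0| < d by rewrite subrr normr0.
  (* The Newton step. It stays in the closed ball because S Phi(a, x0) is at most rho / 2, and it at
     least halves the residual, so the minimal residual is 0. *)
  pose x1 := x - S (Phi (a, x)).
  have x1r : `|x1 - x0| <= rho.
    have h := est0 _ _ _ ad x0d xd.
    have -> : x1 - x0 = - (S (Phi (a, x) - Phi (a, x0)) - (x - x0)) - S (Phi (a, x0)).
      rewrite (lin_sub lS) /x1; module.
    apply: le_trans (ler_normB _ _) _; rewrite normrN.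
    apply: le_trans (lerD h Sa) _; move: xr; rewrite /rho; lra.
  have x1d := le_lt_trans x1r rhod.
  have := est0 _ _ _ ad xd x1d.
  have -> : x1 - x = - S (Phi (a, x)) by rewrite /x1 addrC addKr.
  rewrite (lin_sub lS) opprK subrK normrN => h.
  have h' := xmin x1 x1r.
  by apply/eqP; rewrite -normr_le0; lra.
have [psi psiP] : exists psi : P -> V, forall a, `|a - a0| < d3 ->
    `|psi a - x0| <= rho /\ Phi (a, psi a) = 0.
  by have [psi H] := choice_on x0 ex; exists psi.
have psid a : `|a - a0| < d3 -> `|psi a - x0| < d.
  by move=> /psiP [h _]; exact: le_lt_trans h rhod.
have psi0 a : `|a - a0| < d3 -> Phi (a, psi a) = 0 by move=> /psiP [].
have d3d a : `|a - a0| < d3 -> `|a - a0| < d by move=> /aP [].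
pose A := [set a | `|a - a0| < d3].
have AE : A = ball a0 d3.
  by apply/funext => a; rewrite -ball_normE /ball_ /A /= distrC.
have oA : open A by rewrite AE; exact: ball_open.
have Aa0 : A a0 by rewrite /A /= subrr normr0.
have lD (h : P) : linear (fun h => S ('d Phi p0 (h, 0))).
  apply: lin_comp => // u v w; rewrite -linearP; congr ('d Phi p0 _).
  by apply: injective_projections; rewrite //= scaler0 addr0.
have [kk kk0 kkE] := linear_bound (lD 0).
(* If [psi] moves more than [a], half of its increment is bounded by the term in kk, whence 2 kk;
   otherwise 1 suffices. The sum serves both cases and is at least 1, which is used to bound the
   norm of the pair (h, dl). *)
pose C := 2 * kk + 1.
have lip a a' : A a -> A a' -> `|psi a' - psi a| <= C * `|a' - a|.
  move=> Aa Aa'; have := est _ _ _ _ (d3d _ Aa) (psid _ Aa) (d3d _ Aa') (psid _ Aa').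
  rewrite !psi0 // subrr (lin_zero lS) sub0r -opprD normrN.
  rewrite [`|(a', _) - _|]prod_normE /= => h.
  have h1 : `|psi a' - psi a| <= `|S ('d Phi p0 (a' - a, 0)) + (psi a' - psi a)| +
       `|S ('d Phi p0 (a' - a, 0))|.
    rewrite -[X in `|X| <= _](addKr (S ('d Phi p0 (a' - a, 0)))) addrC.
    exact: ler_normB.
  have h2 := kkE (a' - a); rewrite /= in h2.
  have h3 := normr_ge0 (a' - a).
  have kn : 0 <= kk * `|a' - a| by rewrite mulr_ge0 // ltW.
  have [le|lt] := leP `|psi a' - psi a| `|a' - a|.
    by apply: le_trans le _; rewrite /C mulrDl mul1r lerDr -mulrA mulr_ge0.
  move: h; rewrite (max_idPr (ltW lt)) => h.
  rewrite /C mulrDl mul1r -mulrA; lra.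
have C1 : 1 <= C by rewrite /C lerDr mulr_ge0 // ltW.
have pB a : A a -> B (a, psi a).
  by move=> Aa; apply: Bd; apply: pd; [exact: d3d|exact: psid].
have dPhi a : A a -> differentiable Phi (a, psi a).
  by move=> /pB; exact: Cinfty_diff.
pose T a v := S ('D_(0, v) Phi (a, psi a)).
have TE a v : A a -> T a v = S ('d Phi (a, psi a) (0, v)).
  by move=> Aa; rewrite /T deriveE //; exact: dPhi.
have linT a : A a -> linear (T a).
  move=> Aa u v w; rewrite !TE // -lS -linearP; congr (S ('d Phi _ _)).
  by apply: injective_projections; rewrite //= scaler0 addr0.
have epsP a : A a -> forall e, 0 < e -> \forall h \near (0 : P * V),
    `|Phi (h + (a, psi a)) - Phi (a, psi a) - 'd Phi (a, psi a) h| <= e * `|h|.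
  move=> Aa; have cd := diff_continuous (dPhi a Aa).
  have lin : linear ('d Phi (a, psi a)) by move=> ???; rewrite linearP.
  exact: ((diff_epsP Phi (a, psi a) lin cd).2 (conj (dPhi a Aa) erefl)).
(* Injectivity away from a0 comes from the half-Lipschitz estimate: if T a v = 0, the differential
   makes S Phi change by at most a quarter of |t v| for small t, whereas [est0] forces a change of
   at least one half. *)
have injT a v : A a -> T a v = 0 -> v = 0.
  move=> Aa; rewrite TE // => Tv0.
  have s4 : 0 < (4 * s)^-1 by rewrite invr_gt0 mulr_gt0.
  have [e1 /= e10 e1P] := (nbhs_ballP _ _).1 (epsP a Aa _ s4).
  pose e2 := Order.min e1 (d - `|psi a - x0|).
  have e20 : 0 < e2 by rewrite lt_min e10 subr_gt0 psid.
  pose t := e2 / (2 * (1 + `|v|)).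
  have v10 : 0 < 1 + `|v| by rewrite ltr_pwDl.
  have t0 : 0 < t by rewrite divr_gt0 // mulr_gt0.
  have tv : `|t *: v| < e2.
    rewrite normrZ gtr0_norm // /t mulrAC ltr_pdivrMr ?mulr_gt0 // ltr_pM2l //.
    by have := normr_ge0 v; lra.
  have := e1P (0, t *: v); rewrite -ball_normE /ball_ /= sub0r normrN.
  have nE : `|(0 : P, t *: v)| = `|t *: v|.
    by rewrite prod_normE /= normr0 (max_idPr (normr_ge0 _)).
  rewrite nE => /(_ (lt_le_trans tv _)); rewrite ge_min lexx => /(_ isT) h1.
  have E : (0, t *: v) + (a, psi a) = (a, psi a + t *: v).
    by apply: injective_projections; rewrite /= ?add0r // addrC.
  have Sd : S ('d Phi (a, psi a) (0, t *: v)) = 0.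
    have -> : (0, t *: v) = t *: (0, v) :> P * V.
      by apply: injective_projections; rewrite //= scaler0.
    by rewrite linearZ /= (lin_scale lS) Tv0 scaler0.
  have h2 : `|S (Phi (a, psi a + t *: v) - Phi (a, psi a))| <= 4^-1 * `|t *: v|.
    rewrite -[X in `|X| <= _]subr0 -Sd -(lin_sub lS); apply: le_trans (sE _) _.
    rewrite -E -ler_pdivlMl // mulrA -invfM [s * 4]mulrC; exact: h1.
  have xd : `|psi a + t *: v - x0| < d.
    rewrite addrAC; apply: le_lt_trans (ler_normD _ _) _.
    by rewrite -ltrBrDl; apply: lt_le_trans tv _; rewrite ge_min lexx orbT.
  have h3 := est0 _ _ _ (d3d _ Aa) (psid _ Aa) xd.
  rewrite [psi a + _]addrC addrK [t *: v + _]addrC in h3.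
  have h4 := ler_normB (S (Phi (a, psi a + t *: v) - Phi (a, psi a))) 
     (S (Phi (a, psi a + t *: v) - Phi (a, psi a)) - t *: v).
  rewrite opprB addrC subrK in h4.
  have : `|t *: v| <= 0 by lra.
  rewrite normr_le0 scaler_eq0 gt_eqF //= => /eqP //.
have dpsi a : A a -> differentiable psi a /\
    forall v, T a ('D_v psi a) = - S ('D_(v, 0) Phi (a, psi a)).
  move=> Aa; have [T' [lT' TK T'K]] := lin_inverse (linT a Aa) (fun v => @injT a v Aa).
  pose L h := - T' (S ('d Phi (a, psi a) (h, 0))).
  have lL : linear L.
    apply: lin_oppf; apply: lin_comp lT'; apply: lin_comp lS => u v w.
    rewrite -linearP; congr ('d Phi _ _).
    by apply: injective_projections; rewrite //= scaler0 addr0.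
  have cL : continuous L by exact: findim_linear_continuous.
  have [t t0 tE] := linear_bound lT'.
  have [dpsi dE] : differentiable psi a /\ 'd psi a = L :> (P -> V).
    apply/diff_epsP => // e e0.
    have e1 : 0 < e / (t * s * C).
      by rewrite divr_gt0 // !mulr_gt0 // (lt_le_trans _ C1).
    have [e2 /= e20 e2P] := (nbhs_ballP _ _).1 (epsP a Aa _ e1).
    have C0 : 0 < C := lt_le_trans ltr01 C1.
    near=> h.
    have Ah : A (h + a).
      near: h; have : \forall y \near a, A y by exact: open_nbhs_nbhs.
      rewrite (near_shift (0 : P) a) /=; apply: filterS => h /=; by rewrite subr0.
    pose dl := psi (h + a) - psi a.
    have ldl : `|dl| <= C * `|h|.
      by have := lip _ _ Aa Ah; rewrite addrK.
    have hn : `|(h, dl)| <= C * `|h|.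
      rewrite prod_normE /= ge_max ldl andbT ler_peMl //.
    have := e2P (h, dl); rewrite -ball_normE /ball_ /= sub0r normrN.
    have -> : (h, dl) + (a, psi a) = (h + a, psi (h + a)).
      by apply: injective_projections; rewrite //= /dl subrK.
    rewrite !psi0 // subrr sub0r normrN => /(_ (le_lt_trans hn _)) h1.
    have {}h1 : `|'d Phi (a, psi a) (h, dl)| <= e / (t * s * C) * `|(h, dl)|.
      apply: h1; rewrite -ltr_pdivlMl //.
      near: h; apply/nbhs_ballP; exists (C^-1 * e2); first by rewrite /= mulr_gt0 ?invr_gt0.
      by move=> h; rewrite -ball_normE /ball_ /= sub0r normrN.
    have -> : psi (h + a) - psi a - L h = T' (S ('d Phi (a, psi a) (h, dl))).
      rewrite /L opprK -/dl.
      have -> : (h, dl) = (h, 0) + (0, dl) :> P * V.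
        by apply: injective_projections; rewrite /= ?addr0 ?add0r.
      by rewrite linearD (lin_add lS) (lin_add lT') -TE // TK addrC.
    apply: le_trans (tE _) _; rewrite -ler_pdivlMl //.
    apply: le_trans (sE _) _; rewrite -ler_pdivlMl //.
    apply: le_trans h1 _; apply: le_trans (ler_wpM2l (ltW e1) hn) _.
    rewrite le_eqVlt; apply/orP; left; apply/eqP.
    by field; rewrite !gt_eqF.
  split => // v; rewrite deriveE // dE /L (lin_opp (linT a Aa)) T'K deriveE //.
  exact: dPhi.
(* Bootstrapping: once [psi] is C^k, its derivative solves a linear equation with C^k coefficients,
   hence is C^k. *)
have cA : forall k, Ck k A psi.
  elim=> [|k IH]; first by move=> a /dpsi [/differentiable_continuous].
  split=> [a /dpsi []//|v].
  have cp : Ck k A (fun a => (a, psi a)).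
    by apply: Ck_pair => //; apply: Ck_lin => // x; exact: cvg_id.
  have cD w : Ck k A (fun a => S ('D_w Phi (a, psi a))).
    apply: (Ck_lincomp (f := fun a => 'D_w Phi (a, psi a))) => //.
      exact: findim_linear_continuous.
    apply: (Ck_comp (f := fun a => (a, psi a)) (g := 'D_w Phi) (B := B)) => //.
    exact: Cinfty_derive HB k.
  apply: (@Ck_linear_solve _ _ _ _ k A T (fun a => - S ('D_(v, 0) Phi (a, psi a)))) => //.
  - by move=> w; exact: cD.
  - have := Ck_scale oA (Ck_cst k A (-1 : R^o)) (cD (v, 0)).
    by apply: Ck_ext => // x _; rewrite scaleN1r.
  - by move=> a /dpsi [_]; apply.
exists d, psi; split => //.
- apply: (uniq a0) => //; rewrite ?subrr ?normr0 //; first exact: psid.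
  exact: psi0.
- near=> a; have Aa : A a by near: a; exact: open_nbhs_nbhs.
  split; [exact: psid|exact: psi0|] => x xd px.
  exact: (uniq a x (psi a) (d3d _ Aa) xd (psid _ Aa) px (psi0 _ Aa)).
- by exists A.
Unshelve. all: by end_near. Qed.

End ImplicitFunction.

(** * Smooth maps between manifolds *)

(** The part of [is_manifold] about charts. Vector spaces and products satisfy it directly;
    separation and countability are invoked where a topological argument calls for them. *)
Class IsAtlas {R : realType} (X : topologicalType) (E : normedModType R)
  (a : atlas X E) : Prop := isAtlas {
  atlas_chart : forall x, is_chart (a x);
  atlas_dom : forall x, cdom (a x) x;
  atlas_transition : forall x y, Cinfty (transition_dom a x y) (transition a x y) }.

Section ChartTheory.
Context {R : realType} {X : topologicalType} {E : normedModType R} (a : atlas X E)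
  {aX : IsAtlas a}.

Lemma cdom_open x : open (cdom (a x)). Proof. by have [[]] := atlas_chart x. Qed.
Lemma cimg_open x : open (cimg (a x)). Proof. by have [[]] := atlas_chart x. Qed.
Lemma cfun_img x y : cdom (a x) y -> cimg (a x) (cfun (a x) y).
Proof. by have [_ H _ _ _] := atlas_chart x => /H []. Qed.
Lemma cfunK x y : cdom (a x) y -> cinv (a x) (cfun (a x) y) = y.
Proof. by have [_ H _ _ _] := atlas_chart x => /H []. Qed.
Lemma cinv_dom x e : cimg (a x) e -> cdom (a x) (cinv (a x) e).
Proof. by have [_ _ H _ _] := atlas_chart x => /H []. Qed.
Lemma cinvK x e : cimg (a x) e -> cfun (a x) (cinv (a x) e) = e.
Proof. by have [_ _ H _ _] := atlas_chart x => /H []. Qed.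
Lemma cfun_cont x y : cdom (a x) y -> {for y, continuous (cfun (a x))}.
Proof. by have [_ _ _ H _] := atlas_chart x => /H. Qed.
Lemma cinv_cont x e : cimg (a x) e -> {for e, continuous (cinv (a x))}.
Proof. by have [_ _ _ _ H] := atlas_chart x => /H. Qed.

Lemma cdom_near x y : cdom (a x) y -> \forall z \near y, cdom (a x) z.
Proof. by move=> h; apply: open_nbhs_nbhs; split => //; exact: cdom_open. Qed.
Lemma cimg_near x e : cimg (a x) e -> \forall z \near e, cimg (a x) z.
Proof. by move=> h; apply: open_nbhs_nbhs; split => //; exact: cimg_open. Qed.

Lemma transition_dom_open x y : open (transition_dom a x y).
Proof.
rewrite openE => e [ie de]; apply: filterI; first exact: cimg_near.
by apply: (cinv_cont ie); exact: cdom_near.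
Qed.

End ChartTheory.

Lemma open_prod (T U : topologicalType) (A : set T) (B : set U) :
  open A -> open B -> open (A `*` B).
Proof.
move=> oA oB; rewrite openE => -[x y] [/= Ax By].
by exists (A, B) => //=; split; exact: open_nbhs_nbhs.
Qed.

Lemma continuous_prod_fst (T U W : topologicalType) (f : T -> W) (p : T * U) :
  {for p.1, continuous f} -> {for p, continuous (fun q => f q.1)}.
Proof. by move=> cf; apply: (@cvg_comp _ _ _ fst f _ (nbhs p.1)); [exact: cvg_fst|exact: cf]. Qed.

Lemma continuous_prod_snd (T U W : topologicalType) (f : U -> W) (p : T * U) :
  {for p.2, continuous f} -> {for p, continuous (fun q => f q.2)}.
Proof. by move=> cf; apply: (@cvg_comp _ _ _ snd f _ (nbhs p.2)); [exact: cvg_snd|exact: cf]. Qed.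

Section AtlasInstances.
Context {R : realType}.

Global Instance vec_atlas_isAtlas (E : normedModType R) : IsAtlas (@vec_atlas R E).
Proof.
split=> // [x|x y].
  by split=> //; [split; exact: openT|move=> *; exact: cvg_id|move=> *; exact: cvg_id].
by move=> k; apply: (@Ck_lin R E E k _ id) => // z; exact: cvg_id.
Qed.

Global Instance prod_atlas_isAtlas X Y (E F : normedModType R) (fE : FinDim E)
  (fF : FinDim F) (a : atlas X E)
  (b : atlas Y F) {aX : IsAtlas a} {bY : IsAtlas b} : IsAtlas (prod_atlas a b).
Proof.
split=> [x|x|x y].
- split=> /=.
  + by split; apply: open_prod; (exact: cdom_open || exact: cimg_open).
  + move=> [u v] [/= hu hv]; rewrite !cfunK //.
    by split => //; split; exact: cfun_img.
  + move=> [u v] [/= hu hv]; rewrite !cinvK //.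
    by split => //; split; exact: cinv_dom.
  + move=> [u v] [/= hu hv]; apply: cvg_pair => /=.
      by apply: (@continuous_prod_fst _ _ _ _ (u, v)); exact: cfun_cont.
    by apply: (@continuous_prod_snd _ _ _ _ (u, v)); exact: cfun_cont.
  + move=> [u v] [/= hu hv]; apply: cvg_pair => /=.
      by apply: (@continuous_prod_fst _ _ _ _ (u, v)); exact: cinv_cont.
    by apply: (@continuous_prod_snd _ _ _ _ (u, v)); exact: cinv_cont.
- by split; exact: atlas_dom.
- move=> k.
  pose A := transition_dom (prod_atlas a b) x y.
  have AE p : A p -> transition_dom a x.1 y.1 p.1 /\ transition_dom b x.2 y.2 p.2.
    by move=> [[/= h1 h2] [/= h3 h4]].
  have oA : open A.
    rewrite (_ : A = (transition_dom a x.1 y.1) `*` (transition_dom b x.2 y.2)).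
      by apply: open_prod; exact: transition_dom_open.
    apply/seteqP; split=> p; first by move=> /AE.
    by move=> [[? ?] [? ?]].
  apply: (Ck_pair (f := transition a x.1 y.1 \o fst) (g := transition b x.2 y.2 \o snd)) => //.
  + apply: (Ck_comp (B := transition_dom a x.1 y.1)) => //.
    * exact: transition_dom_open.
    * by move=> p /AE [].
    * by apply: Ck_lin => // p; exact: cvg_fst.
    * exact: atlas_transition.
  + apply: (Ck_comp (B := transition_dom b x.2 y.2)) => //.
    * exact: transition_dom_open.
    * by move=> p /AE [].
    * by apply: Ck_lin => // p; exact: cvg_snd.
    * exact: atlas_transition.
Qed.

End AtlasInstances.

Section SmoothMaps.
Context {R : realType}.
Variables (X Y Z : topologicalType) (E F H : normedModType R).
Variables (a : atlas X E) (b : atlas Y F) (c : atlas Z H).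
Context {aX : IsAtlas a} {bY : IsAtlas b} {cZ : IsAtlas c}.
Context {fE : FinDim E} {fF : FinDim F} {fH : FinDim H}.

Lemma smooth_at_cont (f : X -> Y) x : smooth_at a b f x -> {for x, continuous f}.
Proof. by case. Qed.

Lemma near_cinv x (P : X -> Prop) : (\forall y \near x, P y) ->
  \forall e \near cfun (a x) x, P (cinv (a x) e).
Proof.
move=> h; apply: (cinv_cont (cfun_img (atlas_dom x))).
by rewrite cfunK //; exact: atlas_dom.
Qed.

Lemma smooth_at_ext (f g : X -> Y) x :
  (\forall y \near x, f y = g y) -> smooth_at a b f x -> smooth_at a b g x.
Proof.
move=> fg [cf sf]; have fgx := nbhs_singleton fg; split.
  by rewrite /prop_for /continuous_at -fgx; apply: cvg_trans cf; exact: near_eq_cvg.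
apply: smooth_near_ext sf; have := near_cinv fg.
by apply: filterS => e h; rewrite /in_charts /= h fgx.
Qed.

Lemma tangent_ext (f g : X -> Y) x : (\forall y \near x, f y = g y) ->
  smooth_at a b f x -> tangent a b f x = tangent a b g x.
Proof.
move=> fg sf; apply/funext => v; rewrite /tangent.
have N : \forall e \near cfun (a x) x, in_charts a b f x e = in_charts a b g x e.
  have := near_cinv fg.
  by apply: filterS => e h; rewrite /in_charts /= h (nbhs_singleton fg).
by have [_ ->] // := near_differentiable N (smooth_near_diff sf.2).
Qed.

Lemma smooth_at_comp (f : X -> Y) (g : Y -> Z) x :
  smooth_at a b f x -> smooth_at b c g (f x) ->
  smooth_at a c (g \o f) x /\
  forall v, tangent a c (g \o f) x v = tangent b c g (f x) (tangent a b f x v).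
Proof.
move=> [cf sf] [cg sg].
have fx : in_charts a b f x (cfun (a x) x) = cfun (b (f x)) (f x).
  by rewrite /in_charts /= cfunK //; exact: atlas_dom.
have N : \forall e \near cfun (a x) x,
    (in_charts b c g (f x) \o in_charts a b f x) e = in_charts a c (g \o f) x e.
  have : \forall y \near x, cdom (b (f x)) (f y).
    by apply: cf; apply: cdom_near; exact: atlas_dom.
  by move=> /near_cinv; apply: filterS => e h; rewrite /in_charts /= cfunK.
rewrite -fx in sg.
have sc := [elaborate smooth_near_comp sf sg].
split.
  split; first exact: continuous_comp.
  exact: smooth_near_ext N sc.
move=> v; rewrite /tangent.
have [_ ->] := near_differentiable N (smooth_near_diff sc).
have df := smooth_near_diff sf; have dg := smooth_near_diff sg.
by rewrite diff_comp //= fx.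
Qed.

Lemma smooth_at_cst (y : Y) x : smooth_at a b (fun=> y) x.
Proof.
by split; [exact: cvg_cst|exact: smooth_near_cst].
Qed.

Lemma tangent_cst (y : Y) x v : tangent a b (fun=> y) x v = 0.
Proof.
rewrite /tangent (_ : in_charts _ _ _ _ = cst (cfun (b y) y)) //.
by rewrite diff_cst.
Qed.

Lemma smooth_at_id x : smooth_at a a id x /\ forall v, tangent a a id x v = v.
Proof.
have N : \forall e \near cfun (a x) x, id e = in_charts a a id x e.
  have := [elaborate cimg_near (cfun_img (atlas_dom (a := a) x))].
  by apply: filterS => e h; rewrite /in_charts /= cinvK.
split; first split; first exact: cvg_id.
  exact: smooth_near_ext N (smooth_near_id _).
move=> v; rewrite /tangent.
have [_ ->] := near_differentiable N (smooth_near_diff (smooth_near_id _)).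
by have [_ ->] := diff_lin_fun (cfun (a x) x) (@lin_id _ E) (fun y => @cvg_id _ (nbhs y)).
Qed.

Lemma smooth_at_pair (f : X -> Y) (g : X -> Z) x :
  smooth_at a b f x -> smooth_at a c g x ->
  smooth_at a (prod_atlas b c) (fun y => (f y, g y)) x /\
  forall v, tangent a (prod_atlas b c) (fun y => (f y, g y)) x v =
    (tangent a b f x v, tangent a c g x v).
Proof.
move=> [cf sf] [cg sg]; split.
  split; first exact: cvg_pair.
  exact: (smooth_near_pair sf sg).
move=> v; rewrite /tangent.
have df := smooth_near_diff sf; have dg := smooth_near_diff sg.
rewrite (_ : in_charts _ _ _ _ = fun e => (in_charts a b f x e, in_charts a c g x e)) //.
by rewrite diff_pair.
Qed.

Lemma smooth_at_fst (p : X * Y) : smooth_at (prod_atlas a b) a fst p /\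
  forall v, tangent (prod_atlas a b) a fst p v = v.1.
Proof.
pose e0 : E * F := cfun (prod_atlas a b p) p.
have N : \forall e \near e0, e.1 = in_charts (prod_atlas a b) a fst p e.
  have : \forall e \near e0, cimg (a p.1) e.1.
    by apply: (cvg_fst (F := nbhs e0.1) (G := nbhs e0.2)); apply: cimg_near; apply: cfun_img; exact: atlas_dom.
  by apply: filterS => e h; rewrite /in_charts /= cinvK.
have lf : linear (fst : E * F -> E) by [].
have cf : continuous (fst : E * F -> E) by move=> ?; exact: cvg_fst.
have sf : smooth_near (fst : E * F -> E) e0 by exact: smooth_near_lin.
split; first split; [exact: cvg_fst|exact: smooth_near_ext N sf|].
move=> v; rewrite /tangent; have [_ ->] := near_differentiable N (smooth_near_diff sf).
by have [_ ->] := diff_lin_fun e0 lf cf.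
Qed.

Lemma smooth_at_snd (p : X * Y) : smooth_at (prod_atlas a b) b snd p /\
  forall v, tangent (prod_atlas a b) b snd p v = v.2.
Proof.
pose e0 : E * F := cfun (prod_atlas a b p) p.
have N : \forall e \near e0, e.2 = in_charts (prod_atlas a b) b snd p e.
  have : \forall e \near e0, cimg (b p.2) e.2.
    by apply: (cvg_snd (F := nbhs e0.1) (G := nbhs e0.2)); apply: cimg_near; apply: cfun_img; exact: atlas_dom.
  by apply: filterS => e h; rewrite /in_charts /= cinvK.
have lf : linear (snd : E * F -> F) by [].
have cf : continuous (snd : E * F -> F) by move=> ?; exact: cvg_snd.
have sf : smooth_near (snd : E * F -> F) e0 by exact: smooth_near_lin.
split; first split; [exact: cvg_snd|exact: smooth_near_ext N sf|].
move=> v; rewrite /tangent; have [_ ->] := near_differentiable N (smooth_near_diff sf).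
by have [_ ->] := diff_lin_fun e0 lf cf.
Qed.

Lemma cfun_smooth x y : cdom (a x) y -> smooth_at a (@vec_atlas R E) (cfun (a x)) y.
Proof.
move=> h; split; first exact: cfun_cont.
exists (transition_dom a y x).
  split; first exact: transition_dom_open.
  split; first exact/cfun_img/atlas_dom.
  by rewrite /= cfunK //; exact: atlas_dom.
exact: atlas_transition.
Qed.

Lemma cinv_smooth x e : cimg (a x) e -> smooth_at (@vec_atlas R E) a (cinv (a x)) e.
Proof.
move=> h; split; first exact: cinv_cont.
exists (transition_dom a x (cinv (a x) e)).
  split; first exact: transition_dom_open.
  by split=> //; exact: atlas_dom.
exact: atlas_transition.
Qed.

End SmoothMaps.

Arguments smooth_at_fst {R X Y E F} a b {aX} p.
Arguments smooth_at_snd {R X Y E F} a b {bY} p.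
Arguments smooth_at_id {R X E} a {aX} x.

Section SmoothVec.
Context {R : realType} {E F : normedModType R}.

Lemma smooth_at_vec (f : E -> F) e :
  smooth_at (@vec_atlas R E) (@vec_atlas R F) f e <-> smooth_near f e.
Proof. by split=> [[]//|s]; split=> //; exact: smooth_near_cont. Qed.

Lemma tangent_vec (f : E -> F) e v :
  tangent (@vec_atlas R E) (@vec_atlas R F) f e v = 'd f e v.
Proof. by []. Qed.

End SmoothVec.

Section SmoothLocal.
Context {R : realType}.
Variables (X Y : topologicalType) (E F : normedModType R).
Variables (a : atlas X E) (b : atlas Y F).
Context {aX : IsAtlas a} {bY : IsAtlas b} {fE : FinDim E} {fF : FinDim F}.

(** Representation in two fixed charts, as opposed to [in_charts], whose charts move with the
    point. *)
Definition local_rep (f : X -> Y) x0 y0 : E -> F := cfun (b y0) \o f \o cinv (a x0).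

Lemma local_rep_smooth (f : X -> Y) x0 y0 e : cimg (a x0) e ->
  cdom (b y0) (f (cinv (a x0) e)) -> smooth_at a b f (cinv (a x0) e) ->
  smooth_near (local_rep f x0 y0) e /\
  forall v, 'd (local_rep f x0 y0) e v = tangent b (@vec_atlas R F) (cfun (b y0)) (f (cinv (a x0) e))
     (tangent a b f (cinv (a x0) e) (tangent (@vec_atlas R E) a (cinv (a x0)) e v)).
Proof.
move=> ie dy sf.
have sc := [elaborate cinv_smooth ie].
have [sfc tfc] := [elaborate smooth_at_comp sc sf].
have sb := [elaborate cfun_smooth dy].
have [s t] := [elaborate smooth_at_comp (f := f \o cinv (a x0)) sfc sb].
split; first by apply/smooth_at_vec.
by move=> v; rewrite -tfc -t.
Qed.

Lemma smooth_at_local_rep (f : X -> Y) x0 y0 x : cdom (a x0) x ->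
  cdom (b y0) (f x) -> {for x, continuous f} ->
  smooth_near (local_rep f x0 y0) (cfun (a x0) x) -> smooth_at a b f x.
Proof.
move=> dx dy cf sr.
have sc := [elaborate cfun_smooth dx].
have [s1 _] := [elaborate smooth_at_comp sc ((smooth_at_vec _ _).2 sr)].
have iy : cimg (b y0) (local_rep f x0 y0 (cfun (a x0) x)).
  by rewrite /local_rep /= cfunK //; exact: cfun_img.
have [s2 _] := [elaborate smooth_at_comp s1 (cinv_smooth iy)].
apply: smooth_at_ext s2.
have N1 : \forall y \near x, cdom (a x0) y by exact: cdom_near.
have N2 : \forall y \near x, cdom (b y0) (f y) by apply: cf; exact: cdom_near.
apply: filterS2 N1 N2 => y h1 h2.
by rewrite /= /local_rep /= (cfunK h1) (cfunK h2).
Qed.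

(** The preferred charts at a nearby point differ from those at [x], so the passage goes through
    [local_rep]. Continuity of [f] is only given at [x]; near [x] it is recovered by writing [f] as
    the inverse chart after its smooth representation. *)
Lemma smooth_at_near (f : X -> Y) x : smooth_at a b f x ->
  \forall y \near x, smooth_at a b f y.
Proof.
move=> sf; have [cf [V [oV Vx] HV]] := sf.
have dx : cdom (a x) x by exact: atlas_dom.
have dy : cdom (b (f x)) (f x) by exact: atlas_dom.
have N1 : \forall y \near x, cdom (a x) y by exact: cdom_near.
have N2 : \forall y \near x, cdom (b (f x)) (f y) by apply: cf; exact: cdom_near.
have N3 : \forall y \near x, V (cfun (a x) y).
  by apply: (cfun_cont dx); exact: open_nbhs_nbhs.
have [W [oW Wx] WP] := near_open (filterI N1 (filterI N2 N3)).
apply: (open_near oW Wx) => y Wy; have [dxy [dfy Vy]] := WP _ Wy.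
have sr : smooth_near (local_rep f x (f x)) (cfun (a x) y) by exists V.
apply: (smooth_at_local_rep dxy dfy _ sr).
have cr : {for y, continuous (cinv (b (f x)) \o local_rep f x (f x) \o cfun (a x))}.
  apply: continuous_comp; first exact: cfun_cont.
  apply: continuous_comp; first exact: smooth_near_cont.
  apply: cinv_cont; rewrite /local_rep /= cfunK //; exact: cfun_img.
have E' : \forall z \near y, (cinv (b (f x)) \o local_rep f x (f x) \o cfun (a x)) z = f z.
  apply: (open_near oW Wy) => z /WP [dz [dfz _]].
  by rewrite /local_rep /= cfunK // cfunK.
rewrite /prop_for /continuous_at -(nbhs_singleton E').
by apply: cvg_trans cr; apply: near_eq_cvg; apply: filterS E' => z ->.
Qed.

End SmoothLocal.

Section SmoothOn.
Context {R : realType}.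
Variables (X Y Z : topologicalType) (E F H : normedModType R).
Variables (a : atlas X E) (b : atlas Y F) (c : atlas Z H).
Context {aX : IsAtlas a} {bY : IsAtlas b} {cZ : IsAtlas c}.
Context {fE : FinDim E} {fF : FinDim F} {fH : FinDim H}.

Lemma smooth_onT (f : X -> Y) (A : set X) :
  (forall x, A x -> smooth_at a b f x) -> smooth_on a b A f.
Proof. by move=> sf x /sf s; exists f => //; exact: nearW. Qed.

Lemma smooth_on_sub (f : X -> Y) (A B : set X) : B `<=` A ->
  smooth_on a b A f -> smooth_on a b B f.
Proof.
by move=> BA H' x /BA /H' [g sg gf]; exists g => //; apply: filterS gf => y h /BA.
Qed.

Lemma smooth_on_eq (f g : X -> Y) (A : set X) : (forall x, A x -> f x = g x) ->
  smooth_on a b A f -> smooth_on a b A g.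
Proof.
move=> fg H' x /H' [h sh hf]; exists h => //; apply: filterS hf => y e Ay.
by rewrite e // fg.
Qed.

Lemma smooth_on_comp (f : X -> Y) (g : Y -> Z) (A : set X) (B : set Y) :
  (forall x, A x -> B (f x)) -> smooth_on a b A f -> smooth_on b c B g ->
  smooth_on a c A (g \o f).
Proof.
move=> AB sf sg x Ax; have [f' sf' ff'] := sf _ Ax; have [g' sg' gg'] := sg _ (AB _ Ax).
have fx : f' x = f x by exact: nbhs_singleton ff' Ax.
rewrite -fx in sg' gg'.
exists (g' \o f'); first by have [] := [elaborate smooth_at_comp sf' sg'].
have N := sf'.1 _ gg'.
near=> y => Ay /=; have e : f' y = f y by move: Ay; near: y.
rewrite -e; have h : B (f' y) -> g' (f' y) = g (f' y) by near: y.
by apply: h; rewrite e; exact: AB.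
Unshelve. all: by end_near. Qed.

Lemma smooth_on_pair (f : X -> Y) (g : X -> Z) (A : set X) :
  smooth_on a b A f -> smooth_on a c A g ->
  smooth_on a (prod_atlas b c) A (fun x => (f x, g x)).
Proof.
move=> sf sg x Ax; have [f' sf' ff'] := sf _ Ax; have [g' sg' gg'] := sg _ Ax.
exists (fun x => (f' x, g' x)); first by have [] := [elaborate smooth_at_pair sf' sg'].
by apply: filterS2 ff' gg' => y h1 h2 Ay; rewrite h1 // h2.
Qed.

Lemma smooth_on_continuous (f : X -> Y) (A : set X) : smooth_on a b A f ->
  {within A, continuous f}.
Proof.
move=> sf; rewrite continuous_subspace_in => x /set_mem Ax.
have [f' [cf' _] ff'] := sf _ Ax.
have fx : f' x = f x by exact: nbhs_singleton ff' Ax.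
suff : f @ (nbhs_subspace (x : subspace A)) --> f x by [].
rewrite -fx -(nbhs_subspace_in Ax).
have cw : f' @ within A (nbhs x) --> f' x by apply: cvg_trans cf'; exact: cvg_app (cvg_within _).
apply: cvg_trans cw; apply: near_eq_cvg; rewrite near_withinE.
by apply: filterS ff' => y h /h ->.
Qed.

End SmoothOn.

(** * Averages of smooth families *)

Section ProdVec.
Context {R : realType}.

Lemma prod_vec_atlas (E F : normedModType R) :
  prod_atlas (@vec_atlas R E) (@vec_atlas R F) = @vec_atlas R (E * F)%type.
Proof.
apply/funext => p; rewrite /prod_atlas /vec_atlas /=.
have -> : [set: E] `*` [set: F] = setT by apply/seteqP; split.
by have -> : (fun q : E * F => (id q.1, id q.2)) = id by apply/funext => -[].
Qed.

End ProdVec.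

(** Tube lemma; the uniformities over compact sets below are obtained from it. *)
Lemma compact_tube (T X : topologicalType) (Q : set X) (P : T -> X -> Prop) (t0 : T) :
  compact Q -> (forall x, Q x -> \forall p \near ((t0, x) : T * X), P p.1 p.2) ->
  \forall t \near t0, forall x, Q x -> P t x.
Proof.
move=> cQ H; apply: ((compact_near_coveringP Q).1 cQ T (nbhs t0) P _) => x Qx.
have [[A1 A2] /= [h1 h2] HP] := H x Qx.
by exists (A2, A1) => //= -[x' t'] [/= Ax' At']; exact: (HP (t', x')).
Qed.

Lemma near_ord (T : Type) (F : set_system T) {FF : Filter F} n (P : 'I_n -> T -> Prop) :
  (forall j, \forall t \near F, P j t) -> \forall t \near F, forall j, P j t.
Proof. exact: filter_forall. Qed.

(* [I] averages functions over the compact set [Q]; only their values and their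
   continuity at the points of [Q] matter. *)
Record mean_functional {R : realType} (X : topologicalType) (Q : set X)
    (I : (X -> R^o) -> R^o) : Prop := MeanFunctional {
  mean_linear : forall (c : R) (f g : X -> R^o), (forall x, Q x -> {for x, continuous f}) ->
    (forall x, Q x -> {for x, continuous g}) ->
    I (fun x => c * f x + g x) = c * I f + I g;
  mean_bound : forall (f : X -> R^o) (C : R), (forall x, Q x -> {for x, continuous f}) ->
    (forall x, Q x -> `|f x| <= C) -> `|I f| <= C }.

Section MeanSmooth.
Context {R : realType} (X : topologicalType) (EX : normedModType R) (aX : atlas X EX)
  {atX : IsAtlas aX} {fX : FinDim EX} (Q : set X) (cQ : compact Q)
  (I : (X -> R^o) -> R^o) (mI : mean_functional Q I).

Lemma continuous_lincomb (f g : X -> R^o) (c : R) x : {for x, continuous f} ->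
  {for x, continuous g} -> {for x, continuous (fun x => c * f x + g x : R^o)}.
Proof.
by move=> cf cg; apply: cvgD => //; apply: cvgM => //; exact: cvg_cst.
Qed.

Lemma mean_sub f g : (forall x, Q x -> {for x, continuous f}) ->
  (forall x, Q x -> {for x, continuous g}) -> I (fun x => f x - g x) = I f - I g.
Proof.
move=> cf cg; have := mean_linear mI (-1) cg cf; rewrite mulN1r addrC => <-.
by congr I; apply/funext => x; rewrite mulN1r addrC.
Qed.

Lemma mean_ext f g : (forall x, Q x -> {for x, continuous f}) ->
  (forall x, Q x -> {for x, continuous g}) -> (forall x, Q x -> f x = g x) ->
  I f = I g.
Proof.
move=> cf cg fg; apply/eqP; rewrite -subr_eq0 -normr_le0 -mean_sub //.
apply: (mean_bound mI) => x Qx; last by rewrite fg // subrr normr0.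
by apply: cvgB; [exact: cf|exact: cg].
Qed.

Section OpenFamily.
Context {E : normedModType R} {fE : FinDim E} (V : set E) (oV : open V).

Let smoothF (Phi : E -> X -> R^o) := forall e x, V e -> Q x ->
  smooth_at (prod_atlas (@vec_atlas R E) aX) (@vec_atlas R R^o)
    (fun p => Phi p.1 p.2) (e, x).

(** In a chart of [X] the derivative in the parameter is a directional derivative of a smooth
    function in the constant direction (v, 0), hence jointly smooth again; this allows the induction
    in [mean_Cinfty]. *)
Lemma family_derive Phi v : smoothF Phi ->
  (forall e x, V e -> Q x -> \forall x' \near x, differentiable (Phi^~ x') e) /\
  smoothF (fun e x => 'D_v (Phi^~ x) e).
Proof.
move=> sPhi.
have key e0 x0 : V e0 -> Q x0 -> (\forall x' \near x0, differentiable (Phi^~ x') e0) /\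
    smooth_at (prod_atlas (@vec_atlas R E) aX) (@vec_atlas R R^o)
    (fun p => 'D_v (Phi^~ p.2) p.1) (e0, x0).
  move=> Ve0 Qx0; have sP := sPhi _ _ Ve0 Qx0.
  pose chi := cfun (aX x0).
  have dx0 : cdom (aX x0) x0 by exact: atlas_dom.
  have sic : smooth_at (@vec_atlas R EX) aX (cinv (aX x0)) (chi x0).
    by apply: cinv_smooth; exact: cfun_img.
  pose G (q : E * EX) : R^o := Phi q.1 (cinv (aX x0) q.2).
  have sG : smooth_near G (e0, chi x0).
    case: sP => _ [W [oW Wx] HW]; exists W => //.
  case: (sG) => W [oW W0] HW.
  have sd w : smooth_near ('D_w G) (e0, chi x0) by exact: smooth_near_derive.
  pose sigma (p : E * X) : E * EX := (p.1, chi p.2).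
  have ssig : smooth_at (prod_atlas (@vec_atlas R E) aX) (@vec_atlas R (E * EX)%type) sigma (e0, x0).
    rewrite -prod_vec_atlas.
    have [s1 _] := [elaborate smooth_at_fst (@vec_atlas R E) aX (e0, x0)].
    have [s2 _] := [elaborate smooth_at_snd (@vec_atlas R E) aX (e0, x0)].
    have s3 : smooth_at aX (@vec_atlas R EX) chi ((e0, x0) : E * X).2 by exact: cfun_smooth.
    have [s4 _] := [elaborate smooth_at_comp s2 s3].
    by have [] := [elaborate smooth_at_pair s1 s4].
  have N1 : \forall p \near ((e0, x0) : E * X), W (sigma p).
    by apply: (smooth_at_cont ssig); exact: open_nbhs_nbhs.
  have N2 : \forall p \near ((e0, x0) : E * X), cdom (aX x0) p.2.
    by apply: (cvg_snd (F := nbhs e0) (G := nbhs x0)); exact: cdom_near.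
  have N3 : \forall p \near ((e0, x0) : E * X),
      differentiable (Phi^~ p.2) p.1 /\
      'D_(v, 0) G (sigma p) = 'D_v (Phi^~ p.2) p.1.
    near=> p.
    have Wp : W (sigma p) by near: p.
    have dp : cdom (aX x0) p.2 by near: p.
    have dG : differentiable G (sigma p) by exact: Cinfty_diff HW Wp.
    pose j (e : E) : E * EX := (e, chi p.2).
    have dj : differentiable j p.1 by [].
    have Pj : Phi^~ p.2 = G \o j.
      by apply/funext => e; rewrite /G /j /= cfunK.
    rewrite Pj; split; first exact: differentiable_comp.
    rewrite derive_compE //; congr ('D_ _ G _).
    rewrite deriveE // /j diff_pair //= diff_val.
    by rewrite diff_cst.
  split.
    case: N3 => -[A1 A2] /= [h1 h2] H'; apply: filterS h2 => x' Ax'.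
    by have [] := H' (e0, x') (conj (nbhs_singleton h1) Ax').
  have [sc _] := [elaborate smooth_at_comp ssig ((smooth_at_vec _ _).2 (sd (v, 0)))].
  apply: smooth_at_ext sc.
  by apply: filterS N3 => p [].
by split=> e x Ve Qx; have [] := key e x Ve Qx.
Unshelve. all: by end_near. Qed.

Lemma family_cont Phi e x : smoothF Phi -> V e -> Q x -> {for x, continuous (Phi e)}.
Proof.
move=> sP Ve Qx; have [cP _] := sP e x Ve Qx.
apply: (@continuous_comp _ _ _ (fun x => (e, x)) (fun p : E * X => Phi p.1 p.2)) => //.
by apply: cvg_pair; [exact: cvg_cst|exact: cvg_id].
Qed.

(** Compactness of [Q] makes the derivatives along the finitely many [b j] uniformly close to those
    at e0. The mean value theorem then bounds the remainder uniformly on [Q], and [mean_bound]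
    carries the bound through the average. *)
Lemma mean_diff Phi e0 : smoothF Phi -> V e0 ->
  differentiable (fun e => I (Phi e)) e0 /\
  forall v, 'd (fun e => I (Phi e)) e0 v = I (fun x => 'D_v (Phi^~ x) e0).
Proof.
move=> sP Ve0; have [n [b [l [ll cl lE]]]] := fE.
pose L v := I (fun x => 'D_v (Phi^~ x) e0).
have dP e x : V e -> Q x -> differentiable (Phi^~ x) e.
  by move=> Ve Qx; exact: nbhs_singleton ((family_derive 0 sP).1 e x Ve Qx).
have sD v := (family_derive v sP).2.
have lL : linear L.
  move=> c u w; rewrite /L /GRing.scale /= -(mean_linear mI c); last 2 first.
  - by move=> x Qx; exact: family_cont (sD u) Ve0 Qx.
  - by move=> x Qx; exact: family_cont (sD w) Ve0 Qx.
  apply: mean_ext => x Qx.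
  - exact: family_cont (sD (c *: u + w)) Ve0 Qx.
  - by apply: continuous_lincomb; [exact: family_cont (sD u) Ve0 Qx|exact: family_cont (sD w) Ve0 Qx].
  - by rewrite !deriveE ?linearP //; exact: dP.
have cL : continuous L by exact: findim_linear_continuous.
have [|dI dE] := (@diff_epsP R _ _ (fun e => I (Phi e)) e0 L lL cL).1; last first.
  by split => // v; rewrite dE.
move=> eps eps0.
have [k k0 kE] := coord_bound b ll cl.
have ek0 : 0 < eps / k by rewrite divr_gt0.
have N : \forall e \near e0, forall x, Q x -> forall j,
    `|'D_(b j) (Phi^~ x) e - 'D_(b j) (Phi^~ x) e0| <= eps / k.
  apply: compact_tube => // x Qx.
  apply: (@near_ord _ (nbhs ((e0, x) : E * X)) _ n
    (fun j p => `|'D_(b j) (Phi^~ p.2) p.1 - 'D_(b j) (Phi^~ p.2) e0| <= eps / k)) => j.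
  have cD := (sD (b j) _ _ Ve0 Qx).1.
  have /cvgrPdist_lt /(_ (eps / k / 2)) := cD.
  rewrite divr_gt0 // => /(_ isT) [[A1 A2] /= [h1 h2] H].
  exists (A1, A2) => /=; first by split.
  move=> [e' x'] [/= Ae' Ax'].
  have h3 := H (e', x') (conj Ae' Ax'); have h4 := H (e0, x') (conj (nbhs_singleton h1) Ax').
  rewrite /= in h3 h4.
  apply: le_trans (ler_distD ('D_(b j) (Phi^~ x) e0) _ _) _.
  rewrite [X in X + _]distrC; rewrite [leRHS]splitr; apply: lerD; exact: ltW.
have N' : \forall e \near e0, V e by exact: open_nbhs_nbhs.
have [d /= d0 dN] := (nbhs_ballP _ _).1 (filterI N N').
have dist e : `|e - e0| < d -> V e /\ forall x, Q x -> forall j,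
     `|'D_(b j) (Phi^~ x) e - 'D_(b j) (Phi^~ x) e0| <= eps / k.
  by move=> h; have [] := dN e; [rewrite -ball_normE /ball_ /= distrC|move=> h1 h2; split].
apply/nbhs_ballP; exists d => // h; rewrite -ball_normE /ball_ /= sub0r normrN => hd.
have hd' : `|(h + e0) - e0| < d by rewrite addrK.
have Vh := (dist _ hd').1.
have c1 x : Q x -> {for x, continuous (Phi (h + e0))} by exact: family_cont.
have c2 x : Q x -> {for x, continuous (Phi e0)} by exact: family_cont.
have c3 x : Q x -> {for x, continuous (fun x => 'D_h (Phi^~ x) e0)}.
  by move=> Qx; exact: family_cont (sD h) Ve0 Qx.
have c12 x : Q x -> {for x, continuous (fun x => Phi (h + e0) x - Phi e0 x)}.
  by move=> Qx; apply: cvgB; [exact: c1|exact: c2].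
rewrite /L -mean_sub // -mean_sub //.
apply: (mean_bound mI) => x Qx; first by apply: cvgB; [exact: c12|exact: c3].
have seg (t : R) : 0 <= t <= 1 -> `|e0 + t *: h - e0| < d.
  move=> t01; have := @segment_in_ball R _ e0 (h + e0) e0 d t.
  by rewrite !addrK subrr normr0; apply.
have [t t01 EQ] := @mean_value_segment R _ (Phi^~ x) e0 h
  (fun t t01 => dP _ _ (dist _ (seg t t01)).1 Qx).
rewrite [h + e0]addrC EQ.
have dE z : V z -> 'd (Phi^~ x) z h = \sum_j l j h *: 'D_(b j) (Phi^~ x) z.
  move=> Vz; have dz := dP _ _ Vz Qx.
  rewrite {1}(lE h) linear_sumE; last by move=> ???; rewrite linearP.
  by apply: eq_bigr => j _; rewrite deriveE.
rewrite deriveE; last exact: dP.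
have [Vt Dt] := dist _ (seg t t01).
rewrite !dE // -sumrB.
apply: le_trans (ler_norm_sum _ _ _) _.
apply: (@le_trans _ _ (\sum_j `|l j h| * (eps / k))).
  by apply: ler_sum => j _; rewrite -scalerBr normrZ ler_wpM2l // Dt.
rewrite -mulr_suml mulrA ler_pdivrMr // mulrC -mulrA ler_wpM2l //; first exact: ltW.
by rewrite mulrC kE.
Qed.

Lemma mean_Cinfty Phi : smoothF Phi -> Cinfty V (fun e => I (Phi e)).
Proof.
move=> sP k; elim: k Phi sP => [|k IH] Phi sP.
  by move=> e Ve; have [/differentiable_continuous] := mean_diff sP Ve.
split=> [e Ve|v]; first by have [] := mean_diff sP Ve.
apply: (Ck_ext (f := fun e => I (fun x => 'D_v (Phi^~ x) e))) => //.
  by move=> e Ve; have [dI dE] := mean_diff sP Ve; rewrite deriveE.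
apply: IH; exact: (family_derive v sP).2.
Qed.

End OpenFamily.

Lemma mean_smooth_at (P : topologicalType) (EP : normedModType R) (aP : atlas P EP)
    (atP : IsAtlas aP) (fP : FinDim EP) (Phi : P -> X -> R^o) g0 :
  (forall x, Q x -> smooth_at (prod_atlas aP aX) (@vec_atlas R R^o)
     (fun p => Phi p.1 p.2) (g0, x)) ->
  smooth_at aP (@vec_atlas R R^o) (fun g => I (Phi g)) g0 /\
  forall v, tangent aP (@vec_atlas R R^o) (fun g => I (Phi g)) g0 v =
    I (fun x => tangent aP (@vec_atlas R R^o) (Phi^~ x) g0 v).
Proof.
move=> sP.
pose psi := cinv (aP g0); pose e0 := cfun (aP g0) g0.
have dg0 : cdom (aP g0) g0 by exact: atlas_dom.
have N : \forall g \near g0, forall x, Q x -> smooth_at (prod_atlas aP aX) (@vec_atlas R R^o)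
     (fun p => Phi p.1 p.2) (g, x).
  apply: compact_tube => // x Qx.
  have := [elaborate smooth_at_near (sP x Qx)].
  by apply: filterS => -[].
have N' := [elaborate near_cinv N].
have ie0 : cimg (aP g0) e0 by exact: cfun_img.
have [V [oV Ve0] HV] := near_open (filterI N' (cimg_near ie0)).
pose Phi' e x := Phi (psi e) x.
have sP' e x : V e -> Q x -> smooth_at (prod_atlas (@vec_atlas R EP) aX) (@vec_atlas R R^o)
    (fun p => Phi' p.1 p.2) (e, x).
  move=> /HV [/= h1 h2] Qx; have s0 := h1 x Qx.
  have [s1 _] := [elaborate smooth_at_fst (@vec_atlas R EP) aX (e, x)].
  have [s2 _] := [elaborate smooth_at_snd (@vec_atlas R EP) aX (e, x)].
  have s3 : smooth_at (@vec_atlas R EP) aP psi (fst ((e, x) : EP * X)) by exact: cinv_smooth.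
  have [s4 _] := [elaborate smooth_at_comp s1 s3].
  have [s5 _] := [elaborate smooth_at_pair s4 s2].
  by have [] := [elaborate smooth_at_comp s5 s0].
have [dI dE] := mean_diff oV sP' Ve0.
have cI := [elaborate mean_Cinfty oV sP'].
have sI : smooth_near (fun e => I (Phi' e)) e0 by exists V.
have sr : smooth_near (local_rep aP (@vec_atlas R R^o) (fun g => I (Phi g)) g0 0) e0 by [].
split.
  have cc : {for g0, continuous (fun g => I (Phi g))}.
    have cc : {for g0, continuous ((fun e => I (Phi' e)) \o cfun (aP g0))}.
      by apply: continuous_comp; [exact: cfun_cont|exact: smooth_near_cont].
    have E : \forall g \near g0, ((fun e => I (Phi' e)) \o cfun (aP g0)) g = I (Phi g).
      have := [elaborate cdom_near dg0].
      by apply: filterS => g h; rewrite /Phi' /psi /= cfunK.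
    rewrite /prop_for /continuous_at -(nbhs_singleton E).
    by apply: cvg_trans cc; apply: near_eq_cvg; apply: filterS E => z ->.
  by split.
move=> v; rewrite /tangent.
rewrite -[LHS]/('d (fun e => I (Phi' e)) e0 v) dE.
have [d0 _] := [elaborate family_derive 0 sP'].
have c1 x : Q x -> {for x, continuous (fun x => 'D_v (Phi'^~ x) e0)}.
  by move=> Qx; exact: family_cont (family_derive v sP').2 Ve0 Qx.
apply: (mean_ext c1) => [x Qx|x Qx].
  have dn := d0 _ _ Ve0 Qx.
  have E : \forall x' \near x, 'D_v (Phi'^~ x') e0 = 'd (Phi'^~ x') e0 v.
    by apply: filterS dn => x' dx'; exact: (deriveE v dx').
  suff : (fun x' => 'd (Phi'^~ x') e0 v) @ x --> 'd (Phi'^~ x) e0 v by [].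
  rewrite -(nbhs_singleton E); apply: cvg_trans (c1 x Qx).
  by apply: near_eq_cvg; apply: filterS E => z ->.
exact: (deriveE v (nbhs_singleton (d0 _ _ Ve0 Qx))).
Qed.

End MeanSmooth.

(** * Null sets of smooth measures *)

Section LebesgueNull.
Context {R : realType}.
Local Open Scope ereal_scope.
Import HBNNSimple.

Lemma lebesgue_rVS k (A : set 'rV[R]_k.+1) :
  lebesgue_rV (A : set (borel 'rV[R]_k.+1)) =
  \int[lebesgue_measure]_(x in [set: R])
    lebesgue_rV ([set v | A (row_mx (x%:M : 'M[R]_1) v)] : set (borel 'rV[R]_k)).
Proof. by []. Qed.

(* The innermost integral defining [lebesgue_rV] runs over the last coordinate. *)
Lemma lebesgue_rV_lines0 k (A : set 'rV[R]_k.+1) :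
  (forall u v, A u -> A v -> (forall j, j != ord_max -> u ord0 j = v ord0 j) -> u = v) ->
  lebesgue_rV (A : set (borel 'rV[R]_k.+1)) = 0.
Proof.
elim: k A => [|k IH] A HA; rewrite lebesgue_rVS.
  pose B := [set x : R | A (row_mx (x%:M : 'M[R]_1) (0 : 'rV[R]_0))].
  have HB x y : B x -> B y -> x = y.
    move=> Bx By; 
    have H (j : 'I_1) : j != ord_max ->
       (row_mx (x%:M : 'M[R]_1) (0 : 'rV[R]_0)) ord0 j =
       (row_mx (y%:M : 'M[R]_1) (0 : 'rV[R]_0)) ord0 j.
      by rewrite [j]ord1 [ord_max]ord1 eqxx.
    have := HA _ _ Bx By H => /(@eq_row_mx R 1 1 0) [/matrixP /(_ ord0 ord0)].
    by rewrite !mxE eqxx !mulr1n.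
  rewrite (_ : (fun x => _) = fun x => (\1_B x)%:E); last first.
    by apply/funext => x; rewrite /B !indicE; congr (_%:R%:E); rewrite !mem_setE.
  have [->|/set0P[x Bx]] := eqVneq B set0.
    by rewrite integral_indic // set0I measure0.
  have -> : B = [set x] by apply/seteqP; split => y; [move=> By; exact: HB|move=> ->].
  rewrite integral_indic; [|exact: measurableT|exact: measurable_set1].
  by rewrite setIT; exact: lebesgue_measure_set1.
apply: integral0_eq => x _; apply: IH => u v Au Av uv.
have H : forall j : 'I_(1 + k.+1), j != ord_max ->
    (row_mx (x%:M : 'M[R]_1) u) ord0 j = (row_mx (x%:M : 'M[R]_1) v) ord0 j.
  move=> j; case: (splitP j) => i ji jm.
    by rewrite (_ : j = lshift k.+1 i) ?row_mxEl //; exact: val_inj.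
  have E : j = rshift 1 i by exact: val_inj.
  rewrite E !row_mxEr; apply: uv; apply: contra_neq jm => im.
  by apply: val_inj; rewrite /= ji im.
by have := HA _ _ Au Av H => /(@eq_row_mx R 1 1 k.+1) [].
Qed.

(** [mu] is an arbitrary set function, since [lebesgue_rV] carries no measure structure; hence the
    hypothesis on all subsets. Any simple function below the positive or negative part of the
    restricted integrand has its positive levels inside [A], so its integral vanishes. *)
Lemma integral_null d (T : measurableType d) (mu : set T -> \bar R) (A : set T)
    (f : T -> \bar R) : (forall B, B `<=` A -> mu B = 0) -> \int[mu]_(x in A) f x = 0.
Proof.
move=> mu0; rewrite /integral /=.
have N g : (forall x, ~ A x -> g x = 0) ->
    ereal_sup [set sintegral mu h | h in [set h : {nnsfun T >-> R} | forall x, (h x)%:E <= g x]] <= 0.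
  move=> g0; apply: ge_ereal_sup => _ [h /= hg <-].
  rewrite /sintegral fsbig1 // => r _.
  have [->|r0] := eqVneq r 0%R; first by rewrite mul0e.
  rewrite mu0 ?mule0 // => x /= hx; apply: contrapT => nA.
  have := hg x; rewrite g0 // lee_fin hx => rle.
  have : (0 <= h x)%R by [].
  by rewrite hx => rge; move: r0; rewrite eq_le rle rge.
have P g : (forall x, 0 <= g x) -> (forall x, ~ A x -> g x = 0) ->
    ereal_sup [set sintegral mu h | h in [set h : {nnsfun T >-> R} | forall x, (h x)%:E <= g x]] = 0.
  move=> gp g0; apply/eqP; rewrite eq_le N //=.
  apply: ereal_sup_ubound; exists (nnsfun0 : {nnsfun T >-> R}) => //=.
  rewrite /sintegral fsbig1 // => r _.
  have [->|r0] := eqVneq r 0%R; first by rewrite mul0e.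
  by rewrite mu0 ?mule0 // => x /= hx; move: r0; rewrite -hx eqxx.
rewrite !P ?sube0 // => x nA.
  by rewrite funenegE patchE memNset // oppe0 maxxx.
by rewrite funeposE patchE memNset // maxxx.
Qed.

End LebesgueNull.

Section BorelSets.
Context {T : ptopologicalType}.

Lemma borel_open (A : set T) : open A -> measurable (A : set (borel T)).
Proof. by move=> oA; exact: sub_sigma_algebra. Qed.

Lemma borel_closed (A : set T) : closed A -> measurable (A : set (borel T)).
Proof.
move=> cA; rewrite -(setCK A); apply: measurableC; apply: borel_open.
exact: closed_openC.
Qed.

End BorelSets.

Lemma borel_continuous_measurable (T U : ptopologicalType) (f : T -> U) :
  continuous f -> measurable_fun (setT : set (borel T)) (f : borel T -> borel U).
Proof.
move=> cf; apply: measurability; first by [].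
move=> _ [A oA <-]; rewrite setTI; apply: borel_open.
by apply: open_comp => // x _; exact: cf.
Qed.

Lemma closed_level {R : realType} (T : topologicalType) (C : set T) (f : T -> R^o) :
  closed C -> (forall x, C x -> {for x, continuous f}) ->
  closed [set x | C x /\ f x = 0].
Proof.
move=> cC cf; rewrite -[X in closed X]setCK; apply: open_closedC.
rewrite openE => x /= nA; have [Cx|nCx] := pselect (C x); last first.
  have : \forall y \near x, (~` C) y by apply: open_nbhs_nbhs; split => //; exact: closed_openC.
  by apply: filterS => y nCy [].
have fx : f x != 0 by apply/eqP => fx; apply: nA.
have : \forall y \near x, f y != 0.
  apply: (cf x Cx [set y : R^o | y != 0]); apply: open_nbhs_nbhs; split => //.
by apply: filterS => y fy [_ fy0]; rewrite fy0 eqxx in fy.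
Qed.

Section SmoothMeasure.
Context {R : realType} (Z : ptopologicalType) (E : normedModType R) {fE : FinDim E}
  (aZ : atlas Z E) {atZ : IsAtlas aZ} (M : set Z).
Hypothesis hZ : hausdorff_space Z.

(** Allows a chart to be sheared so that a given direction becomes the last coordinate, the one
    treated by [lebesgue_rV_lines0]. *)
Lemma submanifold_chart_linear k W V phi psi (S S' : 'rV[R]_k -> 'rV[R]_k) :
  linear S -> linear S' -> cancel S S' -> cancel S' S ->
  submanifold_chart aZ M W V phi psi ->
  submanifold_chart aZ M W [set u | V (S u)] (S' \o phi) (psi \o S).
Proof.
move=> lS lS' SK S'K [oW oV [h1 h2 s1 s2]].
have cS : continuous S by exact: findim_linear_continuous.
split => //; first by apply: open_comp => // x _; exact: cS.
split.
- by move=> x /h1 [h3 h4]; rewrite /= S'K.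
- by move=> y /= /h2 [h3 h4]; split => //; rewrite h4 SK.
- have sS' : smooth_on (@vec_atlas R 'rV[R]_k) (@vec_atlas R 'rV[R]_k) setT S'.
    by apply: smooth_onT => x _; apply/smooth_at_vec; exact: smooth_near_linear.
  by apply: (smooth_on_comp _ s1 sS').
- have sS : smooth_on (@vec_atlas R 'rV[R]_k) (@vec_atlas R 'rV[R]_k) [set u | V (S u)] S.
    by apply: smooth_onT => x _; apply/smooth_at_vec; exact: smooth_near_linear.
  by apply: (smooth_on_comp _ sS s2).
Qed.

Lemma chart_psi_smooth k W V phi psi e : @submanifold_chart R Z E aZ M k W V phi psi ->
  V e -> smooth_at (@vec_atlas R 'rV[R]_k) aZ psi e.
Proof.
move=> [oW oV [_ _ _ s2]] Ve; have [g sg gf] := s2 _ Ve.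
apply: smooth_at_ext sg.
have : \forall y \near e, V y by exact: open_nbhs_nbhs.
by apply: filterS2 gf => y h /h.
Qed.

(** By strict differentiability and the nonzero derivative in the last coordinate, h vanishes at
    most once on each line in that direction near e0, so its zero set is null by
    [lebesgue_rV_lines0]. The neighbourhood is chosen before the measure, because it will serve for
    all pushforwards of nu0 at once. *)
Lemma smooth_measure_level_last k W V phi psi (h : 'rV[R]_k.+1 -> R^o) e0 :
  submanifold_chart aZ M W V phi psi -> V e0 -> smooth_near h e0 ->
  'd h e0 (delta_mx 0 ord_max) != 0 ->
  exists2 N : set Z, open N /\ N (psi e0) &
    forall nu0 : probability (borel Z) R, smooth_measure aZ M nu0 ->
    nu0.-negligible [set x : borel Z | [/\ M x, N x & h (phi x) = 0]].
Proof.
move=> ch Ve0 [B [oB Be0] HB] c0; set dl : 'rV[R]_k.+1 := delta_mx 0 ord_max in c0.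
set c := 'd h e0 dl in c0.
(* With this precision the error on a segment t dl is at most |t| |c| / 2, less than the linear term
   |t| |c|; two zeros on one line therefore force t = 0. *)
have eps0 : 0 < `|c| / (2 * (`|dl| + 1)).
  by rewrite divr_gt0 ?normr_gt0 // mulr_gt0 // ltr_pwDr.
have [d1 d10 d1P] := [elaborate strict_diff oB Be0 (HB 1%N) eps0].
have [oW oV [h1 h2 s1 s2]] := ch.
have BV : \forall e \near e0, B e /\ V e.
  by apply: filterI; exact: open_nbhs_nbhs.
have [d2 /= d20 d2P] := (nbhs_ballP _ _).1 BV.
pose d := Order.min d1 d2; have d0 : 0 < d by rewrite lt_min d10.
pose r := d / 2; have r0 : 0 < r by rewrite divr_gt0.
have rd : r < d by rewrite /r; lra.
pose C := closed_ball e0 r.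
have CE u : C u -> `|u - e0| < d.
  by rewrite /C closed_ballE // /closed_ball_ /= distrC => /le_lt_trans; apply.
have Cd1 u : C u -> `|u - e0| < d1.
  by move=> /CE /lt_le_trans; apply; rewrite ge_min lexx.
have CBV u : C u -> B u /\ V u.
  move=> /CE ud; apply: d2P; rewrite -ball_normE /ball_ /= distrC.
  by apply: lt_le_trans ud _; rewrite ge_min lexx orbT.
(* Cutting by a closed ball makes the zero set compact, so its image under [psi] is compact and
   hence Borel. *)
pose A := [set u | C u /\ h u = 0].
have cA : closed A.
  apply: closed_level; first exact: closed_ball_closed.
  by move=> x /CBV [Bx _]; exact: (Ck_continuous (HB 0%N) Bx).
have kA : compact A.
  apply: (subclosed_compact cA (@findim_closed_ball_compact _ _ _ e0 r)).
  by move=> x [].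
have null (nu0 : probability (borel Z) R) : smooth_measure aZ M nu0 ->
    nu0 (psi @` A) = 0%E.
  move=> nu0_smooth; have [rho [_ _ H]] := nu0_smooth _ _ _ _ _ ch.
  rewrite H; last 2 first.
  - exact: borel_closed.
  - by move=> u [/CBV []].
  apply: integral_null => A' A'A; apply: lebesgue_rV_lines0 => u v Au Av uv.
  have [Cu hu] := A'A _ Au; have [Cv hv] := A'A _ Av.
  have := d1P _ _ (Cd1 _ Cu) (Cd1 _ Cv).
  pose t := (v - u) ord0 ord_max.
  have vu : v - u = t *: dl.
    apply/rowP => j; rewrite !mxE !eqxx /=; have [->|jm] := eqVneq j ord_max.
      by rewrite /t !mxE mulr1.
    by rewrite uv // subrr mulr0.
  rewrite hu hv subrr sub0r normrN vu linearZ /= !normrZ -/c.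
  move=> ht; apply/eqP; rewrite eq_sym -subr_eq0 vu scaler_eq0 -normr_eq0.
  apply/orP; left; apply/negPn/negP => tn.
  have tp : 0 < `|t| by rewrite lt_def tn /=.
  move: ht; rewrite mulrCA ler_pM2l // mulrAC ler_pdivlMr ?mulr_gt0 ?ltr_pwDr //.
  rewrite ler_pM2l ?normr_gt0 //.
  by have := normr_ge0 dl; lra.
have ce u : A u -> {for u, continuous psi}.
  by move=> [/CBV [_ Vu] _]; have [] := [elaborate chart_psi_smooth ch Vu].
have mA : measurable (psi @` A : set (borel Z)).
  apply: borel_closed; apply: compact_closed => //.
  apply: continuous_compact => //.
  by apply: continuous_in_subspaceT => u /set_mem /ce.
have [Mz pz] := h2 _ Ve0.
have [g [cg _] gf] := s1 _ Mz; have gz := nbhs_singleton gf Mz.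
have : \forall x \near psi e0, `|g x - e0| < r /\ W x.
  apply: filterI; last by apply: open_nbhs_nbhs; split => //; case: Mz.
  have /cvgrPdist_lt /(_ r r0) := cg.
  by rewrite gz pz; apply: filterS => x; rewrite distrC.
move=> /(filterI gf) /near_open [N [oN Nz] NP]; exists N => // nu0 nu0_smooth.
exists (psi @` A); split => //; first exact: null.
move=> x [Mx Nx hx].
have [gx [gr Wx]] := NP _ Nx; have {}gx := gx (conj Mx Wx).
have [_ px] := h1 x (conj Mx Wx).
exists (phi x) => //; split => //.
by rewrite /C closed_ballE // /closed_ball_ /= distrC -gx ltW.
Qed.

(** A shear of the chart turns a direction in which the differential of h does not vanish into the
    last coordinate direction. *)
Lemma smooth_measure_level k W V phi psi (h : 'rV[R]_k -> R^o) e0 :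
  submanifold_chart aZ M W V phi psi -> V e0 -> smooth_near h e0 ->
  (exists u, 'd h e0 u != 0) ->
  exists2 N : set Z, open N /\ N (psi e0) &
    forall nu0 : probability (borel Z) R, smooth_measure aZ M nu0 ->
    nu0.-negligible [set x : borel Z | [/\ M x, N x & h (phi x) = 0]].
Proof.
case: k => [|k] in V phi psi h e0 *.
  by move=> _ _ _ [u]; rewrite [u]thinmx0 linear0 eqxx.
move=> ch Ve0 sh [u du].
pose dl : 'rV[R]_k.+1 := delta_mx 0 ord_max.
(* The correction w has no last coordinate, so the shear x + x_last w is inverted by x - x_last w.
   It is needed only when the derivative along the last axis vanishes. *)
have [w w0 dw] : exists2 w : 'rV[R]_k.+1, w 0 ord_max = 0 & 'd h e0 (dl + w) != 0.
  have [d0|d0] := eqVneq ('d h e0 dl) 0; last by exists 0; rewrite ?mxE ?addr0.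
  exists (u - u 0 ord_max *: dl); first by rewrite !mxE !eqxx mulr1 subrr.
  by rewrite linearD linearB linearZ /= d0 scaler0 subr0 add0r.
pose S (x : 'rV[R]_k.+1) := x + x 0 ord_max *: w.
pose S' (x : 'rV[R]_k.+1) := x - x 0 ord_max *: w.
have lS : linear S by move=> a x y; rewrite /S !mxE; module.
have lS' : linear S' by move=> a x y; rewrite /S' !mxE; module.
have SK : cancel S S' by move=> x; rewrite /S /S' !mxE w0 mulr0 addr0 addrK.
have S'K : cancel S' S by move=> x; rewrite /S /S' !mxE w0 mulr0 subr0 subrK.
have ch' := [elaborate submanifold_chart_linear lS lS' SK S'K ch].
have Se0 : S (S' e0) = e0 by [].
have sh' : smooth_near (h \o S) (S' e0).
  apply: smooth_near_comp; first exact: smooth_near_linear.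
  by rewrite Se0.
have [dS dSE] : differentiable S (S' e0) /\ 'd S (S' e0) = S :> ('rV[R]_k.+1 -> _).
  by apply: diff_lin_fun => //; exact: findim_linear_continuous.
have [||] := @smooth_measure_level_last _ _ _ _ _ (h \o S) (S' e0) ch' _ sh'.
- by rewrite /= Se0.
- rewrite diff_comp //; last by rewrite Se0; exact: smooth_near_diff.
  rewrite dSE Se0 /= (_ : S _ = dl + w) //.
  by rewrite /S !mxE !eqxx scale1r.
move=> N [oN Nz] H; exists N; first by split => //; move: Nz; rewrite /= Se0.
by move=> nu0 /H; apply: negligibleS => x [Mx Nx hx]; split => //=; rewrite S'K.
Qed.

(** Composing with [g] turns a chart of [M] into another chart of [M]; the density of nu0 in the
    latter is the density of the pushed measure in the former. *)
Lemma smooth_measure_push (g g' : Z -> Z) (nu0 : set (borel Z) -> \bar R) :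
  (forall z, smooth_at aZ aZ g z) -> (forall z, smooth_at aZ aZ g' z) ->
  cancel g g' -> cancel g' g -> (forall x, M x -> M (g x)) -> (forall x, M x -> M (g' x)) ->
  smooth_measure aZ M nu0 -> smooth_measure aZ M (push g nu0).
Proof.
move=> sg sg' gK g'K Mg Mg' nu0s k W V phi psi ch.
have [oW oV [h1 h2 s1 s2]] := ch.
have ch' : submanifold_chart aZ M (g @^-1` W) V (phi \o g) (g' \o psi).
  split => //; first by apply: open_comp => // z _; have [] := sg z.
  split.
  - by move=> x [Mx Wx]; have [Vx Ex] := h1 (g x) (conj (Mg _ Mx) Wx); rewrite /= Ex gK.
  - by move=> e Ve; have [[Mx Wx] Ee] := h2 _ Ve; rewrite /= g'K; split => //; split; [exact: Mg'|by rewrite /= ?g'K].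
  - refine (smooth_on_comp (B := M `&` W) _ _ s1); first by move=> x [/Mg ? ?].
    by apply: smooth_onT => x _; exact: sg.
  - refine (smooth_on_comp (B := setT) _ s2 _) => //.
    by apply: smooth_onT => x _; exact: sg'.
have [rho [r1 r2 r3]] := nu0s _ _ _ _ _ ch'.
exists rho; split => // A mA AV; rewrite -r3 // /push /pushforward; congr nu0.
apply/seteqP; split=> [x [e Ae Ex]|x [e Ae <-]].
  by exists e => //=; rewrite Ex gK.
by exists e => //=; rewrite g'K.
Qed.

End SmoothMeasure.

(** * One-parameter subgroups and the polar decomposition *)

Lemma manifold_isAtlas {R : realType} (X : topologicalType) (E : normedModType R)
  (a : atlas X E) : is_manifold a -> IsAtlas a.
Proof. by move=> [_ _ H1 H2]; split=> // x; case: (H1 x). Qed.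

Section SmoothCurves.
Context {R : realType} (X : topologicalType) (E : normedModType R) (a : atlas X E)
  {aX : IsAtlas a} {fE : FinDim E}.
Notation vR := (@vec_atlas R R^o).

Lemma zero_derivative_near (g : R^o -> E) (t0 : R) (d : R) : 0 < d ->
  (forall t, `|t - t0| < d -> differentiable g t /\ 'd g t 1 = 0) ->
  forall t, `|t - t0| < d -> g t = g t0.
Proof.
have [n [b [l [ll cl lE]]]] := fE => d0 Hg t td.
rewrite (lE (g t)) (lE (g t0)); apply: eq_bigr => j _; congr (_ *: _).
have seg (s : R) : 0 <= s <= 1 -> `|t0 + s *: (t - t0) - t0| < d.
  by move=> s01; apply: segment_in_ball => //; rewrite subrr normr0.
have dl s : `|s - t0| < d -> differentiable (l j \o g) s /\ forall u, 'd (l j \o g) s u = 0.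
  move=> /Hg [dg d1]; have [dlj E1] := diff_lin_fun (g s) (ll j) (cl j).
  split; first exact: differentiable_comp.
  move=> u; rewrite diff_comp //= E1.
  by rewrite (_ : u = u *: (1 : R^o)) ?linearZ /= ?d1 ?scaler0 ?(lin_zero (ll j)) // /GRing.scale /= mulr1.
have [s s01] := @mean_value_segment R _ (l j \o g) t0 (t - t0) (fun s s01 => (dl _ (seg s s01)).1).
rewrite (dl _ (seg s s01)).2 [t0 + _]addrC subrK => /eqP.
by rewrite subr_eq0 => /eqP.
Qed.

(** The set where g takes its value at 0 is closed by separation and open by the local statement
    read in a chart; the line is connected. *)
Lemma zero_velocity_constant (g : R^o -> X) : hausdorff_space X ->
  (forall t, smooth_at vR a g t) -> (forall t, tangent vR a g t 1 = 0) ->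
  forall t, g t = g 0.
Proof.
move=> hX sg tg.
have cR : connected [set: R].
  by apply/connected_intervalP; move=> ? ? ? ? ? ?.
have cg : continuous g by move=> t; exact: smooth_at_cont (sg t).
have E1 : [set t | g t = g 0] = [set: R].
  apply: cR; first by exists 0.
  - exists [set t | g t = g 0]; last by rewrite setTI.
    rewrite openE => t /= gt.
    have dt : cdom (a (g t)) (g t) by exact: atlas_dom.
    have : \forall s \near t, cdom (a (g t)) (g s) by apply: (cg t); exact: cdom_near.
    move=> /nbhs_ballP [e /= e0 He].
    apply/nbhs_ballP; exists e => // s ts /=.
    have He' r : `|r - t| < e -> cdom (a (g t)) (g r).
      by move=> h; apply: He; rewrite -ball_normE /ball_ /= distrC.
    pose h := local_rep vR a g 0 (g t).
    have st : `|s - t| < e by move: ts; rewrite -ball_normE /ball_ /= distrC.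
    have Hh r : `|r - t| < e -> differentiable h r /\ 'd h r 1 = 0.
      move=> /He' dr.
      have [sm dE] := @local_rep_smooth _ _ _ _ _ vR a _ aX _ fE g 0 (g t) r I dr (sg r).
      split; first exact: smooth_near_diff.
      rewrite dE; have [_ tid] := smooth_at_id vR r.
      by rewrite (_ : cinv (vR 0) = id) // tid tg /tangent linear0.
    have := zero_derivative_near e0 Hh st.
    rewrite /h /local_rep /= => hE.
    by rewrite -gt -(cfunK (He' _ st)) hE cfunK.
  - exists [set t | g t = g 0]; last by rewrite setTI.
    apply: (@preimage_closed _ _ g [set g 0]) => [t _|]; first exact: cg.
    exact: accessible_closed_set1 (hausdorff_accessible hX) _.
by move=> t; have : [set: R] t by []; rewrite -E1.
Qed.

End SmoothCurves.

Section LieGroup.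
Context {R : realType} (H : topGroupType) (d : nat) (a : atlas H (Cn R d)).
Hypothesis Hlie : is_complex_lie_group a.
Local Open Scope group_scope.
Notation vR := (@vec_atlas R R^o).
Notation "1" := (1%g) : group_scope.

Let aH : IsAtlas a.
Proof. by apply: manifold_isAtlas; case: (lie_manifold Hlie). Qed.
#[local] Existing Instance aH.

Lemma lie_hausdorff : hausdorff_space H.
Proof. by case: (lie_manifold Hlie) => -[]. Qed.

Section Products.
Context (X : topologicalType) (E : normedModType R) (b : atlas X E)
  {bX : IsAtlas b} {fE : FinDim E}.

Lemma smooth_mul (f g : X -> H) x : smooth_at b a f x -> smooth_at b a g x ->
  smooth_at b a (fun y => f y * g y) x /\
  forall v, tangent b a (fun y => f y * g y) x v =
    tangent (prod_atlas a a) a (fun p => p.1 * p.2) (f x, g x)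
      (tangent b a f x v, tangent b a g x v).
Proof.
move=> sf sg; have [s1 t1] := [elaborate smooth_at_pair sf sg].
have [s2 t2] := [elaborate smooth_at_comp s1 ((lie_mul Hlie).1 (f x, g x))].
by split => // v; rewrite -t1 -t2.
Qed.

Lemma smooth_inv (f : X -> H) x : smooth_at b a f x ->
  smooth_at b a (fun y => (f y)^-1) x.
Proof.
by move=> sf; have [] := [elaborate smooth_at_comp sf ((lie_inv Hlie).1 (f x))].
Qed.

End Products.

Lemma smooth_mull g x : smooth_at a a (fun y => g * y) x.
Proof.
have [s _] := smooth_at_id a x.
by have [] := [elaborate smooth_mul (smooth_at_cst a a g x) s].
Qed.

Lemma smooth_mulr g x : smooth_at a a (fun y => y * g) x.
Proof.
have [s _] := smooth_at_id a x.
by have [] := [elaborate smooth_mul s (smooth_at_cst a a g x)].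
Qed.

Lemma tangent_mul11 (u v : Cn R d) :
  tangent (prod_atlas a a) a (fun p => p.1 * p.2) (1, 1) (u, v) = (u + v)%R.
Proof.
have [s t] := smooth_at_id a (1 : H).
have sc := [elaborate smooth_at_cst a a (1 : H) 1].
have [_ t1] := [elaborate smooth_mul s sc].
have [_ t2] := [elaborate smooth_mul sc s].
have E1 : (fun y : H => id y * 1) = id by apply/funext => y; exact: mulg1.
have E2 : (fun y : H => 1 * id y) = id by apply/funext => y; exact: mul1g.
rewrite E1 in t1; rewrite E2 in t2.
have tu : tangent (prod_atlas a a) a (fun p => p.1 * p.2) (1, 1) (u, 0%R) = u.
  by have := t1 u; rewrite t tangent_cst.
have tv : tangent (prod_atlas a a) a (fun p => p.1 * p.2) (1, 1) (0%R, v) = v.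
  by have := t2 v; rewrite t tangent_cst.
have -> : (u, v) = ((u, 0) + (0, v))%R.
  by apply: injective_projections; rewrite /= ?addr0 ?add0r.
by rewrite -[in RHS]tu -[in RHS]tv /tangent linearD.
Qed.

Lemma one_ps0 X c : one_parameter_subgroup a X c -> c 0%R = 1.
Proof.
move=> [cD _ _]; have := cD 0%R 0%R; rewrite addr0 => h.
by apply: (mulgI (c 0%R)); rewrite mulg1 -h.
Qed.

Lemma one_ps_opp X c t : one_parameter_subgroup a X c -> c (- t)%R = (c t)^-1.
Proof.
move=> h; apply: (mulgI (c t)); rewrite mulgV; have [cD _ _] := h.
by rewrite -cD subrr; exact: one_ps0 h.
Qed.

Lemma one_ps_scale X c (s : R) : one_parameter_subgroup a X c ->
  one_parameter_subgroup a (s *: X)%R (fun t => c (s * t)%R).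
Proof.
move=> [cD sc tc].
have ls : linear (fun t : R^o => s * t : R^o)%R.
  by move=> k x y; rewrite mulrDr /GRing.scale /= mulrCA.
have sl t : smooth_at vR vR (fun t : R^o => s * t : R^o)%R t.
  by apply/smooth_at_vec; exact: smooth_near_linear.
have S t := [elaborate smooth_at_comp (sl t) (sc (s * t)%R)].
split.
- by move=> t u; rewrite mulrDr cD.
- by move=> t; have [] := S t.
- have [_ ->] := S 0%R; rewrite tangent_vec.
  have [_ ->] := diff_lin_fun (0 : R^o)%R ls (findim_linear_continuous ls).
  rewrite mulr1 mulr0 -tc (_ : s = s *: (1 : R^o))%R ?/tangent ?linearZ //=.
  all: by rewrite /GRing.scale /= ?mulr1.
Qed.

(** The curve g(t) = c(t) c'(-t) has zero velocity: at 0 it is X - X, and g(u) = c(t) g(u - t)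
    c'(-t) carries this to every time t. So g is constantly 1. *)
Lemma one_ps_uniq X c c' : one_parameter_subgroup a X c ->
  one_parameter_subgroup a X c' -> c = c'.
Proof.
move=> hc hc'; have [cD sc tc] := hc; have [cD' sc' tc'] := hc'.
have hn := one_ps_scale (-1)%R hc'; have [cDn scn tcn] := hn.
pose g t := c t * c' (-1 * t)%R.
have G t := [elaborate smooth_mul (sc t) (scn t)].
have g0 : g 0%R = 1 by rewrite /g mulr0 (one_ps0 hc) (one_ps0 hc') mulg1.
have tg0 : tangent vR a g 0%R 1%R = 0%R.
  have [_ ->] := G 0%R.
  rewrite mulr0 (one_ps0 hc) (one_ps0 hc') tangent_mul11 tc tcn.
  by rewrite scaleN1r subrr.
have tg t : tangent vR a g t 1%R = 0%R.
  pose sh (u : R^o) : R^o := (u - t)%R.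
  pose LR (x : H) := (c t * x) * c' (-1 * t)%R.
  have gE : g = LR \o (g \o sh).
    apply/funext => u; rewrite /g /LR /sh /=.
    have -> : c u = c t * c (u - t)%R by rewrite -cD addrC subrK.
    have -> : c' (-1 * u)%R = c' (-1 * (u - t))%R * c' (-1 * t)%R.
      by rewrite -cD'; congr c'; ring.
    by rewrite !mulgA.
  have ssh : smooth_at vR vR sh t.
    by apply/smooth_at_vec; apply: smooth_near_add; [exact: smooth_near_id|exact: smooth_near_cst].
  have sg : smooth_at vR a g (sh t) by have [] := G (sh t).
  have [s1 t1] := [elaborate smooth_at_comp ssh sg].
  have sLR x : smooth_at a a LR x.
    have [s3 _] := [elaborate smooth_at_comp (smooth_mull (c t) x) (smooth_mulr (c' (-1 * t)%R) _)].
    exact: s3.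
  have [s2 t2] := [elaborate smooth_at_comp s1 (sLR _)].
  rewrite gE t2 t1 tangent_vec.
  have -> : 'd sh t 1%R = 1%R.
    have dsh : is_diff t sh (id - 0)%R by exact: is_diffB.
    by rewrite diff_val /= fctE /= subr0.
  have -> : sh t = 0%R by rewrite /sh subrr.
  by rewrite tg0 /tangent linear0.
have gc : forall t, g t = g 0%R.
  apply: zero_velocity_constant => //; first exact: lie_hausdorff.
  by move=> t; have [] := G t.
apply/funext => t; have := gc t; rewrite g0 /g mulN1r (one_ps_opp _ hc') => h.
by rewrite -[LHS]mulg1 -(mulVg (c' t)) mulgA h mul1g.
Qed.

Lemma one_ps_cst : one_parameter_subgroup a 0%R (fun=> 1).
Proof.
split=> [s t|t|]; first by rewrite mulg1.
  exact: smooth_at_cst.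
exact: tangent_cst.
Qed.

Lemma lie_exp_1ps X c : one_parameter_subgroup a X c -> lie_exp a X = c 1%R.
Proof.
move=> hc; rewrite /lie_exp; case: xgetP => [h _ [c' hc' ->]|/(_ (c 1%R)) []].
  by rewrite (one_ps_uniq hc hc').
by exists c.
Qed.

Lemma lie_expZ X c (t : R) : one_parameter_subgroup a X c -> lie_exp a (t *: X)%R = c t.
Proof. by move=> hc; rewrite (lie_exp_1ps (one_ps_scale t hc)) mulr1. Qed.

Lemma lie_exp0 : lie_exp a (0 : Cn R d)%R = 1.
Proof. exact: lie_exp_1ps one_ps_cst. Qed.

(** The default value of [lie_exp] is 1, so any other value certifies that a one-parameter subgroup
    exists. *)
Lemma one_ps_exists X : lie_exp a X <> 1 -> exists c, one_parameter_subgroup a X c.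
Proof.
rewrite /lie_exp; case: xgetP => [h _ [c hc _] _|_ /(_ erefl)//].
by exists c.
Qed.

Lemma smooth_conj (g x : H) : smooth_at a a (fun h => g * h * g^-1) x.
Proof.
have [s _] := [elaborate smooth_at_comp (smooth_mull g x) (smooth_mulr g^-1 _)].
exact: s.
Qed.

Lemma Ad_linear g : linear (Ad a g).
Proof. by move=> k x y; rewrite /Ad /tangent linearP. Qed.

Lemma AdM g h X : Ad a (g * h) X = Ad a g (Ad a h X).
Proof.
rewrite /Ad.
have [_ t1] := [elaborate smooth_at_comp (smooth_conj h 1) (smooth_conj g _)].
have E : (fun x : H => g * x * g^-1) \o (fun x : H => h * x * h^-1) =
    (fun x => (g * h) * x * (g * h)^-1).
  by apply/funext => x; rewrite /= invgM !mulgA.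
by have := t1 X; rewrite E mulg1 mulgV.
Qed.

Lemma Ad1 X : Ad a 1 X = X.
Proof.
have E : (fun x : H => 1 * x * 1^-1) = id.
  by apply/funext => x; rewrite invg1 mulg1 mul1g.
by rewrite /Ad E; exact: (smooth_at_id a (1 : H)).2.
Qed.

Lemma AdKV g X : Ad a g (Ad a g^-1 X) = X.
Proof. by rewrite -AdM mulgV Ad1. Qed.

Lemma one_ps_conj g X c : one_parameter_subgroup a X c ->
  one_parameter_subgroup a (Ad a g X) (fun t => g * c t * g^-1).
Proof.
move=> hc; have [cD sc tc] := hc.
have S t := [elaborate smooth_at_comp (sc t) (smooth_conj g (c t))].
split.
- by move=> s t; rewrite cD !mulgA -[X in _ = X * _ * _]mulgA mulVg mulg1.
- by move=> t; have [] := S t.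
- have [_ /(_ 1%R)] := S 0%R; rewrite tc (one_ps0 hc) => E.
  exact: E.
Qed.

Lemma Ad_exp X c (t : R) : one_parameter_subgroup a X c ->
  Ad a (lie_exp a (t *: X)%R) X = X.
Proof.
move=> hc; have [cD sc tc] := hc; rewrite (lie_expZ _ hc).
have [_ /(_ 1%R)] := [elaborate smooth_at_comp (sc 0%R) (smooth_conj (c t) (c 0%R))].
have E : (fun h => c t * h * (c t)^-1) \o c = c.
  by apply/funext => s; rewrite /= -(one_ps_opp _ hc) -!cD; congr c; ring.
by rewrite E (one_ps0 hc) tc.
Qed.

Lemma tangent_mul_Cprod (p : H * H) v :
  tangent (prod_atlas a a) a (fun p => p.1 * p.2) p (Cprod v) =
  Ci (tangent (prod_atlas a a) a (fun p => p.1 * p.2) p v).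
Proof. exact: (lie_mul Hlie).2. Qed.

Lemma Ci0 : Ci (0 : Cn R d)%R = 0%R.
Proof. by rewrite /Ci /= oppr0. Qed.

Lemma Ci_linear n : linear (@Ci R n).
Proof.
by move=> k x y; apply: injective_projections; rewrite //= opprD scalerN.
Qed.

Lemma CiCi n (v : Cn R n) : Ci (Ci v) = (- v)%R.
Proof. by case: v => v w; apply: injective_projections. Qed.

Lemma Ad_Ci g X : Ad a g (Ci X) = Ci (Ad a g X).
Proof.
have [s t] := smooth_at_id a (1 : H).
have sc := [elaborate smooth_at_cst a a g (1 : H)].
have [s1 t1] := [elaborate smooth_mul sc s].
have sc' := [elaborate smooth_at_cst a a g^-1 (1 : H)].
have [s2 t2] := [elaborate smooth_mul s1 sc'].
have E v : Ad a g v = tangent (prod_atlas a a) a (fun p => p.1 * p.2) (g * 1, g^-1)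
    (tangent (prod_atlas a a) a (fun p => p.1 * p.2) (g, 1) (0%R, v), 0%R).
  by rewrite /Ad t2 t1 t !tangent_cst.
rewrite !E -tangent_mul_Cprod /Cprod /= Ci0 -tangent_mul_Cprod /Cprod /= Ci0.
by [].
Qed.

End LieGroup.

Section ClosedCones.
Context {R : realType} {V W : normedModType R} (C : set W).
Hypotheses (cC : closed C) (CZ : forall (t : R) x, C x -> C (t *: x)).

(** As f vanishes at x, the difference quotients are multiples of values of f and stay in the cone;
    closedness passes this to the limit. *)
Lemma closed_cone_diff (f : V -> W) x v : differentiable f x -> f x = 0 ->
  (forall y, C (f y)) -> C ('d f x v).
Proof.
move=> df f0 Cf; rewrite -deriveE //.
have dv : derivable f x v by exact: diff_derivable.
have [l hl] : exists l : W, (fun t : R => t^-1 *: (f (t *: v + x) - f x)) @ 0^' --> l.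
  by have /cvg_ex [l hl] := dv; exists l.
have -> : 'D_v f x = l by apply/cvg_lim.
have Cn : \forall t \near (0 : R)^', C (t^-1 *: (f (t *: v + x) - f x)).
  by apply: (filterS _ filterT) => t _; rewrite f0 subr0; exact: CZ.
apply: (@closed_cvg _ _ _ _ (fun t : R => t^-1 *: (f (t *: v + x) - f x)) C cC _ l hl).
exact: Cn.
Qed.

End ClosedCones.

(** A cone is closed as soon as it is closed near 0: scale a point of the closure into the small
    ball and back. *)
Lemma closed_cone_local {R : realType} {V : normedModType R} (C F : set V) (e : R) :
  (0 < e)%R -> (forall (t : R) x, C x -> C (t *: x)) -> closed F ->
  C `&` ball 0 e `<=` F -> F `<=` C -> closed C.
Proof.
move=> e0 CZ cF CF FC X cX.
have [s s0 sX] : exists2 s : R, 0 < s & ball 0 e (s *: X).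
  exists (e / 2 / (`|X| + 1)); first by rewrite !divr_gt0 // ltr_pwDr.
  rewrite -ball_normE /ball_ /= sub0r normrN normrZ ger0_norm; last first.
    by rewrite ltW // !divr_gt0 // ltr_pwDr.
  rewrite mulrAC ltr_pdivrMr ?ltr_pwDr // mulrAC ltr_pdivrMr //.
  by have := normr_ge0 X; nra.
have csX : closure F (s *: X).
  move=> B nB.
  have nB' : nbhs (s *: X) (B `&` ball 0 e).
    by apply: filterI => //; apply: open_nbhs_nbhs; split => //; exact: ball_open.
  have cs : {for X, continuous (fun Y : V => s *: Y)} by exact: scaler_continuous.
  have [Y [iY [BY bY]]] := cX _ (cs _ nB').
  by exists (s *: Y); split => //; apply: CF; split => //; exact: CZ.
rewrite -[X]scale1r -(mulVf (lt0r_neq0 s0)) -scalerA.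
by apply/CZ/FC/cF.
Qed.

Lemma near_closed_ball {R : realType} {X : topologicalType} {V : normedModType R}
  (f : X -> V) x (r : R) : 0 < r -> {for x, continuous f} ->
  \forall y \near x, closed_ball (f x) r (f y).
Proof.
move=> r0 cf; apply: (cf (closed_ball (f x) r)).
by apply: (filterS _ (nbhsx_ballx (f x) r r0)) => y; exact: subset_closed_ball.
Qed.

Lemma closure_scale_preimage {R : realType} {X : topologicalType} {V : normedModType R}
  (C P : set V) (A : set X) (f : V -> X) x (t : R) : closure C x ->
  {for t *: x, continuous f} -> (\forall y \near t *: x, P y) ->
  (forall y, C y -> P (t *: y) -> A (f (t *: y))) -> closure A (f (t *: x)).
Proof.
move=> cx cf Px CA B /cf nB.
have ct : {for x, continuous (fun y : V => t *: y)} by exact: scaler_continuous.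
have nBP : nbhs (t *: x) ((f @^-1` B) `&` P) by exact: (filterI (F := nbhs (t *: x))).
have [y [Cy [By Py]]] := cx _ (ct _ nBP).
by exists (f (t *: y)); split => //; exact: CA.
Qed.

Section PolarDecomposition.
Context {R : realType} (H : topGroupType) (d : nat) (a : atlas H (Cn R d)).
Hypothesis Hlie : is_complex_lie_group a.
Variable U : set H.
Hypotheses (U_subgroup : subgroup U) (U_cartan : cartan_decomposition a U).
Local Open Scope group_scope.
Notation vR := (@vec_atlas R R^o).
Notation vH := (@vec_atlas R (Cn R d)).
Notation iu := ([set Ci x | x in lie_alg a U]).

Let aH : IsAtlas a.
Proof. by apply: manifold_isAtlas; case: (lie_manifold Hlie). Qed.
#[local] Existing Instance aH.

Lemma lie_alg_scale (A : set H) (t : R) x : lie_alg a A x -> lie_alg a A (t *: x)%R.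
Proof. by move=> Ax s; rewrite scalerA. Qed.

Lemma lie_alg0 (A : set H) : subgroup A -> lie_alg a A 0%R.
Proof. by move=> [A1 _ _] t; rewrite scaler0 lie_exp0. Qed.

Lemma iu_scale (t : R) X : iu X -> iu (t *: X)%R.
Proof.
move=> [x ux <-]; exists (t *: x)%R; first exact: lie_alg_scale.
by rewrite (lin_scale (@Ci_linear R d)).
Qed.

Lemma iu0 : iu 0%R.
Proof. by exists 0%R; [exact: lie_alg0|exact: Ci0]. Qed.

Lemma polar_inverse : exists f1 f2, [/\ continuous f1, forall h, smooth_at a vH f2 h,
  forall h, [/\ U (f1 h), iu (f2 h) & f1 h * lie_exp a (f2 h) = h],
  forall u X, U u -> iu X -> f1 (u * lie_exp a X) = u /\ f2 (u * lie_exp a X) = X &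
  smooth_on vH a iu (lie_exp a)].
Proof.
have [_ _ [f [h1 h2 s1 s2]]] := U_cartan.
have sf h : smooth_at a (prod_atlas a vH) f h.
  have [g sg gf] := s2 h I; apply: smooth_at_ext sg.
  by apply: filterS gf => y /(_ I).
exists (fun h => (f h).1), (fun h => (f h).2); split.
- move=> h; apply: (@continuous_comp _ _ _ f fst); first exact: smooth_at_cont (sf h).
  exact: cvg_fst.
- move=> h; have [s3 _] := [elaborate smooth_at_snd a vH (f h)].
  by have [] := [elaborate smooth_at_comp (sf h) s3].
- by move=> h; have [[]] := h2 h I.
- by move=> u X uu iX; have [_] := h1 (u, X) (conj uu iX) => /= ->.
- have sp : smooth_on vH (prod_atlas a vH) iu (fun X => (1 : H, X)).
    apply: smooth_onT => X _.
    have [s3 _] := [elaborate smooth_at_pair (smooth_at_cst vH a (1 : H) X) (smooth_at_id vH X).1].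
    exact: s3.
  have sub X : iu X -> (U `*` iu) (1, X).
    by move=> iX; split => //; case: U_subgroup.
  have sc : smooth_on vH a iu ((fun q => q.1 * lie_exp a q.2) \o (fun X => (1 : H, X))).
    by refine (smooth_on_comp _ sp s1); exact: sub.
  by apply: smooth_on_eq sc => X _ /=; rewrite mul1g.
Qed.

(** Injectivity of the polar map gives exp(X) different from 1 for X nonzero, which excludes the
    default value of [lie_exp]. *)
Lemma iu_one_ps X : iu X -> exists c, one_parameter_subgroup a X c.
Proof.
move=> iX; have [->|/eqP X0] := eqVneq X 0%R; first by exists (fun=> 1); exact: one_ps_cst.
apply: one_ps_exists => e1; apply: X0.
have [f1 [f2 [_ _ _ H2 _]]] := polar_inverse.
have [U1 _ _] := U_subgroup.
have [_ E1] := H2 1 X U1 iX; have [_ E2] := H2 1 0%R U1 iu0.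
by rewrite -E1 -[RHS]E2 e1 lie_exp0.
Qed.

Lemma lie_exp_opp X : iu X -> lie_exp a (- X)%R = (lie_exp a X)^-1.
Proof.
move=> /iu_one_ps [c hc]; rewrite -scaleN1r (lie_expZ Hlie _ hc).
by rewrite (lie_exp_1ps Hlie hc) (one_ps_opp _ hc).
Qed.

Lemma iu_closed : closed iu.
Proof.
have [f1 [f2 [_ s2 H1 H2 se]]] := polar_inverse.
have [U1 _ _] := U_subgroup.
pose chi := cfun (a 1); pose e1 := chi 1.
have d1 : cdom (a 1) 1 by exact: atlas_dom.
have ie1 : cimg (a 1) e1 by exact: cfun_img.
have /nbhs_ballP [r /= r0 rP] := [elaborate cimg_near ie1].
pose N := cinv (a 1) @` closed_ball e1 (r / 2).
have r20 : (0 < r / 2)%R by rewrite divr_gt0.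
have cbr x : closed_ball e1 (r / 2) x -> cimg (a 1) x.
  rewrite closed_ballE // /closed_ball_ /= => h; apply: rP; rewrite -ball_normE /ball_ /=.
  by apply: le_lt_trans h _; rewrite ltr_pdivrMr // ltr_pMr // ltr1n.
have cN : compact N.
  apply: continuous_compact; last exact: findim_closed_ball_compact.
  by apply: continuous_in_subspaceT => x /set_mem /cbr; exact: cinv_cont.
have cf2 : continuous f2 by move=> h; exact: smooth_at_cont (s2 h).
have cf2N : closed (f2 @` N).
  apply: compact_closed; first exact: norm_hausdorff.
  by apply: continuous_compact => //; exact: continuous_subspaceT.
have Nnear : \forall h \near (1 : H), N h.
  have cc : {for (1 : H), continuous chi} by exact: cfun_cont.
  have cb := near_closed_ball r20 cc.
  have dd : \forall h \near (1 : H), cdom (a 1) h by exact: cdom_near.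
  by apply: filterS2 dd cb => h dh ch; exists (chi h) => //; exact: cfunK.
have [g [cg _] gE] := se 0%R iu0.
have g0 : g 0%R = 1 by rewrite (nbhs_singleton gE iu0) lie_exp0.
have : \forall Y \near (0%R : Cn R d), N (g Y) by apply: cg; rewrite g0.
move=> /(filterI gE) /nbhs_ballP [e /= e0 eP].
have sub : iu `&` ball (0%R : Cn R d) e `<=` f2 @` N.
  move=> Y [iY Ye]; have [gY NY] := eP _ Ye; exists (lie_exp a Y); first by rewrite -gY.
  by have [_] := H2 1 Y U1 iY; rewrite mul1g.
apply: (closed_cone_local e0 iu_scale cf2N sub).
by move=> _ [h Nh <-]; have [] := H1 h.
Qed.

Lemma exp_curve X c : one_parameter_subgroup a X c -> forall f2,
  (forall h, smooth_at a vH f2 h) -> (forall t : R, f2 (c t) = (t *: X)%R) ->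
  tangent a vH f2 1 X = X.
Proof.
move=> hc f2 s2 E; have [cD sc tc] := hc.
have [_ /(_ 1%R)] := [elaborate smooth_at_comp (sc 0%R) (s2 (c 0%R))].
rewrite tc (one_ps0 hc) => <-.
have -> : f2 \o c = fun t : R^o => (t *: X)%R by apply/funext => t; exact: E.
rewrite tangent_vec.
have ll : linear (fun t : R^o => t *: X)%R by move=> k x y; rewrite scalerDl scalerA.
have [_ ->] := diff_lin_fun (0 : R^o)%R ll (findim_linear_continuous ll).
by rewrite scale1r.
Qed.

(* [iu] is the range of the derivative at 1 of the radial part of the polar
   decomposition, because it is a closed cone fixed by that derivative. *)
Lemma radial_derivative f2 : (forall h, smooth_at a vH f2 h) -> (forall h, iu (f2 h)) ->
  (forall X, iu X -> f2 (lie_exp a X) = X) ->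
  (forall X, iu X -> tangent a vH f2 1 X = X) /\ (forall V, iu (tangent a vH f2 1 V)).
Proof.
move=> s2 i2 E; split=> [X iX|V].
  have [c hc] := iu_one_ps iX; apply: (exp_curve hc) => // t.
  by rewrite -(lie_expZ Hlie _ hc) E //; exact: iu_scale.
rewrite /tangent; have [_ s0] := s2 1.
apply: (closed_cone_diff iu_closed iu_scale).
- exact: smooth_near_diff s0.
- rewrite /in_charts /= cfunK; last exact: atlas_dom.
  by have := E 0%R iu0; rewrite lie_exp0.
- by move=> e; exact: i2.
Qed.

Lemma iu_subspace : subspace_set iu.
Proof.
have [f1 [f2 [_ s2 H1 H2 _]]] := polar_inverse.
have [U1 _ _] := U_subgroup.
have E X : iu X -> f2 (lie_exp a X) = X.
  by move=> iX; have [_] := H2 1 X U1 iX; rewrite mul1g.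
have [D1 D2] := radial_derivative s2 (fun h => let: And3 _ h2 _ := H1 h in h2) E.
split; first exact: iu0.
move=> k x y ix iy; rewrite -(D1 _ ix) -(D1 _ iy).
by have := D2 (k *: x + y)%R; rewrite {1}/tangent linearP.
Qed.

Section Compatible.
Variable G : set H.
Hypothesis G_compatible : is_compatible a U G.
Notation p := (gp_p a U G).
Notation K := (G `&` U).

Lemma p_iu X : p X -> iu X. Proof. by case. Qed.

Lemma p_scale (t : R) X : p X -> p (t *: X)%R.
Proof. by move=> [gX iX]; split; [exact: lie_alg_scale|exact: iu_scale]. Qed.

Lemma p_exp X : p X -> G (lie_exp a X).
Proof. by move=> [/(_ 1%R)]; rewrite scale1r. Qed.

Lemma p0 : p 0%R.
Proof. by split; [apply: lie_alg0; exact: (compatible_subgroup G_compatible)|exact: iu0]. Qed.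

(** [exp] is continuous on [iu] only, so the limit is taken through a local smooth extension; then
    closedness of [G] applies. *)
Lemma p_closed : closed p.
Proof.
have [f1 [f2 [_ s2 H1 H2 se]]] := polar_inverse.
move=> X cX.
have iX : iu X by apply: iu_closed => B /cX [Y [[_ iY] BY]]; exists Y.
split=> // t; have itX : iu (t *: X)%R by exact: iu_scale.
have [g [cg _] gE] := se _ itX.
rewrite -(nbhs_singleton gE itX).
have cGg : closure G (g (t *: X)%R).
  apply: (closure_scale_preimage cX cg gE) => Y pY ->; first exact/p_exp/p_scale.
  exact/iu_scale/p_iu.
by have -> : G = closure G by apply/closure_id; exact: compatible_closed G_compatible.
Qed.

Lemma polar_G f1 f2 :
  (forall u X, U u -> iu X -> f1 (u * lie_exp a X) = u /\ f2 (u * lie_exp a X) = X) ->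
  forall g, G g -> [/\ K (f1 g), p (f2 g) & g = f1 g * lie_exp a (f2 g)].
Proof.
move=> H2 g; rewrite {1}(compatible_polar G_compatible) => -[[k X] /= [Kk pX] <-].
by have [-> ->] := H2 k X Kk.2 (p_iu pX).
Qed.

Lemma polar_exists g : G g -> exists k X, [/\ K k, p X & g = k * lie_exp a X].
Proof.
by rewrite {1}(compatible_polar G_compatible) => -[[k X] /= [Kk pX] <-]; exists k, X.
Qed.

(** The radial part of exp(tX) exp(tY) lies in p, because this product lies in G = K exp(p). Its
    derivative at 0 is X + Y, since the derivative of the radial part fixes [iu], and it belongs to
    p because p is a closed cone. *)
Lemma p_subspace : subspace_set p.
Proof.
have [f1 [f2 [_ s2 H1 H2 _]]] := polar_inverse.
have [U1 _ _] := U_subgroup; have [G1 GM GV] := compatible_subgroup G_compatible.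
have E X : iu X -> f2 (lie_exp a X) = X.
  by move=> iX; have [_] := H2 1 X U1 iX; rewrite mul1g.
have [D1 D2] := radial_derivative s2 (fun h => let: And3 _ h2 _ := H1 h in h2) E.
have add X Y : p X -> p Y -> p (X + Y)%R.
  move=> pX pY.
  have iXY : iu (X + Y)%R.
    have [_ iuP] := iu_subspace; rewrite -[X]scale1r; apply: iuP; exact: p_iu.
  have [c hc] := iu_one_ps (p_iu pX); have [c' hc'] := iu_one_ps (p_iu pY).
  have [_ sc tc] := hc; have [_ sc' tc'] := hc'.
  have [s t] := [elaborate smooth_mul Hlie (sc 0%R) (sc' 0%R)].
  have [s3 t3] := [elaborate smooth_at_comp s (s2 _)].
  have t31 := t3 1%R.
  rewrite t tc tc' (one_ps0 hc) (one_ps0 hc') (tangent_mul11 Hlie) mulg1 D1 // in t31.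
  rewrite -t31; apply: (closed_cone_diff p_closed p_scale).
  - by case: s3 => _; exact: smooth_near_diff.
  - rewrite /in_charts /= (one_ps0 hc) (one_ps0 hc') mulg1.
    by have := E 0%R iu0; rewrite lie_exp0.
  - move=> t0; rewrite /in_charts /=.
    have [] // := polar_G H2 (g := c t0 * c' t0); apply: GM.
      by rewrite -(lie_expZ Hlie _ hc); apply: p_exp; exact: p_scale.
    by rewrite -(lie_expZ Hlie _ hc'); apply: p_exp; exact: p_scale.
split; first exact: p0.
by move=> k x y px py; apply: add => //; exact: p_scale.
Qed.

Lemma K_compact : compact U -> compact K.
Proof.
by move=> cU; rewrite setIC; apply: compact_closedI => //; exact: (compatible_closed G_compatible).
Qed.

(** K is the image of the connected group G under the unitary part of the polar decomposition. *)
Lemma K_connected : connected K.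
Proof.
have [f1 [f2 [cf1 _ H1 H2 _]]] := polar_inverse.
have -> : K = f1 @` G.
  apply/seteqP; split=> [k Kk|_ [g Gg <-]]; last by have [] := polar_G H2 Gg.
  exists k; first by case: Kk.
  by have [+ _] := H2 k 0%R Kk.2 iu0; rewrite lie_exp0 // mulg1.
apply: connected_continuous_connected; first exact: compatible_connected G_compatible.
exact: continuous_subspaceT.
Qed.

Lemma K_subgroup : subgroup K.
Proof.
have [U1 UM UV] := U_subgroup; have [G1 GM GV] := compatible_subgroup G_compatible.
split; first by split.
- by move=> x y [? ?] [? ?]; split; [exact: GM|exact: UM].
- by move=> x [? ?]; split; [exact: GV|exact: UV].
Qed.

Lemma p_Ad k X : K k -> p X -> p (Ad a k X).
Proof. exact: compatible_stable G_compatible k X. Qed.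

Lemma exp_Ad k X : iu X -> lie_exp a (Ad a k X) = k * lie_exp a X * k^-1.
Proof.
move=> /iu_one_ps [c hc]; rewrite (lie_exp_1ps Hlie hc).
exact: (lie_exp_1ps Hlie (one_ps_conj Hlie k hc)).
Qed.

(** Extends the hypothesis on maximal Abelian subalgebras to every direction in p, by Zorn's lemma
    starting from the line through beta. *)
Lemma maximal_abelian_exists beta : p beta -> exists2 fa, maximal_abelian a p fa & fa beta.
Proof.
move=> pb.
pose P (s : set (Cn R d)) := s = set0 \/ [/\ abelian_subalgebra a s, s `<=` p & s beta].
have [ps0 pP] := p_subspace.
pose line : set (Cn R d) := [set (t *: beta)%R | t in [set: R]].
have Pline : P line.
  right; split.
  - split.
      split; first by exists 0%R => //; rewrite scale0r.
      by move=> c x y [t _ <-] [u _ <-]; exists (c * t + u)%R => //; rewrite scalerDl scalerA.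
    move=> X Y [t _ <-] [u _ <-]; rewrite /lie_bracket.
    have [c hc] := iu_one_ps (p_iu pb).
    rewrite (_ : (fun s : R^o => _) = fun=> (u *: beta)%R); first exact: derive_cst.
    apply/funext => s; rewrite (lin_scale (@Ad_linear _ _ _ a _)) scalerA.
    by rewrite (Ad_exp Hlie _ hc).
  - by move=> _ [t _ <-]; exact: p_scale.
  - by exists 1%R => //; rewrite scale1r.
have [fa [Pfa famax]] : exists A, P A /\ forall B, A `<` B -> ~ P B.
  apply: Zorn_bigcup => F FP tF.
  have [[s0 [Fs0 s0n]]|none] := pselect (exists s0, F s0 /\ s0 <> set0); last first.
    left; apply/seteqP; split=> // x [s Fs sx]; apply: none; exists s; split => // s0.
    by rewrite s0 in sx.
  right.
  have two x y : (\bigcup_(X in F) X) x -> (\bigcup_(X in F) X) y ->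
      exists s, [/\ F s, s x & s y].
    move=> [s Fs sx] [s' Fs' sy]; have [h|h] := tF s s' Fs Fs'.
      by exists s'; split => //; exact: h.
    by exists s; split => //; exact: h.
  have good s x : F s -> s x -> [/\ abelian_subalgebra a s, s `<=` p & s beta].
    by move=> Fs sx; case: (FP s Fs) => // s0'; rewrite s0' in sx.
  have [b0 sb0] : s0 !=set0 by apply/set0P/eqP.
  have gs0 := good _ _ Fs0 sb0.
  split.
  - split.
      split; first by exists s0 => //; case: gs0 => -[[]].
      move=> c x y ux uy; have [s [Fs sx sy]] := two _ _ ux uy.
      by exists s => //; have [[[_ h] _] _ _] := good _ _ Fs sx; exact: h.
    move=> x y ux uy; have [s [Fs sx sy]] := two _ _ ux uy.
    by have [[_ h] _ _] := good _ _ Fs sx; exact: h.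
  - by move=> x [s Fs sx]; have [_ h _] := good _ _ Fs sx; exact: h.
  - by exists s0 => //; case: gs0.
case: Pfa => [fa0|[ab fap fab]].
  exfalso; apply: (famax line) => //; rewrite fa0; split => //.
  by move=> /(_ beta) h; apply: h; exists 1%R => //; rewrite scale1r.
exists fa => //; split => // s' ab' s'p fs'.
apply: contrapT => ne; apply: (famax s'); first split => //.
  by move=> s'fa; apply: ne; apply/seteqP.
by right; split => //; exact: fs'.
Qed.

End Compatible.
End PolarDecomposition.

(** * Spectral theorem and Morse inequalities *)

Lemma near_comp (T U : topologicalType) (f : T -> U) x y (P : U -> Prop) :
  {for x, continuous f} -> f x = y -> (\forall z \near y, P z) ->
  \forall z \near x, P (f z).
Proof. by move=> cf <- /cf. Qed.

Lemma continuous_near_eq (T U : topologicalType) (f g : T -> U) x :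
  {for x, continuous f} -> (\forall z \near x, f z = g z) -> {for x, continuous g}.
Proof.
move=> cf fg; rewrite /prop_for /continuous_at -(nbhs_singleton fg).
by apply: cvg_trans cf; exact: near_eq_cvg.
Qed.

Lemma continuous_at_sum {R : realType} (T : topologicalType) (V : normedModType R) n
  (F : 'I_n -> T -> V) t0 : (forall i, {for t0, continuous (F i)}) ->
  {for t0, continuous (fun t => \sum_i F i t)}.
Proof.
elim: n F => [|n IH] F cF.
  rewrite (_ : (fun t => _) = fun=> 0); first exact: cvg_cst.
  by apply/funext => t; rewrite big_ord0.
rewrite (_ : (fun t => _) = fun t => F ord0 t + \sum_i F (lift ord0 i) t).
  by apply: cvgD; [exact: cF|apply: IH].
by apply/funext => t; rewrite big_ord_recl.
Qed.

Section Spectral.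
Context {R : realType} (E : normedModType R) {fE : FinDim E}.
Variable g : E -> E -> R.
Hypotheses (g_bil : bilinear_form g) (g_sym : forall u v, g u v = g v u)
  (g_pos : forall u, u != 0 -> 0 < g u u).

Lemma bil_linl (h : E -> E -> R) v : bilinear_form h -> linear (fun u => h u v : R^o).
Proof. by move=> [_ H] a x y; exact: H. Qed.
Lemma bil_linr (h : E -> E -> R) u : bilinear_form h -> linear (fun v => h u v : R^o).
Proof. by move=> [H _] a x y; exact: H. Qed.
Lemma bilDl (h : E -> E -> R) u v w : bilinear_form h -> h (u + v) w = h u w + h v w.
Proof. by move=> hb; exact: (lin_add (bil_linl w hb)). Qed.
Lemma bilDr (h : E -> E -> R) u v w : bilinear_form h -> h u (v + w) = h u v + h u w.
Proof. by move=> hb; exact: (lin_add (bil_linr u hb)). Qed.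
Lemma bilZl (h : E -> E -> R) a u w : bilinear_form h -> h (a *: u) w = a * h u w.
Proof. by move=> hb; exact: (lin_scale (bil_linl w hb)). Qed.
Lemma bilZr (h : E -> E -> R) a u w : bilinear_form h -> h u (a *: w) = a * h u w.
Proof. by move=> hb; exact: (lin_scale (bil_linr u hb)). Qed.
Lemma bilBl (h : E -> E -> R) u v w : bilinear_form h -> h (u - v) w = h u w - h v w.
Proof. by move=> hb; exact: (lin_sub (bil_linl w hb)). Qed.
Lemma bilBr (h : E -> E -> R) u v w : bilinear_form h -> h u (v - w) = h u v - h u w.
Proof. by move=> hb; exact: (lin_sub (bil_linr u hb)). Qed.
Lemma bil_suml (h : E -> E -> R) n (c : 'I_n -> R) (b : 'I_n -> E) w : bilinear_form h ->
  h (\sum_i c i *: b i) w = \sum_i c i * h (b i) w.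
Proof. by move=> hb; exact: (linear_sumE (bil_linl w hb)). Qed.
Lemma bil_sumr (h : E -> E -> R) n (c : 'I_n -> R) (b : 'I_n -> E) u : bilinear_form h ->
  h u (\sum_i c i *: b i) = \sum_i c i * h u (b i).
Proof. by move=> hb; exact: (linear_sumE (bil_linr u hb)). Qed.

(* Continuity of an evaluated family of bilinear forms, by expansion in a basis. *)
Lemma bil_cont (T : topologicalType) (t0 : T) (G : T -> E -> E -> R) (a b : T -> E) :
  (\forall t \near t0, bilinear_form (G t)) ->
  (forall x y, {for t0, continuous (fun t => G t x y : R^o)}) ->
  {for t0, continuous a} -> {for t0, continuous b} ->
  {for t0, continuous (fun t => G t (a t) (b t) : R^o)}.
Proof.
have [n [c [l [ll cl lE]]]] := fE => Gb Gc ca cb.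
have E1 : \forall t \near t0, \sum_i \sum_j l i (a t) * l j (b t) * G t (c i) (c j) = G t (a t) (b t).
  apply: filterS Gb => t Gt; rewrite [in RHS](lE (a t)) bil_suml //; apply: eq_bigr => i _.
  rewrite [in RHS](lE (b t)) bil_sumr // mulr_sumr; apply: eq_bigr => j _; by rewrite mulrA.
have cs : {for t0, continuous (fun t => \sum_i \sum_j l i (a t) * l j (b t) * G t (c i) (c j) : R^o)}.
  apply: continuous_at_sum => i; apply: continuous_at_sum => j; apply: cvgM; last exact: Gc.
  by apply: cvgM; apply: continuous_comp => //; exact: cl.
exact: continuous_near_eq cs E1.
Qed.

Lemma g_cont (T : topologicalType) (t0 : T) (a b : T -> E) : {for t0, continuous a} ->
  {for t0, continuous b} -> {for t0, continuous (fun t => g (a t) (b t) : R^o)}.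
Proof.
apply: (@bil_cont _ _ (fun=> g)); first exact: nearW.
by move=> x y; exact: cvg_cst.
Qed.

Variable L : E -> E.
Hypotheses (L_lin : linear L) (L_sym : forall u v, g (L u) v = g u (L v)).

Let eigenfamily n (v : nat -> E) (lam : nat -> R) :=
  (forall i, (i < n)%N -> L (v i) = lam i *: v i) /\
  (forall i j, (i < n)%N -> (j < n)%N -> g (v i) (v j) = (i == j)%:R).

(** At a maximum x0 of the Rayleigh quotient on the invariant subspace, the form lam g(x, y) - g(L
    x, y) is nonnegative and vanishes at x0, so x0 lies in its radical; testing with L x0 - lam x0
    gives the eigenvalue equation. *)
Lemma rayleigh_eigenvector (W : set E) w : (forall a x y, W x -> W y -> W (a *: x + y)) ->
  closed W -> (forall x, W x -> W (L x)) -> W w -> w != 0 ->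
  exists x lam, [/\ W x, g x x = 1 & L x = lam *: x].
Proof.
move=> Wlin cW WL Ww w0.
have WZ a x : W x -> W (a *: x).
  move=> Wx; have W0 : W 0 by have := Wlin (-1) x x Wx Wx; rewrite scaleN1r addNr.
  by have := Wlin a x 0 Wx W0; rewrite addr0.
pose S := [set x | W x /\ `|x| = 1].
have S0 : S !=set0.
  exists (`|w|^-1 *: w); split; first exact: WZ.
  by rewrite normrZ normfV normr_id mulVf // normr_eq0.
have cS : compact S.
  apply: (findim_compact (M := 1)) => [x [_ ->]//|].
  rewrite (_ : S = W `&` (fun x : E => `|x|) @^-1` [set 1 : R]) //; apply: closedI => //.
  by apply: preimage_closed => [x _|]; [exact: norm_continuous|exact: closed_eq].
have xn0 x : S x -> x != 0 by move=> [_ x1]; rewrite -normr_eq0 x1 oner_neq0.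
pose r x : R^o := g (L x) x / g x x.
have cL : continuous L by exact: findim_linear_continuous.
have cr x : S x -> {for x, continuous r}.
  move=> Sx; apply: cvgM; first by apply: g_cont; [exact: cL|exact: cvg_id].
  apply: cvgV; first by rewrite gt_eqF // g_pos // xn0.
  by apply: g_cont; exact: cvg_id.
have [x0 Sx0 xmax] := [elaborate cont_EVT_max S0 cS cr].
have [Wx0 x01] := Sx0; pose lam : R := r x0.
have g0 : 0 < g x0 x0 by rewrite g_pos // xn0.
pose h x y := lam * g x y - g (L x) y.
have hge y : W y -> 0 <= h y y.
  move=> Wy; have [->|y0] := eqVneq y 0.
    by rewrite /h (lin_zero L_lin) (lin_zero (bil_linr 0 g_bil)) mulr0 subr0.
  have Sy : S (`|y|^-1 *: y).
    split; first exact: WZ.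
    by rewrite normrZ normfV normr_id mulVf // normr_eq0.
  have := xmax _ Sy; rewrite -/lam /r (lin_scale L_lin) !bilZl // !bilZr //.
  rewrite -!mulf_div divff ?mul1r ?invr_neq0 ?normr_eq0 //.
  by rewrite ler_pdivrMr ?g_pos // /h subr_ge0.
have h0 : h x0 x0 = 0.
  by rewrite /h /lam /r -mulrA mulVf ?mulr1 ?subrr // gt_eqF.
have hs y : h y x0 = h x0 y by rewrite /h [g y x0]g_sym L_sym [g y _]g_sym.
have hz y : W y -> h x0 y = 0.
  move=> Wy; apply/eqP; rewrite eq_le; apply/andP.
  have key t : 0 <= 2 * t * h x0 y + t ^+ 2 * h y y.
    have := hge _ (Wlin t y x0 Wy Wx0).
    suff -> : h (t *: y + x0) (t *: y + x0) = h x0 x0 + 2 * t * h x0 y + t ^+ 2 * h y y.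
      by rewrite h0 add0r.
    have E1 : h y x0 = h x0 y by exact: hs.
    move: E1; rewrite /h L_lin !bilDl // !bilDr // !bilZl // !bilZr //.
    move=> E1; have -> : g (L y) x0 = lam * g y x0 - lam * g x0 y + g (L x0) y by lra.
    by ring.
  have hy := hge _ Wy.
  (* The optimal t would divide by h y y, which may be 0; the added 1 avoids the case split and
     still makes the quadratic negative unless h x0 y = 0. *)
  pose k := h y y + 1; have k0 : 0 < k by rewrite /k; lra.
  have t1 := key (- h x0 y / k).
  have : 0 <= (2 * (- h x0 y / k) * h x0 y + (- h x0 y / k) ^+ 2 * h y y) * k ^+ 2.
    by rewrite mulr_ge0 // sqr_ge0.
  rewrite (_ : _ * k ^+ 2 = - (h x0 y) ^+ 2 * (2 * k - h y y)); last by field; rewrite gt_eqF.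
  move=> h2; have : h x0 y ^+ 2 = 0.
    by have := sqr_ge0 (h x0 y); rewrite /k in h2 *; nra.
  by move=> /eqP; rewrite sqrf_eq0 => /eqP ->.
have Lx0 : L x0 = lam *: x0.
  apply/eqP; rewrite -subr_eq0; apply/negPn/negP => n0.
  pose y := L x0 - lam *: x0.
  have Wy : W y.
    by rewrite /y addrC -scaleNr; apply: Wlin => //; exact: WL.
  have := g_pos n0; rewrite -/y {1}/y bilBl // bilZl //.
  by have := hz _ Wy; rewrite /h; lra.
exists ((Num.sqrt (g x0 x0))^-1 *: x0), lam; split.
- exact: WZ.
- rewrite bilZl // bilZr // mulrA -invfM -expr2 sqr_sqrtr ?mulVf //; last exact: ltW.
  by rewrite gt_eqF.
- by rewrite (lin_scale L_lin) Lx0 !scalerA mulrC.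
Qed.

Lemma orthonormal_bound : exists N, forall n (v : nat -> E),
  (forall i j, (i < n)%N -> (j < n)%N -> g (v i) (v j) = (i == j)%:R) -> (n <= N)%N.
Proof.
have [N [tov [ofv [tovl ofvl ofvK]]]] := [elaborate findim_coords (V := E)].
exists N => n v ho.
pose A : 'M[R]_(n, N) := \matrix_(i, j) ofv (v i) 0 j.
have rA : row_free A.
  apply: inj_row_free => u uA.
  have E1 : ofv (\sum_i u 0 i *: v i) = 0.
    rewrite (linear_sumE ofvl); transitivity (u *m A) => //.
    rewrite mulmx_sum_row; apply: eq_bigr => i _; congr (_ *: _).
    by apply/rowP => j; rewrite !mxE.
  have E2 : \sum_i u 0 i *: v i = 0.
    by rewrite -[LHS]ofvK E1 (lin_zero tovl).
  apply/rowP => i; have := bil_suml (fun i => u 0 i) (fun i : 'I_n => v i) (v i) g_bil.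
  rewrite E2 (lin_zero (bil_linl _ g_bil)) (bigD1 i) //= ho // eqxx mulr1 big1 ?addr0 ?mxE //.
  by move=> j ji; rewrite ho // (negbTE (_ : nat_of_ord j != i)) ?mulr0.
by rewrite -(eqP rA) rank_leq_col.
Qed.

(** Take an orthonormal family of eigenvectors of maximal length. If it failed to span, its
    orthogonal complement, invariant by symmetry of L, would supply one more. *)
Lemma spectral_theorem : exists n (v : 'I_n -> E) (lam : 'I_n -> R),
  [/\ forall i, L (v i) = lam i *: v i,
      forall i j, g (v i) (v j) = (i == j)%:R &
      forall u, u = \sum_i g u (v i) *: v i].
Proof.
pose P n := `[< exists v lam, eigenfamily n v lam >].
have exP : exists n, P n by exists 0%N; apply/asboolP; exists (fun=> 0), (fun=> 0); split.
have [N NP] := orthonormal_bound.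
have bP n : P n -> (n <= N)%N by move=> /asboolP [v [lam [_ ho]]]; exact: NP ho.
have [n /asboolP [v [lam [ve vo]]] nmax] := ex_maxnP exP bP.
exists n, (fun i => v i), (fun i => lam i); split.
- by move=> i; exact: ve.
- by move=> i j; exact: vo.
move=> u; apply/eqP; rewrite -subr_eq0; apply/negPn/negP => n0.
set w := u - _ in n0.
pose W := [set x | forall i, (i < n)%N -> g x (v i) = 0].
have Ww : W w.
  move=> i ni; rewrite /w bilBl // (bil_suml (fun i => g u (v i)) (fun i : 'I_n => v i)) //.
  rewrite (bigD1 (Ordinal ni)) //= vo // eqxx mulr1 big1 ?addr0 ?subrr //.
  by move=> j ji; rewrite vo // (negbTE (_ : nat_of_ord j != i)) ?mulr0.
have [|||||x [l [Wx x1 Lx]]] := @rayleigh_eigenvector W w.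
- by move=> a x y Wx Wy i ni; rewrite bilDl // bilZl // Wx // Wy // mulr0 addr0.
- rewrite (_ : W = \bigcap_(i in [set i | (i < n)%N]) ((fun x => g x (v i)) @^-1` [set 0])); last first.
    by apply/seteqP; split=> x H i; exact: H.
  apply: closed_bigI => i _; apply: preimage_closed; last exact: closed_eq.
  by move=> x _; exact: (findim_linear_continuous (bil_linl (v i) g_bil)).
- by move=> x Wx i ni; rewrite L_sym ve // bilZr // Wx // mulr0.
- by [].
- by [].
have /nmax : P n.+1; last by rewrite ltnn.
apply/asboolP; exists (fun i => if (i < n)%N then v i else x), (fun i => if (i < n)%N then lam i else l).
split=> [i|i j]; rewrite !ltnS.
  by move=> _; case: ifP => // /ve.
move=> ilen jlen; case: ifP => [ni|/negbT nn]; case: ifP => [nj|/negbT nn'].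
- exact: vo.
- by rewrite g_sym Wx // (_ : (i == j) = false) //; apply/negbTE; rewrite neq_ltn (leq_trans ni) // leqNgt.
- by rewrite Wx // (_ : (i == j) = false) //; apply/negbTE; rewrite neq_ltn (leq_trans nj) ?orbT // leqNgt.
- rewrite x1; have -> : i = n by apply/eqP; rewrite eqn_leq ilen leqNgt.
  have -> : j = n by apply/eqP; rewrite eqn_leq jlen leqNgt.
  by rewrite eqxx.
Qed.

End Spectral.

Lemma unit_halves {R : realType} (t : R) : 0 <= t <= 1 ->
  0 <= t / 2 <= 1 /\ 0 <= (1 + t) / 2 <= 1.
Proof. by move=> /andP [a b]; split; apply/andP; split; lra. Qed.

Section MorseInequalities.
Context {R : realType} (E : normedModType R) {fE : FinDim E}.
Variables (e0 : E) (f : E -> R^o) (X T : E -> E) (g : E -> E -> E -> R) (L : E -> E).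
Hypotheses (sT : smooth_near T e0) (T0 : T e0 = 0) (dT0 : forall v, 'd T e0 v = v)
  (dTX : \forall e \near e0, 'd T e (X e) = L (T e))
  (df : \forall e \near e0, differentiable f e /\ forall w, 'd f e w = g e (X e) w)
  (g_bil : forall e, bilinear_form (g e))
  (g_cont : forall a b, {for e0, continuous (fun e => g e a b : R^o)})
  (L_lin : linear L).

Lemma straighten : exists S : E -> E, [/\ smooth_near S 0, S 0 = e0,
  forall v, 'd S 0 v = v, (\forall e \near e0, S (T e) = e) &
  \forall u \near 0, 'd S u (L u) = X (S u) /\ differentiable f (S u)].
Proof.
pose Phi (p : E * E) : E := T p.2 - p.1.
have sPhi : smooth_near Phi (0, e0).
  rewrite (_ : Phi = fun p => (T \o snd) p + -%R p.1).
    apply: smooth_near_add.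
      apply: smooth_near_comp => //=; apply: smooth_near_linear.
      by move=> a x y.
    by apply: smooth_near_linear => a x y /=; rewrite opprD scalerN.
  by [].
have dT := smooth_near_diff sT.
have dPhi v : 'd Phi (0, e0) (0, v) = v.
  have dPr := smooth_near_diff sPhi.
  pose j (e : E) : E * E := (0, e).
  have dj : differentiable j e0 by [].
  have PT : Phi \o j = T by apply/funext => e; rewrite /Phi /= subr0.
  rewrite -[RHS]dT0 -PT diff_comp //=; congr ('d Phi _ _).
  by rewrite /j diff_pair //= diff_cst diff_val.
have Phi0 : Phi (0, e0) = 0 by rewrite /Phi /= T0 subrr.
have [r [S [r0 S0 SP sS]]] := implicit_function fE fE fE sPhi Phi0 (@lin_id R E) dPhi dPhi.
have ST : \forall e \near e0, S (T e) = e.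
  have N1 : \forall e \near e0, `|e - e0| < r.
    by apply/nbhs_ballP; exists r => // e; rewrite -ball_normE /ball_ /= distrC.
  have N2 : \forall e \near e0, forall x, `|x - e0| < r -> Phi (T e, x) = 0 -> x = S (T e).
    apply: (near_comp (smooth_near_cont sT) T0 (P := fun u => forall x, `|x - e0| < r -> Phi (u, x) = 0 -> x = S u)).
    by apply: filterS SP => u [].
  apply: filterS2 N1 N2 => e re /(_ e re) <- //.
  by rewrite /Phi /= subrr.
have [A [oA Ae0] AST] := near_open ST.
have dS : \forall u \near 0, [/\ T (S u) = u, A (S u), differentiable S u & differentiable T (S u)].
  have N1 : \forall u \near 0, T (S u) = u.
    by apply: filterS SP => u [_ /eqP + _]; rewrite /Phi /= subr_eq0 => /eqP.
  have cS : {for 0, continuous S} := smooth_near_cont sS.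
  have N2 : \forall u \near 0, A (S u) by apply: cS; rewrite S0; exact: open_nbhs_nbhs.
  have N3 : \forall u \near 0, differentiable S u.
    by apply: filterS (smooth_near_near sS) => u /smooth_near_diff.
  have N4 : \forall u \near 0, differentiable T (S u).
    apply: (near_comp cS S0 (P := fun e => differentiable T e)).
    by apply: filterS (smooth_near_near sT) => u /smooth_near_diff.
  by apply: filterS2 (filterI N1 N2) (filterI N3 N4) => u [? ?] [? ?].
have inv u w : [/\ T (S u) = u, A (S u), differentiable S u & differentiable T (S u)] ->
    'd S u ('d T (S u) w) = w.
  move=> [E1 Au dSu dTu].
  have N : \forall e \near S u, (S \o T) e = e.
    by apply: filterS (open_nbhs_nbhs (conj oA Au)) => e /AST.
  have di : differentiable id (S u) by [].
  have N' : \forall e \near S u, id e = (S \o T) e by apply: filterS N.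
  have [_ E2] := near_differentiable N' di.
  have := diff_comp dTu; rewrite E1 => /(_ _ S dSu) E3.
  have : 'd (S \o T) (S u) w = w by rewrite E2 diff_val.
  by rewrite E3.
exists S; split => //.
- move=> v; have h := nbhs_singleton dS.
  by have := inv 0 v h; rewrite S0 dT0.
- have cS : {for 0, continuous S} := smooth_near_cont sS.
  have N5 : \forall u \near 0, 'd T (S u) (X (S u)) = L (T (S u)).
    exact: (near_comp cS S0 (P := fun e => 'd T e (X e) = L (T e))).
  have N6 : \forall u \near 0, differentiable f (S u).
    apply: (near_comp cS S0 (P := fun e => differentiable f e)).
    by apply: filterS df => e [].
  apply: filterS2 (filterI dS N5) N6 => u [h E1] h6; split => //.
  by have [Tu _ _ _] := h; rewrite -[in L u]Tu -E1 inv.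
Qed.

Section Spectrum.
Variables (n : nat) (v : 'I_n -> E) (lam : 'I_n -> R).
Hypotheses (L_eig : forall i, L (v i) = lam i *: v i)
  (v_orth : forall i j, g e0 (v i) (v j) = (i == j)%:R)
  (v_span : forall u, u = \sum_i g e0 u (v i) *: v i).

Let q (u : E) (i : 'I_n) : R := g e0 u (v i).

(** In the coordinates given by [S], the differential of f at u is G_u(L u, .) with G_u close to the
    metric at e0. Go first along the kernel part u0, where f does not change, then along the rest
    u'; the increment is a nonnegative multiple of a number within eps S of Q, which settles the
    signs. Only the first derivative of f enters. *)
Lemma morse_inequalities (eps : R) : 0 < eps -> \forall e \near e0,
  let Q := \sum_i lam i * q (T e) i ^+ 2 in
  let S := \sum_(i | lam i != 0) q (T e) i ^+ 2 in
  [/\ eps * S <= Q -> f e0 <= f e, 0 < S -> eps * S <= Q -> f e0 < f e &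
      Q <= - (eps * S) -> f e <= f e0].
Proof.
move=> eps0; have [S [sS S0 dS0 ST NS]] := straighten.
have cS : {for 0, continuous S} := smooth_near_cont sS.
pose K := \sum_i `|v i|; pose Lam := \sum_i `|lam i|.
have K0 : 0 <= K by exact: sumr_ge0.
have Lam0 : 0 <= Lam by exact: sumr_ge0.
have lamle i : `|lam i| <= Lam.
  by rewrite /Lam (bigD1 i) //= lerDl sumr_ge0.
(* With metric coefficients this close, the error in H is at most de Lam n S, and de Lam n is less
   than eps. *)
pose de := eps / (Lam * n%:R + 1).
have Ln1 : 0 < Lam * n%:R + 1 by rewrite ltr_pwDr // mulr_ge0.
have de0 : 0 < de by rewrite divr_gt0.
pose G u a b := g (S u) ('d S u a) ('d S u b).
have dSc a : {for 0, continuous (fun u => 'd S u a)}.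
  have N : \forall u \near 0, 'D_a S u = 'd S u a.
    by apply: filterS (smooth_near_near sS) => u /smooth_near_diff du; exact: deriveE.
  exact: continuous_near_eq (smooth_near_cont (smooth_near_derive a sS)) N.
have Gc i j : \forall u \near 0, `|G u (v i) (v j) - (i == j)%:R| < de.
  have cG : {for 0, continuous (fun u => G u (v i) (v j) : R^o)}.
    apply: (bil_cont (G := fun u => g (S u))) => //; first exact: nearW.
    move=> x y; apply: (@continuous_comp _ _ _ S (fun e => g e x y : R^o)) => //.
    by rewrite S0; exact: g_cont.
  have : G 0 (v i) (v j) = (i == j)%:R by rewrite /G S0 !dS0 v_orth.
  move/cvgrPdist_lt : cG => /(_ _ de0) cG G0; apply: filterS cG => u.
  by rewrite G0 distrC.
have GN : \forall u \near 0, forall i j, `|G u (v i) (v j) - (i == j)%:R| < de.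
  apply: near_ord => i; apply: (@near_ord _ (nbhs (0 : E)) _ n (fun j u => `|G u (v i) (v j) - (i == j)%:R| < de)) => j.
  exact: Gc.
have N2 : \forall u \near 0, differentiable S u /\ forall w, 'd f (S u) w = g (S u) (X (S u)) w.
  apply: filterI.
    by apply: filterS (smooth_near_near sS) => u /smooth_near_diff.
  apply: (near_comp cS S0 (P := fun e => forall w, 'd f e w = g e (X e) w)).
  by apply: filterS df => e [].
have [rho /= rho0 rhoP] := (nbhs_ballP _ _).1 (filterI GN (filterI N2 NS)).
have good u : `|u| < rho -> [/\ forall i j, `|G u (v i) (v j) - (i == j)%:R| < de,
    differentiable (f \o S) u & forall w, 'd (f \o S) u w = G u (L u) w].
  move=> ur; have bu : ball 0 rho u by rewrite -ball_normE /ball_ /= sub0r normrN.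
  have [h1 [[h2 h3] [h4 h5]]] := rhoP _ bu.
  split => //; first exact: differentiable_comp.
  by move=> w; rewrite diff_comp //= h3 /G h4.
have qs : \forall e \near e0, forall i, `|q (T e) i| < rho / (K + 1).
  apply: near_ord => i.
  have cq : {for e0, continuous (fun e => q (T e) i : R^o)}.
    apply: (@continuous_comp _ _ _ T (fun u => q u i : R^o)); first exact: smooth_near_cont.
    exact: (findim_linear_continuous (bil_linl (v i) (g_bil e0))).
  have q0 : q (T e0) i = 0 by rewrite T0 /q (lin_zero (bil_linl _ (g_bil e0))).
  have r0 : 0 < rho / (K + 1) by rewrite divr_gt0 // ltr_pwDr.
  move/cvgrPdist_lt : cq => /(_ _ r0); apply: filterS => e.
  by rewrite q0 sub0r normrN.
apply: filterS2 qs ST => e qe STe /=.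
set Q := \sum_i _ * _; set S' := \sum_(i | _) _.
set c := q (T e) in qe Q S' *.
(* The coordinates outside the kernel of [L]; their squares sum to S, those of the kernel part c - d
   do not enter Q. *)
pose d i := if lam i == 0 then 0 else c i.
have S'E : S' = \sum_i d i ^+ 2.
  rewrite /S' big_mkcond; apply: eq_bigr => i _; rewrite /d.
  by case: eqP => // _; rewrite expr0n.
have S'0 : 0 <= S' by rewrite S'E sumr_ge0 // => i _; exact: sqr_ge0.
pose u0 := \sum_i (c i - d i) *: v i; pose u' := \sum_i d i *: v i.
have Lu0 : L u0 = 0.
  rewrite (linear_sumE L_lin) big1 // => i _; rewrite L_eig scalerA /d.
  by case: eqP => [->|_]; rewrite ?mulr0 ?subrr ?mul0r scale0r.
have uE : T e = u0 + u'.
  rewrite [LHS]v_span -big_split; apply: eq_bigr => i _ /=.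
  by rewrite -scalerDl subrK.
have norm_lt (b : 'I_n -> R) : (forall i, `|b i| <= `|c i|) -> `|\sum_i b i *: v i| < rho.
  move=> bc; apply: le_lt_trans (ler_norm_sum _ _ _) _.
  apply: (@le_lt_trans _ _ (\sum_i rho / (K + 1) * `|v i|)).
    apply: ler_sum => i _; rewrite normrZ ler_wpM2r //.
    exact: le_trans (bc i) (ltW (qe i)).
  rewrite -mulr_sumr -/K mulrAC ltr_pdivrMr ?ltr_pwDr // ltr_pM2l // ltrDl //.
have path_lt (t : R) : 0 <= t <= 1 -> `|u0 + t *: u'| < rho.
  move=> /andP [t0 t1].
  rewrite /u0 /u' scaler_sumr -big_split /= (eq_bigr (fun i => ((c i - d i) + t * d i) *: v i)).
    apply: norm_lt => i; rewrite /d; case: eqP => _; first by rewrite subr0 mulr0 addr0.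
    by rewrite subrr add0r normrM ger0_norm // ler_piMl.
  by move=> i _; rewrite scalerA -scalerDl.
have u0_lt (t : R) : 0 <= t <= 1 -> `|t *: u0| < rho.
  move=> /andP [t0 t1].
  rewrite /u0 scaler_sumr (eq_bigr (fun i => (t * (c i - d i)) *: v i)).
    apply: norm_lt => i; rewrite /d; case: eqP => _; last by rewrite subrr mulr0 normr0.
    by rewrite subr0 normrM ger0_norm // ler_piMl.
  by move=> i _; rewrite scalerA.
pose H p := G p (L u') u'.
have Hest p : `|p| < rho -> `|H p - Q| <= de * (Lam * n%:R) * S'.
  move=> /good [Gp _ _].
  have Gb : bilinear_form (G p).
    split=> x a y z; rewrite /G linearP; [rewrite bilDr // bilZr //|rewrite bilDl // bilZl //]; exact: g_bil.
  have HE : H p = \sum_i \sum_j (lam i * d i) * d j * G p (v i) (v j).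
    rewrite /H {1}/u' (linear_sumE L_lin).
    rewrite (eq_bigr (fun i => (lam i * d i) *: v i)); last first.
      by move=> i _; rewrite L_eig scalerA mulrC.
    rewrite bil_suml //; apply: eq_bigr => i _; rewrite /u' bil_sumr // mulr_sumr.
    by apply: eq_bigr => j _; rewrite mulrA.
  have QE : Q = \sum_i \sum_j (lam i * d i) * d j * (i == j)%:R.
    apply: eq_bigr => i _; rewrite (bigD1 i) //= eqxx mulr1 big1 ?addr0; last first.
      by move=> j /negbTE; rewrite eq_sym => ->; rewrite mulr0.
    by rewrite /d; case: eqP => [->|_]; rewrite ?mul0r // expr2 mulrA.
  rewrite HE QE -sumrB; apply: le_trans (ler_norm_sum _ _ _) _.
  apply: (@le_trans _ _ (\sum_(i < n) \sum_(j < n) (Lam * de / 2) * (d i ^+ 2 + d j ^+ 2))).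
    apply: ler_sum => i _; rewrite -sumrB; apply: le_trans (ler_norm_sum _ _ _) _.
    apply: ler_sum => j _; rewrite -mulrBr !normrM.
    have := ltW (Gp i j); have := lamle i; have := normr_ge0 (lam i).
    have := normr_ge0 (G p (v i) (v j) - (i == j)%:R).
    move: `|G p _ _ - _| `|lam i| => x l x0 l0 lL xd.
    have dd : `|d i| * `|d j| <= (d i ^+ 2 + d j ^+ 2) / 2.
      have := sqr_ge0 (`|d i| - `|d j|); rewrite sqrrB !real_normK ?num_real //.
      by move: (_ ^+ 2) (_ ^+ 2) (_ * _) => a b c'; rewrite -mulr_natl; lra.
    apply: (@le_trans _ _ (Lam * (`|d i| * `|d j|) * de)).
      rewrite (_ : _ * x = (l * (`|d i| * `|d j|)) * x); last by ring.
      apply: ler_pM => //; first by rewrite !mulr_ge0.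
      by rewrite ler_wpM2r // mulr_ge0.
    rewrite (_ : Lam * de / 2 * _ = Lam * ((d i ^+ 2 + d j ^+ 2) / 2) * de); last by field.
    by apply: ler_wpM2r; [exact: ltW|exact: ler_wpM2l].
  rewrite le_eqVlt; apply/orP; left; apply/eqP.
  under eq_bigr do rewrite -mulr_sumr big_split /= sumr_const card_ord -S'E.
  rewrite -mulr_sumr big_split /= sumr_const card_ord sumrMnl -S'E -[S' *+ n]mulr_natr.
  have key (x y z w : R) : x * y / 2 * (z * w + z * w) = y * (x * w) * z by field.
  exact: key.
have theta : de * (Lam * n%:R) < eps.
  by rewrite /de mulrAC ltr_pdivrMr // ltr_pM2l // ltrDl.
pose F := f \o S.
have F0 : f e0 = F 0 by rewrite /F /= S0.
have Fe : f e = F (u0 + u') by rewrite /F /= -uE STe.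
have dF p w : `|p| < rho -> 'd F p w = G p (L p) w by move=> /good [].
have mvt (a b : E) : (forall t : R, 0 <= t <= 1 -> `|a + t *: b| < rho) ->
    exists2 t : R, 0 <= t <= 1 & F (a + b) = F a + G (a + t *: b) (L (a + t *: b)) b.
  move=> ab; have [|t t01 E1] := @mean_value_segment R _ F a b.
    by move=> t /ab /good [].
  by exists t => //; rewrite -dF ?ab // -E1 [RHS]addrC subrK.
have G0l p w : G p 0 w = 0 by rewrite /G linear0 (lin_zero (bil_linl _ (g_bil _))).
have Fu0 : F u0 = F 0.
  have [|t t01 E1] := mvt 0 u0; first by move=> t /u0_lt; rewrite add0r.
  by rewrite -[u0 in LHS]add0r E1 add0r (lin_scale L_lin) Lu0 scaler0 G0l addr0.
have Lp (t : R) : L (u0 + t *: u') = t *: L u'.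
  by rewrite (lin_add L_lin) (lin_scale L_lin) Lu0 add0r.
have GZl p (t : R) a w : G p (t *: a) w = t * G p a w.
  by rewrite /G linearZ /= bilZl.
have GZr p (t : R) a w : G p a (t *: w) = t * G p a w.
  by rewrite /G linearZ /= bilZr.
have [t1 t101 E1] := mvt u0 u' path_lt; rewrite Lp GZl -/(H _) Fu0 in E1.
have h1 := Hest _ (path_lt _ t101).
have [t10 t11] := andP t101.
have th0 : 0 <= de * (Lam * n%:R) by rewrite mulr_ge0 ?(ltW de0) // mulr_ge0.
rewrite F0 Fe E1; split.
- move=> hQ; rewrite lerDl mulr_ge0 //.
  by move: h1; rewrite ler_norml => /andP [h1 _]; nra.
(* The mean value parameter of one step could be 0, which would lose strictness. The segment is
   halved: the first half contributes something nonnegative, and on the second the parameter is at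
   least 1/2. *)
- move=> S'p hQ.
  have md (h t : R) : u0 + h *: u' + t *: (h *: u') = u0 + ((1 + t) * h) *: u' by module.
  have halves := @unit_halves R.
  have [t3 t301|t2 t201 E2] := mvt u0 (2^-1 *: u').
    by rewrite scalerA; exact: path_lt (halves _ t301).1.
  have [t3 t301|t3 t301 E3] := mvt (u0 + 2^-1 *: u') (2^-1 *: u').
    rewrite md.
    exact: path_lt (halves _ t301).2.
  move: E3; rewrite -addrA -scalerDl -[X in X + X]mul1r -splitr scale1r E2.
  rewrite scalerA md.
  rewrite !Lp !GZl !GZr -!/(H _) Fu0 -E1 => ->.
  have [ha _] := halves _ t201; have [_ hb] := halves _ t301.
  have pos z : `|z - Q| <= de * (Lam * n%:R) * S' -> 0 < z.
    rewrite ler_norml => /andP [z1 _].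
    have : de * (Lam * n%:R) * S' < eps * S' by rewrite ltr_pM2r.
    by move: z1 hQ; move: (_ * S') (_ * S') => A1 A2; lra.
  have := pos _ (Hest _ (path_lt _ ha)); have := pos _ (Hest _ (path_lt _ hb)).
  move: (H _) (H _) => y x y0 x0.
  have [/andP [t20 _] /andP [t30 _]] := (t201, t301).
  rewrite -addrA ltrDl; apply: ltr_wpDl; last by rewrite !mulr_gt0 //; lra.
  by rewrite mulr_ge0 ?divr_ge0 // mulr_ge0 // ltW.
- move=> hQ; rewrite gerDl mulr_ge0_le0 //.
  by move: h1; rewrite ler_norml => /andP [_ h1]; nra.
Qed.

End Spectrum.
End MorseInequalities.

(** * Trajectories near a fixed point *)

(** At the infimum of the escape times the curve is a left limit of points of the closed C, hence in
    the open A, and it stays in A a little longer. *)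
Lemma trapped {R : realType} (Z : topologicalType) (c : R -> Z) (A C : set Z) :
  open A -> closed C -> C `<=` A -> continuous c -> A (c 0) ->
  (forall t, 0 <= t -> (forall s, 0 <= s <= t -> A (c s)) -> C (c t)) ->
  forall t, 0 <= t -> A (c t).
Proof.
move=> oA cC CA cc A0 AC t t0; apply: contrapT => nA.
pose S := [set t | 0 <= t /\ ~ A (c t)].
have St : S t by [].
have lbS : lbound S 0 by move=> s [].
have hS : has_inf S by split; [exists t|exists 0].
have i0 : 0 <= inf S by apply: lb_le_inf => //; exists t.
have before s : 0 <= s -> s < inf S -> A (c s).
  move=> s0 si; apply: contrapT => nAs; have : inf S <= s by apply: ge_inf; [exists 0|].
  by rewrite leNgt si.
have Ai : A (c (inf S)).
  have [i00|ipos] := eqVneq (inf S) 0; first by rewrite i00.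
  have {}ipos : 0 < inf S by rewrite lt_def ipos.
  apply: CA; apply: (@closed_cvg _ _ ((inf S)^'-) _ c C cC _ (c (inf S))).
    near=> s; apply: AC; first by near: s; apply: nbhs_left_ge.
    move=> r /andP [r0 rs]; apply: before => //; apply: le_lt_trans rs _.
    by near: s; exact: nbhs_left_lt.
  exact: (cvg_at_left_filter (cc (inf S))).
have /nbhs_ballP [e /= e0 eP] : nbhs (inf S) (c @^-1` A) by apply: cc; exact: open_nbhs_nbhs.
have [s [s0 nAs] se] := inf_adherent e0 hS.
have si : inf S <= s by apply: ge_inf; [exists 0|split].
by apply: nAs; apply: eP; rewrite -ball_normE /ball_ /= distrC ger0_norm ?ltrBlDl // subr_ge0.
Unshelve. all: by end_near. Qed.

Lemma exp_solution {R : realType} (l : R) (s : R^o) :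
  differentiable (fun s : R^o => expR (l * s) : R^o) s /\
  'd (fun s : R^o => expR (l * s) : R^o) s 1 = l * expR (l * s).
Proof.
have D : is_derive s 1 (fun s : R^o => expR (l * s) : R^o) (l * expR (l * s)).
  have D1 : is_derive s (1 : R^o) (fun s : R^o => l * s : R^o) l.
    by apply: is_derive_eq; rewrite /GRing.scale /= mulr1.
  by have := is_derive1_comp (is_derive_expR (l * s)) D1; rewrite mulrC.
have dd : differentiable (fun s : R^o => expR (l * s) : R^o) s.
  by apply/derivable1_diffP; exact: (@ex_derive _ _ _ _ _ _ _ D).
by split => //; rewrite -deriveE // derive_val.
Qed.

Lemma product_constant {R : realType} (h u : R^o -> R^o) (l t : R) : 0 <= t ->
  (forall s, 0 <= s <= t -> differentiable h s /\ 'd h s 1 = - l * h s) ->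
  (forall s, 0 <= s <= t -> differentiable u s /\ 'd u s 1 = l * u s) ->
  h t * u t = h 0 * u 0.
Proof.
move=> t0 dh du.
pose w (s : R^o) : R^o := h s *: u s.
have dw s : 0 <= s <= t -> differentiable w s /\ forall k : R^o, 'd w s k = 0.
  move=> st; have [dhs Eh] := dh s st; have [dus Eu] := du s st.
  have [dw Ew] := diff_scale (1 : R^o) dhs dus; split => // k.
  have E1 : 'd w s 1 = 0.
    rewrite -(deriveE _ dw) Ew (deriveE _ dhs) (deriveE _ dus) Eh Eu /GRing.scale /=; ring.
  by rewrite -[k]mulr1 -[k * 1]/(k *: (1 : R^o)) linearZ /= E1 scaler0.
have st (s : R) : 0 <= s <= 1 -> 0 <= s *: t <= t.
  by move=> /andP [s0 s1]; rewrite /GRing.scale /= mulr_ge0 //= ler_piMl.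
have [|s s01] := @mean_value_segment R _ w 0 t.
  by move=> s /st; rewrite add0r => /dw [].
by rewrite !add0r (dw _ (st _ s01)).2 => /eqP; rewrite subr_eq0 => /eqP.
Qed.

(** The product with exp(-lt) has zero derivative. *)
Lemma linear_ode {R : realType} (u : R^o -> R^o) (l t : R) : 0 <= t ->
  (forall s, 0 <= s <= t -> differentiable u s /\ 'd u s 1 = l * u s) ->
  u t = expR (l * t) * u 0.
Proof.
move=> t0 du.
have := product_constant t0 (fun s _ => exp_solution (- l) s) du.
by rewrite mulr0 expR0 mul1r => <-; rewrite mulrA -expRD mulNr subrr expR0 mul1r.
Qed.

Section LocalAnalysis.
Context {R : realType} (Z : ptopologicalType) (E : normedModType R) {fE : FinDim E}
  (aZ : atlas Z E) {atZ : IsAtlas aZ} (M : set Z).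
Hypothesis hZ : hausdorff_space Z.
Variables (phi : R -> Z -> Z) (f : Z -> R^o) (z0 : Z).
Notation chi := (cfun (aZ z0)).
Notation e0 := (cfun (aZ z0) z0).
Variables (X T : E -> E) (g : E -> E -> E -> R) (L : E -> E).
Hypotheses (phi_cont : forall z, continuous (phi ^~ z)) (phi0 : forall z, phi 0 z = z).
Hypotheses (sT : smooth_near T e0) (T0 : T e0 = 0) (dT0 : forall v, 'd T e0 v = v)
  (dTX : \forall e \near e0, 'd T e (X e) = L (T e))
  (df : \forall e \near e0, differentiable (f \o cinv (aZ z0)) e /\
     forall w, 'd (f \o cinv (aZ z0)) e w = g e (X e) w)
  (g_bil : forall e, bilinear_form (g e))
  (g_cont : forall a b, {for e0, continuous (fun e => g e a b : R^o)})
  (g_sym : forall u v, g e0 u v = g e0 v u) (g_pos : forall u, u != 0 -> 0 < g e0 u u)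
  (L_lin : linear L) (L_sym : forall u v, g e0 (L u) v = g e0 u (L v))
  (flow_chart : forall z t, cdom (aZ z0) (phi t z) ->
     differentiable ((fun s : R^o => chi (phi s z)) : R^o -> E) t /\
     'd ((fun s : R^o => chi (phi s z)) : R^o -> E) t 1 = X (chi (phi t z))).

Let d0 : cdom (aZ z0) z0. Proof. exact: atlas_dom. Qed.
Let chi_cont : {for z0, continuous chi}. Proof. exact: cfun_cont. Qed.

Let near_chi (P : E -> Prop) : (\forall e \near e0, P e) -> \forall z \near z0, P (chi z).
Proof. exact: near_comp. Qed.

Section Spectrum.
Variables (n : nat) (v : 'I_n -> E) (lam : 'I_n -> R).
Hypotheses (L_eig : forall i, L (v i) = lam i *: v i)
  (v_orth : forall i j, g e0 (v i) (v j) = (i == j)%:R)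
  (v_span : forall u, u = \sum_i g e0 u (v i) *: v i).

Let q (z : Z) (i : 'I_n) : R := g e0 (T (chi z)) (v i).
Let Qp (z : Z) := \sum_(i | 0 < lam i) q z i ^+ 2.
Let Qm (z : Z) := \sum_(i | lam i <= 0) q z i ^+ 2.

Lemma coordinate_cont i : {for z0, continuous (fun z => q z i : R^o)}.
Proof.
apply: (@continuous_comp _ _ _ chi (fun e => g e0 (T e) (v i) : R^o)) => //.
apply: (@continuous_comp _ _ _ T (fun u => g e0 u (v i) : R^o)); first exact: smooth_near_cont.
exact: (findim_linear_continuous (bil_linl (v i) (g_bil e0))).
Qed.

Lemma coordinate0 i : q z0 i = 0.
Proof. by rewrite /q T0 (lin_zero (bil_linl _ (g_bil e0))). Qed.

Let good e := [/\ differentiable T e & 'd T e (X e) = L (T e)].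

Lemma coordinate_flow z t i : 0 <= t ->
  (forall s, 0 <= s <= t -> cdom (aZ z0) (phi s z) /\ good (chi (phi s z))) ->
  q (phi t z) i = expR (lam i * t) * q z i.
Proof.
move=> t0 H.
pose l (u : E) : R^o := g e0 u (v i).
have ll : linear l by exact: (bil_linl (v i) (g_bil e0)).
have cl : continuous l by exact: findim_linear_continuous.
pose u (s : R^o) : R^o := q (phi s z) i.
have du s : 0 <= s <= t -> differentiable u s /\ 'd u s 1 = lam i * u s.
  move=> /H [ds [dT ET]]; have [dc Ec] := flow_chart ds.
  have dTc : differentiable (T \o (fun s : R^o => chi (phi s z))) s by exact: differentiable_comp.
  have [dl El] := diff_lin_fun (T (chi (phi s z))) ll cl.
  split; first exact: (differentiable_comp dTc dl).
  rewrite -[LHS]/('d (l \o (T \o (fun s : R^o => chi (phi s z)))) s 1).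
  rewrite (diff_comp dTc dl) /= El (diff_comp dc dT) /= Ec ET /l.
  rewrite {1}(v_span (T _)) (linear_sumE L_lin) (bil_suml (fun i => g e0 (T (chi (phi s z))) (v i)) _ _ (g_bil e0)).
  rewrite (bigD1 i) //= L_eig (bilZl _ _ _ (g_bil e0)) v_orth eqxx mulr1 big1 ?addr0; first by rewrite mulrC.
  by move=> j ji; rewrite L_eig (bilZl _ _ _ (g_bil e0)) v_orth (negbTE ji) !mulr0.
by have := linear_ode t0 du; rewrite /u phi0.
Qed.

(** While a trajectory is near z0, its coordinates with nonpositive eigenvalue do not grow, and the
    cone condition bounds the positive ones by them; so it never leaves. A positive coordinate,
    which grows exponentially while remaining bounded, must then be 0. *)
Lemma stays_near (O : set Z) (kappa : R) : open O -> O z0 -> 0 <= kappa ->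
  exists2 W : set Z, open W /\ W z0 & forall x, W x ->
   (forall t, 0 <= t -> O (phi t x) -> Qp (phi t x) <= kappa * Qm (phi t x)) ->
   O x /\ forall i, 0 < lam i -> q x i = 0.
Proof.
move=> oO Oz kap0.
pose K := \sum_i `|v i|; have K0 : 0 <= K by exact: sumr_ge0.
have [B [oB Be0] HB] := sT.
have h12 : 0 < (2^-1 : R) by rewrite invr_gt0.
have [r1 r10 r1P] := [elaborate strict_diff oB Be0 (HB 1%N) h12].
have dTn : \forall e \near e0, differentiable T e.
  by apply: filterS (smooth_near_near sT) => e /smooth_near_diff.
have Oe : \forall e \near e0, O (cinv (aZ z0) e).
  by apply: near_cinv; exact: open_nbhs_nbhs.
have ie : \forall e \near e0, cimg (aZ z0) e by apply: cimg_near; exact: cfun_img.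
have [r2 /= r20 r2P] := (nbhs_ballP _ _).1 (filterI (filterI dTn dTX) (filterI Oe ie)).
pose r := Order.min r1 r2; have r0 : 0 < r by rewrite lt_min r10.
have rr1 : r <= r1 by rewrite ge_min lexx.
have rr2 : r <= r2 by rewrite ge_min lexx orbT.
have ok e : `|e - e0| < r -> [/\ good e, O (cinv (aZ z0) e), cimg (aZ z0) e &
    `|e - e0| <= 2 * `|T e|].
  move=> er; have [] := r2P e; first by rewrite -ball_normE /ball_ /= distrC (lt_le_trans er).
  move=> [h1 h2] [h3 h4]; split => //.
  have := r1P e0 e; rewrite subrr normr0 => /(_ r10 (lt_le_trans er rr1)).
  rewrite T0 subr0 dT0 => h5.
  have := ler_normD (T e - (e - e0)) (- T e); rewrite addrAC subrr sub0r !normrN.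
  lra.
pose N := [set z | cdom (aZ z0) z /\ `|chi z - e0| < r].
(* The trap of [trapped]: the open chart ball N of radius r and the compact ball of half the radius,
   closed in Z by separation. *)
pose C := cinv (aZ z0) @` closed_ball e0 (r / 2).
have r2' : 0 < r / 2 by rewrite divr_gt0.
have Cball e : closed_ball e0 (r / 2) e -> `|e - e0| < r.
  rewrite closed_ballE // /closed_ball_ /= distrC => h; apply: le_lt_trans h _.
  by rewrite ltr_pdivrMr // ltr_pMr // ltr1n.
have oN : open N.
  rewrite openE => z [dz zr]; apply: filterI; first exact: cdom_near.
  have /cvgrPdist_lt := [elaborate cfun_cont dz].
  move=> /(_ (r - `|chi z - e0|)); rewrite subr_gt0 => /(_ zr).
  apply: filterS => y; rewrite distrC => h; have := ler_distD (chi z) (chi y) e0.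
  by move=> h2; lra.
have cC : closed C.
  apply: compact_closed => //; apply: continuous_compact.
    apply: continuous_in_subspaceT => e /set_mem /Cball /ok [_ _ ie' _].
    exact: cinv_cont.
  exact: findim_closed_ball_compact.
have CN : C `<=` N.
  move=> _ [e /Cball er <-]; have [_ _ ie' _] := ok _ er.
  by split; [exact: cinv_dom|rewrite cinvK].
have NO z : N z -> O z by move=> [dz /ok [_ + _ _]]; rewrite cfunK.
(* Coordinates bounded by b give |T| at most b K, hence at most r / 4, and so a distance to e0 of at
   most r / 2. *)
pose b := r / (4 * (K + 1)); have b0 : 0 < b by rewrite divr_gt0 // mulr_gt0 // ltr_pwDr.
pose k := 1 + kappa * n%:R; have k1 : 1 <= k by rewrite /k lerDl mulr_ge0.
have k0 : 0 < k by exact: lt_le_trans k1.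
(* Initial coordinates below eta have squares bounded by k eta^2 for all time, which is at most b^2
   because k is at least 1. *)
pose eta := b / k; have eta0 : 0 < eta by rewrite divr_gt0.
have qn : \forall z \near z0, forall i, `|q z i| < eta.
  apply: near_ord => i; have /cvgrPdist_lt /(_ _ eta0) := @coordinate_cont i.
  by rewrite coordinate0; apply: filterS => z; rewrite sub0r normrN.
have Nz : N z0 by split => //; rewrite subrr normr0.
have [W [oW Wz] WP] := near_open (filterI qn (open_nbhs_nbhs (conj oN Nz))).
exists W => // x /WP [xq Nx] cone.
have bound t i : 0 <= t -> (forall s, 0 <= s <= t -> N (phi s x)) -> `|q (phi t x) i| <= b.
  move=> t0 Ht.
  have E1 j : q (phi t x) j = expR (lam j * t) * q x j.
    by apply: coordinate_flow => // s /Ht [ds /ok [gs _ _ _]].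
  have small j : lam j <= 0 -> q (phi t x) j ^+ 2 <= eta ^+ 2.
    move=> lj; rewrite -real_normK ?num_real // E1 normrM ger0_norm ?expR_ge0 //.
    apply: lerXn2r; rewrite ?nnegrE; [by rewrite mulr_ge0 // expR_ge0|exact: ltW|].
    apply/ltW; apply: le_lt_trans (xq j); rewrite ler_piMl // -expR0 ler_expR.
    by rewrite mulr_le0_ge0.
  have Qmle : Qm (phi t x) <= n%:R * eta ^+ 2.
    rewrite /Qm big_mkcond /=; apply: (@le_trans _ _ (\sum_(j < n) eta ^+ 2)).
      by apply: ler_sum => j _; case: ifP => [/small//|_]; exact: sqr_ge0.
    by rewrite sumr_const card_ord mulr_natl.
  have Qple : Qp (phi t x) <= kappa * (n%:R * eta ^+ 2).
    apply: le_trans (cone t t0 _) _; last by rewrite ler_wpM2l.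
    by apply/NO/Ht; rewrite t0 lexx.
  have qi : q (phi t x) i ^+ 2 <= k * eta ^+ 2.
    have [li|li] := ltP 0 (lam i).
      apply: (@le_trans _ _ (Qp (phi t x))).
        rewrite /Qp (bigD1 i) //= lerDl sumr_ge0 // => j _; exact: sqr_ge0.
      apply: le_trans Qple _; rewrite /k mulrDl mulrA lerDr mul1r; exact: sqr_ge0.
    apply: le_trans (small _ li) _; rewrite ler_peMl //; exact: sqr_ge0.
  have : q (phi t x) i ^+ 2 <= b ^+ 2.
    apply: le_trans qi _; rewrite /eta expr_div_n mulrCA -[leRHS]mulr1 ler_wpM2l ?sqr_ge0 //.
    by rewrite expr2 invfM mulrA divff ?gt_eqF // mul1r invf_le1.
  by rewrite -(real_normK (num_real _)) ler_pXn2r ?nnegrE // ltW.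
have stay : forall t, 0 <= t -> N (phi t x).
  apply: (trapped (c := phi ^~ x) (C := C)) => //; first by rewrite phi0.
  move=> t t0 Ht; have [dt tr] : N (phi t x) by apply: Ht; rewrite t0 lexx.
  exists (chi (phi t x)); last by rewrite cfunK.
  rewrite closed_ballE // /closed_ball_ /= distrC.
  have [_ _ _ h1] := ok _ tr; apply: le_trans h1 _.
  have : `|T (chi (phi t x))| <= b * K.
    rewrite (v_span (T _)) /K mulr_sumr; apply: le_trans (ler_norm_sum _ _ _) _.
    by apply: ler_sum => i _; rewrite normrZ ler_wpM2r // bound.
  move=> h2; have : b * K <= r / 4.
    rewrite /b invfM mulrA -mulrA ler_piMr ?divr_ge0 ?(ltW r0) //.
    by rewrite mulrC ler_pdivrMr ?ltr_pwDr // mul1r lerDl.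
  by move=> h3; lra.
split; first exact: NO.
move=> i li; apply: contrapT => /eqP q0.
have qp : 0 < `|q x i| by rewrite normr_gt0.
(* At this time already the lower bound 1 + lam t of the exponential pushes the coordinate past
   b. *)
pose t := b / (`|q x i| * lam i); have t0 : 0 <= t by apply/ltW/divr_gt0 => //; exact: mulr_gt0.
have := bound t i t0 (fun s st => stay s (andP st).1).
rewrite (coordinate_flow i t0); last first.
  by move=> s /andP [s0 _]; have [ds /ok [gs _ _ _]] := stay s s0.
rewrite normrM (ger0_norm (expR_ge0 _)) => h.
have := ler_wpM2r (ltW qp) (expR_ge1Dx (lam i * t)) => h2.
have : (1 + lam i * t) * `|q x i| = `|q x i| + b.
  by rewrite /t; field; rewrite ?gt_eqF.
lra.
Qed.

(** The factor 2 leaves a margin eps between the nonzero eigenvalues and the threshold in the Morse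
    inequalities. *)
Lemma spectral_gap : exists2 eps, 0 < eps & forall i, lam i != 0 -> 2 * eps <= `|lam i|.
Proof.
pose s := 1 + \sum_i 2 * `|lam i|^-1.
have s0 : 0 < s by rewrite ltr_pwDl // sumr_ge0 // => i _; rewrite mulr_ge0 ?invr_ge0.
exists s^-1; first by rewrite invr_gt0.
move=> i li; have lp : 0 < `|lam i| by rewrite normr_gt0.
rewrite ler_pdivrMr // mulrC -ler_pdivrMr // /s (bigD1 i) //= addrCA lerDl.
by rewrite addr_ge0 // sumr_ge0 // => j _; rewrite mulr_ge0 ?invr_ge0.
Qed.

Let Q (z : Z) := \sum_i lam i * q z i ^+ 2.
Let S (z : Z) := \sum_(i | lam i != 0) q z i ^+ 2.

Let Qp_ge0 z : 0 <= Qp z. Proof. by rewrite sumr_ge0 // => i _; exact: sqr_ge0. Qed.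
Let Qm_ge0 z : 0 <= Qm z. Proof. by rewrite sumr_ge0 // => i _; exact: sqr_ge0. Qed.

Let QpQm z : \sum_i q z i ^+ 2 = Qp z + Qm z.
Proof.
rewrite (bigID (fun i => 0 < lam i)) /=; congr (_ + _).
by apply: eq_bigl => i; rewrite -leNgt.
Qed.

Let S_le z : Qp z <= S z <= Qp z + Qm z.
Proof.
rewrite -QpQm /Qp /S !(big_mkcond _ (fun i => q z i ^+ 2)) /=; apply/andP; split.
  apply: ler_sum => i _; case: ifP => [l0|_]; first by rewrite gt_eqF.
  by case: ifP => // _; exact: sqr_ge0.
by apply: ler_sum => i _; case: ifP => // _; exact: sqr_ge0.
Qed.

Lemma morse_near (eps : R) : 0 < eps -> \forall z \near z0,
  [/\ eps * S z <= Q z -> f z0 <= f z, 0 < S z -> eps * S z <= Q z -> f z0 < f z &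
      Q z <= - (eps * S z) -> f z <= f z0].
Proof.
move=> eps0.
have := near_chi [elaborate morse_inequalities sT T0 dT0 dTX df g_bil g_cont L_lin L_eig v_orth v_span eps0].
have := [elaborate cdom_near d0].
by apply: filterS2 => z dz /=; rewrite (cfunK dz) (cfunK d0).
Qed.

(** Outside the cone the positive part dominates, so Q is at least eps S with S positive, and the
    strict Morse inequality gives f z > f z0. The value of kappa absorbs the negative eigenvalues,
    bounded by Lam, and one further eps. *)
Lemma cone_of_le : exists2 kappa, 0 <= kappa &
  \forall z \near z0, f z <= f z0 -> Qp z <= kappa * Qm z.
Proof.
have [eps eps0 gap] := spectral_gap.
pose Lam := \sum_i `|lam i|; have Lam0 : 0 <= Lam by exact: sumr_ge0.
have lamle i : `|lam i| <= Lam by rewrite /Lam (bigD1 i) //= lerDl sumr_ge0.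
exists ((Lam + eps) / eps); first by rewrite divr_ge0 ?addr_ge0 // ltW.
apply: filterS (morse_near eps0) => z [_ H _] fz; rewrite leNgt; apply/negP => hz.
have Q1 : 2 * eps * Qp z - Lam * Qm z <= Q z.
  rewrite /Q (bigID (fun i => 0 < lam i)) /= lerD //.
    rewrite mulr_sumr; apply: ler_sum => i li; rewrite ler_wpM2r ?sqr_ge0 //.
    by have := gap i; rewrite gt_eqF // gtr0_norm // => /(_ isT).
  have -> : \sum_(i < n | ~~ (0 < lam i)) lam i * q z i ^+ 2 = \sum_(i | lam i <= 0) lam i * q z i ^+ 2.
    by apply: eq_bigl => i; rewrite leNgt.
  rewrite -mulNr /Qm mulr_sumr.
  apply: ler_sum => i li; rewrite ler_wpM2r ?sqr_ge0 //.
  by have := lamle i; rewrite ler_norml => /andP [].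
have [/andP [S1 S2] Qm0] := (S_le z, Qm_ge0 z).
have {}hz : (Lam + eps) * Qm z < eps * Qp z.
  by move: hz; rewrite mulrAC ltr_pdivrMr // [eps * _]mulrC.
have Sp : 0 < S z.
  apply: lt_le_trans S1; rewrite -(pmulr_rgt0 _ eps0); apply: le_lt_trans hz.
  by rewrite mulr_ge0 // addr_ge0 // ltW.
have := H Sp; rewrite ltNge fz => /(_ _)/negP; apply => //.
apply: le_trans Q1; have : eps * S z <= eps * (Qp z + Qm z) by rewrite ler_pM2l.
by move=> h; apply: le_trans h _; rewrite mulrDl in hz; rewrite mulrDr; lra.
Qed.

Lemma le_of_positive0 : \forall z \near z0,
  (forall i, 0 < lam i -> q z i = 0) -> f z <= f z0.
Proof.
have [eps eps0 gap] := spectral_gap.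
apply: filterS (morse_near eps0) => z [_ _ H] qz; apply: H.
rewrite /Q /S [X in - (eps * X)]big_mkcond /= mulr_sumr -sumrN; apply: ler_sum => i _.
have [->|l0] := eqVneq (lam i) 0; first by rewrite mul0r mulr0 oppr0.
have [lp|lm] := ltP 0 (lam i); first by rewrite qz // expr0n /= !mulr0 oppr0.
rewrite -mulNr ler_wpM2r ?sqr_ge0 //.
by have := gap i l0; rewrite ler0_norm // => h; lra.
Qed.

(** At a zero of X the point T lies in the kernel of L, so both Q and S vanish. It lets zeros of X
    in one small neighbourhood stand for one another in the covering argument of
    [almost_every_trajectory]. *)
Lemma zero_value : \forall z \near z0, X (chi z) = 0 -> f z = f z0.
Proof.
have N1 := near_chi dTX.
apply: filterS2 N1 (morse_near ltr01) => z N1 [H1 _ H2] Xz.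
have LT : L (T (chi z)) = 0 by rewrite -N1 Xz linear0.
have lq i : lam i * q z i = 0.
  by rewrite /q -(bilZr _ _ _ (g_bil e0)) -L_eig -L_sym LT (lin_zero (bil_linl _ (g_bil e0))).
have Q0 : Q z = 0 by rewrite /Q big1 // => i _; rewrite expr2 mulrA lq mul0r.
have S0 : S z = 0.
  rewrite /S big1 // => i l0; have /eqP := lq i; rewrite mulf_eq0 (negbTE l0) /= => /eqP ->.
  by rewrite expr0n.
apply/eqP; rewrite eq_le H1 ?H2 // ?Q0 ?S0 ?mulr0 ?oppr0 //.
Qed.

Section SubmanifoldChart.
Variables (k : nat) (W : set Z) (V : set 'rV[R]_k) (ph : Z -> 'rV[R]_k) (psi : 'rV[R]_k -> Z).
Hypotheses (ch : submanifold_chart aZ M W V ph psi) (Wz : W z0) (Mz : M z0).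
Let e1 := ph z0.

Lemma chart_base : V e1 /\ psi e1 = z0.
Proof. by have [_ _ [h1 _ _ _]] := ch; exact: h1. Qed.

Lemma chart_coordinate_smooth i : smooth_near (fun e => q (psi e) i : R^o) e1.
Proof.
have [Ve1 pz] := chart_base.
have sp := [elaborate chart_psi_smooth ch Ve1].
have sc : smooth_at aZ (@vec_atlas R E) chi (psi e1) by apply: cfun_smooth; rewrite pz.
have [/smooth_at_vec sn _] := [elaborate smooth_at_comp sp sc].
have lq := bil_linl (v i) (g_bil e0).
have E0 : (chi \o psi) e1 = e0 by rewrite /= pz.
have s2 : smooth_near (T \o (chi \o psi)) e1 by apply: smooth_near_comp => //; rewrite E0.
apply: (@smooth_near_comp _ _ _ _ _ (T \o (chi \o psi)) (fun u => g e0 u (v i) : R^o)) => //.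
exact: smooth_near_linear.
Qed.

(** If the positive coordinates have zero differential on M, they are of smaller order than the
    distance to z0 along M, so their squares are eventually dominated by the remaining ones. *)
Lemma tangent_cone :
  (forall i, 0 < lam i -> forall w, 'd (fun e => q (psi e) i : R^o) e1 w = 0) ->
  \forall z \near z0, M z -> Qp z <= Qm z.
Proof.
move=> dq; have [Ve1 pz] := chart_base; have [oW _ [h1 _ s1 _]] := ch.
have [G [cG sG] GE] := s1 z0 (conj Mz Wz).
have Gz : G z0 = e1 by exact: nbhs_singleton GE (conj Mz Wz).
have [A [oA Ae0] HA] := sG.
have [r1 r10 r1P] := [elaborate strict_diff oA Ae0 (HA 1%N) ltr01].
have [C C0 CE] := linear_bound (linearP ('d (in_charts aZ (@vec_atlas R 'rV[R]_k) G z0) e0)).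
have Glip : \forall z \near z0, `|G z - e1| <= (C + 1) * `|chi z - e0|.
  have N1 : \forall z \near z0, `|chi z - e0| < r1.
    apply: (near_chi (P := fun e => `|e - e0| < r1)); apply/nbhs_ballP; exists r1 => // e.
    by rewrite -ball_normE /ball_ /= distrC.
  apply: filterS2 N1 [elaborate cdom_near d0] => z zr dz.
  have := r1P e0 (chi z); rewrite subrr normr0 => /(_ r10 zr).
  rewrite /in_charts /= !cfunK // Gz mul1r => h2.
  have h3 := CE (chi z - e0).
  rewrite -[G z - e1](subrK ('d (in_charts aZ (@vec_atlas R 'rV[R]_k) G z0) e0 (chi z - e0))).
  by apply: le_trans (ler_normD _ _) _; rewrite mulrDl mul1r addrC; exact: lerD.
have [B [oB Be0] HB] := sT.
have h12 : 0 < (2^-1 : R) by rewrite invr_gt0.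
have [r2 r20 r2P] := [elaborate strict_diff oB Be0 (HB 1%N) h12].
have Tlip : \forall z \near z0, `|chi z - e0| <= 2 * `|T (chi z)|.
  apply: (near_chi (P := fun e => `|e - e0| <= 2 * `|T e|)); apply/nbhs_ballP; exists r2 => // e.
  rewrite -ball_normE /ball_ /= distrC => er.
  have := r2P e0 e; rewrite subrr normr0 => /(_ r20 er); rewrite T0 subr0 dT0 => h5.
  have := ler_normD (T e - (e - e0)) (- T e); rewrite addrAC subrr sub0r !normrN.
  lra.
pose K := \sum_i `|v i|; have K0 : 0 <= K by exact: sumr_ge0.
pose D := (C + 1) * (2 * K) + 1.
have CK0 : 0 <= (C + 1) * (2 * K) by rewrite !mulr_ge0 // addr_ge0 // ltW.
have D0 : 0 < D by rewrite ltr_pwDr.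
have n20 : 0 < 2 * (n%:R + 1) :> R by rewrite mulr_gt0 // ltr_pwDr.
(* D bounds the chart distance by D times the square root of Qp + Qm, so each positive coordinate is
   at most that root over 2(n + 1); summing n squares gives at most half of Qp + Qm. *)
pose de := (D * (2 * (n%:R + 1)))^-1.
have de0 : 0 < de by rewrite invr_gt0 mulr_gt0.
have uq : \forall e \near e1, forall i, 0 < lam i -> `|q (psi e) i| <= de * `|e - e1|.
  apply: (@near_ord _ (nbhs e1) _ n (fun i e => 0 < lam i -> `|q (psi e) i| <= de * `|e - e1|)) => i.
  have [li|li] := boolP (0 < lam i); last by exact: nearW.
  have [A' [oA' A'e] HA'] := chart_coordinate_smooth i.
  have [r3 r30 r3P] := [elaborate strict_diff oA' A'e (HA' 1%N) de0].
  apply/nbhs_ballP; exists r3 => // e; rewrite -ball_normE /ball_ /= distrC => er _.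
  have := r3P e1 e; rewrite subrr normr0 => /(_ r30 er).
  by rewrite pz coordinate0 dq // !subr0.
have uG : \forall z \near z0, forall i, 0 < lam i -> `|q (psi (G z)) i| <= de * `|G z - e1|.
  exact: (near_comp cG Gz uq).
have NW : \forall z \near z0, W z by exact: open_nbhs_nbhs.
apply: filterS2 (filterI uG NW) (filterI GE (filterI Glip Tlip)) => z [h2 Wz'] [GEz [h3 h4]] Mz'.
have Gph : G z = ph z by exact: GEz.
have pzz : psi (ph z) = z by have [] := h1 z (conj Mz' Wz').
rewrite Gph pzz in h2; rewrite Gph in h3.
pose s := Num.sqrt (Qp z + Qm z).
have QQ0 : 0 <= Qp z + Qm z by rewrite addr_ge0.
have s0 : 0 <= s by exact: sqrtr_ge0.
have s2 : s ^+ 2 = Qp z + Qm z by exact: sqr_sqrtr.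
have qs i : `|q z i| <= s.
  rewrite -sqrtr_sqr ler_wsqrtr // -QpQm (bigD1 i) //= lerDl sumr_ge0 // => j _; exact: sqr_ge0.
have Ts : `|T (chi z)| <= s * K.
  rewrite (v_span (T _)) /K mulr_sumr; apply: le_trans (ler_norm_sum _ _ _) _.
  by apply: ler_sum => i _; rewrite normrZ ler_wpM2r // qs.
have phs : `|ph z - e1| <= D * s.
  apply: le_trans h3 _; apply: (@le_trans _ _ ((C + 1) * (2 * (s * K)))).
    rewrite ler_wpM2l ?addr_ge0 ?(ltW C0) //; apply: le_trans h4 _; by rewrite ler_wpM2l.
  rewrite (_ : _ * _ = ((C + 1) * (2 * K)) * s); last by ring.
  by rewrite ler_wpM2r // /D lerDl.
have qp i : 0 < lam i -> q z i ^+ 2 <= (Qp z + Qm z) / (2 * (n%:R + 1)).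
  move=> li; have := h2 i li => h5.
  have h6 : `|q z i| <= s / (2 * (n%:R + 1)).
    apply: le_trans h5 _; apply: (@le_trans _ _ (de * (D * s))); first by rewrite ler_pM2l.
    by rewrite /de invfM mulrACA mulVf ?gt_eqF // mul1r mulrC.
  rewrite -real_normK ?num_real // expr2 -s2 expr2 -mulrA; apply: ler_pM => //.
have QpS : Qp z <= n%:R * ((Qp z + Qm z) / (2 * (n%:R + 1))).
  rewrite {1}/Qp big_mkcond /=; apply: (@le_trans _ _ (\sum_(i < n) ((Qp z + Qm z) / (2 * (n%:R + 1))))).
    by apply: ler_sum => i _; case: ifP => [/qp//|_]; rewrite divr_ge0 // ltW.
  by rewrite sumr_const card_ord -[leLHS]mulr_natl.
have : n%:R * ((Qp z + Qm z) / (2 * (n%:R + 1))) <= (Qp z + Qm z) / 2.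
  rewrite mulrA ler_pdivrMr // (_ : _ * (2 * (n%:R + 1)) = (Qp z + Qm z) * (n%:R + 1)); last by field.
  by rewrite mulrC ler_wpM2l // lerDl.
by lra.
Qed.

(** Otherwise M lies near z0 in the cone where Qp is at most Qm. Trajectories in M then stay near z0
    by [stays_near], so their positive coordinates vanish and f is at most f z0: z0 would be a local
    maximum on M. *)
Lemma unstable_direction : (forall x t, M x -> M (phi t x)) ->
  ~ (\forall x \near z0, M x -> f x <= f z0) ->
  exists2 i, 0 < lam i & exists w, 'd (fun e => q (psi e) i : R^o) e1 w != 0.
Proof.
move=> Mphi nloc; apply: contrapT => none; apply: nloc.
have dq i : 0 < lam i -> forall w, 'd (fun e => q (psi e) i : R^o) e1 w = 0.
  move=> li w; apply/eqP/negPn/negP => dw; apply: none; exists i => //; by exists w.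
have NA : \forall x \near z0, (M x -> Qp x <= Qm x) /\
    ((forall i, 0 < lam i -> q x i = 0) -> f x <= f z0).
  by apply: filterI; [exact: tangent_cone|exact: le_of_positive0].
have [A [oA Az] AP] := near_open NA.
have [W' [oW' W'z] W'P] := stays_near oA Az ler01.
apply: (open_near oW' W'z) => x W'x Mx.
have [t t0 At|Ax qx] := W'P x W'x.
  by rewrite mul1r; apply: (AP _ At).1; exact: Mphi.
exact: (AP _ Ax).2.
Qed.

End SubmanifoldChart.
End Spectrum.

(** A trajectory with f at most f z0 remains in the cone of [cone_of_le] while near z0, so
    [stays_near] kills its unstable coordinate. The neighbourhood does not depend on the measure. *)
Lemma trajectories_below_null : submanifold aZ M -> (forall x t, M x -> M (phi t x)) ->
  M z0 -> ~ (\forall x \near z0, M x -> f x <= f z0) ->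
  exists2 O : set Z, open O /\ O z0 & (forall z, O z -> X (chi z) = 0 -> f z = f z0) /\
    forall nu0 : probability (borel Z) R, smooth_measure aZ M nu0 ->
      nu0.-negligible [set x : borel Z | [/\ M x, O x & forall t, 0 <= t -> f (phi t x) <= f z0]].
Proof.
move=> M_sub Mphi Mz nloc.
have [n [v [lam [L_eig v_orth v_span]]]] := [elaborate spectral_theorem (g_bil e0) g_sym g_pos L_lin L_sym].
have [k [W [V [ph [psi [Wz ch]]]]]] := M_sub z0 Mz.
have [i li [w dw]] := unstable_direction L_eig v_orth v_span ch Wz Mz Mphi nloc.
have [Ve1 pz] := chart_base ch Wz Mz.
have [N [oN Nz] Nnull] := smooth_measure_level hZ ch Ve1 (chart_coordinate_smooth v ch Wz Mz i) (ex_intro _ w dw).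
have [kappa k0 cone] := cone_of_le L_eig v_orth v_span.
have /near_open [A1 [oA1 A1z] A1P] := cone.
have [W1 [oW1 W1z] W1P] := stays_near L_eig v_orth v_span oA1 A1z k0.
have /near_open [A2 [oA2 A2z] A2P] := zero_value L_eig v_orth v_span.
have oW : open W by case: ch.
rewrite pz in Nz.
exists ((W1 `&` A2) `&` (N `&` W)).
  by split; [do !apply: openI|do !split].
split; first by move=> z [[_ /A2P]].
move=> nu0 /Nnull; apply: negligibleS => x [Mx [[W1x _] [Nx Wx]] fx].
split => //.
have [_ [_ _ [h1 _ _ _]]] := (I, ch); have [_ ->] := h1 x (conj Mx Wx).
have [t t0 At|_ qx] := W1P x W1x; first by apply: (A1P _ At); exact: fx.
exact: qx.
Qed.

End LocalAnalysis.

(** * Convergence of almost every trajectory to the maximum *)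

Lemma push_probability {R : realType} (Z : ptopologicalType) (g : Z -> Z)
  (nu : probability (borel Z) R) : continuous g ->
  exists nu' : probability (borel Z) R, (nu' : set (borel Z) -> \bar R) = push g nu.
Proof.
move=> cg; have mg := borel_continuous_measurable cg.
pose X : {mfun borel Z >-> borel Z} := HB.pack (g : borel Z -> borel Z) (isMeasurableFun.Build _ _ _ _ _ mg).
by exists (distribution nu X).
Qed.

Lemma push_negligible {R : realType} (Z : ptopologicalType) (g : Z -> Z)
  (nu nu' : probability (borel Z) R) (A : set (borel Z)) : continuous g ->
  (nu' : set (borel Z) -> \bar R) = push g nu -> nu'.-negligible A ->
  nu.-negligible (g @^-1` A : set (borel Z)).
Proof.
move=> cg E [B [mB B0 AB]]; exists (g @^-1` B : set (borel Z)); split.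
- by have := borel_continuous_measurable cg measurableT mB; rewrite setTI.
- by move: B0; rewrite E.
- by move=> x /AB.
Qed.

Section GradientTrajectories.
Context {R : realType} (Z : ptopologicalType) (E : normedModType R) {fE : FinDim E}
  (aZ : atlas Z E) {atZ : IsAtlas aZ} (M : set Z) (M_compact : compact M).
Hypothesis Z_countable : @second_countable Z.
Variables (phi : R -> Z -> Z) (f : Z -> R^o) (crit : set Z).
Hypotheses (phi_smooth : forall t z, smooth_at aZ aZ (phi t) z)
  (phi0 : forall z, phi 0 z = z) (phiD : forall s t z, phi (s + t) z = phi s (phi t z))
  (phi_M : forall x t, M x -> M (phi t x)) (f_cont : continuous f)
  (f_mono : forall x s t, s <= t -> f (phi s x) <= f (phi t x))
  (critP : forall z, (forall t, 0 <= t -> f (phi t z) = f z) -> crit z)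
  (f_max : unique_local_maximum M f)
  (null_near : forall z0, crit z0 -> M z0 -> ~ (\forall x \near z0, M x -> f x <= f z0) ->
    exists2 O : set Z, open O /\ O z0 & (forall z, O z -> crit z -> f z = f z0) /\
    forall nu0 : probability (borel Z) R, smooth_measure aZ M nu0 ->
      nu0.-negligible [set x : borel Z | [/\ M x, O x & forall t, 0 <= t -> f (phi t x) <= f z0]]).

Let phi_cont t : continuous (phi t).
Proof. by move=> z; exact: smooth_at_cont (phi_smooth t z). Qed.

(** By compactness the positions at integer times have a cluster point. Monotonicity of f along the
    flow makes f constant on its forward trajectory, equal to the supremum along the given one. *)
Lemma limit_point x c : M x -> (forall t, 0 <= t -> f (phi t x) <= c) ->
  exists z0, [/\ M z0, crit z0, f z0 <= c, forall t, 0 <= t -> f (phi t x) <= f z0 &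
    forall B, nbhs z0 B -> exists n : nat, B (phi n%:R x)].
Proof.
move=> Mx fc.
have [z0 [Mz0 cz]] : M `&` cluster ((fun n : nat => phi n%:R x) @ \oo) !=set0.
  by apply: M_compact; exists 0%N => // n _; exact: phi_M.
have often B N : nbhs z0 B -> exists2 n : nat, (N <= n)%N & B (phi n%:R x).
  pose A := (fun n : nat => phi n%:R x) @` [set n | (N <= n)%N].
  have nA : nbhs ((fun n : nat => phi n%:R x) @ \oo) A by exists N => // n /= Nn; exists n.
  by move=> /(cz _ _ nA) [_ [[n Nn <-] Bn]]; exists n.
have up t s : 0 <= t -> 0 <= s -> f (phi t x) <= f (phi s z0).
  move=> t0 s0; rewrite leNgt; apply/negP => lt.
  have cs : {for z0, continuous (f \o phi s)}.
    by apply: continuous_comp; [exact: phi_cont|exact: f_cont].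
  have nB : \forall y \near z0, f (phi s y) < f (phi t x).
    by apply: (cs [set y | y < f (phi t x)]); apply: open_nbhs_nbhs; split => //; exact: open_lt.
  have [n nN] := often _ (Num.bound t) nB; rewrite ltNge -phiD f_mono //.
  apply: (@le_trans _ _ n%:R); last by rewrite lerDr.
  by apply: le_trans (ltW (archi_boundP t0)) _; rewrite ler_nat.
have down s d : (forall t, 0 <= t -> f (phi t x) <= d) -> 0 <= s -> f (phi s z0) <= d.
  move=> fd s0; rewrite leNgt; apply/negP => lt.
  have cs : {for z0, continuous (f \o phi s)}.
    by apply: continuous_comp; [exact: phi_cont|exact: f_cont].
  have nB : \forall y \near z0, d < f (phi s y).
    by apply: (cs [set y | d < y]); apply: open_nbhs_nbhs; split => //; exact: open_gt.
  have [n _] := often _ 0%N nB; rewrite -phiD ltNge fd //.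
  by rewrite addr_ge0.
have fz t : 0 <= t -> f (phi t x) <= f z0.
  by move=> t0; have := up t 0 t0 (lexx _); rewrite phi0.
exists z0; split => //.
- apply: critP => s s0; apply/eqP; rewrite eq_le down //=.
  by have := f_mono z0 s0; rewrite phi0.
- by have := down 0 c fc (lexx _); rewrite phi0.
- by move=> B nB; have [n _ Bn] := often B 0%N nB; exists n.
Qed.

(** A trajectory staying below the maximum accumulates at a critical point that is no local maximum,
    so at some integer time it lies in a basic open set contained in one of the null neighbourhoods.
    A countable base leaves countably many conditions, each the preimage of a null set under a
    time-n map, and pushforwards of smooth measures are smooth. *)
Lemma almost_every_trajectory (nu0 : probability (borel Z) R) : smooth_measure aZ M nu0 ->
  nu0.-negligible [set x : borel Z | M x /\
    exists2 c, (exists2 y, M y & c < f y) & forall t, 0 <= t -> f (phi t x) <= c].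
Proof.
move=> nu0s.
pose D z0 := [/\ crit z0, M z0 & ~ (\forall x \near z0, M x -> f x <= f z0)].
pose P z0 O := [/\ open O, O z0, forall z, O z -> crit z -> f z = f z0 &
    forall nu0 : probability (borel Z) R, smooth_measure aZ M nu0 ->
      nu0.-negligible [set x : borel Z | [/\ M x, O x & forall t, 0 <= t -> f (phi t x) <= f z0]]].
have exO z0 : D z0 -> exists N, P z0 N.
  by move=> [h1 h2 h3]; have [N [? ?] [? ?]] := null_near h1 h2 h3; exists N.
have [N NP] := choice_on set0 exO.
have [B /countable_injP [idx idx_inj] [Bo Bb]] := Z_countable.
pose bad n b := [set x : borel Z | exists2 z0, [/\ D z0, b `<=` N z0 & b z0] &
   [/\ M (phi n%:R x), b (phi n%:R x) & forall t, 0 <= t -> f (phi t (phi n%:R x)) <= f z0]].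
pose badk n k := [set x | exists2 b, B b /\ idx b = k & bad n b x].
have nullk n k : nu0.-negligible (badk n k).
  have [[b [Bb' idb]]|none] := pselect (exists b, B b /\ idx b = k); last first.
    by apply: negligibleS (negligible_set0 _) => x [b h]; case: none; exists b.
  have uniq b' : B b' -> idx b' = k -> b' = b.
    by move=> Bb2 idb2; apply: idx_inj; rewrite ?inE // idb idb2.
  (* One representative z suffices for the basic set b: every other critical point in b has the same
     value of f, by the property that [null_near] provides. *)
  have [[z [Dz bz]]|none] := pselect (exists z, D z /\ b `<=` N z); last first.
    apply: negligibleS (negligible_set0 _) => x [b' [Bb2 idb2]].
    by rewrite (uniq b') // => -[z [Dz bz _] _]; case: none; exists z.
  have [oN Nz fN Nnull] := NP z Dz.
  have [nu' nu'E] := push_probability nu0 (@phi_cont n%:R).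
  have nu's : smooth_measure aZ M nu'.
    rewrite nu'E; apply: (smooth_measure_push (g' := phi (- n%:R))) nu0s => //.
    - by move=> x; rewrite -phiD addNr phi0.
    - by move=> x; rewrite -phiD addrN phi0.
    - by move=> x; exact: phi_M.
    - by move=> x; exact: phi_M.
  apply: negligibleS (push_negligible (@phi_cont n%:R) nu'E (Nnull nu' nu's)).
  move=> x [b' [Bb2 idb2]]; rewrite (uniq b') // => -[z1 [Dz1 bz1 bz11] [h1 h2 h3]].
  split => //; first exact: bz.
  move=> t t0; rewrite -(fN z1); [exact: h3|exact: bz|by case: Dz1].
have := negligible_bigcup (fun n => negligible_bigcup (nullk n)).
apply: negligibleS => x [Mx [c [y My cy] fc]].
have [z0 [Mz0 cz fz0 fz lim]] := limit_point Mx fc.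
(* A local maximum at z0 would be global, whereas f z0 is at most c and c is below a value of f on
   M. *)
have Dz0 : D z0.
  split => // loc; have := f_max Mz0 loc My; rewrite leNgt => /negP; apply.
  exact: le_lt_trans cy.
have [oN Nz0 _ _] := NP z0 Dz0.
have [b [Bb' bz0] bN] := Bb z0 (N z0) (open_nbhs_nbhs (conj oN Nz0)).
have nb : nbhs z0 b by apply: open_nbhs_nbhs; split => //; exact: Bo.
have [n bn] := lim b nb.
exists n => //; exists (idx b) => //; exists b => //; exists z0 => //.
split => //; first exact: phi_M.
by move=> t t0; rewrite -phiD; apply: fz; rewrite addr_ge0.
Qed.

End GradientTrajectories.

(** * Linearisation at a fixed point *)

Lemma ultra_limit {R : realType} (F : set_system nat) {UF : UltraFilter F} (a : nat -> R) (C : R) :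
  (forall n, `|a n| <= C) -> exists2 l, `|l| <= C & a @ F --> l.
Proof.
move=> aC.
have uF : UltraFilter (a @ F).
  have PF : ProperFilter (a @ F) by apply: fmap_proper_filter; exact: ultra_proper.
  split => // G PG FG; apply/seteqP; split=> // B GB.
  have [//|FnB] := in_ultra_setVsetC (a @^-1` B) UF.
  have GnB : G (~` B) by exact: FG.
  by have [x [Bx nBx]] := filter_ex (filterI GB GnB).
have := @segment_compact R (- C) C; rewrite compact_ultra => /(_ (a @ F) uF) [|l [lC al]].
  suff E : a @^-1` [set` `[- C, C]] = setT by rewrite /fmap /= E; exact: filterT.
  by apply/seteqP; split=> // n _; rewrite /= in_itv /= -ler_norml.
by exists l => //; move: lC; rewrite /= in_itv /= -ler_norml.
Qed.

Lemma sum_nat_split {R : realType} (h : nat -> R) N j :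
  \sum_(0 <= k < N + j) h k = \sum_(0 <= k < N) h k + \sum_(0 <= k < j) h (k + N)%N.
Proof.
elim: j => [|j IH]; first by rewrite addn0 [X in _ + X]big_geq // addr0.
by rewrite addnS !big_nat_recr //= IH addrA addnC.
Qed.

(* A limit of averages over longer and finer dyadic grids is invariant under the dyadic
   translations, which is enough below since both sides depend continuously on the
   translation. *)
Lemma dyadic_mean (R : realType) : exists D : (R -> R) -> R, [/\
  forall c (f g : R -> R) A B, (forall t, `|f t| <= A) -> (forall t, `|g t| <= B) ->
    D (fun t => c * f t + g t) = c * D f + D g,
  forall (f : R -> R) A, (forall t, `|f t| <= A) -> `|D f| <= A,
  forall c, D (fun=> c) = c &
  forall (f : R -> R) A m, (forall t, `|f t| <= A) -> D (fun t => f (t + (2 ^+ m)^-1)) = D f].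
Proof.
have [F [UF FE]] := @ultraFilterLemma nat \oo _.
(* 4^n samples at spacing 2^-n cover a window of length 2^n. Translation by 2^-m shifts the index by
   2^(n-m) and replaces that many terms by as many others, so the average changes by at most 2 A
   2^-n. *)
pose a (f : R -> R) (n : nat) : R := (4 ^ n)%:R^-1 * \sum_(k < 4 ^ n) f (k%:R / 2 ^+ n).
have p4 n : 0 < (4 ^ n)%:R :> R by rewrite ltr0n expn_gt0.
have abound f A n : (forall t, `|f t| <= A) -> `|a f n| <= A.
  move=> fA; rewrite /a normrM normfV (gtr0_norm (p4 n)) ler_pdivrMl //.
  apply: le_trans (ler_norm_sum _ _ _) _; apply: (@le_trans _ _ (\sum_(k < 4 ^ n) A)).
    by apply: ler_sum => k _; exact: fA.
  by rewrite sumr_const card_ord mulr_natl.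
pose D f : R := lim (a f @ F).
have Dlim f A : (forall t, `|f t| <= A) -> `|D f| <= A /\ a f @ F --> D f.
  move=> fA; have [l lA al] := @ultra_limit _ _ UF _ _ (fun n => abound f A n fA).
  by rewrite /D (cvg_lim _ al).
exists D; split.
- move=> c f g A B fA gB; apply: cvg_lim => //.
  have -> : a (fun t => c * f t + g t) = fun n => c * a f n + a g n.
    by apply/funext => n; rewrite /a big_split /= -mulr_sumr mulrDr mulrCA.
  apply: cvgD; last exact: (Dlim g B gB).2.
  by apply: cvgM; [exact: cvg_cst|exact: (Dlim f A fA).2].
- by move=> f A /Dlim [].
- move=> c; apply: cvg_lim => //.
  have -> : a (fun=> c) = fun=> c; last exact: cvg_cst.
  apply/funext => n; rewrite /a sumr_const card_ord -[c *+ _]mulr_natl mulrA mulVf ?mul1r //.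
- move=> f A m fA; have A0 : 0 <= A by exact: le_trans (fA 0).
  pose g t := f (t + (2 ^+ m)^-1); have gA t : `|g t| <= A by exact: fA.
  have [_ lf] := Dlim f A fA; have [_ lg] := Dlim g A gA.
  have small : (fun n => a g n - a f n) @ F --> (0 : R).
    suff : (fun n => a g n - a f n) @ \oo --> (0 : R).
      by apply: cvg_trans => B /FE.
    apply: (@squeeze_cvgr _ _ _ _ (fun n => - (2 * A * (2^-1) ^+ n)) (fun n => 2 * A * (2^-1) ^+ n)).
    + exists m => // n /= mn.
      pose h k := f (k%:R / 2 ^+ n).
      have E1 : a f n = (4 ^ n)%:R^-1 * \sum_(0 <= k < 4 ^ n) h k.
        by rewrite /a big_mkord.
      have E2 : a g n = (4 ^ n)%:R^-1 * \sum_(0 <= k < 4 ^ n) h (k + 2 ^ (n - m))%N.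
        rewrite /a big_mkord; congr (_ * _); apply: eq_bigr => k _; rewrite /g /h.
        congr f; rewrite natrD mulrDl natrX; congr (_ + _).
        by rewrite -[in X in _ / X](subnK mn) exprD invfM mulrA divff ?mul1r // expf_neq0 // pnatr_eq0.
      have := sum_nat_split h (4 ^ n) (2 ^ (n - m)); rewrite addnC sum_nat_split => E3.
      rewrite -ler_norml E1 E2 -mulrBr normrM normfV (gtr0_norm (p4 n)) ler_pdivrMl //.
      have bd (u : nat -> R) : (forall k, `|u k| <= A) -> `|\sum_(0 <= k < 2 ^ (n - m)) u k| <= 2 ^+ n * A.
        move=> uA; apply: le_trans (ler_norm_sum _ _ _) _.
        apply: (@le_trans _ _ (\sum_(0 <= k < 2 ^ (n - m)) A)); first by apply: ler_sum => k _.
        rewrite sumr_const_nat subn0 -[leLHS]mulr_natl ler_wpM2r // -natrX ler_nat leq_exp2l //.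
        exact: leq_subr.
      rewrite (_ : \sum_(0 <= k < _) h _ - _ = \sum_(0 <= k < 2 ^ (n - m)) h (k + 4 ^ n)%N
        - \sum_(0 <= k < 2 ^ (n - m)) h k); last by lra.
      apply: le_trans (ler_normB _ _) _.
      apply: (@le_trans _ _ (2 ^+ n * A + 2 ^+ n * A)); first by apply: lerD; apply: bd => k; exact: fA.
      rewrite natrX (_ : 4%:R = 2 * 2 :> R) ?exprMn -?natrM //.
      rewrite exprVn (_ : _ * _ * (_ / _) = 2 ^+ n * A * 2) ?mulr_natr ?mulr2n //.
      by field; rewrite expf_neq0 // pnatr_eq0.
    + rewrite -[X in _ --> X]oppr0; apply: cvgN; rewrite -[X in _ --> X](mulr0 (2 * A)).
      apply: cvgM; [exact: cvg_cst|apply: cvg_expr].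
      by rewrite ger0_norm ?invr_ge0 // invf_lt1 // ltr1n.
    + rewrite -[X in _ --> X](mulr0 (2 * A)).
      apply: cvgM; [exact: cvg_cst|apply: cvg_expr].
      by rewrite ger0_norm ?invr_ge0 // invf_lt1 // ltr1n.
  have lgf : (fun n => a g n - a f n) @ F --> D g - D f by exact: cvgB.
  have E0 : 0 = D g - D f by rewrite -(cvg_lim _ lgf) // (cvg_lim _ small).
  by apply/eqP; rewrite -subr_eq0 -/(D g) -E0.
Qed.

Section RealValued.
Context {R : realType} (X : topologicalType) (E : normedModType R) (a : atlas X E).
Notation vR := (@vec_atlas R R^o).

Lemma smooth_at_realM (f g : X -> R^o) x : smooth_at a vR f x -> smooth_at a vR g x ->
  smooth_at a vR (fun y => f y * g y : R^o) x.
Proof.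
move=> [cf sf] [cg sg]; split; first exact: cvgM.
exact: (smooth_near_mul sf sg).
Qed.

Lemma smooth_at_realS n (f : 'I_n -> X -> R^o) x : (forall i, smooth_at a vR (f i) x) ->
  smooth_at a vR (fun y => \sum_i f i y : R^o) x.
Proof.
move=> sf; split; first by apply: continuous_at_sum => i; case: (sf i).
exact: (smooth_near_sum (fun i => (sf i).2)).
Qed.

End RealValued.

(** * Holomorphic actions and their fundamental fields *)

Section Actions.
Context {R : realType} (H : topGroupType) (d : nat) (a : atlas H (Cn R d)).
Context (Z : topologicalType) (m : nat) (b : atlas Z (Cn R m)) (act : H -> Z -> Z).
Hypotheses (Hlie : is_complex_lie_group a) (b_complex : is_complex_manifold b)
  (act_hol : is_holomorphic_action a b act).
Notation E := (Cn R m).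
Notation vR := (@vec_atlas R R^o).
Notation vE := (@vec_atlas R (Cn R m)).

Let aH : IsAtlas a.
Proof. by apply: manifold_isAtlas; case: (lie_manifold Hlie). Qed.
Let bZ : IsAtlas b.
Proof. by apply: manifold_isAtlas; case: b_complex. Qed.
#[local] Existing Instance aH.
#[local] Existing Instance bZ.

Let Dact := tangent (prod_atlas a b) b (fun p => act p.1 p.2).

Lemma act_smooth (X : topologicalType) (F : normedModType R) (c : atlas X F)
    {cX : IsAtlas c} {fF : FinDim F} (f : X -> H) (g : X -> Z) x :
  smooth_at c a f x -> smooth_at c b g x ->
  smooth_at c b (fun y => act (f y) (g y)) x /\
  forall v, tangent c b (fun y => act (f y) (g y)) x v =
    Dact (f x, g x) (tangent c a f x v, tangent c b g x v).
Proof.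
move=> sf sg; have [s1 t1] := [elaborate smooth_at_pair sf sg].
have [s2 t2] := [elaborate smooth_at_comp s1 ((action_holomorphic act_hol).1 (f x, g x))].
by split => // v; rewrite /Dact -t1 -t2.
Qed.

Lemma act_point_smooth h z : smooth_at b b (act h) z /\
  forall v, tangent b b (act h) z v = Dact (h, z) (0, v).
Proof.
have [s1 t1] := smooth_at_id b z.
have [s2 t2] := [elaborate act_smooth (smooth_at_cst b a h z) s1].
by split => // v; have := t2 v; rewrite tangent_cst t1.
Qed.

Lemma orbit_smooth h z : smooth_at a b (act ^~ z) h /\
  forall X, tangent a b (act ^~ z) h X = Dact (h, z) (X, 0).
Proof.
have [s1 t1] := smooth_at_id a h.
have [s2 t2] := [elaborate act_smooth s1 (smooth_at_cst a b z h)].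
by split => // v; have := t2 v; rewrite tangent_cst t1.
Qed.

Let Dact_Ci p v : Dact p (Cprod v) = Ci (Dact p v).
Proof. exact: (action_holomorphic act_hol).2. Qed.

Lemma tangent_act_Ci h z v : tangent b b (act h) z (Ci v) = Ci (tangent b b (act h) z v).
Proof. by rewrite !(act_point_smooth h z).2 -Dact_Ci /Cprod /= Ci0. Qed.

Lemma tangent_orbit_Ci h z X : tangent a b (act ^~ z) h (Ci X) = Ci (tangent a b (act ^~ z) h X).
Proof. by rewrite !(orbit_smooth h z).2 -Dact_Ci /Cprod /= Ci0. Qed.

Lemma fundamental_fieldE X c z : one_parameter_subgroup a X c ->
  fundamental_field a b act X z = tangent a b (act ^~ z) 1%g X.
Proof.
move=> hc; rewrite /fundamental_field; have [cD sc tc] := hc.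
have -> : (fun t : R^o => act (lie_exp a (t *: X)) z) = (act ^~ z) \o c.
  by apply/funext => t; rewrite /= (lie_expZ Hlie _ hc).
have [_ ->] := [elaborate smooth_at_comp (sc 0) (orbit_smooth (c 0) z).1].
by rewrite tc (one_ps0 hc).
Qed.

Lemma flow_smooth X c z t : one_parameter_subgroup a X c ->
  smooth_at vR b (fun s => act (c s) z) t.
Proof.
move=> [_ sc _].
by have [] := [elaborate smooth_at_comp (sc t) (orbit_smooth (c t) z).1].
Qed.

Lemma flow_velocity X c z t : one_parameter_subgroup a X c ->
  tangent vR b (fun s => act (c s) z) t 1 = fundamental_field a b act X (act (c t) z).
Proof.
move=> hc; have [cD sc tc] := hc.
pose sh (u : R^o) : R^o := u - t.
have -> : (fun s => act (c s) z) = (fun s => act (c s) (act (c t) z)) \o sh.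
  by apply/funext => s; rewrite /sh /= -(actionM act_hol) -cD subrK.
have ssh : smooth_at vR vR sh t.
  by apply/smooth_at_vec; apply: smooth_near_add; [exact: smooth_near_id|exact: smooth_near_cst].
have [_ ->] := [elaborate smooth_at_comp ssh (flow_smooth (act (c t) z) (sh t) hc)].
rewrite tangent_vec.
have -> : 'd sh t 1 = 1.
  have dsh : is_diff t sh (id - 0) by exact: is_diffB.
  by rewrite diff_val /= fctE /= subr0.
have -> : sh t = 0 by rewrite /sh subrr.
rewrite (fundamental_fieldE _ hc).
have [_ E1] := [elaborate smooth_at_comp (sc 0) (orbit_smooth (c 0) (act (c t) z)).1].
by have := E1 1; rewrite tc (one_ps0 hc).
Qed.

Lemma chart_Ci z0 y v : cdom (b z0) y ->
  tangent b vE (cfun (b z0)) y (Ci v) = Ci (tangent b vE (cfun (b z0)) y v).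
Proof.
move=> dy; have [_ h] := b_complex; apply: (h y z0); split.
  by apply: cfun_img; exact: atlas_dom.
by rewrite /= cfunK //; exact: atlas_dom.
Qed.

Lemma chart_inv_Ci z0 e v : cimg (b z0) e ->
  tangent vE b (cinv (b z0)) e (Ci v) = Ci (tangent vE b (cinv (b z0)) e v).
Proof.
by move=> ie; have [_ h] := b_complex; apply: (h z0 (cinv (b z0) e)); split => //; exact: atlas_dom.
Qed.

End Actions.

Lemma derive_affine {R : realType} (V W : normedModType R) (L : W -> R^o) (f : V -> W) k x v :
  linear L -> continuous L -> differentiable f x ->
  'D_v (fun y => L (f y - k)) x = L ('d f x v).
Proof.
move=> lL cL df; have dL := derive_lin v lL cL df.
have E1 : (fun y => L (f y - k)) = (L \o f) - cst (L k).
  by apply/funext => y; rewrite !fctE /= (lin_sub lL).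
have [dLk _] := diff_lin_fun (f x) lL cL.
have d1 : derivable (L \o f) x v by apply: diff_derivable; exact: differentiable_comp.
have d2 : derivable (cst (L k) : V -> R^o) x v by exact: derivable_cst.
by rewrite E1 (deriveB d1 d2) derive_cst subr0 dL (deriveE v df).
Qed.

Lemma diff_lincomb {R : realType} (V W : normedModType R) (f g : V -> W) k x v :
  differentiable f x -> differentiable g x ->
  'd (fun y => k *: f y + g y) x v = k *: 'd f x v + 'd g x v.
Proof.
move=> df dg; have -> : (fun y => k *: f y + g y) = k *: f + g by [].
have dkf : differentiable (k *: f) x by exact: differentiableZ.
have d1 : derivable (k *: f) x v by exact: diff_derivable.
have d2 : derivable g x v by exact: diff_derivable.
have d3 : differentiable (k *: f + g) x by exact: differentiableD.
rewrite -(deriveE v d3) (deriveD d1 d2) (deriveE v dg) deriveZ; last exact: diff_derivable.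
by rewrite (deriveE v df).
Qed.

Lemma diff_linE {R : realType} (V W Y : normedModType R) (L : W -> Y) (f : V -> W) x v :
  linear L -> continuous L -> differentiable f x ->
  'd (fun y => L (f y)) x v = L ('d f x v).
Proof.
move=> lL cL df; have dL := derive_lin v lL cL df.
have [dLk _] := diff_lin_fun (f x) lL cL.
have d1 : differentiable (L \o f) x by exact: differentiable_comp.
by rewrite -(deriveE v d1) dL (deriveE v df).
Qed.

Lemma diff_compE {R : realType} (V W Y : normedModType R) (f : V -> W) (g : W -> Y) x y v :
  differentiable f x -> differentiable g y -> f x = y ->
  'd (g \o f) x v = 'd g y ('d f x v).
Proof.
move=> df dg fxy; rewrite -fxy in dg *.
have d1 : differentiable (g \o f) x by exact: differentiable_comp.
by rewrite -(deriveE v d1) (derive_compE v df dg) (deriveE v df) (deriveE _ dg).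
Qed.

Lemma diff_oppE {R : realType} (W : normedModType R) (f : R^o -> W) v : differentiable f 0 ->
  differentiable (fun s => f (- s)) 0 /\ 'd (fun s => f (- s)) 0 v = - 'd f 0 v.
Proof.
move=> df; pose opp (s : R^o) : R^o := - s.
have lo : linear opp by move=> k x y; rewrite /opp opprD scalerN.
have [do1 Eo] := diff_lin_fun (0 : R^o) lo (findim_linear_continuous lo).
have o0 : opp 0 = 0 by rewrite /opp oppr0.
have d1 : differentiable (f \o opp) 0 by apply: differentiable_comp => //; rewrite o0.
split => //; rewrite -[LHS]/('d (f \o opp) 0 v) (diff_compE v do1 df o0).
by rewrite Eo /opp linearN.
Qed.

Lemma derive_sumE {R : realType} (V W : normedModType R) n (F : 'I_n -> V -> W) x v :
  (forall j, differentiable (F j) x) ->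
  'D_v (fun y => \sum_j F j y) x = \sum_j 'D_v (F j) x.
Proof.
move=> dF; have -> : (fun y => \sum_j F j y) = \sum_j F j by apply/funext => y; rewrite fct_sumE.
by apply: derive_sum => j; exact: diff_derivable.
Qed.

(** A derivative at 0 is determined by the values along any sequence tending to 0; this turns dyadic
    equivariance into an infinitesimal identity. *)
Lemma dyadic_diff {R : realType} (W : normedModType R) (f g : R^o -> W) :
  differentiable f 0 -> differentiable g 0 -> f 0 = g 0 ->
  (forall k, f (2 ^+ k)^-1 = g (2 ^+ k)^-1) -> 'd f 0 1 = 'd g 0 1.
Proof.
move=> df dg fg0 fgk.
pose h := f - g.
have dh : differentiable h 0 by exact: differentiableB.
have h0 : h 0 = 0 by rewrite /h !fctE fg0 subrr.
have hk k : h (2 ^+ k)^-1 = 0 by rewrite /h !fctE fgk subrr.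
suff : 'd h 0 1 = 0 by rewrite (diffB df dg) /= => /eqP; rewrite subr_eq0 => /eqP.
have cd : continuous ('d h 0) by exact: diff_continuous.
have := (diff_epsP h 0 (linearP ('d h 0)) cd).2 (conj dh erefl) => H.
apply/eqP; rewrite -normr_le0; apply/ler_addgt0Pr => e e0; rewrite add0r.
have [r /= r0 rP] := (nbhs_ballP _ _).1 (H e e0).
have [k kr] : exists k, (2 ^+ k)^-1 < r :> R.
  have /cvgrPdist_lt /(_ r r0) [N _ NP] : (fun n => (2^-1 : R) ^+ n) @ \oo --> (0 : R).
    by apply: cvg_expr; rewrite ger0_norm ?invr_ge0 // invf_lt1 // ltr1n.
  exists N; have := NP N (leqnn N); rewrite sub0r normrN ger0_norm ?exprn_ge0 ?invr_ge0 //.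
  by rewrite exprVn.
have k0 : 0 < (2 ^+ k)^-1 :> R by rewrite invr_gt0 exprn_gt0.
have := rP ((2 ^+ k)^-1 : R^o).
rewrite -ball_normE /ball_ /= sub0r normrN ger0_norm ?(ltW k0) // => /(_ kr).
rewrite addr0 hk h0 subrr sub0r normrN.
rewrite -[X in 'd h 0 X]mulr1 -[_ * 1]/(_ *: (1 : R^o)) linearZ normrZ ger0_norm ?(ltW k0) //.
by rewrite mulrC ler_pM2r.
Qed.

(** * Bochner linearisation along a one-parameter subgroup *)

Section Linearise.
Context {R : realType} (H : topGroupType) (d : nat) (a : atlas H (Cn R d)).
Context (Z : topologicalType) (m : nat) (b : atlas Z (Cn R m)) (act : H -> Z -> Z).
Hypotheses (Hlie : is_complex_lie_group a) (b_complex : is_complex_manifold b)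
  (act_hol : is_holomorphic_action a b act).
Notation E := (Cn R m).
Notation vR := (@vec_atlas R R^o).
Notation vE := (@vec_atlas R (Cn R m)).

Let aH : IsAtlas a.
Proof. by apply: manifold_isAtlas; case: (lie_manifold Hlie). Qed.
Let bZ : IsAtlas b.
Proof. by apply: manifold_isAtlas; case: b_complex. Qed.
#[local] Existing Instance aH.
#[local] Existing Instance bZ.
Let hZ : hausdorff_space Z. Proof. by case: b_complex => -[]. Qed.

Variables (U : set H) (U_compact : compact U) (U_subgroup : subgroup U).
Variables (X : Cn R d) (c : R^o -> H) (hc : one_parameter_subgroup a X c).
Hypothesis cU : forall t, U (c t).
Variable z0 : Z.
Hypothesis cz0 : forall t, act (c t) z0 = z0.
Notation chi := (cfun (b z0)).
Notation psi := (cinv (b z0)).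
Notation e0 := (cfun (b z0) z0).

Let Q := [set u | U u /\ act u z0 = z0].
Let A (e : E) (u : H) : E := chi (act u (psi e)).
Let rho (u : H) (v : E) : E := tangent b b (act u) z0 v.

Let Qc t : Q (c t). Proof. by []. Qed.
Let Q1 : Q 1%g.
Proof. by split; [case: U_subgroup|exact: (action1 act_hol)]. Qed.
Let QM u w : Q u -> Q w -> Q (u * w)%g.
Proof.
move=> [Uu uz] [Uw wz]; split; first by case: U_subgroup => _ UM _; exact: UM.
by rewrite (actionM act_hol) wz uz.
Qed.
Let QV u : Q u -> Q u^-1%g.
Proof.
move=> [Uu uz]; split; first by case: U_subgroup => _ _; exact.
by rewrite -[in LHS]uz -(actionM act_hol) mulVg (action1 act_hol).
Qed.

Let Q_compact : compact Q.
Proof.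
apply: compact_closedI => //; apply: (@preimage_closed _ _ (act ^~ z0) [set z0]).
  by move=> u _; exact: smooth_at_cont (orbit_smooth Hlie b_complex act_hol u z0).1.
exact: accessible_closed_set1 (hausdorff_accessible hZ) _.
Qed.

Let d0 : cdom (b z0) z0. Proof. exact: atlas_dom. Qed.
Let i0 : cimg (b z0) e0. Proof. exact: cfun_img. Qed.
Let psi0 : psi e0 = z0. Proof. exact: cfunK. Qed.

Let joint e u : cimg (b z0) e -> smooth_at (prod_atlas vE a) b (fun p => act p.2 (psi p.1)) (e, u).
Proof.
move=> ie.
have [s1 _] := [elaborate smooth_at_fst vE a (e, u)].
have [s2 _] := [elaborate smooth_at_snd vE a (e, u)].
have s3 : smooth_at vE b psi (fst ((e, u) : E * H)) by exact: cinv_smooth.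
have [s4 _] := [elaborate smooth_at_comp s1 s3].
by have [] := [elaborate act_smooth Hlie b_complex act_hol s2 s4].
Qed.

Lemma linear_chart_domain : exists V : set E, [/\ open V, V e0, V `<=` cimg (b z0) &
  forall e u, V e -> Q u -> cdom (b z0) (act u (psi e))].
Proof.
have N : \forall e \near e0, forall u, Q u -> cdom (b z0) (act u (psi e)).
  apply: compact_tube => // u [Uu uz].
  have cj := smooth_at_cont (joint u i0).
  apply: (near_comp cj (y := z0) (P := fun z => cdom (b z0) z)); first by rewrite /= psi0.
  exact: cdom_near.
have Ni : \forall e \near e0, cimg (b z0) e by exact: cimg_near.
have [V [oV Ve0] HV] := near_open (filterI N Ni).
by exists V; split => // [e /HV []|e u /HV [] + _ Qu]; [|apply].
Qed.

Variables (V : set E) (oV : open V) (Ve0 : V e0) (Vi : V `<=` cimg (b z0))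
  (Vd : forall e u, V e -> Q u -> cdom (b z0) (act u (psi e))).

Let A_smooth e u : V e -> Q u -> smooth_at (prod_atlas vE a) vE (fun p => A p.1 p.2) (e, u).
Proof.
move=> Ve Qu; have s3 : smooth_at b vE chi (act u (psi e)) by apply: cfun_smooth; exact: Vd.
by have [] := [elaborate smooth_at_comp (joint u (Vi Ve)) s3].
Qed.

Let A_diff e u v : V e -> Q u -> smooth_near (A ^~ u) e /\
  'd (A ^~ u) e v = tangent b vE chi (act u (psi e)) (tangent b b (act u) (psi e) (tangent vE b psi e v)).
Proof.
move=> Ve Qu.
have [s1 s2] := [elaborate local_rep_smooth (Vi Ve) (Vd Ve Qu) (act_point_smooth Hlie b_complex act_hol u (psi e)).1].
by split.
Qed.

Let A_Q u : Q u -> A e0 u = e0.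
Proof. by move=> [_ uz]; rewrite /A psi0 uz. Qed.

Let rho_diff u v : Q u -> 'd (A ^~ u) e0 v = rho u v.
Proof. by move=> [_ uz]; rewrite /rho /tangent /in_charts uz. Qed.

Let rho_lin u : linear (rho u).
Proof. by move=> k v w; rewrite /rho /tangent linearP. Qed.

Let rho1 v : rho 1%g v = v.
Proof.
have E1 : act 1%g = id by apply/funext => z; exact: (action1 act_hol).
by rewrite /rho E1; exact: (smooth_at_id b z0).2.
Qed.

Let rhoM u w v : Q w -> rho (u * w)%g v = rho u (rho w v).
Proof.
move=> [_ wz]; rewrite /rho.
have E1 : act (u * w)%g = act u \o act w by apply/funext => z; exact: (actionM act_hol).
have [_ t] := [elaborate smooth_at_comp (act_point_smooth Hlie b_complex act_hol w z0).1
  (act_point_smooth Hlie b_complex act_hol u (act w z0)).1].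
by rewrite E1 t wz.
Qed.

Let rho_Ci u v : rho u (Ci v) = Ci (rho u v).
Proof. exact: (tangent_act_Ci Hlie b_complex act_hol). Qed.

Variables (n : nat) (bs : 'I_n -> E) (l : 'I_n -> E -> R^o).
Hypotheses (ll : forall j, linear (l j)) (lE : forall v, v = \sum_j l j v *: bs j).

Let comp_smooth j e u : V e -> Q u -> smooth_at (prod_atlas vE a) vR (fun p => l j (A p.1 p.2)) (e, u).
Proof.
move=> Ve Qu; have sl : smooth_at vE vR (l j) (A e u) by apply/smooth_at_vec; exact: smooth_near_linear.
by have [] := [elaborate smooth_at_comp (A_smooth Ve Qu) sl].
Qed.

Let l_A_diff j e u v : V e -> Q u ->
  'D_v (fun e => l j (A e u)) e = l j ('d (A ^~ u) e v).
Proof.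
move=> Ve Qu; have [/smooth_near_diff dA _] := A_diff v Ve Qu.
have cl : continuous (l j) by exact: findim_linear_continuous.
by rewrite -(deriveE v dA); exact: (derive_lin v (ll j) cl dA).
Qed.

(* Agrees with [rho] on [Q] and is smooth near [Q]. *)
Let rho' (u : H) (v : E) : E := \sum_j 'D_v (fun e => l j (A e u)) e0 *: bs j.

Let rho'E u v : Q u -> rho' u v = rho u v.
Proof.
move=> Qu; rewrite [RHS]lE /rho'; apply: eq_bigr => j _.
by rewrite (l_A_diff j v Ve0 Qu) (rho_diff v Qu).
Qed.

Let rho'_smooth i v u : Q u -> smooth_at a vR (fun u => l i (rho' u v)) u.
Proof.
move=> Qu.
have -> : (fun u => l i (rho' u v)) = fun u => \sum_j 'D_v (fun e => l j (A e u)) e0 * l i (bs j).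
  by apply/funext => w; rewrite /rho' linear_sumE.
apply: smooth_at_realS => j; apply: smooth_at_realM; last exact: smooth_at_cst.
have [_ s1] := [elaborate family_derive (Phi := fun e u => l j (A e u)) v (@comp_smooth j)].
have [s2 _] := [elaborate smooth_at_pair (smooth_at_cst a vE e0 u) (smooth_at_id a u).1].
by have [] := [elaborate smooth_at_comp s2 (s1 e0 u Ve0 Qu)].
Qed.

(** The integrand of the Bochner average: on [Q] it is rho(u)^-1 applied to the displacement of the
    moved point in the chart. The expansion in coordinates with rho' keeps it jointly smooth near
    [Q]. *)
Let Psi (e : E) (u : H) : E := \sum_k l k (A e u - e0) *: rho' u^-1%g (bs k).

Let PsiE e u : Q u -> Psi e u = rho u^-1%g (A e u - e0).
Proof.
move=> Qu; rewrite [in RHS](lE (A e u - e0)) (linear_sumE (rho_lin _)).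
by apply: eq_bigr => k _; rewrite rho'E //; exact: QV.
Qed.

Let Psi_smooth j e u : V e -> Q u -> smooth_at (prod_atlas vE a) vR (fun p => l j (Psi p.1 p.2)) (e, u).
Proof.
move=> Ve Qu.
have -> : (fun p : E * H => l j (Psi p.1 p.2)) =
    fun p => \sum_k (l k (A p.1 p.2) - l k e0) * l j (rho' p.2^-1%g (bs k)).
  apply/funext => p; rewrite /Psi (linear_sumE (ll j)); apply: eq_bigr => k _.
  by rewrite (lin_sub (ll k)).
apply: smooth_at_realS => k; apply: smooth_at_realM.
  have [c1 s1] := comp_smooth k Ve Qu; split; first by apply: cvgB => //; exact: cvg_cst.
  have := smooth_near_add s1 (smooth_near_cst (- l k e0 : R^o) _).
  exact.
have [s2 _] := [elaborate smooth_at_snd vE a (e, u)].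
have s3 := [elaborate smooth_inv Hlie s2].
by have [] := [elaborate smooth_at_comp s3 (rho'_smooth j (bs k) (QV Qu))].
Qed.

Variable D : (R -> R) -> R.
Hypotheses (D_lin : forall c (f g : R -> R) A B, (forall t, `|f t| <= A) ->
    (forall t, `|g t| <= B) -> D (fun t => c * f t + g t) = c * D f + D g)
  (D_bound : forall (f : R -> R) A, (forall t, `|f t| <= A) -> `|D f| <= A)
  (D_cst : forall c, D (fun=> c) = c)
  (D_shift : forall (f : R -> R) A m, (forall t, `|f t| <= A) ->
    D (fun t => f (t + (2 ^+ m)^-1)) = D f).

(** The mean runs along the one-parameter subgroup, the only one for which equivariance is wanted;
    the compact group [Q] containing it provides the bounds. *)
Let I (f : H -> R^o) : R^o := D (fun t => f (c t)).

Let Q_bounded (f : H -> R^o) : (forall u, Q u -> {for u, continuous f}) ->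
  exists C, forall t, `|f (c t)| <= C.
Proof.
move=> cf; pose nf u : R^o := `|f u|.
have cnf u : Q u -> {for u, continuous nf}.
  by move=> Qu; apply: (@continuous_comp _ _ _ f (fun x : R^o => `|x| : R^o)); [exact: cf|exact: norm_continuous].
have [u0 _ h] := [elaborate cont_EVT_max (ex_intro _ 1%g Q1) Q_compact cnf].
by exists (`|f u0|) => t; exact: (h (c t)).
Qed.

Let I_mean : mean_functional Q I.
Proof.
split=> [k f g cf cg|f C cf fC].
  have [C1 h1] := Q_bounded cf; have [C2 h2] := Q_bounded cg.
  exact: (D_lin k h1 h2).
by apply: D_bound => t; exact: fC.
Qed.

Let That (e : E) : E := \sum_j I (fun u => l j (Psi e u)) *: bs j.

Let That_Cinfty : Cinfty V That.
Proof.
move=> k; apply: Ck_sum => // j; apply: Ck_scale => //; last exact: Ck_cst.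
have := [elaborate mean_Cinfty Q_compact I_mean oV (Phi := fun e u => l j (Psi e u)) (@Psi_smooth j)].
exact.
Qed.

Let J (e v : E) (u : H) : E := rho u^-1%g ('d (A ^~ u) e v).
Let IV (F : H -> E) : E := \sum_j I (fun u => l j (F u)) *: bs j.

Let I_ext (f g : H -> R^o) : (forall t, f (c t) = g (c t)) -> I f = I g.
Proof. by move=> fg; congr D; apply/funext => t; exact: fg. Qed.

Let Psi_derive j e v u : V e -> Q u -> 'D_v (fun e => l j (Psi e u)) e = l j (J e v u).
Proof.
move=> Ve Qu; have [/smooth_near_diff dA _] := A_diff v Ve Qu.
have lr : linear (l j \o rho u^-1%g) by exact: lin_comp.
have cr : continuous (l j \o rho u^-1%g) by exact: findim_linear_continuous.
have E1 : (fun e => l j (Psi e u)) = (fun e => (l j \o rho u^-1%g) (A e u - e0)).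
  by apply/funext => x; rewrite /= PsiE.
by rewrite E1; exact: (derive_affine e0 v lr cr dA).
Qed.

Let That_diff e v : V e -> 'd That e v = IV (J e v).
Proof.
move=> Ve.
have D1 j := [elaborate mean_diff Q_compact I_mean oV (Phi := fun e u => l j (Psi e u)) (@Psi_smooth j) Ve].
have dT : differentiable That e by exact: Cinfty_diff That_Cinfty Ve.
rewrite -(deriveE v dT) /That derive_sumE; last first.
  move=> j; have [dj _] := D1 j; have db : differentiable (fun _ : E => bs j) e by [].
  by have [] := diff_scale v dj db.
apply: eq_bigr => j _; have [dj Ej] := D1 j.
have db : differentiable (fun _ : E => bs j) e by [].
have [_ ->] := diff_scale v dj db; rewrite derive_cst scaler0 addr0 (deriveE v dj) Ej.
by congr (_ *: _); apply: I_ext => t; exact: Psi_derive.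
Qed.

Let bounded_of_comp (F : H -> E) : (forall j, exists C, forall t, `|l j (F (c t))| <= C) ->
  exists C, forall t, `|F (c t)| <= C.
Proof.
move=> /choice [C CP]; exists (\sum_j C j * `|bs j|) => t.
rewrite (lE (F _)); apply: le_trans (ler_norm_sum _ _ _) _.
by apply: ler_sum => j _; rewrite normrZ ler_wpM2r.
Qed.

Let J_bounded e v : V e -> exists C, forall t, `|J e v (c t)| <= C.
Proof.
move=> Ve; apply: bounded_of_comp => j.
have [_ s1] := [elaborate family_derive (Phi := fun e u => l j (Psi e u)) v (@Psi_smooth j)].
have cJ u : Q u -> {for u, continuous (fun u => 'D_v (fun e => l j (Psi e u)) e)}.
  by move=> Qu; exact: (family_cont (Phi := fun e u => 'D_v (fun e => l j (Psi e u)) e) s1 Ve Qu).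
have [C CP] := Q_bounded cJ; exists C => t.
by have := CP t; rewrite Psi_derive.
Qed.

Let Psi_bounded e : V e -> exists C, forall t, `|Psi e (c t)| <= C.
Proof.
move=> Ve; apply: bounded_of_comp => j.
apply: (Q_bounded (f := fun u => l j (Psi e u))) => u Qu.
exact: (family_cont (Phi := fun e u => l j (Psi e u)) (@Psi_smooth j) Ve Qu).
Qed.

Let linear_bounded (W : normedModType R) (K : E -> W) (F : R^o -> E) : linear K ->
  (exists C, forall t, `|F t| <= C) -> exists C, forall t, `|K (F t)| <= C.
Proof.
move=> lK [C FC]; have [k k0 kP] := linear_bound lK; exists (k * C) => t.
by apply: le_trans (kP _) _; rewrite ler_pM2l.
Qed.

Let D_sum p (r : 'I_p -> R) (f : 'I_p -> R -> R) : (forall j, exists C, forall t, `|f j t| <= C) ->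
  D (fun t => \sum_j r j * f j t) = \sum_j r j * D (f j).
Proof.
elim: p r f => [|p IH] r f bf.
  by rewrite big_ord0 -[RHS](D_cst 0); congr D; apply/funext => t; rewrite big_ord0.
have [C1 h1] := bf ord0.
have [C2 h2] : exists C, forall t, `|\sum_(j < p) r (lift ord0 j) * f (lift ord0 j) t| <= C.
  have [C CP] := choice (fun j => bf (lift ord0 j)).
  exists (\sum_j `|r (lift ord0 j)| * C j) => t; apply: le_trans (ler_norm_sum _ _ _) _.
  by apply: ler_sum => j _; rewrite normrM ler_wpM2l.
rewrite big_ord_recl -IH; last by move=> j; exact: bf.
by rewrite -(D_lin (r ord0) h1 h2); congr D; apply/funext => t; rewrite big_ord_recl.
Qed.

Let IV_lin (K : E -> E) (F : H -> E) : linear K -> (exists C, forall t, `|F (c t)| <= C) ->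
  IV (K \o F) = K (IV F).
Proof.
move=> lK bF.
have E1 i : I (fun u => l i (K (F u))) = \sum_j l i (K (bs j)) * I (fun u => l j (F u)).
  rewrite -D_sum; last by move=> j; exact: (@linear_bounded _ (l j) (fun t => F (c t))).
  rewrite /I; congr D; apply/funext => t; rewrite [in LHS](lE (F (c t))) (linear_sumE lK) (linear_sumE (ll i)).
  by apply: eq_bigr => j _; rewrite mulrC.
rewrite /IV (linear_sumE lK); under eq_bigr do rewrite E1 scaler_suml.
rewrite exchange_big; apply: eq_bigr => j _ /=.
rewrite [in RHS](lE (K (bs j))) scaler_sumr; apply: eq_bigr => i _.
by rewrite scalerA mulrC.
Qed.

Let IV_cst v : IV (fun=> v) = v.
Proof. by rewrite [RHS]lE; apply: eq_bigr => j _; rewrite /I D_cst. Qed.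

Let IV_ext F G : (forall t, F (c t) = G (c t)) -> IV F = IV G.
Proof. by move=> FG; apply: eq_bigr => j _; congr (_ *: _); apply: I_ext => t; rewrite FG. Qed.

Let That0 : That e0 = 0.
Proof.
rewrite -[RHS]IV_cst -[LHS]/(IV (Psi e0)); apply: IV_ext => t.
by rewrite PsiE // A_Q // subrr (lin_zero (rho_lin _)).
Qed.

Let That_diff0 v : 'd That e0 v = v.
Proof.
rewrite That_diff // -[RHS]IV_cst; apply: IV_ext => t.
by rewrite /J rho_diff // -rhoM // mulVg rho1.
Qed.

Let That_diff_Ci e v : V e -> 'd That e (Ci v) = Ci ('d That e v).
Proof.
move=> Ve; rewrite !That_diff //.
rewrite -(IV_lin (@Ci_linear R m) (J_bounded v Ve)); apply: IV_ext => t /=.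
rewrite /J (A_diff _ Ve (Qc t)).2 (A_diff _ Ve (Qc t)).2.
rewrite (chart_inv_Ci b_complex _ (Vi Ve)) (tangent_act_Ci Hlie b_complex act_hol).
by rewrite (chart_Ci b_complex _ (Vd Ve (Qc t))) rho_Ci.
Qed.

Let A_comp e u w : V e -> Q w -> A (A e w) u = A e (u * w)%g.
Proof. by move=> Ve Qw; rewrite /A cfunK ?(actionM act_hol) //; exact: Vd. Qed.

(** Translation of the averaging variable by s = 2^-k moves rho(c s) out of the integrand;
    invariance of the mean holds for such s. *)
Let That_equivariant e k : V e ->
  That (A e (c (2 ^+ k)^-1)) = rho (c (2 ^+ k)^-1) (That e).
Proof.
move=> Ve; set s := (2 ^+ k)^-1.
have [cD _ _] := hc.
have E1 t : Psi (A e (c s)) (c t) = rho (c s) (Psi e (c (t + s))).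
  have Eg : ((c t)^-1 = c s * (c t * c s)^-1)%g by rewrite invgM mulgA mulgV mul1g.
  rewrite (PsiE _ (Qc t)) (PsiE _ (Qc (t + s))) (A_comp (c t) Ve (Qc s)) cD {1}Eg.
  by rewrite rhoM //; apply: QV; exact: QM.
rewrite -[That e]/(IV (Psi e)) -(IV_lin (rho_lin (c s)) (Psi_bounded Ve)).
apply: eq_bigr => j _; congr (_ *: _); rewrite /I.
have [C CP] := @linear_bounded _ (l j \o rho (c s)) (fun t => Psi e (c t)) (lin_comp (rho_lin _) (ll j)) (Psi_bounded Ve).
rewrite -[RHS](@D_shift (fun t => (l j \o rho (c s)) (Psi e (c t))) C k CP).
by congr D; apply/funext => t; rewrite E1.
Qed.

Let rho_curve w : smooth_near (fun s : R^o => rho (c s) w) 0.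
Proof.
have -> : (fun s : R^o => rho (c s) w) = fun s => \sum_i l i (rho' (c s) w) *: bs i.
  by apply/funext => s; rewrite rho'E // -lE.
apply: smooth_near_sum => i; apply: smooth_near_scale; last exact: smooth_near_cst.
have [_ sc _] := hc.
by have [/smooth_at_vec] := [elaborate smooth_at_comp (sc 0) (rho'_smooth i w (Qc 0))].
Qed.

Let Lam (w : E) : E := 'd (fun s : R^o => rho (c s) w) 0 1.

Let Lam_lin : linear Lam.
Proof.
move=> k v w; rewrite /Lam.
have dv := smooth_near_diff (rho_curve v); have dw := smooth_near_diff (rho_curve w).
have -> : (fun s : R^o => rho (c s) (k *: v + w)) = fun s => k *: rho (c s) v + rho (c s) w.
  by apply/funext => s; rewrite rho_lin.
exact: diff_lincomb.
Qed.

Let Lam_Ci w : Lam (Ci w) = Ci (Lam w).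
Proof.
have dw := smooth_near_diff (rho_curve w).
rewrite /Lam (_ : (fun s : R^o => rho (c s) (Ci w)) = Ci \o (fun s : R^o => rho (c s) w)); last first.
  by apply/funext => s; exact: rho_Ci.
exact: (diff_linE (1 : R^o) (@Ci_linear R m) (findim_linear_continuous (@Ci_linear R m)) dw).
Qed.

Let orbit_curve e : V e -> smooth_near (fun s : R^o => A e (c s)) 0 /\
  'd (fun s : R^o => A e (c s)) 0 1 =
    tangent b vE chi (psi e) (fundamental_field a b act X (psi e)).
Proof.
move=> Ve; have [_ sc _] := hc.
have c0 : act (c 0) (psi e) = psi e by rewrite (one_ps0 hc) (action1 act_hol).
have s1 := flow_smooth Hlie b_complex act_hol (psi e) 0 hc.
have s2 : smooth_at b vE chi (act (c 0) (psi e)) by apply: cfun_smooth; rewrite c0; apply: cinv_dom; exact: Vi.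
have [/smooth_at_vec s3 t3] := [elaborate smooth_at_comp s1 s2].
split => //; rewrite -tangent_vec.
have := t3 1; rewrite (flow_velocity Hlie b_complex act_hol (psi e) 0 hc) c0 => <-.
by [].
Qed.

(** The derivative at s = 0 of the equivariance, which is known at s = 2^-k and trivially at s = 0;
    [dyadic_diff] closes the gap. *)
Let That_field e : V e ->
  'd That e (tangent b vE chi (psi e) (fundamental_field a b act X (psi e))) = Lam (That e).
Proof.
move=> Ve; have [so <-] := orbit_curve Ve.
have dso := smooth_near_diff so.
have A0 : A e (c 0) = e by rewrite /A (one_ps0 hc) (action1 act_hol) cinvK //; exact: Vi.
have dT : differentiable That (A e (c 0)) by rewrite A0; exact: Cinfty_diff That_Cinfty Ve.
rewrite A0 in dT.
rewrite -(diff_compE (1 : R^o) dso dT A0).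
apply: dyadic_diff => //=.
- by apply: differentiable_comp => //; rewrite A0.
- exact: smooth_near_diff (rho_curve _).
- by rewrite A0 (one_ps0 hc) rho1.
- by move=> k; exact: That_equivariant.
Qed.

Let Lam_skew (g : E -> E -> R) : bilinear_form g ->
  (forall u v w, Q u -> g (rho u v) (rho u w) = g v w) ->
  forall v w, g (Lam v) w = - g v (Lam w).
Proof.
move=> gb gQ v w.
have lgr := bil_linl w gb; have lgl := bil_linr v gb.
have dv := smooth_near_diff (rho_curve v); have dw := smooth_near_diff (rho_curve w).
have cl : continuous (fun v => g v w : R^o) by exact: findim_linear_continuous.
have cr : continuous (fun w => g v w : R^o) by exact: findim_linear_continuous.
(* Invariance of g moves c(s) to the other side as c(-s); differentiating at 0 gives skewness. *)
have E5 : (fun s : R^o => g (rho (c s) v) w : R^o) = (fun s : R^o => g v (rho (c (- s)) w) : R^o).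
  apply/funext => s; rewrite -(gQ (c (- s)) _ w) // -rhoM // (one_ps_opp _ hc) mulVg rho1.
  by [].
have dwo : differentiable (fun s : R^o => rho (c (- s)) w) 0 by exact: (diff_oppE 1 dw).1.
have Eo : 'd (fun s : R^o => rho (c (- s)) w) 0 1 = - Lam w by exact: (diff_oppE 1 dw).2.
have Ev : 'd (fun s : R^o => g (rho (c s) v) w : R^o) 0 1 = g (Lam v) w.
  exact: (diff_linE (1 : R^o) lgr cl dv).
have Ew : 'd (fun s : R^o => g v (rho (c (- s)) w) : R^o) 0 1 = g v (- Lam w).
  by rewrite -Eo; exact: (diff_linE (1 : R^o) lgl cr dwo).
by rewrite -Ev E5 Ew; exact: (lin_opp lgl).
Qed.

Lemma linearisation_on (g : E -> E -> R) : bilinear_form g ->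
  (forall u v w, Q u -> g (rho u v) (rho u w) = g v w) ->
  exists T Lam', [/\ smooth_near T e0, T e0 = 0, forall v, 'd T e0 v = v & linear Lam'] /\
    [/\ forall v w, g (Lam' v) w = - g v (Lam' w), forall v, Lam' (Ci v) = Ci (Lam' v),
      \forall e \near e0, forall v, 'd T e (Ci v) = Ci ('d T e v) &
      \forall e \near e0, 'd T e (tangent b vE chi (psi e)
        (fundamental_field a b act X (psi e))) = Lam' (T e)].
Proof.
move=> gb gQ; exists That, Lam; split; split => //.
- by exists V.
- exact: Lam_skew.
- by apply: (open_near oV Ve0) => e Ve v; exact: That_diff_Ci.
- by apply: (open_near oV Ve0) => e Ve; exact: That_field.
Qed.

End Linearise.

Section LinearisationTheorem.
Context {R : realType} (H : topGroupType) (d : nat) (a : atlas H (Cn R d)).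
Context (Z : topologicalType) (m : nat) (b : atlas Z (Cn R m)) (act : H -> Z -> Z).
Hypotheses (Hlie : is_complex_lie_group a) (b_complex : is_complex_manifold b)
  (act_hol : is_holomorphic_action a b act).
Variables (U : set H) (U_compact : compact U) (U_subgroup : subgroup U).
Notation vE := (@vec_atlas R (Cn R m)).

(* Bochner linearisation: average the chart over the isotropy group of z0 in U. *)
Theorem linearisation (X : Cn R d) (c : R^o -> H) z0 (g : Cn R m -> Cn R m -> R) :
  one_parameter_subgroup a X c -> (forall t, U (c t)) -> (forall t, act (c t) z0 = z0) ->
  bilinear_form g ->
  (forall u v w, U u -> act u z0 = z0 ->
     g (tangent b b (act u) z0 v) (tangent b b (act u) z0 w) = g v w) ->
  exists T Lam, [/\ smooth_near T (cfun (b z0) z0), T (cfun (b z0) z0) = 0,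
      forall v, 'd T (cfun (b z0) z0) v = v & linear Lam] /\
    [/\ forall v w, g (Lam v) w = - g v (Lam w), forall v, Lam (Ci v) = Ci (Lam v),
      \forall e \near cfun (b z0) z0, forall v, 'd T e (Ci v) = Ci ('d T e v) &
      \forall e \near cfun (b z0) z0, 'd T e (tangent b vE (cfun (b z0)) (cinv (b z0) e)
        (fundamental_field a b act X (cinv (b z0) e))) = Lam (T e)].
Proof.
move=> hc cU cz0 gb gU.
have [V [oV Ve0 Vi Vd]] := linear_chart_domain Hlie b_complex act_hol U_compact z0.
have [n [bs [l [ll _ lE]]]] : FinDim (Cn R m : normedModType R) by exact: FinDim_prod.
have [D [D1 D2 D3 D4]] := dyadic_mean R.
have D4' (f : R -> R) A k : (forall t, `|f t| <= A) -> D (fun t => f (t + (2 ^+ k)^-1)) = D f.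
  exact: D4.
apply: (linearisation_on Hlie b_complex act_hol U_compact U_subgroup hc cU cz0 oV Ve0 Vi Vd ll lE
  D1 D2 D3 D4' gb) => u v w [Uu uz].
exact: gU.
Qed.

End LinearisationTheorem.

(** * Subspaces, orthogonal projections and convex hulls *)

Section Subspaces.
Context {R : realType} (V : normedModType R) {fV : FinDim V} (W : set V).
Hypothesis W_sub : subspace_set W.

(** A matrix of maximal rank with rows in the coordinate image of [W] spans that image; its row base
    provides independent coordinates, which [FinDim] does not. *)
Lemma subspace_param : exists r (iota : 'rV[R]_r -> V) (q : V -> 'rV[R]_r),
  [/\ linear iota, linear q, cancel iota q, forall u, W (iota u) & forall w, W w -> iota (q w) = w].
Proof.
have [N [tov [ofv [tovl ofvl ofvK]]]] := [elaborate findim_coords (V := V)].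
have [W0 WP] := W_sub.
pose W' := [set u : 'rV[R]_N | exists2 w, W w & u = ofv w].
have W'0 : W' 0 by exists 0 => //; rewrite (lin_zero ofvl).
have W'P k u v : W' u -> W' v -> W' (k *: u + v).
  by move=> [w Ww ->] [x Wx ->]; exists (k *: w + x); [exact: WP|rewrite ofvl].
have W'K u : W' u -> ofv (tov u) = u by move=> [w _ ->]; rewrite ofvK.
have W'W u : W' u -> W (tov u) by move=> [w Ww ->]; rewrite ofvK.
have W'sum n (D : 'rV[R]_n) (A : 'M[R]_(n, N)) : (forall i, W' (row i A)) -> W' (D *m A).
  move=> WA; rewrite mulmx_sum_row; elim/big_ind: _ => //.
    by move=> u v Wu Wv; rewrite -[u]scale1r; exact: W'P.
  by move=> i _; rewrite -[_ *: _]addr0; exact: W'P.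
pose P k := `[< exists2 A : 'M[R]_N, \rank A = k & forall i, W' (row i A) >].
have exP : exists k, P k.
  by exists 0%N; apply/asboolP; exists 0; [exact: mxrank0|move=> i; rewrite row0].
have bP k : P k -> (k <= N)%N by move=> /asboolP [A <- _]; exact: rank_leq_row.
have [k /asboolP [A rA WA] kmax] := ex_maxnP exP bP.
have subA w : W w -> (ofv w <= A)%MS.
  move=> Ww; set u := ofv w.
  have W'u : W' u by exists w.
  have uA : (A + u <= A)%MS.
    rewrite -(geq_leqif (mxrank_leqif_sup (addsmxSl A u))) rA; apply: kmax.
    apply/asboolP; exists (A + u)%MS => // i.
    have /sub_addsmxP [[D1 D2] /= ->] := row_sub i (A + u)%MS.
    have h1 : W' (D1 *m A) by exact: W'sum.
    have h2 : W' (D2 *m u) by apply: W'sum => j; rewrite (_ : row j u = u) // [j]ord1 row_id.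
    by rewrite -[D1 *m A]scale1r; exact: W'P.
  exact: submx_trans (addsmxSr A u) uA.
pose RB := row_base A.
have WRB u : W' (u *m RB).
  have /submxP [D ->] : (u *m RB <= A)%MS by rewrite (submx_trans (submxMl u RB)) // eq_row_base.
  exact: W'sum.
exists (\rank A), (fun u => tov (u *m RB)), (fun v => ofv v *m pinvmx RB); split.
- by move=> x u v; rewrite mulmxDl -scalemxAl tovl.
- by move=> x u v; rewrite ofvl mulmxDl -scalemxAl.
- by move=> u; rewrite W'K // -mulmxA mulmxVp ?mulmx1 // row_base_free.
- by move=> u; exact: W'W.
- by move=> w Ww; rewrite mulmxKpV ?ofvK // eq_row_base subA.
Qed.

Variable s : V -> V -> R.
Hypotheses (s_bil : bilinear_form s) (s_pos : forall w, W w -> w <> 0 -> 0 < s w w).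

(** The projection solves the Gram system of [s] in coordinates of [W]; positivity on [W] makes the
    Gram operator injective, hence invertible. *)
Lemma orth_projection : exists P : V -> V, linear P /\
  forall X, W (P X) /\ forall T, W T -> s (X - P X) T = 0.
Proof.
have [r [iota [q [il ql iotaK iW Wi]]]] := subspace_param.
pose L (u : 'rV[R]_r) : 'rV[R]_r := \row_j s (iota u) (iota (delta_mx 0 j)).
have lL : linear L.
  move=> k u v; apply/rowP => j; rewrite !mxE il.
  by rewrite (bilDl _ _ _ s_bil) (bilZl _ _ _ s_bil).
have iE t : iota t = \sum_j t 0 j *: iota (delta_mx 0 j).
  by rewrite {1}(row_sum_delta t) linear_sumE.
have L0 u : L u = 0 -> u = 0.
  move=> Lu; apply: contrapT => u0.
  have iu0 : iota u <> 0.
    by move=> iu; apply: u0; rewrite -[u]iotaK iu (lin_zero ql).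
  have := s_pos (iW u) iu0; rewrite {2}(iE u) (bil_sumr (fun j => u 0 j) _ _ s_bil) big1 ?ltxx //.
  move=> j _; have := congr1 (fun v : 'rV[R]_r => v 0 j) Lu.
  by rewrite !mxE => ->; rewrite mulr0.
have [L' [lL' LK L'K]] := [elaborate lin_inverse lL L0].
pose rhs X : 'rV[R]_r := \row_j s X (iota (delta_mx 0 j)).
have lr : linear rhs.
  move=> k u v; apply/rowP => j; rewrite !mxE.
  by rewrite (bilDl _ _ _ s_bil) (bilZl _ _ _ s_bil).
exists (fun X => iota (L' (rhs X))); split.
  exact: lin_comp lr (lin_comp lL' il).
move=> X; split => // T /Wi <-; set t := q T.
rewrite (iE t) (bil_sumr (fun j => t 0 j) _ _ s_bil) big1 // => j _.
rewrite (bilBl _ _ _ s_bil).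
have := congr1 (fun v : 'rV[R]_r => v 0 j) (L'K (rhs X)).
by rewrite !mxE => ->; rewrite subrr mulr0.
Qed.

Lemma orth_projE (P : V -> V) X : (W (P X) /\ forall T, W T -> s (X - P X) T = 0) ->
  xget 0 [set Y | W Y /\ forall T, W T -> s (X - Y) T = 0] = P X.
Proof.
move=> [WPX HPX]; case: xgetP => [Y _ [WY HY]|/(_ (P X)) h]; last by case: h.
have [_ WP] := W_sub.
apply: contrapT => ne.
have Wd : W (P X - Y) by rewrite addrC -scaleN1r; exact: WP.
have d0 : P X - Y <> 0 by move=> /eqP; rewrite subr_eq0 => /eqP e; apply: ne.
have := s_pos Wd d0.
have -> : s (P X - Y) (P X - Y) = s (X - Y) (P X - Y) - s (X - P X) (P X - Y).
  by rewrite -(bilBl _ _ _ s_bil); congr (s _ _); module.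
by rewrite HY // HPX // subrr ltxx.
Qed.

End Subspaces.

Lemma zero_tangent_constant {R : realType} (X : topologicalType) (E : normedModType R)
  (a : atlas X E) {aX : IsAtlas a} {fE : FinDim E} (f : X -> R^o) :
  connected [set: X] -> (forall x, smooth_at a (@vec_atlas R R^o) f x) ->
  (forall x v, tangent a (@vec_atlas R R^o) f x v = 0) -> forall x y, f x = f y.
Proof.
move=> conX sf tf x y.
have E1 : [set z | f z = f y] = [set: X].
  apply: conX; first by exists y.
  - exists [set z | f z = f y]; last by rewrite setTI.
    rewrite openE => z /= fz.
    have iz : cimg (a z) (cfun (a z) z) by apply: cfun_img; exact: atlas_dom.
    have [e /= e0 He] := (nbhs_ballP _ _).1 (cimg_near iz).
    have loc w : `|w - cfun (a z) z| < e -> differentiable (f \o cinv (a z)) w /\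
        forall v, 'd (f \o cinv (a z)) w v = 0.
      move=> we; have iw : cimg (a z) w by apply: He; rewrite -ball_normE /ball_ /= distrC.
      have [s1 d1] := @local_rep_smooth R _ _ _ _ a (@vec_atlas R R^o) _ _ _ _ f z 0 w iw I (sf _).
      split; first exact: smooth_near_diff s1.
      by move=> v; have := d1 v; rewrite tf => ->; rewrite /tangent linear0.
    have N1 : \forall w \near z, `|cfun (a z) w - cfun (a z) z| < e.
      have /cvgrPdist_lt /(_ e e0) := [elaborate cfun_cont (atlas_dom z)].
      by apply: filterS => w; rewrite distrC.
    apply: filterS2 N1 (cdom_near (atlas_dom z)) => w we dw.
    have seg (t : R) : 0 <= t <= 1 -> `|cfun (a z) z + t *: (cfun (a z) w - cfun (a z) z) - cfun (a z) z| < e.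
      by apply: segment_in_ball => //; rewrite subrr normr0.
    have [t t01] := mean_value_segment (fun t t01 => (loc _ (seg t t01)).1).
    rewrite (loc _ (seg t t01)).2 [_ + (_ - _)]addrC subrK /= (cfunK dw) (cfunK (atlas_dom z)).
    by move=> /eqP; rewrite subr_eq0 => /eqP ->.
  - exists [set z | f z = f y]; last by rewrite setTI.
    apply: (@preimage_closed _ _ f [set f y]); last exact: closed_eq.
    by move=> z _; exact: smooth_at_cont (sf z).
by have : [set: X] x by []; rewrite -E1.
Qed.

Section ConvexHulls.
Context {R : realType} (V : normedModType R) (A : set V).

Lemma convex_hull_le (f : V -> R^o) c : linear f -> (forall x, A x -> f x <= c) ->
  forall y, convex_hull A y -> f y <= c.
Proof.
move=> lf fA y /(_ [set y | f y <= c]); apply => //.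
move=> u v t; rewrite !inE /= => fu fv.
have -> : f (conv t u v) = t%:num * f u + (1 - t%:num) * f v.
  by rewrite (lin_add lf) !(lin_scale lf).
have [t0 t1] : 0 <= t%:num /\ t%:num <= 1 by [].
nra.
Qed.

Lemma sub_convex_hull : A `<=` convex_hull A.
Proof. by move=> x Ax C _; apply. Qed.

Lemma convex_hull_convex x y (t : R) : convex_hull A x -> convex_hull A y ->
  0 <= t <= 1 -> convex_hull A (t *: x + (1 - t) *: y).
Proof.
move=> hx hy /andP [t0 t1] C cC AC.
have := cC x y (Itv01 t0 t1); rewrite !inE => /(_ (hx C cC AC) (hy C cC AC)).
exact.
Qed.

End ConvexHulls.

(** * The gradient map *)

Section GradientMap.
Context {R : realType} (Z : ptopologicalType) (m : nat) (aZ : atlas Z (Cn R m))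
  (omega : Z -> Cn R m -> Cn R m -> R).
Hypotheses (Z_connected : connected [set: Z]) (Z_kaehler : is_kaehler aZ omega).
Context (H : topGroupType) (d : nat) (a : atlas H (Cn R d)) (U : set H).
Hypotheses (Hlie : is_complex_lie_group a) (U_subgroup : subgroup U)
  (U_cartan : cartan_decomposition a U).
Variable act : H -> Z -> Z.
Hypothesis act_hol : is_holomorphic_action a aZ act.
Variables (s : Cn R d -> Cn R d -> R) (mu : Z -> Cn R d).
Hypotheses (s_product : is_invariant_product a U s)
  (mu_momentum : is_momentum_map a aZ act omega U s mu).
Variable G : set H.
Hypothesis G_compatible : is_compatible a U G.
Let K := G `&` U.
Let p := gp_p a U G.
Let mup := gradient_mu s p mu.
Let ip := Ci @` p.
Let aH : IsAtlas a. Proof. by have [[? _] _ _] := Hlie; exact: manifold_isAtlas. Qed.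
Let bZ : IsAtlas aZ.
Proof. by have [[? _] _ _ _ _ _ _] := Z_kaehler; exact: manifold_isAtlas. Qed.
Existing Instances aH bZ.
Local Notation vR := (@vec_atlas R R^o).
Local Notation vH := (@vec_atlas R (Cn R d)).

Lemma lie_algP X : lie_alg a U X <-> (Ci @` lie_alg a U) (Ci X).
Proof.
split=> [UX|[Y UY CY]]; first by exists X.
suff <- : Y = X by [].
by apply: oppr_inj; rewrite -!CiCi CY.
Qed.

Lemma lie_alg_U_subspace : subspace_set (lie_alg a U).
Proof.
have [i0 iP] := iu_subspace Hlie U_subgroup U_cartan; split; first exact: lie_alg0.
move=> c x y /lie_algP ux /lie_algP uy; apply/lie_algP.
by rewrite (@Ci_linear R d); exact: iP.
Qed.

Lemma p_sub_iu X : p X -> (Ci @` lie_alg a U) X. Proof. by move=> []. Qed.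

Lemma ip_lie_alg X : ip X -> lie_alg a U X.
Proof.
move=> [Y pY <-]; have [W UW <-] := p_sub_iu pY.
by rewrite CiCi -scaleN1r; exact: lie_alg_scale.
Qed.

Lemma ip_subspace : subspace_set ip.
Proof.
have [p_0 pP] := p_subspace Hlie U_subgroup U_cartan G_compatible.
split; first by exists 0 => //; rewrite Ci0.
move=> c _ _ [x px <-] [y py <-]; exists (c *: x + y); first exact: pP.
by rewrite (@Ci_linear R d).
Qed.

Lemma s_pos X : ip X -> X <> 0 -> 0 < s X X.
Proof. by move=> /ip_lie_alg uX; exact: (product_positive s_product). Qed.

Lemma gradient_muE : exists P : Cn R d -> Cn R d, [/\ linear P, forall X, ip (P X),
  forall X T, ip T -> s (X - P X) T = 0 & forall z, mup z = - Ci (P (mu z))].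
Proof.
have [P [lP PP]] := orth_projection (V := (Cn R d : normedModType R)) ip_subspace (product_bilinear s_product) s_pos.
exists P; split=> //; [by move=> X; have [] := PP X|by move=> X; have [_] := PP X|move=> z].
by rewrite /mup /gradient_mu /orth_proj (orth_projE ip_subspace (product_bilinear s_product) s_pos (PP (mu z))).
Qed.

Lemma gradient_mu_in z : p (mup z).
Proof.
have [P [_ iP _ ->]] := gradient_muE; have [X pX <-] := iP (mu z).
by rewrite CiCi opprK.
Qed.

Lemma gradient_mu_smooth z : smooth_at aZ vH mup z.
Proof.
have [P [lP _ _ mE]] := gradient_muE.
have sL : smooth_at vH vH (fun X => - Ci (P X)) (mu z).
  apply/smooth_at_vec; apply: smooth_near_linear.
  exact: lin_oppf (lin_comp lP (@Ci_linear R d)).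
have [s1 _] := smooth_at_comp (momentum_smooth mu_momentum z) sL.
by apply: smooth_at_ext s1; near=> y; rewrite /= mE.
Unshelve. all: end_near.
Qed.

Lemma gradient_mu_equivariant k z : K k -> mup (act k z) = Ad a k (mup z).
Proof.
move=> [Gk Uk]; have [P [lP iP oP _]] := gradient_muE.
have sB := product_bilinear s_product.
have Adlin h := Ad_linear a h.
have kV : K (k^-1)%g by have [_ _ V] := K_subgroup U_subgroup G_compatible; exact: V.
have ipAd h X : K h -> ip X -> ip (Ad a h X).
  move=> Kh [Y pY <-]; exists (Ad a h Y); first exact: (p_Ad G_compatible).
  by rewrite Ad_Ci.
have e1 : forall z, orth_proj s ip (mu z) = P (mu z).
  by move=> y; exact: (orth_projE (P := P) ip_subspace sB s_pos (conj (iP _) (oP _))).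
have e2 : orth_proj s ip (mu (act k z)) = Ad a k (P (mu z)).
  (* Uniqueness of the projection at a single point: the transported vector satisfies its defining
     property, so a constant function can play the role of the projector. *)
  apply: (orth_projE (P := fun=> Ad a k (P (mu z))) ip_subspace sB s_pos); split.
    exact: ipAd.
  move=> T ipT; rewrite (momentum_equivariant mu_momentum) // -(lin_sub (Adlin k)) -[T](AdKV Hlie k).
  have ipT' : ip (Ad a (k^-1)%g T) by exact: ipAd.
  rewrite (product_invariant s_product) //; first exact: oP.
    have [_ sub] := lie_alg_U_subspace.
    have := sub (-1) _ _ (ip_lie_alg (iP (mu z))) (momentum_in mu_momentum z).
    by rewrite scaleN1r addrC.
  exact: ip_lie_alg.
by rewrite /mup /gradient_mu e2 e1 (lin_opp (Adlin k)) Ad_Ci.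
Qed.

Variable M : set Z.
Let Omega := interior_in p (convex_hull (mup @` M)).
Hypothesis Omega0 : Omega 0.

Lemma interior_in_direction y beta : Omega y -> p beta ->
  \forall t \near (0 : R), convex_hull (mup @` M) (y + t *: beta).
Proof.
move=> [py [N [oN Ny] NH]] pb.
have [_ pP] := p_subspace Hlie U_subgroup U_cartan G_compatible.
have ct : {for (0 : R^o), continuous (fun t : R^o => y + t *: beta : Cn R d)}.
  by apply: continuousD; [exact: cst_continuous|exact: scalel_continuous].
have N1 : \forall z \near y, N z by exact: open_nbhs_nbhs.
have e0 : y + (0 : R^o) *: beta = y by rewrite scale0r addr0.
have := near_comp (P := N) ct e0 N1.
by apply: filterS => t Nt; apply: NH; split => //; rewrite addrC; exact: pP.
Qed.

(** The polar map controls exp on iu, not on u, so a trivial exponential has to be excluded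
    otherwise. If exp(t xi) = 1 for all t, the field of xi vanishes and the momentum equation makes
    s(mu, xi) constant on the connected Z. The corresponding functional is constant on the hull,
    which contains a segment through 0 along beta; so s(xi, xi) = 0 and xi = 0. *)
Lemma compact_one_ps beta : p beta -> exists c, one_parameter_subgroup a (- Ci beta) c.
Proof.
move=> pb; set xi := - Ci beta.
have ipxi : ip xi.
  by have [_ h] := ip_subspace; have := h (-1) (Ci beta) 0; rewrite scaleN1r addr0; apply; [exists beta|exact: ip_subspace.1].
have [P [lP iP oP mE]] := gradient_muE; have sB := product_bilinear s_product.
(* A nontrivial value at one multiple of xi yields a one-parameter subgroup for that multiple, which
   is then rescaled. *)
have [ex|nex] := pselect (exists t : R, lie_exp a (t *: xi) <> 1%g).
  have [t te] := ex; have t0 : t != 0.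
    by apply/eqP => t0; apply: te; rewrite t0 scale0r lie_exp0.
  have [c hc] := one_ps_exists te; exists (fun r => c (t^-1 * r)).
  by have := one_ps_scale t^-1 hc; rewrite scalerA mulVf // scale1r.
have ee t : lie_exp a (t *: xi) = 1%g by apply: contrapT => h; apply: nex; exists t.
have V0 z : fundamental_field a aZ act xi z = 0.
  rewrite /fundamental_field.
  rewrite (_ : (fun t : R^o => act (lie_exp a (t *: xi)) z) = fun=> z); first exact: tangent_cst.
  by apply/funext => t; rewrite ee (action1 act_hol).
have Uxi := ip_lie_alg ipxi.
pose f z : R^o := s (mu z) xi.
have sf z : smooth_at aZ vR f z.
  have sL : smooth_at vH vR (fun X => s X xi : R^o) (mu z).
    by apply/smooth_at_vec; apply: smooth_near_linear; exact: bil_linl sB.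
  exact: (smooth_at_comp (momentum_smooth mu_momentum z) sL).1.
have tf z v : tangent aZ vR f z v = 0.
  rewrite (momentum_eq mu_momentum) // V0.
  by have [h _] := kaehler_bilinear Z_kaehler z; rewrite -(scale0r (0 : Cn R m)) (bilZr _ _ _ (kaehler_bilinear Z_kaehler z)) mul0r.
have fc := [elaborate zero_tangent_constant Z_connected sf tf].
pose l y : R^o := s (Ci y) xi.
have ll : linear l by move=> k u v; rewrite /l (@Ci_linear R d) (bilDl _ _ _ sB) (bilZl _ _ _ sB).
have lmup z : l (mup z) = f point.
  rewrite /l mE (lin_opp (@Ci_linear R d)) CiCi opprK -(fc z point) /f.
  by apply/eqP; rewrite eq_sym -subr_eq0 -(bilBl _ _ _ sB) oP.
have lhull y : convex_hull (mup @` M) y -> l y = f point.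
  move=> hy; apply/eqP; rewrite eq_le; apply/andP; split.
    by apply: (convex_hull_le ll _ hy) => _ [z _ <-]; rewrite lmup.
  rewrite -lerN2; apply: (convex_hull_le (f := fun y => - l y) _ _ hy); first exact: lin_oppf.
  by move=> _ [z _ <-]; rewrite lmup.
have l0 := nbhs_singleton (interior_in_direction Omega0 pb).
have lt : \forall t \near (0 : R), t * l beta = 0.
  apply: filterS (interior_in_direction Omega0 pb) => t /lhull h; move/lhull: (l0) => h0.
  rewrite add0r (lin_scale ll) in h; rewrite add0r scale0r (lin_zero ll) in h0.
  exact: etrans h (esym h0).
have [e /= e0 /(_ (e / 2))] := (nbhs_ballP _ _).1 lt.
rewrite /ball /= sub0r normrN gtr0_norm ?divr_gt0 // ltr_pdivrMr // ltr_pMr // ltr1n => /(_ isT) /eqP.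
rewrite mulf_eq0 gt_eqF ?divr_gt0 //= => /eqP lb.
suff -> : xi = 0 by exists (fun=> 1%g); exact: one_ps_cst.
apply: contrapT => xi0; have := s_pos ipxi xi0.
have -> : s xi xi = - l beta.
  by rewrite {1}/xi -scaleN1r (bilZl _ _ _ sB) mulN1r.
by rewrite lb oppr0 ltxx.
Qed.

End GradientMap.

Lemma nonneg_derivative_mono {R : realType} (h : R^o -> R^o) :
  (forall t, differentiable h t /\ 0 <= 'd h t 1) -> forall s t, s <= t -> h s <= h t.
Proof.
move=> dh s t st; have dhs (r : R) : 0 <= r <= 1 -> differentiable h (s + r *: (t - s)).
  by move=> _; have [] := dh (s + r *: (t - s)).
have [r _] := mean_value_segment dhs; set x := s + r *: (t - s).
rewrite [s + (t - s)]addrC subrK => E1; rewrite -subr_ge0 E1.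
rewrite -[t - s]mulr1 -[_ * 1]/((t - s) *: (1 : R^o)) linearZ /=.
by rewrite mulr_ge0 ?subr_ge0 //; have [] := dh x.
Qed.

Lemma Ci_opp_solve {R : realType} n (u w : Cn R n) : - Ci u = w -> u = Ci w.
Proof. by move=> <-; rewrite (lin_opp (@Ci_linear R n)) CiCi opprK. Qed.

(** * The gradient flow of a component of the momentum map *)

Section GradientFlow.
Context {R : realType} (Z : ptopologicalType) (m : nat) (aZ : atlas Z (Cn R m))
  (omega : Z -> Cn R m -> Cn R m -> R).
Hypothesis Z_kaehler : is_kaehler aZ omega.
Context (H : topGroupType) (d : nat) (a : atlas H (Cn R d)) (U : set H).
Hypotheses (Hlie : is_complex_lie_group a) (U_subgroup : subgroup U) (U_compact : compact U).
Variable act : H -> Z -> Z.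
Hypotheses (act_hol : is_holomorphic_action a aZ act) (U_omega : preserves_form aZ act omega U).
Let aH : IsAtlas a. Proof. by have [[? _] _ _] := Hlie; exact: manifold_isAtlas. Qed.
Let bZ : IsAtlas aZ.
Proof. by have [[? _] _ _ _ _ _ _] := Z_kaehler; exact: manifold_isAtlas. Qed.
Existing Instances aH bZ.
Let b_complex := kaehler_complex Z_kaehler.
Local Notation vR := (@vec_atlas R R^o).
Local Notation vE := (@vec_atlas R (Cn R m)).
Local Notation V := (fundamental_field a aZ act).
Local Notation metric := (kaehler_metric omega).

Lemma kaehler_metricC z u v : metric z u v = metric z v u.
Proof.
rewrite /kaehler_metric -(kaehler_invariant Z_kaehler) CiCi.
have wb := kaehler_bilinear Z_kaehler z.
rewrite -scaleN1r (bilZr _ _ _ wb) mulN1r; apply/eqP; rewrite eq_sym -addr_eq0; apply/eqP.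
have := kaehler_alternating Z_kaehler z (v + Ci u).
rewrite (bilDl _ _ _ wb) !(bilDr _ _ _ wb) !(kaehler_alternating Z_kaehler) add0r addr0.
done.
Qed.

Lemma kaehler_metric_bilinear z : bilinear_form (metric z).
Proof.
have wb := kaehler_bilinear Z_kaehler z; split => [u k x y|u k x y] /=.
  by rewrite /kaehler_metric (@Ci_linear R m) (bilDr _ _ _ wb) (bilZr _ _ _ wb).
by rewrite /kaehler_metric (bilDl _ _ _ wb) (bilZl _ _ _ wb).
Qed.

Lemma kaehler_metric_ge0 z v : 0 <= metric z v v.
Proof.
have [->|v0] := eqVneq v 0; last exact: ltW (kaehler_positive Z_kaehler _ v0).
by rewrite -{1}(scale0r (0 : Cn R m)) (bilZl _ _ _ (kaehler_metric_bilinear z)) mul0r.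
Qed.

Lemma kaehler_metric_eq0 z v : metric z v v = 0 -> v = 0.
Proof.
move=> v0; apply: contrapT => /eqP /(kaehler_positive Z_kaehler z).
by rewrite -/(metric z v v) v0 ltxx.
Qed.

Section OneParameter.
Variables (X : Cn R d) (c : R^o -> H).
Hypothesis hc : one_parameter_subgroup a X c.

(** The velocity at time s is the image of the velocity at time t under the differential of a flow
    map. *)
Lemma velocity_push z t s : V X (act (c t) z) = 0 -> V X (act (c s) z) = 0.
Proof.
move=> V0; pose gam (r : R^o) := act (c r) z.
have sg r : smooth_at vR aZ gam r by exact: (flow_smooth Hlie b_complex act_hol _ _ hc).
have vg r : tangent vR aZ gam r 1 = V X (act (c r) z) by exact: (flow_velocity Hlie b_complex act_hol _ _ hc).
pose sh (r : R^o) : R^o := r + (t - s).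
have [dsh1 dsh2] : differentiable sh s /\ 'd sh s 1 = 1.
  have dsh : is_diff s sh (id + 0) by exact: is_diffD.
  by split; [exact: ex_diff|rewrite diff_val /= fctE /= addr0].
have ssh : smooth_at vR vR sh s.
  by apply/smooth_at_vec; apply: smooth_near_add; [exact: smooth_near_id|exact: smooth_near_cst].
have sgsh : smooth_at vR aZ gam (sh s) by exact: sg.
have [s1 d1] := smooth_at_comp ssh sgsh.
have [sa _] := act_point_smooth Hlie b_complex act_hol (c (s - t)) (gam (sh s)).
have [_ d2] := smooth_at_comp s1 sa.
have gE : (act (c (s - t)) \o (gam \o sh)) = gam.
  apply/funext => r /=; rewrite /gam /sh -(actionM act_hol).
  have [hD _ _] := hc; have E1 : ((s : R) - t) + ((r : R) + (t - s)) = r by ring.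
  by rewrite -hD [X in c X]E1.
rewrite -vg -gE d2 d1 tangent_vec dsh2 vg (_ : sh s = t) ?V0; last by rewrite /sh addrC subrK.
by rewrite /tangent linear0.
Qed.

Lemma fixed_of_zero z : V X z = 0 -> forall t, act (c t) z = z.
Proof.
have c0 : act (c 0) z = z by rewrite (one_ps0 hc) (action1 act_hol).
move=> Vz t; rewrite -[RHS]c0; apply: (zero_velocity_constant (g := fun s => act (c s) z)).
- by have [[[? _ _ _] _] _ _ _ _ _ _] := Z_kaehler.
- by move=> s; exact: (flow_smooth Hlie b_complex act_hol _ _ hc).
- move=> s; rewrite (flow_velocity Hlie b_complex act_hol z s hc).
  by apply: (@velocity_push z 0 s); rewrite c0.
Qed.

End OneParameter.

Section Gradient.
Variables (X : Cn R d) (c : R^o -> H).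
Hypothesis hc : one_parameter_subgroup a X c.
Variable f : Z -> R^o.
Hypotheses (f_smooth : forall z, smooth_at aZ vR f z) (f_grad : is_gradient aZ omega f (V X)).

Lemma flow_derivative z t : differentiable (fun s : R^o => f (act (c s) z) : R^o) t /\
  'd (fun s : R^o => f (act (c s) z) : R^o) t 1 = metric (act (c t) z) (V X (act (c t) z)) (V X (act (c t) z)).
Proof.
have sg := flow_smooth Hlie b_complex act_hol z t hc.
have [s1 d1] := smooth_at_comp sg (f_smooth _).
split; first by move/smooth_at_vec: s1; exact: smooth_near_diff.
by rewrite -tangent_vec -f_grad -(flow_velocity Hlie b_complex act_hol z t hc) -d1.
Qed.

Lemma flow_mono z s t : s <= t -> f (act (c s) z) <= f (act (c t) z).
Proof.
apply: (nonneg_derivative_mono (h := fun s => f (act (c s) z))) => r.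
by have [? ->] := flow_derivative z r; split => //; exact: kaehler_metric_ge0.
Qed.

Lemma constant_critical z : (forall t, 0 <= t -> f (act (c t) z) = f z) -> V X z = 0.
Proof.
move=> fc; rewrite -[z](action1 act_hol) -(one_ps0 hc).
(* Time 1 rather than 0: constancy is known for nonnegative times and the derivative needs a
   two-sided neighbourhood. [velocity_push] brings the zero back to time 0. *)
apply: (velocity_push hc (t := 1)); apply: (kaehler_metric_eq0 (z := act (c 1) z)).
have [d1 E1] := flow_derivative z 1; rewrite -E1.
have N : \forall s \near (1 : R^o), f z = f (act (c s) z).
  have := @lt_nbhsr R 0 1 ltr01; apply: filterS => s s0; exact: esym (fc _ (ltW s0)).
have [_ ->] := near_differentiable N (differentiable_cst (f z) (1 : R^o)).
by rewrite diff_cst.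
Qed.

Variable c' : R^o -> H.
Hypotheses (hc' : one_parameter_subgroup a (- Ci X) c') (cU : forall t, U (c' t)).
Variable M : set Z.
Hypotheses (M_submanifold : submanifold aZ M) (M_compact : compact M)
  (M_stable : forall x t, M x -> M (act (c t) x)).

Lemma velocity_Ci z : V (- Ci X) z = - Ci (V X z).
Proof.
rewrite (fundamental_fieldE Hlie b_complex act_hol z hc') (fundamental_fieldE Hlie b_complex act_hol z hc).
rewrite -(tangent_orbit_Ci Hlie b_complex act_hol) /tangent.
by rewrite linearN.
Qed.

(** Provides the data of [trajectories_below_null] at a zero of the field of X: the subgroup of -iX
    fixes z0 and acts by isometries, hence is linearised with a skew generator [Lam], and X is then
    linearised with generator i Lam. *)
Lemma critical_null z0 : V X z0 = 0 -> M z0 -> ~ (\forall x \near z0, M x -> f x <= f z0) ->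
  exists2 N : set Z, open N /\ N z0 & (forall z, N z -> V X z = 0 -> f z = f z0) /\
    forall nu0 : probability (borel Z) R, smooth_measure aZ M nu0 ->
      nu0.-negligible [set x : borel Z | [/\ M x, N x & forall t, 0 <= t -> f (act (c t) x) <= f z0]].
Proof.
move=> Vz Mz nmax.
have hZ : hausdorff_space Z by have [[[? _ _ _] _] _ _ _ _ _ _] := Z_kaehler.
have d0 : cdom (aZ z0) z0 by exact: atlas_dom.
pose chi := cfun (aZ z0); pose psi := cinv (aZ z0).
set e0 := chi z0.
have ie0 : cimg (aZ z0) e0 by exact: cfun_img.
have psie0 : psi e0 = z0 by exact: cfunK.
have V'z : V (- Ci X) z0 = 0.
  by rewrite velocity_Ci Vz -(scale0r (0 : Cn R m)) (lin_scale (@Ci_linear R m)) !scale0r oppr0.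
have cz0 := [elaborate fixed_of_zero hc' V'z].
have mb z := kaehler_metric_bilinear z.
have isoU u v w : U u -> act u z0 = z0 ->
    metric z0 (tangent aZ aZ (act u) z0 v) (tangent aZ aZ (act u) z0 w) = metric z0 v w.
  move=> Uu uz; rewrite /kaehler_metric -(tangent_act_Ci Hlie b_complex act_hol).
  by have := U_omega z0 v (Ci w) Uu; rewrite uz.
have [T [Lam [[sT T0 dT0 lLam] [asym LamCi dTCi dTV]]]] :=
  linearisation Hlie b_complex act_hol U_compact U_subgroup hc' cU cz0 (mb z0) isoU.
pose Te e := tangent vE aZ psi e.
pose X1 e := tangent aZ vE chi (psi e) (V X (psi e)).
(* The Kähler metric read in the chart at z0; written through [form_in_chart], its continuity in e
   follows from [kaehler_smooth]. *)
pose g e u v : R := form_in_chart aZ omega z0 e u (Ci v).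
have lTe e k u v : Te e (k *: u + v) = k *: Te e u + Te e v by rewrite /Te /tangent linearP.
have TeK e v : cimg (aZ z0) e -> Te e (tangent aZ vE chi (psi e) v) = v.
  move=> ie; have dp : cdom (aZ z0) (psi e) by exact: cinv_dom.
  have chie : chi (psi e) = e by exact: cinvK.
  have s1 : smooth_at aZ vE chi (psi e) by exact: cfun_smooth.
  have s2 : smooth_at vE aZ psi (chi (psi e)) by apply: cinv_smooth; exact: cfun_img.
  have [s3 E3] := smooth_at_comp s1 s2.
  have E4 := E3 v; rewrite chie in E4; rewrite /Te -E4.
  have N : \forall y \near psi e, (psi \o chi) y = id y.
    by apply: filterS (cdom_near dp) => y dy; exact: cfunK.
  by rewrite (tangent_ext N s3); have [_ ->] := [elaborate smooth_at_id aZ (psi e)].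
have near_img : \forall e \near e0, cimg (aZ z0) e := [elaborate cimg_near ie0].
have Te0 v : Te e0 v = v.
  have N : \forall e \near e0, e = in_charts vE aZ psi e0 e.
    apply: filterS near_img => e ie.
    by rewrite /in_charts /= psie0 /psi (cinvK ie).
  rewrite /Te /tangent. 
  have [di dE] := diff_lin_fun e0 (@lin_id R (Cn R m)) (fun x => @cvg_id _ (nbhs x)).
  by have [_ ->] := near_differentiable N di; rewrite dE.
have gE0 u v : g e0 u v = metric z0 u v.
  by rewrite /g /form_in_chart -/psi psie0 -/(Te e0 u) -/(Te e0 (Ci v)) !Te0.
have gE e u v : cimg (aZ z0) e -> g e u v = metric (psi e) (Te e u) (Te e v).
  by move=> ie; rewrite /g /form_in_chart (chart_inv_Ci b_complex).
(* [T] carries the field of -iX to [Lam], and its differential commutes with i near e0; so it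
   carries the field of X to i Lam. *)
have dTX : \forall e \near e0, 'd T e (X1 e) = (Ci \o Lam) (T e).
  apply: filterS3 near_img dTCi dTV => e ie h1.
  rewrite velocity_Ci -/psi -/chi.
  have -> : tangent aZ vE chi (psi e) (- Ci (V X (psi e))) = - Ci (X1 e).
    rewrite /X1 -(chart_Ci b_complex _ (cinv_dom ie)) /tangent.
    by rewrite linearN.
  have lD : linear ('d T e) by move=> k u v; rewrite linearP.
  move=> E2; rewrite (lin_opp lD) h1 in E2.
  exact: Ci_opp_solve E2.
have df : \forall e \near e0, differentiable (f \o psi) e /\
    forall w, 'd (f \o psi) e w = g e (X1 e) w.
  apply: filterS near_img => e ie.
  have [s1 E1] := smooth_at_comp (cinv_smooth ie) (f_smooth (psi e)).
  split; first by move/smooth_at_vec: s1; exact: smooth_near_diff.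
  by move=> w; rewrite -tangent_vec E1 f_grad (gE _ _ _ ie) (TeK _ _ ie).
have g_bil e : bilinear_form (g e).
  have wb := kaehler_bilinear Z_kaehler (psi e).
  rewrite /Te in lTe; split => [u k x y|u k x y] /=; rewrite /g /form_in_chart -/psi.
    by rewrite (@Ci_linear R m) (lTe e k) (bilDr _ _ _ wb) (bilZr _ _ _ wb).
  by rewrite (lTe e k) (bilDl _ _ _ wb) (bilZl _ _ _ wb).
have g_cont u v : {for e0, continuous (fun e => g e u v : R^o)}.
  exact: (kaehler_smooth Z_kaehler z0 u (Ci v) 0%N e0 ie0).
have g_sym u v : g e0 u v = g e0 v u by rewrite !gE0 kaehler_metricC.
have g_pos u : u != 0 -> 0 < g e0 u u by rewrite gE0; exact: (kaehler_positive Z_kaehler).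
have lL : linear (Ci \o Lam) := lin_comp lLam (@Ci_linear R m).
(* [Lam] is skew and commutes with i, and i is itself skew for the Kähler metric; the product is
   symmetric. *)
have L_sym u v : g e0 ((Ci \o Lam) u) v = g e0 u ((Ci \o Lam) v).
  have e1 : metric z0 u (Ci (Lam v)) = - metric z0 (Lam u) (Ci v) by rewrite -LamCi asym opprK.
  rewrite !gE0 /= e1 /kaehler_metric (kaehler_invariant Z_kaehler) CiCi.
  by rewrite -[- v]scaleN1r (bilZr _ _ _ (kaehler_bilinear Z_kaehler z0)) mulN1r opprK.
have fl z t : cdom (aZ z0) (act (c t) z) ->
    differentiable ((fun s : R^o => chi (act (c s) z)) : R^o -> Cn R m) t /\
    'd ((fun s : R^o => chi (act (c s) z)) : R^o -> Cn R m) t 1 = X1 (chi (act (c t) z)).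
  move=> dz; have sg := flow_smooth Hlie b_complex act_hol z t hc.
  have [s1 E1] := smooth_at_comp sg (cfun_smooth dz).
  split; first by move/smooth_at_vec: s1; exact: smooth_near_diff.
  rewrite -tangent_vec E1 (flow_velocity Hlie b_complex act_hol z t hc).
  by rewrite /X1 /psi /chi (cfunK dz).
have phi_cont z : continuous (fun t : R => act (c t) z).
  by move=> t; exact: smooth_at_cont (flow_smooth Hlie b_complex act_hol z t hc).
have phi0 z : act (c 0) z = z by rewrite (one_ps0 hc) (action1 act_hol).
have [N [oN Nz] [N1 N2]] := trajectories_below_null (phi := fun t z => act (c t) z) (g := g)
  hZ phi_cont phi0 sT T0 dT0 dTX df g_bil g_cont g_sym g_pos lL L_sym fl M_submanifold M_stable Mz nmax.
exists (N `&` cdom (aZ z0)); first by split=> //; apply: openI => //; exact: cdom_open.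
split.
  move=> z [Nz' dz] Vz'; apply: (N1 z Nz'); rewrite /X1 -/chi /psi /chi (cfunK dz) Vz'.
  by rewrite /tangent linear0.
move=> nu0 /N2; apply: negligibleS => x [Mx [Nx _] fx]; split => //.
Qed.

Lemma gradient_trajectories (nu0 : probability (borel Z) R) : unique_local_maximum M f ->
  smooth_measure aZ M nu0 -> nu0.-negligible [set x : borel Z | M x /\
    exists2 l, (exists2 y, M y & l < f y) & forall t, 0 <= t -> f (act (c t) x) <= l].
Proof.
move=> fmax snu.
have hZ : hausdorff_space Z by have [[[? _ _ _] _] _ _ _ _ _ _] := Z_kaehler.
have cZ : @second_countable Z by have [[[_ ? _ _] _] _ _ _ _ _ _] := Z_kaehler.
apply: (almost_every_trajectory (phi := fun t z => act (c t) z) (crit := [set z | V X z = 0])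
  M_compact cZ _ _ _ _ _ _ _ fmax _ snu).
- by move=> t z; have [] := act_point_smooth Hlie b_complex act_hol (c t) z.
- by move=> z; rewrite (one_ps0 hc) (action1 act_hol).
- by move=> s t z; have [-> _ _] := hc; rewrite (actionM act_hol).
- by move=> x t; exact: M_stable.
- by move=> z; exact: smooth_at_cont (f_smooth z).
- by move=> x s t; exact: flow_mono.
- by move=> z; exact: constant_critical.
- exact: critical_null.
Qed.

End Gradient.

End GradientFlow.

(** * The averaged gradient map *)

Lemma continuous_borel_measurable {R : realType} (Z : ptopologicalType) (h : Z -> R^o) : continuous h ->
  measurable_fun [set: borel Z] (h : borel Z -> R).
Proof.
move=> ch; apply: (measurability _ (measurable_realfun.RGenOInfty.measurableE R)) => _ [_ [x ->] <-].
rewrite setTI; apply: borel_open.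
have -> : h @^-1` `]x, +oo[%classic = h @^-1` [set y | x < y].
  by apply/seteqP; split => z /=; rewrite in_itv /= andbT.
by apply: open_comp => //; exact: open_gt.
Qed.

Section ProbabilityMean.
Context {R : realType} (Z : ptopologicalType) (nu : probability (borel Z) R).
Hypothesis Z_compact : compact [set: Z].

Definition average (h : Z -> R^o) : R^o := (\int[nu]_x (h x : R))%R.

Lemma continuous_bounded (h : Z -> R^o) : continuous h -> exists C, forall z, `|h z| <= C.
Proof.
move=> ch; have Z0 : [set: Z] !=set0 by exists point.
have [z z1 zmax] := cont_EVT_max (f := fun z => `|h z| : R^o) Z0 Z_compact
  (fun z _ => continuous_comp (ch z) (@norm_continuous _ R^o (h z))).
by exists `|h z| => y; exact: zmax.
Qed.

Lemma continuous_integrable (h : Z -> R^o) : continuous h -> nu.-integrable [set: borel Z] (EFin \o h).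
Proof.
move=> ch; apply: measurable_bounded_integrable => //.
- by apply: (@le_lt_trans _ _ 1%E); [exact: probability_le1|exact: ltry].
- exact: continuous_borel_measurable.
- have [C hC] := continuous_bounded ch.
  exists C; split; first exact: num_real.
  by move=> C' CC' z _ /=; apply: le_trans (hC z) (ltW CC').
Qed.

Lemma average_le (f g : Z -> R^o) : continuous f -> continuous g -> (forall z, f z <= g z) ->
  average f <= average g.
Proof.
move=> cf cg fg; apply: le_Rintegral => //; exact: continuous_integrable.
Qed.

Lemma average_cst c : average (fun=> c) = c.
Proof.
rewrite /average Rintegral_cst //; transitivity (c * fine (1%E : \bar R)); last by rewrite mulr1.
by congr (c * fine _); exact: probability_setT. Qed.

Lemma average_mean : mean_functional [set: Z] average.
Proof.
split=> [c f g cf cg|f C cf fC].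
  have {}cf : continuous f by move=> z; exact: cf.
  have {}cg : continuous g by move=> z; exact: cg.
  have ccf : continuous (fun z => c * f z : R^o).
    by move=> z; apply: (@continuousM _ _ (fun=> c) f); [exact: cst_continuous|exact: cf].
  rewrite /average RintegralD //; [|exact: continuous_integrable|exact: continuous_integrable].
  by rewrite RintegralZl //; exact: continuous_integrable.
have {}cf : continuous f by move=> z; exact: cf.
rewrite ler_norml; apply/andP; split.
  rewrite -(average_cst (- C)); apply: average_le => //; first by move=> z; exact: cst_continuous.
  by move=> z; have := fC z I; rewrite ler_norml => /andP [].
rewrite -(average_cst C); apply: average_le => //; first by move=> z; exact: cst_continuous.
by move=> z; have := fC z I; rewrite ler_norml => /andP [].
Qed.

Lemma average_gt0 (h : Z -> R^o) : continuous h -> (forall z, 0 <= h z) ->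
  ~ nu.-negligible [set z : borel Z | 0 < h z] -> 0 < average h.
Proof.
move=> ch h0 nn; rewrite lt_neqAle; apply/andP; split; last first.
  by rewrite -(average_cst 0); apply: average_le => //; move=> z; exact: cst_continuous.
apply/eqP => ah; apply: nn.
have ih := continuous_integrable ch.
have mh := measurable_int _ ih.
have E0 : (\int[nu]_x `|(EFin \o h) x| = 0)%E.
  have -> : (\int[nu]_x `|(EFin \o h) x| = \int[nu]_x (EFin \o h) x)%E.
    by apply: eq_integral => z _ /=; rewrite ger0_norm.
  by rewrite -(fineK (integrable_fin_num measurableT ih)) -/(Rintegral nu setT h) -/(average h) -ah.
have [B [mB B0 AB]] := (ae_eq_integral_abs nu measurableT mh).1 E0.
exists B; split => // z /= hz; apply: AB => /= /(_ I) [] h0z.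
by rewrite h0z ltxx in hz.
Qed.

Lemma negligible_exists (M : set Z) (A : set (borel Z)) : nu (M : set (borel Z)) = 1%E ->
  measurable (M : set (borel Z)) -> nu.-negligible A -> exists2 x, M x & ~ A x.
Proof.
move=> M1 mM [B [mB B0 AB]]; apply: contrapT => h.
have MB : (M : set (borel Z)) `<=` B.
  by move=> x Mx; apply: AB; apply: contrapT => nA; apply: h; exists x.
have := le_measure nu (mem_set mM) (mem_set mB) MB.
by move=> h1; have : (1 <= 0 :> \bar R)%E; [rewrite -{1}M1 -B0|rewrite leNgt lte01].
Qed.

Lemma dominates_negligible (nu0 : probability (borel Z) R) (A : set (borel Z)) :
  nu `<< nu0 -> nu0.-negligible A -> nu.-negligible A.
Proof.
move=> dom [B [mB B0 AB]]; exists B; split => //.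
apply: (dom B) => // C mC CB; apply/eqP; rewrite eq_le measure_ge0 andbT -B0.
by apply: le_measure => //; rewrite inE.
Qed.

End ProbabilityMean.

Lemma average_le_on {R : realType} (Z : ptopologicalType) (nu : probability (borel Z) R)
  (M : set Z) (h : Z -> R^o) k : compact [set: Z] -> closed M -> nu M = 1%E ->
  continuous h -> (forall x, M x -> h x <= k) -> average nu h <= k.
Proof.
move=> Z_compact M_closed nuM ch hk.
have mM : measurable (M : set (borel Z)) by exact: borel_closed.
have nuMC : nu (~` M : set (borel Z)) = 0%E by rewrite probability_setC // nuM subee.
have ih := continuous_integrable nu Z_compact ch.
have ck : continuous ((fun=> k) : Z -> R^o) by move=> z; exact: cst_continuous.
have ik := continuous_integrable nu Z_compact ck.
have aM f : nu.-integrable [set: borel Z] (EFin \o f) -> average nu f = (\int[nu]_(x in M) f x)%R.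
  move=> jf; rewrite /average /Rintegral; congr fine.
  by rewrite (negligible_integral (measurableC mM) measurableT jf nuMC) setTD setCK.
rewrite -(average_cst nu k) !aM //; apply: le_Rintegral => //.
  exact: integrableS ih.
exact: integrableS ik.
Qed.

Section PushedIntegral.
Context {R : realType} (Z : ptopologicalType) (nu : probability (borel Z) R) (M : set Z) (g : Z -> Z).
Hypotheses (Z_compact : compact [set: Z]) (cg : continuous g) (M_closed : closed M)
  (nuM : nu M = 1%E) (gM : forall x, M x -> M (g x)).

(** Both measures give M full mass, so the integral over M equals the integral over Z, to which the
    change of variables applies. *)
Lemma push_integral (h : Z -> R^o) : continuous h ->
  fine (\int[push g nu]_(x in (M : set (borel Z))) (h x)%:E)%E = average nu (h \o g).
Proof.
move=> ch; have [nu' nuE] := push_probability nu cg.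
have mg := borel_continuous_measurable cg.
have mM : measurable (M : set (borel Z)) by exact: borel_closed.
have mh := continuous_borel_measurable ch.
have chg : continuous (h \o g) by move=> x; apply: continuous_comp; [exact: cg|exact: ch].
have nuMC : nu' (~` M : set (borel Z)) = 0%E.
  have sub : (g @^-1` ~` M : set (borel Z)) `<=` (~` M : set (borel Z)).
    by move=> x /= ngx Mx; apply: ngx; exact: gM.
  rewrite nuE /push /pushforward; apply/eqP; rewrite eq_le measure_ge0 andbT.
  have <- : nu (~` M : set (borel Z)) = 0%E.
    by rewrite probability_setC // nuM subee.
  apply: le_measure => //; rewrite inE; last exact: measurableC.
  by have := mg measurableT _ (measurableC mM); rewrite setTI.
rewrite -nuE /average /Rintegral; congr fine.
have i1 := continuous_integrable nu' Z_compact ch.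
transitivity (\int[nu']_x (h x)%:E)%E.
  rewrite (negligible_integral (measurableC mM) measurableT i1 nuMC).
  by rewrite setTD setCK.
have i2 := continuous_integrable nu Z_compact chg.
rewrite nuE -[RHS](integral_pushforward (phi := g : borel Z -> borel Z) mg (f := fun x => (h x)%:E) _ i2 measurableT) //.
exact/measurable_realfun.measurable_EFinP.
Qed.

End PushedIntegral.

Lemma smooth_at_coordinates {R : realType} (X : topologicalType) (E V : normedModType R)
  (a : atlas X E) {aX : IsAtlas a} {fE : FinDim E} {fV : FinDim V} (f : X -> V) x :
  (forall l : V -> R^o, linear l -> smooth_at a (@vec_atlas R R^o) (l \o f) x) ->
  smooth_at a (@vec_atlas R V) f x.
Proof.
move=> sl; have [n [b [l [ll lc lE]]]] := fV.
have fEq : f = fun y => \sum_j l j (f y) *: b j by apply/funext => y; exact: lE.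
split.
  rewrite fEq; apply: continuous_at_sum => j.
  have cj : {for x, continuous (l j \o f)} := smooth_at_cont (sl _ (ll j)).
  by apply: (@continuous_comp _ _ _ (l j \o f) (fun k : R^o => k *: b j) x cj); exact: scalel_continuous.
have -> : in_charts a (@vec_atlas R V) f x =
    fun e => \sum_j in_charts a (@vec_atlas R R^o) (l j \o f) x e *: b j.
  by apply/funext => e; exact: (lE (f (cinv (a x) e))).
apply: (smooth_near_sum (f := fun j e => in_charts a (@vec_atlas R R^o) (l j \o f) x e *: b j)) => j.
apply: smooth_near_scale; last exact: smooth_near_cst.
exact: (sl _ (ll j)).2.
Qed.

Section VectorMean.
Context {R : realType} (X : topologicalType) (Q : set X) (I : (X -> R^o) -> R^o).
Hypothesis mI : mean_functional Q I.

Lemma mean_sum n (c : 'I_n -> R) (f : 'I_n -> X -> R^o) : (forall i, continuous (f i)) ->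
  I (fun x => \sum_i c i * f i x) = \sum_i c i * I (f i).
Proof.
elim: n c f => [|n IHn] c f cf.
  rewrite big_ord0; have c0 : forall x, Q x -> {for x, continuous (fun=> 0 : R^o)}.
    by move=> x _; exact: cst_continuous.
  have E1 : I (fun=> -1 * 0 + 0) = 0 by rewrite (mean_linear mI (-1) c0 c0) mulN1r addNr.
  rewrite -[RHS]E1; congr I.
  by apply/funext => x; rewrite big_ord0 mulr0 addr0.
rewrite big_ord_recl -(IHn (fun i => c (lift ord0 i)) (fun i => f (lift ord0 i))) //.
rewrite -(mean_linear mI).
- by congr I; apply/funext => x; rewrite big_ord_recl.
- by move=> x _; exact: cf.
- move=> x _; apply: continuous_at_sum => i.
  by apply: (@continuousM _ _ (fun=> c (lift ord0 i)) (f (lift ord0 i))); [exact: cst_continuous|exact: cf].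
Qed.

Context (d : nat).

Definition vector_mean (f : X -> Cn R d) : Cn R d :=
  (\row_j I (fun x => (f x).1 0 j), \row_j I (fun x => (f x).2 0 j)).

Lemma Cn_sum_delta (y : Cn R d) : y = \sum_j y.1 0 j *: ((delta_mx 0 j, 0) : Cn R d) +
  \sum_j y.2 0 j *: ((0, delta_mx 0 j) : Cn R d).
Proof.
have h1 n (c : 'I_n -> R) (b : 'I_n -> 'rV[R]_d) :
    \sum_j c j *: ((b j, 0) : Cn R d) = (\sum_j c j *: b j, 0).
  by rewrite (linear_sumE (@pairl_linear R 'rV[R]_d 'rV[R]_d)).
have h2 n (c : 'I_n -> R) (b : 'I_n -> 'rV[R]_d) :
    \sum_j c j *: ((0, b j) : Cn R d) = (0, \sum_j c j *: b j).
  by rewrite (linear_sumE (@pairr_linear R 'rV[R]_d 'rV[R]_d)).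
rewrite h1 h2 -!row_sum_delta; case: y => y1 y2.
by rewrite -[RHS]/(y1 + 0, 0 + y2) addr0 add0r.
Qed.

Lemma vector_mean_linear (l : Cn R d -> R^o) (f : X -> Cn R d) : linear l -> continuous f ->
  l (vector_mean f) = I (l \o f).
Proof.
move=> ll cf.
have lE y : l y = \sum_j l (delta_mx 0 j, 0) * y.1 0 j + \sum_j l (0, delta_mx 0 j) * y.2 0 j.
  rewrite {1}(Cn_sum_delta y) (lin_add ll) !(linear_sumE ll).
  by congr (_ + _); apply: eq_bigr => j _; rewrite mulrC.
have c1 j : continuous (fun x => (f x).1 0 j : R^o).
  move=> x; apply: (@continuous_comp _ _ _ (fst \o f) (fun v : 'rV[R]_d => v 0 j : R^o)).
    by apply: continuous_comp; [exact: cf|exact: cvg_fst].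
  exact: coord_continuous.
have c2 j : continuous (fun x => (f x).2 0 j : R^o).
  move=> x; apply: (@continuous_comp _ _ _ (snd \o f) (fun v : 'rV[R]_d => v 0 j : R^o)).
    by apply: continuous_comp; [exact: cf|exact: cvg_snd].
  exact: coord_continuous.
rewrite lE; under eq_bigr do rewrite mxE; under [X in _ + X]eq_bigr do rewrite mxE.
rewrite -!mean_sum // -[X in X + _]mul1r -(mean_linear mI).
- by congr I; apply/funext => x /=; rewrite lE mul1r.
- move=> x _; apply: continuous_at_sum => i.
  by apply: (@continuousM _ _ (fun=> l _ : R^o)); [exact: cst_continuous|exact: c1].
- move=> x _; apply: continuous_at_sum => i.
  by apply: (@continuousM _ _ (fun=> l _ : R^o)); [exact: cst_continuous|exact: c2].
Qed.

Lemma linear_separates (y z : Cn R d) : (forall l : Cn R d -> R^o, linear l -> l y = l z) -> y = z.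
Proof.
move=> h; rewrite (Cn_sum_delta y) (Cn_sum_delta z); congr (_ + _); apply: eq_bigr => j _.
  by congr (_ *: _); apply: (h (fun y => y.1 0 j)) => k u v; rewrite !mxE.
by congr (_ *: _); apply: (h (fun y => y.2 0 j)) => k u v; rewrite !mxE.
Qed.

End VectorMean.

Lemma derive_along {R : realType} (h : R^o -> R^o) t : differentiable h t -> 'D_1 h t = 'd h t 1.
Proof. by move=> dh; rewrite deriveE. Qed.

Section MeanGradient.
Context {R : realType} (Z : ptopologicalType) (m : nat) (aZ : atlas Z (Cn R m))
  (omega : Z -> Cn R m -> Cn R m -> R).
Hypotheses (Z_compact : compact [set: Z]) (Z_kaehler : is_kaehler aZ omega).
Context (H : topGroupType) (d : nat) (a : atlas H (Cn R d)) (U : set H).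
Hypotheses (Hlie : is_complex_lie_group a) (U_subgroup : subgroup U) (U_compact : compact U).
Variable act : H -> Z -> Z.
Hypotheses (act_hol : is_holomorphic_action a aZ act) (U_omega : preserves_form aZ act omega U).
Let aH : IsAtlas a. Proof. by have [[? _] _ _] := Hlie; exact: manifold_isAtlas. Qed.
Let bZ : IsAtlas aZ.
Proof. by have [[? _] _ _ _ _ _ _] := Z_kaehler; exact: manifold_isAtlas. Qed.
Existing Instances aH bZ.
Let b_complex := kaehler_complex Z_kaehler.
Local Notation vR := (@vec_atlas R R^o).
Local Notation vH := (@vec_atlas R (Cn R d)).
Local Notation V := (fundamental_field a aZ act).
Local Notation metric := (kaehler_metric omega).
Variables (B : Cn R d -> Cn R d -> R) (B_bil : bilinear_form B).
Variables (p : set (Cn R d)) (mup : Z -> Cn R d) (G : set H).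
Hypotheses (p_sub : subspace_set p)
  (p_curve : forall X, p X -> exists2 c, one_parameter_subgroup a X c &
    (forall t, G (c t)) /\ forall t : R, lie_exp a (t *: X) = c t)
  (ip_curve : forall X, p X -> exists2 c, one_parameter_subgroup a (- Ci X) c & forall t, U (c t))
  (mup_in : forall z, p (mup z)) (mup_smooth : forall z, smooth_at aZ vH mup z)
  (mup_gradient : forall X, p X -> is_gradient aZ omega (fun z => B (mup z) X) (V X)).
Variable M : set Z.
Hypotheses (M_compact : compact M) (M_submanifold : submanifold aZ M)
  (M_stable : forall g x, G g -> M x -> M (act g x)) (G_inv : forall g, G g -> G g^-1%g)
  (mup_max : forall X, p X -> unique_local_maximum M (fun x => B (mup x) X))
  (mup_nonconstant : forall X, p X -> X <> 0 ->
    exists x y, [/\ M x, M y & B (mup x) X < B (mup y) X]).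
Variables (nu nu0 : probability (borel Z) R).
Hypotheses (nu_M : nu M = 1%E) (nu0_smooth : smooth_measure aZ M nu0) (nu_nu0 : nu `<< nu0).

Let M_closed : closed M.
Proof.
have hZ : hausdorff_space Z by have [[[? _ _ _] _] _ _ _ _ _ _] := Z_kaehler.
exact: compact_closed.
Qed.

(** The integral is taken over all of Z, which makes the map defined and smooth on the whole complex
    group; for g in [G] it agrees with the integral over M, see [mean_gradientE]. *)
Definition mean_gradient (g : H) : Cn R d :=
  vector_mean (average nu) (fun x => mup (act g x)).
Local Notation F := mean_gradient.

Let mI := average_mean nu Z_compact.

Let mup_cont : continuous mup. Proof. by move=> z; exact: smooth_at_cont (mup_smooth z). Qed.

Let act_cont g : continuous (act g).
Proof. by move=> z; have [s1 _] := act_point_smooth Hlie b_complex act_hol g z; exact: smooth_at_cont s1. Qed.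

Let mup_act_cont g : continuous (fun x => mup (act g x)).
Proof. by move=> z; apply: continuous_comp; [exact: act_cont|exact: mup_cont]. Qed.

Let linear_cont (l : Cn R d -> R^o) : linear l -> continuous l.
Proof. by move=> ll; exact: findim_linear_continuous. Qed.

Lemma mean_gradient_linear (l : Cn R d -> R^o) g : linear l ->
  l (F g) = average nu (fun x => l (mup (act g x))).
Proof. by move=> ll; rewrite /F (vector_mean_linear mI ll (@mup_act_cont g)). Qed.

Lemma mean_gradientE g : G g -> integral_Cn M mup (push (act g) nu) = F g.
Proof.
move=> Gg; have gM x : M x -> M (act g x) by exact: M_stable.
congr (_, _); apply/rowP => j; rewrite !mxE.
  apply: (push_integral (h := fun z => (mup z).1 0 j) Z_compact (@act_cont g) M_closed nu_M gM) => z.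
  by apply: (@continuous_comp _ _ _ mup (fun y : Cn R d => y.1 0 j : R^o)); [exact: mup_cont|apply: linear_cont => k u v; rewrite !mxE].
apply: (push_integral (h := fun z => (mup z).2 0 j) Z_compact (@act_cont g) M_closed nu_M gM) => z.
by apply: (@continuous_comp _ _ _ mup (fun y : Cn R d => y.2 0 j : R^o)); [exact: mup_cont|apply: linear_cont => k u v; rewrite !mxE].
Qed.

Lemma mean_gradient_in g : p (F g).
Proof.
have [r [iota [q [il ql iotaK iW Wi]]]] := subspace_param (V := (Cn R d : normedModType R)) p_sub.
suff -> : F g = iota (q (F g)) by exact: iW.
apply: linear_separates => l ll; rewrite (mean_gradient_linear g ll).
apply: etrans (esym (mean_gradient_linear g (lin_comp ql (lin_comp il ll)))).
by congr average; apply/funext => x /=; rewrite Wi.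
Qed.

Lemma mean_gradient_equivariant k g : (forall z, mup (act k z) = Ad a k (mup z)) ->
  F (k * g)%g = Ad a k (F g).
Proof.
move=> mk; apply: linear_separates => l ll; rewrite (mean_gradient_linear _ ll).
apply: etrans (esym (mean_gradient_linear g (lin_comp (Ad_linear a k) ll))).
by congr average; apply/funext => x /=; rewrite (actionM act_hol) mk.
Qed.

Let sphi (l : Cn R d -> R^o) g0 x : linear l ->
  smooth_at (prod_atlas a aZ) vR (fun q => l (mup (act q.1 q.2))) (g0, x).
Proof.
move=> ll.
have [s1 _] := act_smooth Hlie b_complex act_hol (smooth_at_fst a aZ (g0, x)).1 (smooth_at_snd a aZ (g0, x)).1.
have [s2 _] := smooth_at_comp s1 (mup_smooth _).
have sl : smooth_at vH vR l (mup (act g0 x)) by apply/smooth_at_vec; exact: smooth_near_linear.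
exact: (smooth_at_comp s2 sl).1.
Qed.

Lemma mean_gradient_smooth g : smooth_at a vH F g.
Proof.
apply: smooth_at_coordinates => l ll.
have -> : l \o F = fun g => average nu (fun x => l (mup (act g x))).
  by apply/funext => h; exact: mean_gradient_linear.
have := @mean_smooth_at R Z _ aZ _ _ [set: Z] Z_compact (average nu) mI H _ a _ _ (fun g x => l (mup (act g x))) g.
by case=> // x _; exact: sphi.
Qed.

Lemma mean_gradient_le X g (k : R) : p X -> G g -> (forall x, M x -> B (mup x) X <= k) ->
  B (F g) X <= k.
Proof.
move=> pX Gg Bk; have lB : linear (fun y => B y X : R^o) := bil_linl X B_bil.
have -> := mean_gradient_linear g lB.
apply: (average_le_on Z_compact M_closed nu_M); last by move=> x Mx; apply: Bk; exact: M_stable.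
by move=> x; apply: (@continuous_comp _ _ _ (fun x => mup (act g x)) (fun y => B y X : R^o)); [exact: mup_act_cont|exact: linear_cont].
Qed.

Section Direction.
Variables (X : Cn R d) (pX : p X) (c : R^o -> H) (hc : one_parameter_subgroup a X c).
Hypotheses (cG : forall t, G (c t)) (G_mul : forall g h, G g -> G h -> G (g * h)%g).
Let f z : R^o := B (mup z) X.
Let speed z : R^o := metric z (V X z) (V X z).
Let lB : linear (fun y => B y X : R^o) := bil_linl X B_bil.

Let f_smooth z : smooth_at aZ vR f z.
Proof.
have sl : smooth_at vH vR (fun y => B y X : R^o) (mup z) by apply/smooth_at_vec; exact: smooth_near_linear.
exact: (smooth_at_comp (mup_smooth z) sl).1.
Qed.

Let f_grad : is_gradient aZ omega f (V X) := mup_gradient pX.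

Let Phi_smooth g t x :
  smooth_at (prod_atlas vR aZ) vR (fun q => f (act (c q.1 * g)%g q.2)) (t, x).
Proof.
have [_ sc _] := hc.
have [s1 _] := smooth_at_comp (smooth_at_fst vR aZ (t, x)).1 (sc t).
have [s2 _] := smooth_at_comp s1 (smooth_mulr Hlie g _).
have [s3 _] := act_smooth Hlie b_complex act_hol s2 (smooth_at_snd vR aZ (t, x)).1.
exact: (smooth_at_comp s3 (f_smooth _)).1.
Qed.

(** The squared length is the derivative at t = 0 of the jointly smooth f(exp(tX) x). Reading it off
    [omega] would be awkward, since that form is smooth chart by chart. *)
Lemma speed_continuous : continuous speed.
Proof.
pose Phi (t : R^o) x := f (act (c t * 1)%g x).
have sPhi e x : [set: R^o] e -> [set: Z] x ->
    smooth_at (prod_atlas vR aZ) vR (fun q => Phi q.1 q.2) (e, x) by move=> _ _; exact: Phi_smooth.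
have [_ s1] := [elaborate family_derive (V := [set: R^o]) (Phi := Phi) 1 sPhi].
move=> x; have := [elaborate family_cont (V := [set: R^o]) (Phi := fun e x => 'D_1 (Phi^~ x) e) (e := 0 : R^o) (x := x) s1 I I].
rewrite (_ : (fun x => 'D_1 (Phi^~ x) 0) = speed) //.
apply/funext => y; have [d1 d2] := flow_derivative Z_kaehler Hlie act_hol hc f_smooth f_grad y 0.
have -> : Phi^~ y = (fun s => f (act (c s) y)) by apply/funext => s; rewrite /Phi mulg1.
apply: etrans (derive_along d1) _; apply: etrans d2 _.
by rewrite (one_ps0 hc) (action1 act_hol).
Qed.

Lemma mean_gradient_derivative g t :
  differentiable (fun t : R^o => B (F (c t * g)%g) X : R^o) t /\
  'd (fun t : R^o => B (F (c t * g)%g) X : R^o) t 1 = average nu (fun x => speed (act (c t * g)%g x)).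
Proof.
have -> : (fun t : R^o => B (F (c t * g)%g) X : R^o) =
    (fun t => average nu (fun x => f (act (c t * g)%g x))).
  by apply/funext => r; exact: (mean_gradient_linear _ lB).
have [s1 d1] := @mean_smooth_at R Z _ aZ _ _ [set: Z] Z_compact (average nu) mI R^o _ vR _ _
  (fun t x => f (act (c t * g)%g x)) t (fun x _ => Phi_smooth g t x).
split; first by move/smooth_at_vec: s1; exact: smooth_near_diff.
rewrite -tangent_vec d1; congr average; apply/funext => x; rewrite tangent_vec.
have [d2 d3] := flow_derivative Z_kaehler Hlie act_hol hc f_smooth f_grad (act g x) t.
have -> : (fun t => f (act (c t * g)%g x)) = (fun s => f (act (c s) (act g x))).
  by apply/funext => s; rewrite (actionM act_hol).
by rewrite d3 /speed (actionM act_hol).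
Qed.

(** The pushforward of nu0 by g is again smooth, so almost all of its trajectories approach the
    maximum; the exceptional set is pulled back by g and passes to [nu] by absolute continuity. *)
Lemma push_gradient_trajectories g : G g ->
  nu.-negligible [set x : borel Z | M x /\ exists2 l, (exists2 y, M y & l < f y) &
    forall t, 0 <= t -> f (act (c t) (act g x)) <= l].
Proof.
move=> Gg; have cg := @act_cont g; have [nu1 nu1E] := push_probability nu0 cg.
have snu1 : smooth_measure aZ M nu1.
  rewrite nu1E; have hZ : hausdorff_space Z by have [[[? _ _ _] _] _ _ _ _ _ _] := Z_kaehler.
  apply: (smooth_measure_push (g' := act g^-1%g) _ _ _ _ _ _ nu0_smooth).
  - by move=> z; have [] := act_point_smooth Hlie b_complex act_hol g z.
  - by move=> z; have [] := act_point_smooth Hlie b_complex act_hol g^-1%g z.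
  - by move=> z; rewrite -(actionM act_hol) mulVg (action1 act_hol).
  - by move=> z; rewrite -(actionM act_hol) mulgV (action1 act_hol).
  - by move=> x; exact: M_stable.
  - by move=> x; apply: M_stable; exact: G_inv.
have [c' hc' cU] := ip_curve pX.
have cM x t : M x -> M (act (c t) x) by exact: M_stable.
have N1 := gradient_trajectories Z_kaehler Hlie U_subgroup U_compact act_hol U_omega hc f_smooth f_grad
  hc' cU M_submanifold M_compact cM (mup_max pX) snu1.
have N0 := dominates_negligible nu_nu0 (push_negligible cg nu1E N1).
apply: negligibleS N0 => x [Mx h]; split => //; exact: M_stable.
Qed.

End Direction.

Hypothesis G_mul : forall g h, G g -> G h -> G (g * h)%g.

(** If the speed vanished almost everywhere, some g x would be a fixed point whose constant
    trajectories, for X and for -X, approach the maximum of f and of -f on M. Then f would be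
    constant on M. *)
Lemma speed_average_gt0 X g : p X -> X <> 0 -> G g ->
  0 < average nu (fun x => metric (act g x) (V X (act g x)) (V X (act g x))).
Proof.
move=> pX X0 Gg; have [c hc [cG cE]] := p_curve pX.
have [p0 pP] := p_sub.
have pNX : p (- X) by rewrite -scaleN1r -[_ *: _]addr0; exact: pP.
have [c2 hc2 [c2G c2E]] := p_curve pNX.
have cs := speed_continuous pX hc.
apply: (average_gt0 Z_compact).
- by move=> x; apply: (@continuous_comp _ _ _ (act g) (fun z => metric z (V X z) (V X z) : R^o)); [exact: act_cont|exact: cs].
- by move=> x; exact: (kaehler_metric_ge0 Z_kaehler).
move=> N0.
have N1 := push_gradient_trajectories pX hc cG Gg.
have N2 := push_gradient_trajectories pNX hc2 c2G Gg.
have [x Mx nx] := negligible_exists nu_M (borel_closed M_closed) (negligibleU N0 (negligibleU N1 N2)).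
have My := M_stable Gg Mx.
have fix1 t : act (c t) (act g x) = act g x.
  apply: (fixed_of_zero Z_kaehler Hlie act_hol hc); apply: (kaehler_metric_eq0 Z_kaehler (z := act g x)).
  apply/eqP; rewrite eq_le (kaehler_metric_ge0 Z_kaehler) andbT leNgt; apply/negP => h; apply: nx; left.
  exact: h.
have fix2 t : act (c2 t) (act g x) = act g x.
  have -> : c2 t = c (- t) by rewrite -c2E -cE scalerN scaleNr.
  exact: fix1.
have [y [z [My' Mz ltyz]]] := mup_nonconstant pX X0.
have le1 : B (mup z) X <= B (mup (act g x)) X.
  rewrite leNgt; apply/negP => h; apply: nx; right; left; split => //.
  exists (B (mup (act g x)) X); first by exists z.
  by move=> t _; rewrite fix1.
have le2 : B (mup (act g x)) X <= B (mup y) X.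
  rewrite leNgt; apply/negP => h; apply: nx; right; right; split => //.
  exists (B (mup (act g x)) (- X)); last by move=> t _; rewrite fix2.
  by exists y => //; rewrite -scaleN1r !(bilZr _ _ _ B_bil) !mulN1r ltrN2.
by have := le_lt_trans (le_trans le1 le2) ltyz; rewrite ltxx.
Qed.

Lemma mean_gradient_mono X c g s t : p X -> X <> 0 -> one_parameter_subgroup a X c ->
  (forall t, G (c t)) -> G g -> s < t -> B (F (c s * g)%g) X < B (F (c t * g)%g) X.
Proof.
move=> pX X0 hc cG Gg st; pose h (t : R^o) : R^o := B (F (c t * g)%g) X.
have dh (r : R) : 0 <= r <= 1 -> differentiable h (s + r *: (t - s)).
  by move=> _; have [] := mean_gradient_derivative pX hc g (s + r *: (t - s)).
have [r _] := mean_value_segment dh; set x := s + r *: (t - s).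
rewrite [s + (t - s)]addrC subrK => E1; rewrite -subr_gt0 -/(h t) -/(h s) E1.
rewrite -[t - s]mulr1 -[_ * 1]/((t - s) *: (1 : R^o)) linearZ /=.
rewrite mulr_gt0 ?subr_gt0 //; have [_ ->] := mean_gradient_derivative pX hc g x.
by apply: speed_average_gt0 => //; exact: G_mul.
Qed.

(** If the value at g already reached the supporting bound, strict growth along exp(tX) would carry
    it beyond that bound, which [mean_gradient_le] forbids. *)
Lemma mean_gradient_lt X g : p X -> X <> 0 -> G g -> exists2 x, M x & B (F g) X < B (mup x) X.
Proof.
move=> pX X0 Gg; apply: contrapT => h.
have le x : M x -> B (mup x) X <= B (F g) X.
  by move=> Mx; rewrite leNgt; apply/negP => lt'; apply: h; exists x.
have [c hc [cG cE]] := p_curve pX.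
have := mean_gradient_mono pX X0 hc cG Gg (ltr01 : (0 : R) < 1).
rewrite (one_ps0 hc) mul1g ltNge; apply/negP; rewrite negbK.
by apply: mean_gradient_le => //; exact: G_mul.
Qed.

(** Dominated convergence along integer times gives the limit max f; monotonicity of f along the
    flow extends the lower bound to all later times. *)
Lemma mean_gradient_limit X c x0 k : p X -> one_parameter_subgroup a X c ->
  (forall t, G (c t)) -> G 1%g -> M x0 -> k < B (mup x0) X ->
  exists T : R, forall t, T <= t -> k < B (F (c t)) X.
Proof.
move=> pX hc cG G1 Mx0 kx0.
pose f z : R^o := B (mup z) X.
have lB : linear (fun y => B y X : R^o) := bil_linl X B_bil.
have cf : continuous f.
  by move=> x; apply: (@continuous_comp _ _ _ mup (fun y => B y X : R^o)); [exact: mup_cont|exact: linear_cont].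
have cft t : continuous (fun x => f (act (c t) x)).
  by move=> x; apply: (@continuous_comp _ _ _ (act (c t)) f); [exact: act_cont|exact: cf].
have fF t : B (F (c t)) X = average nu (fun x => f (act (c t) x)) by exact: (mean_gradient_linear _ lB).
have [x1 Mx1 fmax] := cont_EVT_max (ex_intro _ x0 Mx0) M_compact (fun x _ => cf x).
have sf z : smooth_at aZ vR f z.
  have sl : smooth_at vH vR (fun y => B y X : R^o) (mup z) by apply/smooth_at_vec; exact: smooth_near_linear.
  exact: (smooth_at_comp (mup_smooth z) sl).1.
have mono x s t : s <= t -> f (act (c s) x) <= f (act (c t) x).
  by apply: (flow_mono Z_kaehler Hlie act_hol hc sf); exact: mup_gradient.
have [C hC] := continuous_bounded Z_compact cf.
have ccst (e : R) : continuous ((fun=> e) : Z -> R^o) by move=> z; exact: cst_continuous.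
have N1 := push_gradient_trajectories pX hc cG G1.
have NM : nu.-negligible (~` M : set (borel Z)).
  exists (~` M); split => //; first exact: measurableC (borel_closed M_closed).
  by rewrite probability_setC ?nu_M ?subee //; exact: borel_closed.
have aecv : {ae nu, forall x : borel Z, [set: borel Z] x -> (f (act (c n%:R) x))%:E @[n --> \oo] --> (f x1)%:E}.
  apply: negligibleS (negligibleU NM N1) => x /= nx.
  have [Mx|nMx] := pselect (M x); last by left.
  right; split => //; apply: contrapT => h; apply: nx => _.
  apply: cvg_EFin; first by near=> n.
  apply/cvgrPdist_lt => e e0.
  have [T [T0 hT]] : exists T, 0 <= T /\ f x1 - e < f (act (c T) (act 1%g x)).
    apply: contrapT => h2; apply: h; exists (f x1 - e).
      by exists x1 => //; rewrite ltrBlDr ltrDl.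
    by move=> t t0; rewrite leNgt; apply/negP => h3; apply: h2; exists t.
  rewrite (action1 act_hol) in hT.
  near=> n; have Tn : T <= n%:R by near: n; exact: nbhs_infty_ger.
  have := mono x _ _ Tn; have := fmax _ (M_stable (cG n%:R) Mx) => le1 le2.
  rewrite ger0_norm ?subr_ge0 //= ltrBlDr addrC -ltrBlDr.
  exact: lt_le_trans hT le2.
have mk (h : Z -> R^o) (ch : continuous h) := measurable_int _ (continuous_integrable nu Z_compact ch).
have bnd : {ae nu, forall (x : borel Z) n, [set: borel Z] x -> (`|(f (act (c n%:R) x))%:E| <= C%:E)%E}.
  by apply: aeW => x n _; rewrite lee_fin; exact: hC.
have [_ _ cv] := @dominated_convergence _ _ _ nu _ measurableT (fun n => EFin \o (fun x => f (act (c n%:R) x)))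
  (EFin \o (fun=> f x1)) (EFin \o (fun=> C)) (fun n => mk _ (cft n%:R)) (mk _ (ccst (f x1))) aecv
  (continuous_integrable nu Z_compact (ccst C)) bnd.
have i1 : (\int[nu]_x (EFin \o (fun=> f x1)) x)%E = (f x1)%:E.
  rewrite -(fineK (integrable_fin_num measurableT (continuous_integrable nu Z_compact (ccst (f x1))))).
  by congr EFin; exact: average_cst.
rewrite i1 in cv; have {}cv := [elaborate fine_cvg cv].
have kf : 0 < f x1 - k by rewrite subr_gt0 (lt_le_trans kx0) //; exact: fmax.
move/cvgrPdist_lt/(_ _ kf): cv => [n _ /(_ n (leqnn n))] h.
exists n%:R => t nt; rewrite fF; apply: (@lt_le_trans _ _ (average nu (fun x => f (act (c n%:R) x)))).
  by have := le_lt_trans (ler_norm _) h; rewrite ltrD2l ltrN2.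
by apply: (average_le nu Z_compact (cft _) (cft _)) => z; exact: mono.
Unshelve. all: end_near.
Qed.

End MeanGradient.

(** * The interior of a convex hull and properness *)

Lemma segment_lt {R : realFieldType} (u v c t : R) : u < c -> v < c -> 0 <= t <= 1 ->
  u + t * (v - u) < c.
Proof.
move=> uc vc /andP [t0 t1]; have [->|tn] := eqVneq t 0; first by rewrite mul0r addr0.
have h1 : 0 < t * (c - v) by rewrite mulr_gt0 ?subr_gt0 // lt_neqAle eq_sym tn.
have h2 : 0 <= (1 - t) * (c - u) by rewrite mulr_ge0 ?subr_ge0 // ltW.
nra.
Qed.

Section HullInterior.
Context {R : realType} (V : normedModType R) {fV : FinDim V}.

(* The hull of [a0 :: l], in a form whose compactness follows by induction. *)
Fixpoint finite_hull (a0 : V) (l : seq V) : set V :=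
  match l with
  | [::] => [set a0]
  | b :: l' => [set q.1 *: b + (1 - q.1) *: q.2 | q in `[0, 1]%classic `*` finite_hull a0 l']
  end.

Lemma finite_hull_compact a0 l : compact (finite_hull a0 l).
Proof.
elim: l => [|b l IHl] /=; first exact: compact_set1.
apply: continuous_compact; last first.
  by apply: compact_setX => //; exact: segment_compact.
apply: continuous_subspaceT => q.
have c1 : {for q, continuous (fun q : R^o * V => q.1)} by exact: cvg_fst.
have c2 : {for q, continuous (fun q : R^o * V => q.2)} by exact: cvg_snd.
have c3 : {for q, continuous (fun q : R^o * V => q.1 *: b + (1 - q.1) *: q.2)}.
  apply: continuousD; first by apply: (continuousZ c1); exact: cst_continuous.
  apply: (continuousZ _ c2).
  by apply: (continuousB _ c1); exact: cst_continuous.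
exact: c3.
Qed.

(** The weight of b in the combination is u = t r + (1 - t) s; the rest is renormalised by 1 - u, so
    the case u = 1 is treated apart. *)
Lemma finite_hull_convex a0 l x y (t : R) : finite_hull a0 l x -> finite_hull a0 l y ->
  0 <= t <= 1 -> finite_hull a0 l (t *: x + (1 - t) *: y).
Proof.
elim: l x y t => [|b l IHl] x y t /=.
  by move=> -> -> _; rewrite -scalerDl addrC subrK scale1r.
move=> [[r x'] /= [r01 hx'] <-] [[s y'] /= [s01 hy'] <-] /andP [t0 t1].
move: r01 s01; rewrite !in_itv /= => /andP [r0 r1] /andP [s0 s1].
pose u := t * r + (1 - t) * s.
have u0 : 0 <= u by rewrite /u; nra.
have u1 : u <= 1 by rewrite /u; nra.
have [e1|ne1] := eqVneq u 1.
  exists (u, x'); first by split => //=; rewrite in_itv /= u0 u1.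
  rewrite /= e1 subrr scale0r addr0 scale1r.
  have h1 : t * (1 - r) = 0 by rewrite /u in e1; nra.
  have h2 : (1 - t) * (1 - s) = 0 by rewrite /u in e1; nra.
  rewrite !scalerDr !scalerA h1 h2 !scale0r !addr0 -scalerDl.
  by rewrite -[X in X *: b]/u e1 scale1r.
have un : 1 - u != 0 by rewrite subr_eq0 eq_sym.
have up : 0 < 1 - u by rewrite subr_gt0 lt_neqAle ne1.
pose v := t * (1 - r) / (1 - u).
exists (u, v *: x' + (1 - v) *: y'); last first.
  have e2 : (1 - u) * v = t * (1 - r) by rewrite /v mulrCA mulfV // mulr1.
  have e3 : (1 - u) * (1 - v) = (1 - t) * (1 - s) by rewrite mulrBr e2 mulr1 /u; ring.
  by rewrite /= scalerDr !scalerA e2 e3 /u; module.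
split => /=; first by rewrite in_itv /= u0 u1.
apply: IHl => //; apply/andP; split; first by rewrite divr_ge0 ?(ltW up) // mulr_ge0 ?subr_ge0.
rewrite ler_pdivrMr // mul1r /u; nra.
Qed.

Lemma finite_hull_base a0 l : finite_hull a0 l a0.
Proof.
elim: l => [|b l IHl] //=; exists (0, a0); first by split => //=; rewrite in_itv /= lexx ler01.
by rewrite /= scale0r subr0 scale1r add0r.
Qed.

Lemma finite_hull_mem a0 l b : b \in l -> finite_hull a0 l b.
Proof.
elim: l => [|c l IHl] //=; rewrite inE => /orP [/eqP ->|/IHl hb].
  exists (1, a0); last by rewrite /= subrr scale0r addr0 scale1r.
  by split => /=; [rewrite in_itv /= lexx ler01|exact: finite_hull_base].
exists (0, b); first by split => //=; rewrite in_itv /= lexx ler01.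
by rewrite /= scale0r subr0 scale1r add0r.
Qed.

Lemma finite_hull_sub (C : set V) a0 l :
  (forall x y (t : R), C x -> C y -> 0 <= t <= 1 -> C (t *: x + (1 - t) *: y)) ->
  C a0 -> (forall b, b \in l -> C b) -> finite_hull a0 l `<=` C.
Proof.
move=> cC Ca; elim: l => [|b l IHl] Cl /=; first by move=> _ ->.
move=> _ [[t x] /= [t01 hx] <-]; apply: cC.
- by apply: Cl; rewrite inE eqxx.
- by apply: IHl => // c cl; apply: Cl; rewrite inE cl orbT.
- by move: t01; rewrite in_itv.
Qed.

Variables (p : set V) (B : V -> V -> R).
Hypotheses (p_sub : subspace_set p) (p_closed : closed p) (B_bil : bilinear_form B)
  (B_sym : forall X Y, B X Y = B Y X) (B_pos : forall X, p X -> X <> 0 -> 0 < B X X).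

Definition unit_sphere : set V := [set X | p X /\ B X X = 1].

Let pZ t X : p X -> p (t *: X).
Proof. by have [p0 pP] := p_sub => pX; rewrite -[_ *: _]addr0; exact: pP. Qed.

Let pD X Y : p X -> p Y -> p (X + Y).
Proof. by have [_ pP] := p_sub => pX pY; rewrite -[X]scale1r; exact: pP. Qed.

Lemma form_continuous (X : topologicalType) (f g : X -> V) x : {for x, continuous f} ->
  {for x, continuous g} -> {for x, continuous (fun y => B (f y) (g y) : R^o)}.
Proof.
move=> cf cg; apply: (bil_cont (G := fun=> B)) => //.
  by near=> y.
by move=> ? ?; exact: cst_continuous.
Unshelve. all: end_near.
Qed.

Lemma form_norm X : p X -> 0 <= B X X.
Proof.
have [->|/eqP X0 pX] := eqVneq X 0; last exact: ltW (B_pos pX X0).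
by rewrite -(scale0r (0 : V)) (bilZl _ _ _ B_bil) mul0r.
Qed.

Lemma to_sphere X : p X -> X <> 0 -> exists t Y, [/\ 0 < t, unit_sphere Y, X = t *: Y & B X X = t ^+ 2].
Proof.
move=> pX X0; have Bp := B_pos pX X0; set t := Num.sqrt (B X X).
have t0 : 0 < t by rewrite sqrtr_gt0.
have tE : t ^+ 2 = B X X by rewrite sqr_sqrtr // ltW.
exists t, (t^-1 *: X); split => //.
  split; first exact: pZ.
  by rewrite (bilZl _ _ _ B_bil) (bilZr _ _ _ B_bil) -tE; field; rewrite gt_eqF.
by rewrite scalerA mulfV ?scale1r // gt_eqF.
Qed.

Lemma form_coercive : exists2 c, 0 < c & forall X, p X -> c * `|X| ^+ 2 <= B X X.
Proof.
pose S := [set X | p X /\ `|X| = 1].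
have cS : compact S.
  apply: (findim_compact (M := 1)); first by move=> X [_ ->].
  apply: closedI => //; apply: (@preimage_closed _ _ (fun X : V => `|X| : R^o) [set 1]).
    by move=> X _; exact: norm_continuous.
  exact: closed_eq.
have cB X : S X -> {for X, continuous (fun X => B X X : R^o)}.
  by move=> _; apply: form_continuous; exact: cvg_id.
have [S0|nS] := pselect (S !=set0); last first.
  exists 1 => // X pX; have -> : X = 0; last by rewrite normr0 expr0n mulr0 form_norm //; have [] := p_sub.
  apply: contrapT => /eqP X0; apply: nS; exists (`|X|^-1 *: X); split; first exact: pZ.
  by rewrite normrZ ger0_norm ?invr_ge0 // mulVf // normr_eq0.
have [X0 [pX0 nX0] Xmin] := cont_EVT_min S0 cS cB.
exists (B X0 X0).
  by apply: B_pos => // X00; move: nX0; rewrite X00 normr0 => /eqP; rewrite eq_sym oner_eq0.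
move=> X pX; have [->|X1] := eqVneq X 0.
  by rewrite normr0 expr0n mulr0 form_norm //; have [] := p_sub.
have nX : `|X| != 0 by rewrite normr_eq0.
have : S (`|X|^-1 *: X).
  by split; [exact: pZ|rewrite normrZ ger0_norm ?invr_ge0 // mulVf].
move/Xmin; rewrite (bilZl _ _ _ B_bil) (bilZr _ _ _ B_bil) => h.
have -> : B X X = (`|X|^-1 * (`|X|^-1 * B X X)) * `|X| ^+ 2 by field.
by rewrite ler_wpM2r // sqr_ge0.
Qed.

Lemma unit_sphere_compact : compact unit_sphere.
Proof.
have [c c0 hc] := form_coercive.
apply: (findim_compact (M := 1 + c^-1)).
  move=> X [pX BX]; have := hc X pX; rewrite BX => h.
  have : `|X| ^+ 2 <= c^-1 by rewrite -[c^-1]mul1r ler_pdivlMr // mulrC.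
  have := normr_ge0 X; have : 0 < c^-1 by rewrite invr_gt0.
  by nra.
apply: closedI => //; apply: (@preimage_closed _ _ (fun X : V => B X X : R^o) [set 1]).
  by move=> X _; apply: form_continuous; exact: cvg_id.
exact: closed_eq.
Qed.

Variable A : set V.
Hypotheses (A_p : A `<=` p) (A0 : A !=set0).

(** The direction from the point x0 of K nearest to y separates strictly: convexity of K gives B(Y,
    x - x0) at most 0, and B(Y, Y) is positive. *)
Lemma separation (K : set V) y : compact K -> K !=set0 -> K `<=` p ->
  (forall x x' (t : R), K x -> K x' -> 0 <= t <= 1 -> K (t *: x + (1 - t) *: x')) -> p y -> ~ K y ->
  exists2 X, unit_sphere X & forall x, K x -> B x X < B y X.
Proof.
move=> cK K0 Kp Kc py nKy.
have cf x : K x -> {for x, continuous (fun x => B (y - x) (y - x) : R^o)}.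
  have cx : {for x, continuous (fun x => y - x)}.
    by apply: continuousB; [exact: cst_continuous|exact: cvg_id].
  by move=> _; exact: form_continuous.
have [x0 Kx0 xmin] := cont_EVT_min K0 cK cf.
set Y := y - x0.
have pY : p Y by rewrite /Y addrC -scaleN1r; apply: pD => //; apply: pZ; exact: Kp.
have Y0 : Y <> 0.
  by move=> /eqP; rewrite subr_eq0 => /eqP yx; apply: nKy; rewrite yx.
have [t [X [t0 SX YX BY]]] := to_sphere pY Y0.
exists X => // x Kx.
suff : B x Y < B y Y by rewrite YX !(bilZr _ _ _ B_bil) ltr_pM2l.
have expand Y' D r : B (Y' - r *: D) (Y' - r *: D) = B Y' Y' - 2 * r * B Y' D + r ^+ 2 * B D D.
  rewrite (bilBl _ _ _ B_bil) !(bilBr _ _ _ B_bil) !(bilZl _ _ _ B_bil) !(bilZr _ _ _ B_bil).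
  by rewrite (B_sym D Y'); ring.
have key r : 0 <= r <= 1 -> 2 * r * B Y (x - x0) <= r ^+ 2 * B (x - x0) (x - x0).
  move=> r01; have := xmin _ (Kc _ _ _ Kx Kx0 r01).
  have -> : y - (r *: x + (1 - r) *: x0) = Y - r *: (x - x0) by rewrite /Y; module.
  by rewrite -/Y expand; lra.
have le0 : B Y (x - x0) <= 0.
  rewrite leNgt; apply/negP => b0; set b := B Y (x - x0) in key b0; set q := B (x - x0) (x - x0) in key.
  have q0 : 0 <= q.
    by apply: form_norm; rewrite addrC -scaleN1r; apply: pD; [apply: pZ|]; exact: Kp.
  (* A step small enough to stay on the segment and to make the gain 2 r b exceed the loss r^2 q,
     against minimality of x0. *)
  pose r := b / (b + q).
  have bq : 0 < b + q by rewrite ltr_pwDl.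
  have r0 : 0 < r by rewrite divr_gt0.
  have r1 : r <= 1 by rewrite ler_pdivrMr // mul1r lerDl.
  have := key r; rewrite (ltW r0) r1 => /(_ isT).
  have rb : r * (b + q) = b by rewrite /r mulfVK // gt_eqF.
  nra.
have BYY : 0 < B Y Y by exact: B_pos.
have e1 : B y Y = B Y Y + B x0 Y by rewrite -(bilDl _ _ _ B_bil) subrK.
move: le0; rewrite (bilBr _ _ _ B_bil) (B_sym Y x) (B_sym Y x0) e1; lra.
Qed.

(** The hull itself need not be closed, so separation is applied to the hull of finitely many points
    of A. Compactness of the unit sphere selects them so that for y' near y each direction is beaten
    by one of them; a y' outside their compact hull would be separated from it, a contradiction. *)
Lemma interior_hullP y : interior_in p (convex_hull A) y <->
  p y /\ forall X, p X -> X <> 0 -> exists2 a, A a & B y X < B a X.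
Proof.
split.
  move=> [py [N [oN Ny] NH]]; split => // X pX X0.
  apply: contrapT => h.
  have ct : {for (0 : R^o), continuous (fun t : R^o => y + t *: X : V)}.
    by apply: continuousD; [exact: cst_continuous|exact: scalel_continuous].
  have N1 : \forall z \near y, N z by exact: open_nbhs_nbhs.
  have e0 : y + (0 : R^o) *: X = y by rewrite scale0r addr0.
  have [e /= e0' /(_ (e / 2))] := (nbhs_ballP _ _).1 (near_comp (P := N) ct e0 N1).
  rewrite /ball /= sub0r normrN gtr0_norm ?divr_gt0 // ltr_pdivrMr // ltr_pMr // ltr1n => /(_ isT) Ne.
  have hull : convex_hull A (y + (e / 2) *: X) by apply: NH; split => //; apply: pD => //; exact: pZ.
  have hA a : A a -> (B a X : R^o) <= B y X.
    by move=> Aa; rewrite leNgt; apply/negP => lt'; apply: h; exists a.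
  have := convex_hull_le (bil_linl X B_bil) hA hull.
  rewrite (bilDl _ _ _ B_bil) (bilZl _ _ _ B_bil) gerDl leNgt mulr_gt0 ?divr_gt0 //; exact: B_pos.
move=> [py Hy]; split => //.
have [a0 Aa0] := A0.
have lt_near (q : V * V) a : B q.1 q.2 < B a q.2 -> \forall z \near q, B z.1 z.2 < B a z.2.
  move=> lq.
  have c1 : {for q, continuous (fun z : V * V => a - z.1)}.
    by apply: continuousB; [exact: cst_continuous|exact: cvg_fst].
  have c2 : {for q, continuous (fun z : V * V => z.2)} by exact: cvg_snd.
  have : \forall z \near q, 0 < (B (a - z.1) z.2 : R^o).
    by apply: (@near_comp _ _ _ _ _ (fun r : R^o => 0 < r) (form_continuous c1 c2) erefl); apply: lt_nbhsr; rewrite (bilBl _ _ _ B_bil) subr_gt0.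
  by apply: filterS => z; rewrite (bilBl _ _ _ B_bil) subr_gt0.
have oS a : A a -> open [set X | B y X < B a X].
  move=> _; rewrite openE => X /= lX.
  have c1 : {for X, continuous (fun X => (y, X))}.
    by apply: cvg_pair; [exact: cvg_cst|exact: cvg_id].
  exact: near_comp c1 erefl (lt_near (y, X) a lX).
have cov : unit_sphere `<=` cover A (fun a => [set X | B y X < B a X]).
  move=> X [pX BX]; have X0 : X <> 0.
    by move=> X0; move: BX; rewrite X0 -(scale0r (0 : V)) (bilZl _ _ _ B_bil) mul0r => /eqP; rewrite eq_sym oner_eq0.
  by have [a Aa la] := Hy X pX X0; exists a.
have := unit_sphere_compact; rewrite compact_cover => /(_ _ _ _ oS cov) [D' DA Dcov].
pose l := finmap.enum_fset D'.
have lA b : b \in l -> A b by move=> bl; have := DA b bl; rewrite inE.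
pose K := finite_hull a0 l.
have Kp : K `<=` p.
  apply: finite_hull_sub; [|exact: A_p|by move=> b /lA /A_p].
  by move=> u v t pu pv _; apply: pD; exact: pZ.
have KA : K `<=` convex_hull A.
  apply: finite_hull_sub; [|exact: sub_convex_hull|by move=> b /lA; exact: sub_convex_hull].
  exact: convex_hull_convex.
have tube : \forall y' \near y, forall X, unit_sphere X -> exists2 a, a \in l & B y' X < B a X.
  apply: (compact_tube (P := fun y' X => exists2 a, a \in l & B y' X < B a X)); first exact: unit_sphere_compact.
  move=> X SX; have [a /= Da la] := Dcov X SX.
  by apply: filterS (lt_near (y, X) a la) => q lq; exists a.
have [N [oN Ny] NH] := near_open tube.
exists N => // y' [Ny' py']; apply: KA; apply: contrapT => nK.
have K0 : K !=set0 by exists a0; exact: finite_hull_base.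
have [X SX sep] := separation (@finite_hull_compact a0 l) K0 Kp (@finite_hull_convex a0 l) py' nK.
have [a al la] := NH y' Ny' X SX.
by have := lt_trans la (sep a (finite_hull_mem a0 al)); rewrite ltxx.
Qed.

Lemma interior_hull_convex y y' (t : R) : interior_in p (convex_hull A) y ->
  interior_in p (convex_hull A) y' -> 0 <= t <= 1 -> interior_in p (convex_hull A) (y + t *: (y' - y)).
Proof.
move=> /interior_hullP [py hy] /interior_hullP [py' hy'] /andP [t0 t1]; apply/interior_hullP; split.
  by apply: pD => //; apply: pZ; rewrite addrC -scaleN1r; apply: pD => //; exact: pZ.
move=> X pX X0; have [a Aa la] := hy X pX X0; have [a' Aa' la'] := hy' X pX X0.
rewrite (bilDl _ _ _ B_bil) (bilZl _ _ _ B_bil) (bilBl _ _ _ B_bil).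
have [aa|aa] := leP (B a X) (B a' X); [exists a' => //|exists a => //].
  by apply: segment_lt => //; [exact: lt_le_trans aa|rewrite t0].
by apply: segment_lt => //; [exact: lt_trans aa|rewrite t0].
Qed.

End HullInterior.

(** A locally constant property on a convex set is constant, by connectedness of [0, 1]. E need not
    be open in V; it serves both for surjectivity and for the type of the fibres. *)
Lemma segment_induction {R : realType} (V : normedModType R) (E : set V) (P : V -> Prop) :
  (forall y z (t : R), E y -> E z -> 0 <= t <= 1 -> E (y + t *: (z - y))) ->
  (forall y, E y -> exists2 N, open N /\ N y & forall z z', E z -> E z' -> N z -> N z' -> P z -> P z') ->
  forall y z, E y -> E z -> P y -> P z.
Proof.
move=> cE loc y z Ey Ez Py.
pose c (t : R) : V := y + t *: (z - y).
have cc (t : R) : {for t, continuous c}.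
  apply: (@continuousD _ _ _ (fun=> y) (fun t : R^o => t *: (z - y))); first exact: cst_continuous.
  exact: scalel_continuous.
pose J : set R := `[0, 1]%classic.
have JE t : J t -> E (c t) by rewrite /J /= in_itv /= => t01; exact: cE.
have near_loc t : J t -> \forall s \near t, J s -> P (c t) <-> P (c s).
  move=> Jt; have [N [oN Nt] NP] := loc _ (JE t Jt).
  have N1 : \forall x \near c t, N x by exact: open_nbhs_nbhs.
  apply: filterS (near_comp (cc t) erefl N1) => s Ns Js.
  by split; apply: NP => //; exact: JE.
(* Conditional on s in the interval, so that their interiors in the line trace the relatively open
   sets where P holds and where it fails. *)
pose D1 := [set s | J s -> P (c s)]; pose D2 := [set s | J s -> ~ P (c s)].
have E1 : [set t | J t /\ P (c t)] = J.
  apply: segment_connected.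
  - by exists 0; split; [rewrite /J /= in_itv /= lexx ler01|rewrite /c scale0r addr0].
  - exists D1^°; first exact: open_interior.
    apply/seteqP; split => t; last by move=> [Jt /interior_subset h]; split => //; exact: h.
    move=> [Jt Pt]; split => //; rewrite /interior; apply: filterS (near_loc t Jt) => s h Js.
    by apply/(h Js).
  - exists (~` D2^°); first by apply: open_closedC; exact: open_interior.
    apply/seteqP; split => t.
      by move=> [Jt Pt]; split => // /interior_subset /(_ Jt).
    move=> [Jt nD]; split => //; apply: contrapT => nP; apply: nD.
    by rewrite /interior; apply: filterS (near_loc t Jt) => s h Js /(h Js).
have : J 1 by rewrite /J /= in_itv /= lexx ler01.
by rewrite -E1 => -[_]; rewrite /c scale1r addrC subrK.
Qed.

Lemma continuous_pair (X Y Z : topologicalType) (f : X -> Y) (g : X -> Z) x :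
  {for x, continuous f} -> {for x, continuous g} -> {for x, continuous (fun y => (f y, g y))}.
Proof. by move=> cf cg; apply: (cvg_pair cf cg). Qed.

(** * Properness of the averaged gradient map *)

Section Properness.
Context {R : realType} (H : topGroupType) (V : normedModType R) {fV : FinDim V}.
Variables (r : nat) (iota : 'rV[R]_r -> V) (B : V -> V -> R) (K : set H) (F : H -> V)
  (expi : 'rV[R]_r -> H) (A : set V).
Hypotheses (iota_lin : linear iota) (iota_inj : forall v, iota v = 0 -> v = 0)
  (B_bil : bilinear_form B) (B_pos : forall v, iota v <> 0 -> 0 < B (iota v) (iota v))
  (B_sym : forall X Y, B X Y = B Y X)
  (K_compact : compact K)
  (F_cont : continuous (fun q : 'rV[R]_r * H => F (expi q.1 * q.2)%g))
  (F_mono : forall v k s t, v <> 0 -> K k -> s < t ->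
     B (F (expi (s *: v) * k)%g) (iota v) < B (F (expi (t *: v) * k)%g) (iota v))
  (F_lim : forall v k a c, K k -> A a -> c < B a (iota v) ->
     exists T : R, forall t, T <= t -> c < B (F (expi (t *: v) * k)%g) (iota v)).

Let iota_cont : continuous iota. Proof. exact: findim_linear_continuous. Qed.

Definition pullback_form (v w : 'rV[R]_r) : R := B (iota v) (iota w).
Local Notation Bi := pullback_form.

Lemma pullback_bilinear : bilinear_form Bi.
Proof.
by split => [u k x y|u k x y] /=; rewrite /Bi iota_lin ?(bilDr _ _ _ B_bil) ?(bilZr _ _ _ B_bil)
  ?(bilDl _ _ _ B_bil) ?(bilZl _ _ _ B_bil).
Qed.

Lemma pullback_pos v : v <> 0 -> 0 < Bi v v.
Proof. by move=> v0; apply: B_pos => /iota_inj. Qed.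

Let setT_sub : subspace_set [set: 'rV[R]_r]. Proof. by []. Qed.

Let sphere_compact : compact (unit_sphere [set: 'rV[R]_r] Bi).
Proof.
apply: (unit_sphere_compact setT_sub closedT pullback_bilinear).
by move=> v _; exact: pullback_pos.
Qed.

(** Uniformity as t tends to infinity becomes a tube statement in an extra parameter e near 0, with
    t e at least 1 in place of t at least 1 / e. At one unit direction and one k, a single time T
    puts the value beyond a level c that separates it from y; this persists nearby by continuity and
    later by monotonicity. *)
Lemma mean_gradient_proper y : (forall v, v <> 0 -> exists2 a, A a & B y (iota v) < B a (iota v)) ->
  exists T N, [/\ 0 < T, open N /\ N y & forall v k, K k -> N (F (expi v * k)%g) -> Bi v v <= T ^+ 2].
Proof.
move=> Hy; pose S := unit_sphere [set: 'rV[R]_r] Bi.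
have tube : \forall e \near ((y, 0) : V * R^o), forall q : 'rV[R]_r * H, (S `*` K) q ->
    forall t : R, 0 <= t -> 1 <= t * e.2 -> S q.1 -> K q.2 -> F (expi (t *: q.1) * q.2)%g <> e.1.
  apply: (compact_tube (P := fun (e : V * R^o) (q : 'rV[R]_r * H) => forall t : R, 0 <= t ->
    1 <= t * e.2 -> S q.1 -> K q.2 -> F (expi (t *: q.1) * q.2)%g <> e.1)).
    exact: compact_setX.
  move=> [w0 k0] /= [[_ Sw0] Kk0].
  have w0n : w0 <> 0.
    by move=> w00; move: Sw0; rewrite w00 -(scale0r (0 : 'rV[R]_r)) (bilZl _ _ _ pullback_bilinear) mul0r => /eqP; rewrite eq_sym oner_eq0.
  have [a Aa la] := Hy w0 w0n; pose c := (B y (iota w0) + B a (iota w0)) / 2.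
  have [yc ca] : B y (iota w0) < c /\ c < B a (iota w0) by rewrite /c; split; lra.
  have [T0 hT0] := F_lim Kk0 Aa ca.
  (* T is made positive so that e below its inverse forces t to be at least T. *)
  pose T := Num.max T0 1; have T1 : 1 <= T by rewrite le_max lexx orbT.
  have hT : c < B (F (expi (T *: w0) * k0)%g) (iota w0) by apply: hT0; rewrite le_max lexx.
  have cw : {for w0, continuous (fun w : 'rV[R]_r => T *: w : 'rV[R]_r)} by exact: scaler_continuous.
  have c1 : {for (w0, k0), continuous (fun q : 'rV[R]_r * H => B (F (expi (T *: q.1) * q.2)%g) (iota q.1) : R^o)}.
    apply: form_continuous => //.
      apply: (@continuous_comp _ _ _ (fun q : 'rV[R]_r * H => (T *: q.1, q.2)) (fun q => F (expi q.1 * q.2)%g)).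
        by apply: continuous_pair; [exact: (continuous_prod_fst (p := (w0, k0)) cw)|exact: cvg_snd].
      exact: F_cont.
    exact: (continuous_prod_fst (p := (w0, k0)) (@iota_cont w0)).
  have N1 : \forall q \near (w0, k0), c < B (F (expi (T *: q.1) * q.2)%g) (iota q.1).
    by apply: (near_comp (P := fun x : R^o => c < x) c1 erefl); exact: lt_nbhsr.
  have c2 : {for (y, w0), continuous (fun q : V * 'rV[R]_r => B q.1 (iota q.2) : R^o)}.
    apply: form_continuous => //; first exact: cvg_fst.
    exact: (continuous_prod_snd (p := (y, w0)) (@iota_cont w0)).
  have N2 : \forall q \near (y, w0), B q.1 (iota q.2) < c.
    by apply: (near_comp (P := fun x : R^o => x < c) c2 erefl); exact: lt_nbhsl.
  have N3 : \forall e \near (0 : R^o), e < T^-1 by apply: lt_nbhsl; rewrite invr_gt0 (lt_le_trans ltr01).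
  pose Z := ((V * R^o) * ('rV[R]_r * H))%type.
  have p1 : {for ((y, 0), (w0, k0)) : Z, continuous (fun z : Z => z.2)} by exact: cvg_snd.
  have p2 : {for ((y, 0), (w0, k0)) : Z, continuous (fun z : Z => (z.1.1, z.2.1))}.
    apply: continuous_pair; apply: (@continuous_comp _ _ _ _ (fun q => q.1)); first exact: cvg_fst.
    + exact: cvg_fst.
    + exact: cvg_snd.
    + exact: cvg_fst.
  have p3 : {for ((y, 0), (w0, k0)) : Z, continuous (fun z : Z => z.1.2)}.
    by apply: (@continuous_comp _ _ _ (fun z : Z => z.1) (fun q => q.2)); [exact: cvg_fst|exact: cvg_snd].
  apply: filterS3 (near_comp p1 erefl N1) (near_comp p2 erefl N2) (near_comp p3 erefl N3).
  move=> [[y' e] [w k]] /= h1 h2 h3 t t0 te [_ Sw] Kk Fy.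
  have w_n : w <> 0.
    by move=> w00; move: Sw; rewrite w00 -(scale0r (0 : 'rV[R]_r)) (bilZl _ _ _ pullback_bilinear) mul0r => /eqP; rewrite eq_sym oner_eq0.
  have Tt : T <= t.
    rewrite leNgt; apply/negP => tT; have T0' : 0 < T by exact: lt_le_trans ltr01 T1.
    have e0 : 0 < e.
      rewrite ltNge; apply/negP => e0; have := mulr_ge0_le0 t0 e0; lra.
    have : t * e < 1.
      apply: (@le_lt_trans _ _ (T * e)); first by rewrite ler_wpM2r // ltW.
      by rewrite mulrC -ltr_pdivlMr // mul1r.
    by rewrite ltNge te.
  have : c < B (F (expi (t *: w) * k)%g) (iota w).
    move: Tt; rewrite le_eqVlt => /orP [/eqP <- //|Tt]; apply: lt_trans h1 _.
    exact: F_mono.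
  by rewrite Fy => h4; have := lt_trans h2 h4; rewrite ltxx.
have [[N1 N2] /= [n1 n2] NP] := tube.
have [e /= e0 he] := (nbhs_ballP _ _).1 n2.
have e2 : N2 (e / 2).
  by apply: he; rewrite /ball /= sub0r normrN gtr0_norm ?divr_gt0 // ltr_pdivrMr // ltr_pMr // ltr1n.
have [N [oN Ny] NN] := near_open n1.
exists (2 / e), N; split => //; first by rewrite divr_gt0.
move=> v k Kk NF; have [->|/eqP v0] := eqVneq v 0.
  by rewrite -(scale0r (0 : 'rV[R]_r)) (bilZl _ _ _ pullback_bilinear) mul0r sqr_ge0.
have [t [w [t0 Sw vE Bt]]] := to_sphere setT_sub pullback_bilinear (fun u w => B_sym (iota u) (iota w)) (fun v _ => @pullback_pos v) (I : [set: _] v) v0.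
rewrite Bt ler_sqr ?nnegrE ?(ltW t0) ?divr_ge0 ?(ltW e0) // leNgt; apply/negP => lt'.
have te : 1 <= t * (e / 2).
  by rewrite -ler_pdivrMr ?divr_gt0 // mul1r invf_div ltW.
have := NP (F (expi v * k)%g, e / 2) (conj (NN _ NF) e2) (w, k) (conj Sw Kk) t (ltW t0) te Sw Kk.
by rewrite /= -vE.
Qed.

End Properness.

(** * Local solutions and the fibration *)

Lemma partial_diff_linear {R : realType} (P V W : normedModType R) (Phi : P * V -> W) z :
  linear (fun v => 'd Phi z (0, v)).
Proof.
have ld : linear ('d Phi z) by move=> k x y; rewrite linearP.
exact: (lin_comp (@pairr_linear R P V) ld).
Qed.

Lemma diff_add_cst {R : realType} (V W : normedModType R) (f : V -> W) (k : W) x v :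
  differentiable f x -> differentiable (fun y => f y + k) x /\ 'd (fun y => f y + k) x v = 'd f x v.
Proof.
move=> df; have -> : (fun y => f y + k) = f + cst k by [].
have df' : is_diff x f ('d f x) by exact: differentiableP.
have dfk : is_diff x (f + cst k) (('d f x : V -> W) + 0) by exact: is_diffD.
by split; [exact: ex_diff|rewrite diff_val fctE /= addr0].
Qed.

Lemma affine_curve {R : realType} (W : normedModType R) (w0 w : W) :
  differentiable (fun t : R^o => t *: w + w0) 0 /\ 'd (fun t : R^o => t *: w + w0) 0 1 = w.
Proof.
pose L (t : R^o) := t *: w.
have lL : linear L by move=> c s t; rewrite /L scalerDl scalerA.
have [dL LE] := diff_lin_fun (0 : R^o) lL (findim_linear_continuous lL).
have [d1 E1] := diff_add_cst w0 (1 : R^o) dL.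
by split => //; rewrite E1 LE /L scale1r.
Qed.

Lemma diff_along_line {R : realType} (P V W : normedModType R) (Phi : P * V -> W) (l : W -> R^o)
  (h : R^o -> R^o) a v k : linear l -> continuous l -> differentiable Phi (a, 0) ->
  (forall t, h t = l (Phi (a, t *: v)) + k) -> 'd h 0 1 = l ('d Phi (a, 0) (0, v)).
Proof.
move=> ll cl dPhi hE.
have [] := affine_curve ((a, 0) : P * V) (0, v).
set gam := (fun t : R^o => _) => dg gE1.
have gE t : gam t = (a, t *: v).
  by rewrite /gam -[LHS]/(t *: 0 + a, t *: v + 0) scaler0 add0r addr0.
have g0 : gam 0 = (a, 0) by rewrite gE scale0r.
have dPg : differentiable (Phi \o gam) 0 by apply: differentiable_comp; rewrite ?g0.
have E1 := diff_compE (1 : R^o) dg dPhi g0; rewrite gE1 in E1.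
have E2 := diff_linE (1 : R^o) ll cl dPg; rewrite E1 in E2; rewrite -E2.
have dl : differentiable (fun t => l (Phi (gam t))) 0.
  apply: (differentiable_comp dPg); exact: (diff_lin_fun _ ll cl).1.
have -> : h = (fun t => l (Phi (gam t)) + k) by apply/funext => t; rewrite hE gE.
by have [_ ->] := diff_add_cst k (1 : R^o) dl.
Qed.

Section LocalSections.
Context {R : realType} (H : topGroupType) (d : nat) (a : atlas H (Cn R d)).
Hypothesis Hlie : is_complex_lie_group a.
Let aH : IsAtlas a. Proof. by have [[? _] _ _] := Hlie; exact: manifold_isAtlas. Qed.
Existing Instance aH.
Local Notation V := (Cn R d).
Local Notation vH := (@vec_atlas R (Cn R d)).
Variables (r : nat) (p : set V) (iota : 'rV[R]_r -> V) (q : V -> 'rV[R]_r).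
Local Notation vr := (@vec_atlas R 'rV[R]_r).
Hypotheses (iota_lin : linear iota) (q_lin : linear q) (iotaK : cancel iota q)
  (iota_p : forall v, p (iota v)) (qK : forall X, p X -> iota (q X) = X).
Variables (B : V -> V -> R) (B_bil : bilinear_form B).
Variables (G : set H) (F : H -> V) (expi : 'rV[R]_r -> H).
Hypotheses (F_smooth : forall g, smooth_at a vH F g) (F_p : forall g, p (F g))
  (expi_smooth : forall v, smooth_at vr a expi v) (expi0 : expi 0 = 1%g)
  (F_pos : forall g v, G g -> v <> 0 ->
    0 < 'd (fun t : R^o => B (F (expi (t *: v) * g)%g) (iota v) : R^o) 0 1).

Let F_cont : continuous F. Proof. by move=> g; exact: smooth_at_cont (F_smooth g). Qed.

Lemma translate_smooth (X : topologicalType) (E : normedModType R) (b : atlas X E)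
    {bX : IsAtlas b} {fE : FinDim E} (f : X -> 'rV[R]_r) (h : X -> H) x :
  smooth_at b vr f x -> smooth_at b a h x ->
  smooth_at b vH (fun y => F (expi (f y) * h y)%g) x.
Proof.
move=> sf sh; have [s1 _] := smooth_at_comp sf (expi_smooth (f x)).
have [s2 _] := smooth_mul Hlie s1 sh.
exact: (smooth_at_comp s2 (F_smooth _)).1.
Qed.

(** Implicit function theorem for the p-coordinates of F(exp(v) g) - y. The partial differential L
    at v = 0 is injective because B(L v, v) is the derivative in [F_pos], positive for v nonzero.
    Coordinates determine elements of p only, hence the condition on z.2. *)
Lemma local_solution g0 : G g0 -> exists rho (Psi : H * V -> 'rV[R]_r),
  [/\ 0 < rho, Psi (g0, F g0) = 0, smooth_at (prod_atlas a vH) vr Psi (g0, F g0) &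
    \forall z \near (g0, F g0), p z.2 -> F (expi (Psi z) * z.1)%g = z.2 /\
      forall v, `|v| < rho -> F (expi v * z.1)%g = z.2 -> v = Psi z].
Proof.
move=> Gg0; set e0 := cfun (a g0) g0; set y0 := F g0.
have d0 : cdom (a g0) g0 by exact: atlas_dom.
have i0 : cimg (a g0) e0 by exact: cfun_img.
have ce0 : cinv (a g0) e0 = g0 by exact: cfunK.
pose P : normedModType R := (V * V)%type.
pose Phi (z : P * 'rV[R]_r) : 'rV[R]_r := q (F (expi z.2 * cinv (a g0) z.1.1)%g) - q z.1.2.
have cq : continuous q by exact: findim_linear_continuous.
have sPhi : smooth_near Phi ((e0, y0), 0).
  have s2 : smooth_at (@vec_atlas R (P * 'rV[R]_r)%type) vr snd ((e0, y0), 0).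
    by apply/smooth_at_vec; apply: smooth_near_linear.
  have s1 : smooth_at (@vec_atlas R (P * 'rV[R]_r)%type) vH (fun z => z.1.1) ((e0, y0), 0).
    by apply/smooth_at_vec; apply: smooth_near_linear.
  have [s3 _] := smooth_at_comp s1 (cinv_smooth i0).
  have s4 := [elaborate translate_smooth s2 s3].
  have sq : smooth_at vH vr q (F (expi 0 * cinv (a g0) e0)%g).
    by apply/smooth_at_vec; exact: smooth_near_linear.
  have [s5 _] := smooth_at_comp s4 sq.
  apply: smooth_near_add; first by move/smooth_at_vec: s5.
  apply: smooth_near_linear; apply: lin_oppf.
  by move=> c u v; rewrite -[LHS]/(q (c *: u.1.2 + v.1.2)) q_lin.
have Phi0 : Phi ((e0, y0), 0) = 0 by rewrite /Phi /= expi0 mul1g ce0 subrr.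
have dPhi := smooth_near_diff sPhi.
pose L v := 'd Phi ((e0, y0), 0) (0, v).
have lL : linear L by exact: partial_diff_linear.
have L0 v : L v = 0 -> v = 0.
  move=> Lv; apply: contrapT => v0.
  pose l (u : 'rV[R]_r) : R^o := B (iota u) (iota v).
  have ll : linear l by move=> c u w; rewrite /l iota_lin (bilDl _ _ _ B_bil) (bilZl _ _ _ B_bil).
  have cl : continuous l by exact: findim_linear_continuous.
  have hE t : B (F (expi (t *: v) * g0)%g) (iota v) = l (Phi ((e0, y0), t *: v)) + l (q y0).
    by rewrite /Phi /= ce0 (lin_sub ll) subrK /l qK.
  have := F_pos Gg0 v0; rewrite (diff_along_line ll cl dPhi hE) -/(L v) Lv (lin_zero ll) ltxx.
  done.
have [S [lS SK KS]] := [elaborate lin_inverse lL L0].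
have [rho [psi [rho0 psi0 psiP spsi]]] :=
  implicit_function (V := ('rV[R]_r : normedModType R)) (W := ('rV[R]_r : normedModType R)) _ _ _ sPhi Phi0 lS SK KS.
pose Psi (z : H * V) := psi (cfun (a g0) z.1, z.2).
have sc : smooth_at (prod_atlas a vH) (prod_atlas vH vH) (fun z : H * V => (cfun (a g0) z.1, z.2)) (g0, y0).
  have [s1 _] := smooth_at_fst a vH (g0, y0).
  have [s2 _] := smooth_at_snd a vH (g0, y0).
  have [s3 _] := smooth_at_comp s1 (cfun_smooth d0).
  exact: (smooth_at_pair s3 s2).1.
exists rho, Psi; split => //.
- have sp : smooth_at (prod_atlas vH vH) vr psi (e0, y0).
    by rewrite prod_vec_atlas; apply/smooth_at_vec.
  exact: (smooth_at_comp sc sp).1.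
- have N1 := near_comp (smooth_at_cont sc) erefl psiP.
  have N2 : \forall z \near (g0, y0), cdom (a g0) (z : H * V).1.
    exact: (near_comp (x := (g0, y0)) cvg_fst erefl (cdom_near d0)).
  apply: filterS2 N1 N2 => [[g y]] /= [h1 h2 h3] dg py.
  have cg : cinv (a g0) (cfun (a g0) g) = g by exact: cfunK.
  have key v : Phi ((cfun (a g0) g, y), v) = 0 <-> F (expi v * g)%g = y.
    rewrite /Phi /= cg; split => [/eqP|->]; last by rewrite subrr.
    by rewrite subr_eq0 => /eqP /(congr1 iota); rewrite !qK.
  by split; [exact/key|move=> v vr' /key e3; apply: h3 => //; rewrite subr0].
Qed.

(** One radius for a whole compact set of g, so that the small solution is unique globally and the
    local ones given by [local_solution] glue. *)
Lemma uniform_injectivity (C : set H) : compact C -> C `<=` G -> exists2 rho, 0 < rho &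
  forall g v w, C g -> `|v| < rho -> `|w| < rho -> F (expi v * g)%g = F (expi w * g)%g -> v = w.
Proof.
move=> cC CG.
have tube : \forall rho \near (0 : R^o), forall g, C g ->
    forall v w, `|v| < rho -> `|w| < rho -> F (expi v * g)%g = F (expi w * g)%g -> v = w.
  apply: (compact_tube (P := fun rho g => forall v w : 'rV[R]_r, `|v| < rho -> `|w| < rho ->
    F (expi v * g)%g = F (expi w * g)%g -> v = w)) => // g0 Cg0.
  have [rho0 [Psi [rho00 Psi0 _ NP]]] := local_solution (CG _ Cg0).
  pose f (z : 'rV[R]_r * H) := (z.2, F (expi z.1 * z.2)%g).
  have cf : {for (0, g0), continuous f}.
    apply: continuous_pair; first exact: cvg_snd.
    have s1 := [elaborate translate_smooth (smooth_at_fst vr a (0, g0)).1 (smooth_at_snd vr a (0, g0)).1].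
    exact: smooth_at_cont s1.
  have f0 : f (0, g0) = (g0, F g0) by rewrite /f /= expi0 mul1g.
  have [[N1 N2] /= [n1 n2] NN] := near_comp cf f0 NP.
  have [e /= ep he] := (nbhs_ballP _ _).1 n1.
  exists ([set x : R^o | x < e] `&` [set x : R^o | x < rho0], N2); first split => //=.
    by apply: filterI; apply: lt_nbhsl.
  move=> [rho g] /= [[le lr] N2g] v w vr' wr' E1.
  have h u : `|u| < rho -> (g, F (expi u * g)%g) = f (u, g) /\ N1 u.
    move=> ur; split => //; apply: he; rewrite -ball_normE /ball_ /= sub0r normrN.
    exact: lt_trans ur le.
  have [_ N1v] := h v vr'.
  have := NN (v, g) (conj N1v N2g) (F_p _) => /= -[_ uniq].
  rewrite (uniq v (lt_trans vr' lr) erefl); apply: esym.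
  by apply: uniq; [exact: lt_trans wr' lr|rewrite E1].
have [e /= ep he] := (nbhs_ballP _ _).1 tube.
exists (e / 2); first by rewrite divr_gt0.
move=> g v w Cg; apply: (he (e / 2)) => //.
by rewrite /ball /= sub0r normrN gtr0_norm ?divr_gt0 // ltr_pdivrMr // ltr_pMr // ltr1n.
Qed.

(** Solutions smaller than a prescribed radius exist as soon as y is within one eps of F g, for all
    g in the compact set. The radius comes first because it is the one of [uniform_injectivity]. *)
Lemma uniform_existence (C : set H) (rho : R) : compact C -> C `<=` G -> 0 < rho ->
  exists2 eps, 0 < eps & forall g y, C g -> p y -> `|y - F g| < eps ->
    exists2 Psi, smooth_at (prod_atlas a vH) vr Psi (g, y) &
      \forall z \near (g, y), p z.2 -> `|Psi z| < rho /\ F (expi (Psi z) * z.1)%g = z.2.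
Proof.
move=> cC CG rho0.
have tube : \forall eps \near (0 : R^o), forall g, C g -> forall y, p y -> `|y - F g| < eps ->
    exists2 Psi, smooth_at (prod_atlas a vH) vr Psi (g, y) &
      \forall z \near (g, y), p z.2 -> `|Psi z| < rho /\ F (expi (Psi z) * z.1)%g = z.2.
  apply: (compact_tube (P := fun (eps : R^o) g => forall y, p y -> `|y - F g| < eps ->
    exists2 Psi, smooth_at (prod_atlas a vH) vr Psi (g, y) &
      \forall z \near (g, y), p z.2 -> `|Psi z| < rho /\ F (expi (Psi z) * z.1)%g = z.2)) => // g0 Cg0.
  have [rho1 [Psi [_ Psi0 sPsi NP]]] := local_solution (CG _ Cg0).
  have cPsi := smooth_at_cont sPsi.
  have N1 : \forall z \near (g0, F g0), `|Psi z| < rho.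
    have : \forall v \near Psi (g0, F g0), `|v| < rho.
      rewrite Psi0; apply/(nbhs_ballP _ _); exists rho => // v.
      by rewrite -ball_normE /ball_ /= sub0r normrN.
    exact: near_comp cPsi erefl.
  have N2 := [elaborate smooth_at_near sPsi].
  have N3 := filterI N2 (filterI N1 NP).
  have [[A1 A2] /= [n1 n2] NN] := N3.
  have [A [oA Ag] AA] := near_open n1.
  have [e /= ep he] := (nbhs_ballP _ _).1 n2.
  have ep2 : 0 < e / 2 by rewrite divr_gt0.
  have N4 : \forall g \near g0, `|F g0 - F g| < e / 2.
    by have /cvgrPdist_lt /(_ _ ep2) := @F_cont g0.
  exists ([set x : R^o | x < e / 2], A `&` [set g | `|F g0 - F g| < e / 2]).
    by split => /=; [exact: lt_nbhsl|apply: filterI => //; exact: open_nbhs_nbhs].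
  move=> [eps g] /= [le [Ag' Fg]] y py yF.
  have inA z : A z.1 -> `|F g0 - z.2| < e -> (A1 `*` A2) z.
    by move=> Az Fz; split; [exact: AA|apply: he; rewrite -ball_normE].
  have cen : `|F g0 - y| < e.
    rewrite -[F g0 - y](subrKA (F g)) (le_lt_trans (ler_normD _ _)) // [e]splitr ltrD //.
    by rewrite distrC; exact: lt_trans yF le.
  have [s1 _] := NN (g, y) (inA (g, y) Ag' cen).
  exists Psi => //.
  have M1 : \forall z \near (g, y), A (z : H * V).1.
    by apply: (near_comp (x := (g, y)) cvg_fst erefl); exact: open_nbhs_nbhs.
  have M2 : \forall z \near (g, y), `|F g0 - (z : H * V).2| < e.
    have M3 : \forall y' \near y, `|F g0 - y'| < e.
      have oB : open (ball (F g0) e) by exact: ball_open.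
      have : \forall y' \near y, ball (F g0) e y'.
        by apply: open_nbhs_nbhs; split => //; rewrite -ball_normE.
      by apply: filterS => y'; rewrite -ball_normE.
    exact: (near_comp (x := (g, y)) cvg_snd erefl M3).
  apply: filterS2 M1 M2 => z Az Fz pz.
  by have [_ [h1 /(_ pz) [h2 _]]] := NN z (inA z Az Fz).
have [e /= ep he] := (nbhs_ballP _ _).1 tube.
exists (e / 2); first by rewrite divr_gt0.
move=> g y Cg; apply: (he (e / 2)) => //.
by rewrite /ball /= sub0r normrN gtr0_norm ?divr_gt0 // ltr_pdivrMr // ltr_pMr // ltr1n.
Qed.

End LocalSections.

Section Diffeomorphisms.
Context {R : realType} (X : topologicalType) (E : normedModType R) (a : atlas X E)
  {aX : IsAtlas a} {fE : FinDim E}.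

Lemma diffeomorphic_sym (A B : set X) : diffeomorphic a a A B -> diffeomorphic a a B A.
Proof. by move=> [f [g [h1 h2 h3 h4]]]; exists g, f. Qed.

Lemma diffeomorphic_trans (A B C : set X) : diffeomorphic a a A B -> diffeomorphic a a B C ->
  diffeomorphic a a A C.
Proof.
move=> [f [g [f1 g1 sf sg]]] [f' [g' [f1' g1' sf' sg']]].
exists (f' \o f), (g \o g'); split.
- move=> x Ax; have [Bf gf] := f1 x Ax; have [Cf gf'] := f1' _ Bf.
  by split => //=; rewrite gf' gf.
- move=> z Cz; have [Bg fg'] := g1' z Cz; have [Ag fg] := g1 _ Bg.
  by split => //=; rewrite fg fg'.
- exact: (smooth_on_comp (fun x Ax => (f1 x Ax).1) sf sf').
- exact: (smooth_on_comp (fun x Ax => (g1' x Ax).1) sg' sg).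
Qed.

Lemma diffeomorphic_compact (A B : set X) : diffeomorphic a a A B -> compact A -> compact B.
Proof.
move=> [f [g [f1 g1 sf sg]]] cA; have -> : B = f @` A.
  apply/seteqP; split => [y By|_ [x Ax <-]]; last exact: (f1 x Ax).1.
  by have [Ag fg] := g1 y By; exists (g y).
by apply: continuous_compact => //; exact: smooth_on_continuous sf.
Qed.

Lemma diffeomorphic_connected (A B : set X) : diffeomorphic a a A B -> connected A -> connected B.
Proof.
move=> [f [g [f1 g1 sf sg]]] cA; have -> : B = f @` A.
  apply/seteqP; split => [y By|_ [x Ax <-]]; last exact: (f1 x Ax).1.
  by have [Ag fg] := g1 y By; exists (g y).
by apply: connected_continuous_connected => //; exact: smooth_on_continuous sf.
Qed.

End Diffeomorphisms.

(** * Local triviality and the fibres *)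

Section Fibration.
Context {R : realType} (H : topGroupType) (d : nat) (a : atlas H (Cn R d)).
Hypothesis Hlie : is_complex_lie_group a.
Let aH : IsAtlas a. Proof. by have [[? _] _ _] := Hlie; exact: manifold_isAtlas. Qed.
Existing Instance aH.
Local Notation V := (Cn R d).
Local Notation vH := (@vec_atlas R (Cn R d)).
Variables (r : nat) (p : set V) (iota : 'rV[R]_r -> V) (q : V -> 'rV[R]_r).
Local Notation vr := (@vec_atlas R 'rV[R]_r).
Hypotheses (iota_lin : linear iota) (q_lin : linear q) (iotaK : cancel iota q)
  (iota_p : forall v, p (iota v)) (qK : forall X, p X -> iota (q X) = X).
Variables (B : V -> V -> R) (B_bil : bilinear_form B).
Variables (G K : set H) (F : H -> V) (expi : 'rV[R]_r -> H).
Hypotheses (F_smooth : forall g, smooth_at a vH F g) (F_p : forall g, p (F g))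
  (expi_smooth : forall v, smooth_at vr a expi v) (expi0 : expi 0 = 1%g)
  (F_pos : forall g v, G g -> v <> 0 ->
    0 < 'd (fun t : R^o => B (F (expi (t *: v) * g)%g) (iota v) : R^o) 0 1).
Variable Omega : set V.
Hypotheses (G_subgroup : subgroup G) (expi_G : forall v, G (expi v))
  (expiN : forall v, expi (- v) = (expi v)^-1%g)
  (Omega_p : Omega `<=` p) (F_Omega : forall g, G g -> Omega (F g))
  (Omega_convex : forall y z (t : R), Omega y -> Omega z -> 0 <= t <= 1 -> Omega (y + t *: (z - y)))
  (F_proper : forall y, Omega y -> exists C N, [/\ compact C, C `<=` G, open N /\ N y &
     forall g, G g -> N (F g) -> C g]).
Local Notation fibre y := (G `&` F @^-1` [set y]).

(** With X(g, y) the unique small solution, the map g to (F g, exp(X(g, y0)) g) is inverted by (y,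
    g) to exp(X(g, y)) g. Properness confines all relevant g to the compact set C on which X is
    defined and smooth. *)
Lemma trivialization y0 : Omega y0 -> exists2 N : set V, open N /\ N y0 &
  exists (h : H -> H) (g : V * H -> H),
    diffeo a (prod_atlas vH a) (G `&` F @^-1` N) ((Omega `&` N) `*` fibre y0)
      (fun x => (F x, h x)) g.
Proof.
move=> Oy0; have [G1 GM GV] := G_subgroup.
have [C [N1 [cC CG [oN1 N1y] NC]]] := F_proper Oy0.
have [rho rho0 inj] := uniform_injectivity Hlie iota_lin q_lin qK B_bil F_smooth F_p expi_smooth expi0 F_pos cC CG.
have [eps eps0 ex] := uniform_existence Hlie iota_lin q_lin qK B_bil F_smooth F_p expi_smooth expi0 F_pos cC CG rho0.
(* Half of eps, so that two values in the ball are within eps of each other. *)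
pose N := N1 `&` ball y0 (eps / 2).
have oN : open N by apply: openI => //; exact: ball_open.
have Ny0 : N y0 by split => //; apply: ballxx; rewrite divr_gt0.
pose D : set (H * V) := [set z | [/\ C z.1, p z.2 & `|z.2 - F z.1| < eps]].
pose X (z : H * V) := xget 0 [set v | `|v| < rho /\ F (expi v * z.1)%g = z.2].
have XE z v : D z -> `|v| < rho -> F (expi v * z.1)%g = z.2 -> X z = v.
  move=> [Cz pz _] vr' Fv; rewrite /X; case: xgetP => [w _ [wr Fw]|/(_ v)]; last by case.
  by apply: (inj z.1) => //; rewrite Fw Fv.
have XP z : D z -> `|X z| < rho /\ F (expi (X z) * z.1)%g = z.2.
  move=> Dz; have [Cz pz ze] := Dz.
  have [Psi _ NP] := ex z.1 z.2 Cz pz ze.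
  have [h1 h2] := nbhs_singleton NP pz.
  by rewrite (XE z (Psi (z.1, z.2))).
have sX : smooth_on (prod_atlas a vH) vr D X.
  move=> [g y] Dz; have [Cz pz ze] := Dz.
  have [Psi sPsi NP] := ex g y Cz pz ze; exists Psi => //.
  apply: filterS NP => z h Dz'; have [_ pz' _] := Dz'; have [h1 h2] := h pz'.
  by rewrite (XE z (Psi z)).
pose sig (z : H * V) := (expi (X z) * z.1)%g.
have ssig : smooth_on (prod_atlas a vH) a D sig.
  move=> z Dz; have [Psi sPsi NP] := sX z Dz.
  exists (fun z => expi (Psi z) * z.1)%g.
    have [s1 _] := smooth_at_comp sPsi (expi_smooth _).
    exact: (smooth_mul Hlie s1 (smooth_at_fst a vH z).1).1.
  by apply: filterS NP => z' h Dz'; rewrite /sig h.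
have inN g y : G g -> N (F g) -> Omega y -> N y -> D (g, y).
  move=> Gg [N1g bg] Oy [_ b'y]; split => /=; [exact: NC|exact: Omega_p|].
  move: bg b'y; rewrite -!ball_normE /ball_ /= => b1 b2.
  rewrite -[y - F g](subrKA y0) (le_lt_trans (ler_normD _ _)) // [eps]splitr ltrD //.
  by rewrite distrC.
have sigG z : D z -> G (sig z).
  by move=> [Cz _ _]; apply: GM => //; exact: CG.
have sigF z : D z -> F (sig z) = z.2 by move=> /XP [].
(* The way back is solved by -X(g, y), which has the same norm; uniqueness of the small solution
   identifies it. *)
have back g y : D (g, y) -> D (sig (g, y), F g) -> sig (sig (g, y), F g) = g.
  move=> D1 D2; have [h1 h2] := XP _ D1.
  rewrite {1}/sig (XE _ (- X (g, y)) D2) ?normrN //; last first.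
    by rewrite /= /sig /= expiN mulgA mulVg mul1g.
  by rewrite /= /sig /= expiN mulgA mulVg mul1g.
exists N => //; exists (fun g => sig (g, y0)), (fun z => sig (z.2, z.1)).
have A1 g : (G `&` F @^-1` N) g -> D (g, y0) by move=> [Gg Ng]; exact: inN.
have A2 z : ((Omega `&` N) `*` fibre y0) z -> D (z.2, z.1).
  by move=> [[Oz Nz] [Gz Fz]]; apply: inN => //; rewrite Fz.
split.
- move=> g Ag; have D1 := A1 g Ag; have [Gg Ng] := Ag; have Og := F_Omega Gg.
  have Fs := sigF _ D1; have Ns : N (F (sig (g, y0))) by rewrite Fs.
  split; last exact: back D1 (inN _ _ (sigG _ D1) Ns Og Ng).
  by split => //=; split => //; exact: sigG.
- move=> [y g] Bz; have D1 := A2 _ Bz; have [[Oy Ny] [Gg Fg]] := Bz; rewrite /= in D1 Oy Ny Gg Fg.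
  have Fs := sigF _ D1; rewrite /= in Fs; split.
    by split; [exact: sigG|rewrite /= Fs].
  rewrite /= Fs; congr pair; rewrite -Fg; apply: back => //; rewrite Fg.
  by apply: inN => //; [exact: sigG|rewrite Fs].
- apply: smooth_on_pair; first by apply: smooth_onT => g _; exact: F_smooth.
  apply: (smooth_on_comp (f := fun g => (g, y0)) (g := sig) A1 _ ssig).
  apply: smooth_onT => g _.
  exact: (smooth_at_pair (smooth_at_id a g).1 (smooth_at_cst a vH y0 g)).1.
- apply: (smooth_on_comp (f := fun z : V * H => (z.2, z.1)) (g := sig) A2 _ ssig).
  apply: smooth_onT => z _.
  exact: (smooth_at_pair (smooth_at_snd vH a z).1 (smooth_at_fst vH a z).1).1.
Qed.

Lemma fibres_diffeomorphic y0 : Omega y0 -> exists2 N : set V, open N /\ N y0 &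
  forall y, Omega y -> N y -> diffeomorphic a a (fibre y) (fibre y0).
Proof.
move=> Oy0; have [N oN [h [g [h1 g1 sh sg]]]] := trivialization Oy0.
exists N => // y Oy Ny.
have A1 x : fibre y x -> (G `&` F @^-1` N) x by move=> [Gx Fx]; split => //=; rewrite Fx.
have B1 z : fibre y0 z -> ((Omega `&` N) `*` fibre y0) (y, z) by move=> fz; split.
exists h, (fun z => g (y, z)); split.
- move=> x fx; have [[_ hx] gx] := h1 x (A1 x fx); split => //.
  by have [_ <-] := fx.
- move=> z fz; have [[Gg _] [Fg hg]] := g1 _ (B1 z fz).
  by split.
- have s1 := smooth_on_sub A1 sh.
  have s2 : smooth_on (prod_atlas vH a) a [set: V * H] snd.
    by apply: smooth_onT => z _; exact: (smooth_at_snd vH a z).1.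
  exact: (smooth_on_comp (f := fun x => (F x, h x)) (fun x _ => I) s1 s2).
- apply: (smooth_on_comp (f := fun z => (y, z)) B1 _ sg).
  apply: smooth_onT => z _.
  exact: (smooth_at_pair (smooth_at_cst a vH y z) (smooth_at_id a z).1).1.
Qed.

(** Nearby fibres are diffeomorphic, so being nonempty is locally constant on the convex [Omega];
    the fibre through 1 is nonempty. *)
Lemma mean_gradient_onto : F @` G = Omega.
Proof.
have [G1 _ _] := G_subgroup.
apply/seteqP; split => [_ [g Gg <-]|y Oy]; first exact: F_Omega.
suff [g [Gg Fg]] : exists g, fibre y g by exists g.
apply: (segment_induction (P := fun y => exists g, fibre y g) Omega_convex _ (F_Omega G1) Oy); last by exists 1%g.
move=> y0 Oy0; have [N oN dN] := fibres_diffeomorphic Oy0; exists N => //.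
move=> z z' Oz Oz' Nz Nz' [g fg].
have [f [f' [h1 _ _ _]]] := diffeomorphic_trans (dN z Oz Nz) (diffeomorphic_sym (dN z' Oz' Nz')).
by exists (f g); exact: (h1 g fg).1.
Qed.

Lemma mean_gradient_fibration : smooth_fibration a vH G Omega F.
Proof.
split; [by apply: smooth_onT => g _; exact: F_smooth|exact: mean_gradient_onto|].
by move=> y /trivialization.
Qed.

Hypotheses (K_subgroup : subgroup K) (KG : K `<=` G) (Omega0 : Omega 0)
  (F_zero : forall k g, K k -> F g = 0 -> F (k * g)%g = 0)
  (F_ray : forall g v, G g -> F g = 0 -> F (expi v * g)%g = 0 -> v = 0)
  (G_polar : forall g, G g -> exists k v, K k /\ g = (k * expi v)%g).

(** Two points of the zero fibre differ by some k exp(v) in G; since K preserves that fibre, k can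
    be stripped, and [F_ray] forces v = 0. Right translation by a point g0 of the fibre is the
    diffeomorphism. *)
Lemma zero_fibre : diffeomorphic a a (fibre 0) K.
Proof.
have [G1 GM GV] := G_subgroup; have [K1 KM KV] := K_subgroup.
have [g0 Gg0 Fg0] : (F @` G) 0 by rewrite mean_gradient_onto.
exists (fun g => g * g0^-1)%g, (fun k => k * g0)%g; split.
- move=> g [Gg Fg]; rewrite mulgVK; split => //.
  have [k [v [Kk E1]]] := G_polar (GM _ _ Gg (GV _ Gg0)).
  have v0 : v = 0.
    apply: (F_ray Gg0 Fg0).
    have -> : (expi v * g0 = k^-1 * g)%g by rewrite -[g in RHS](mulgVK g0) E1 !mulgA mulVg mul1g.
    by apply: F_zero => //; exact: KV.
  by rewrite E1 v0 expi0 mulg1.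
- move=> k Kk; rewrite mulgK; split => //; split; first by apply: GM => //; exact: KG.
  exact: F_zero.
- by apply: smooth_onT => g _; exact: smooth_mulr.
- by apply: smooth_onT => g _; exact: smooth_mulr.
Qed.

(** The diffeomorphism type is carried from the fibre over 0 along a segment in [Omega]. *)
Lemma fibre_diffeomorphic y : Omega y -> diffeomorphic a a (fibre y) K.
Proof.
move=> Oy; apply: (segment_induction (P := fun y => diffeomorphic a a (fibre y) K) Omega_convex _ Omega0 Oy zero_fibre).
move=> y0 Oy0; have [N oN dN] := fibres_diffeomorphic Oy0; exists N => //.
move=> z z' Oz Oz' Nz Nz'; apply: diffeomorphic_trans.
exact: diffeomorphic_trans (dN z' Oz' Nz') (diffeomorphic_sym (dN z Oz Nz)).
Qed.

End Fibration.

(** * Application to the averaged gradient map *)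

Lemma smooth_on_setT {R : realType} (X Y : topologicalType) (E F : normedModType R)
  (a : atlas X E) (b : atlas Y F) {aX : IsAtlas a} {bY : IsAtlas b} (f : X -> Y) x :
  smooth_on a b [set: X] f -> smooth_at a b f x.
Proof.
move=> /(_ x I) [g sg gf]; apply: smooth_at_ext sg.
by apply: filterS gf => y; exact.
Qed.

Lemma smooth_fibration_eq {R : realType} (X Y : topologicalType) (E F : normedModType R)
  (a : atlas X E) (b : atlas Y F) (A : set X) (B : set Y) (f g : X -> Y) :
  (forall x, A x -> f x = g x) -> smooth_fibration a b A B f -> smooth_fibration a b A B g.
Proof.
move=> fg [sf fA loc].
have preE N : A `&` f @^-1` N = A `&` g @^-1` N.
  by apply/seteqP; split => x [Ax] /=; rewrite fg.
split; first exact: smooth_on_eq sf.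
  by rewrite -fA; apply/seteqP; split => _ [x Ax <-]; exists x => //; rewrite fg.
move=> y By; have [N oN [h [g' [h1 h2 h3 h4]]]] := loc y By; exists N => //; exists h, g'.
rewrite -!preE; split.
- by move=> x Ax; have [Ax' _] := Ax; rewrite -fg //; exact: h1.
- by move=> z Bz; have [Ag E1] := h2 z Bz; have [Ag' _] := Ag; rewrite -fg.
- by apply: smooth_on_eq h3 => x [Ax _]; rewrite fg.
- exact: h4.
Qed.

Lemma form_ball_compact {R : realType} (V : normedModType R) {fV : FinDim V} (B : V -> V -> R) (T : R) :
  bilinear_form B -> (forall v, v <> 0 -> 0 < B v v) -> compact [set v | B v v <= T ^+ 2].
Proof.
move=> B_bil B_pos; have T_sub : subspace_set [set: V] by [].
have [c c0 hc] := form_coercive T_sub closedT B_bil (fun v _ => @B_pos v).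
apply: (findim_compact (M := 1 + c^-1 * T ^+ 2)).
  move=> X /= BX; have := hc X I => h.
  have : `|X| ^+ 2 <= c^-1 * T ^+ 2.
    by rewrite mulrC ler_pdivlMr // mulrC; exact: le_trans h BX.
  by have := normr_ge0 X; nra.
have cB : continuous (fun v => B v v : R^o) by move=> v; apply: form_continuous => //; exact: cvg_id.
by apply: (@preimage_closed _ _ (fun v => B v v : R^o) [set x | x <= T ^+ 2]) => [v _|]; [exact: cB|exact: closed_le].
Qed.

Theorem theorem5p2 (R : realType)
  (Z : ptopologicalType) (m : nat) (aZ : atlas Z (Cn R m))
  (omega : Z -> Cn R m -> Cn R m -> R)
  (Z_compact : compact [set: Z]) (Z_connected : connected [set: Z])
  (Z_kaehler : is_kaehler aZ omega)
  (UC : topGroupType) (d : nat) (aUC : atlas UC (Cn R d)) (U : set UC)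
  (UC_lie : is_complex_lie_group aUC)
  (U_subgroup : subgroup U) (U_compact : compact U) (U_connected : connected U)
  (UC_complexification : is_complexification aUC U)
  (UC_cartan : cartan_decomposition aUC U)
  (act : UC -> Z -> Z) (act_holomorphic : is_holomorphic_action aUC aZ act)
  (U_omega : preserves_form aZ act omega U)
  (s : Cn R d -> Cn R d -> R) (s_product : is_invariant_product aUC U s)
  (mu : Z -> Cn R d) (mu_momentum : is_momentum_map aUC aZ act omega U s mu)
  (B : Cn R d -> Cn R d -> R) (B_form : is_admissible_form aUC U B)
  (G : set UC) (G_compatible : is_compatible aUC U G)
  (K := G `&` U) (p := gp_p aUC U G)
  (mup := gradient_mu s p mu)
  (mup_gradient : forall beta, p beta ->
     is_gradient aZ omega (fun z => B (mup z) beta)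
       (fundamental_field aUC aZ act beta))
  (M : set Z) (M_compact : compact M) (M_submanifold : submanifold aZ M)
  (M_stable : forall g x, G g -> M x -> M (act g x))
  (mup_max : forall fa, maximal_abelian aUC p fa -> forall beta, fa beta ->
     unique_local_maximum M (fun x => B (mup x) beta))
  (nu nu0 : probability (borel Z) R)
  (nu_M : nu M = 1%E) (nu0_M : nu0 M = 1%E)
  (nu0_smooth : smooth_measure aZ M nu0)
  (nu0_invariant : invariant_measure act K nu0)
  (nu_nu0 : nu `<< nu0)
  (Omega := interior_in p (convex_hull (mup @` M)))
  (Omega0 : Omega 0)
  (F := fun g : UC => integral_Cn M mup (push (act g) nu)) :
  [/\ F @` G = Omega,
      smooth_fibration aUC (@vec_atlas R (Cn R d)) G Omega F &
      forall y, Omega y ->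
        let fibre := G `&` F @^-1` [set y] in
        [/\ compact fibre, connected fibre &
            diffeomorphic aUC aUC fibre K]].
Proof.
have bH : IsAtlas aUC by have [[? _] _ _] := UC_lie; exact: manifold_isAtlas.
have bZ : IsAtlas aZ by have [[? _] _ _ _ _ _ _] := Z_kaehler; exact: manifold_isAtlas.
have hZ : hausdorff_space Z by have [[[? _ _ _] _] _ _ _ _ _ _] := Z_kaehler.
have p_sub := p_subspace UC_lie U_subgroup UC_cartan G_compatible.
have p_cl := p_closed UC_lie U_subgroup UC_cartan G_compatible.
have [p_0 pP] := p_sub.
have pN X : p X -> p (- X) by move=> pX; rewrite -scaleN1r -[_ *: _]addr0; exact: pP.
have B_bil := form_bilinear B_form.
have B_sym := form_symmetric B_form.
have B_pos X : p X -> X <> 0 -> 0 < B X X by move=> /p_iu; exact: form_positive.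
have mup_in : forall z, p (mup z) by exact: (gradient_mu_in UC_lie U_subgroup UC_cartan mu s_product G_compatible).
have mup_smooth := gradient_mu_smooth Z_kaehler UC_lie U_subgroup UC_cartan s_product mu_momentum G_compatible.
have mup_eq k z (Kk : K k) : mup (act k z) = Ad aUC k (mup z).
  exact: (gradient_mu_equivariant UC_lie U_subgroup UC_cartan s_product mu_momentum G_compatible).
have G_sub := compatible_subgroup G_compatible; have [G1 GM GV] := G_sub.
have K_sub : subgroup K := K_subgroup U_subgroup G_compatible; have [_ _ KV] := K_sub.
have M_closed : closed M by exact: compact_closed.
have mup_cont : continuous mup by move=> z; exact: smooth_at_cont (mup_smooth z).
have [x0 Mx0 _] : exists2 x, M x & ~ (set0 : set Z) x.
  by apply: (negligible_exists nu_M (borel_closed M_closed)); exact: negligible_set0.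
have A0 : mup @` M !=set0 by exists (mup x0); exists x0.
have A_p : mup @` M `<=` p by move=> _ [x _ <-].
have OmegaP := [elaborate interior_hullP p_sub p_cl B_bil B_sym B_pos A_p A0].
have p_curve X : p X -> exists2 c, one_parameter_subgroup aUC X c &
    (forall t, G (c t)) /\ forall t : R, lie_exp aUC (t *: X) = c t.
  move=> pX; have [c hc] := iu_one_ps UC_lie U_subgroup UC_cartan (p_iu pX); exists c => //.
  have cE t : lie_exp aUC (t *: X) = c t := lie_expZ UC_lie t hc.
  by split => // t; rewrite -cE; exact: (p_exp (p_scale t pX)).
have ip_curve X : p X -> exists2 c, one_parameter_subgroup aUC (- Ci X) c & forall t, U (c t).
  move=> pX; have [c hc] := compact_one_ps Z_connected Z_kaehler UC_lie U_subgroup UC_cartan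
    act_holomorphic s_product mu_momentum G_compatible Omega0 pX.
  exists c => // t; rewrite -(lie_expZ UC_lie t hc).
  have [W UW <-] := p_iu pX; rewrite CiCi opprK; exact: UW.
(* Every element of p lies in a maximal Abelian subalgebra, so the hypothesis reaches all directions
   of p. *)
have max_p X : p X -> unique_local_maximum M (fun x => B (mup x) X).
  move=> pX; have [fa hfa faX] := maximal_abelian_exists UC_lie U_subgroup UC_cartan G_compatible pX.
  exact: mup_max hfa _ faX.
have [_ O0] := (OmegaP 0).1 Omega0.
have B0 X : B 0 X = 0 by rewrite -(scale0r (0 : Cn R d)) (bilZl _ _ _ B_bil) mul0r.
(* As 0 is interior, some component value on M is positive for X and some is positive for -X. *)
have nonconst X : p X -> X <> 0 -> exists x y, [/\ M x, M y & B (mup x) X < B (mup y) X].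
  move=> pX X0; have nX0 : - X <> 0 by move=> /eqP; rewrite oppr_eq0 => /eqP.
  have [_ [y My <-]] := O0 X pX X0; have [_ [x Mx <-]] := O0 (- X) (pN X pX) nX0.
  rewrite !B0 -scaleN1r (bilZr _ _ _ B_bil) mulN1r oppr_gt0 => lx ly.
  by exists x, y; split => //; exact: lt_trans lx ly.
pose Fm := mean_gradient act mup nu.
have FE g : G g -> Fm g = F g.
  by move=> Gg; rewrite /F (mean_gradientE Z_compact Z_kaehler UC_lie act_holomorphic mup_smooth M_compact M_stable nu_M Gg).
have Fm_smooth g : smooth_at aUC (@vec_atlas R (Cn R d)) Fm g.
  exact: (mean_gradient_smooth Z_compact Z_kaehler UC_lie act_holomorphic mup_smooth).
have Fm_p g : p (Fm g).
  exact: (mean_gradient_in Z_compact Z_kaehler UC_lie act_holomorphic p_sub mup_in mup_smooth).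
have Fm_eq k g : K k -> Fm (k * g)%g = Ad aUC k (Fm g).
  move=> Kk; apply: (mean_gradient_equivariant Z_compact Z_kaehler UC_lie act_holomorphic mup_smooth).
  by move=> z; exact: mup_eq.
(* Coordinates on p: equations for the small solution are solved in row vectors, where p has become
   a whole space. *)
have [r [iota [q [iota_lin q_lin iotaK iota_p qK]]]] := subspace_param (V := (Cn R d : normedModType R)) p_sub.
have iota0 v : iota v = 0 -> v = 0 by move=> iv; rewrite -[v]iotaK iv (lin_zero q_lin).
pose expi v := lie_exp aUC (iota v).
have expi_smooth v : smooth_at (@vec_atlas R 'rV[R]_r) aUC expi v.
  have [f1 [f2 [_ _ _ _ se]]] := polar_inverse UC_lie U_subgroup UC_cartan.
  have si : smooth_on (@vec_atlas R 'rV[R]_r) (@vec_atlas R (Cn R d)) [set: _] iota.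
    by apply: smooth_onT => w _; apply/smooth_at_vec; exact: smooth_near_linear.
  have rI : IsAtlas (@vec_atlas R 'rV[R]_r) by exact: vec_atlas_isAtlas.
  have se' := [elaborate smooth_on_comp (fun w (_ : setT w) => p_iu (iota_p w)) si se].
  exact: smooth_on_setT se'.
have expi0 : expi 0 = 1%g by rewrite /expi (lin_zero iota_lin) (lie_exp0 UC_lie).
have expiN v : expi (- v) = (expi v)^-1%g.
  by rewrite /expi (lin_opp iota_lin) (lie_exp_opp UC_lie U_subgroup UC_cartan) //; exact: p_iu (iota_p v).
have expi_G v : G (expi v) by exact: (p_exp (iota_p v)).
have expiZ c t v : (forall t : R, lie_exp aUC (t *: iota v) = c t) -> expi (t *: v) = c t.
  by move=> cE; rewrite /expi (lin_scale iota_lin).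
have KG : K `<=` G by move=> k [].
have mono g v s1 t1 : v <> 0 -> G g -> s1 < t1 ->
    B (Fm (expi (s1 *: v) * g)%g) (iota v) < B (Fm (expi (t1 *: v) * g)%g) (iota v).
  move=> v0 Gg st; have [c hc [cG cE]] := p_curve _ (iota_p v); rewrite !(expiZ c) //.
  apply: (mean_gradient_mono Z_compact Z_kaehler UC_lie U_subgroup U_compact act_holomorphic U_omega
    B_bil p_sub p_curve ip_curve mup_smooth mup_gradient M_compact M_submanifold M_stable GV max_p nonconst
    nu_M nu0_smooth nu_nu0 GM (iota_p v) _ hc cG Gg st).
  by move=> /iota0.
have F_pos g v : G g -> v <> 0 ->
    0 < 'd (fun t : R^o => B (Fm (expi (t *: v) * g)%g) (iota v) : R^o) 0 1.
  move=> Gg v0; have [c hc [cG cE]] := p_curve _ (iota_p v).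
  have -> : (fun t : R^o => B (Fm (expi (t *: v) * g)%g) (iota v) : R^o) =
      (fun t : R^o => B (Fm (c t * g)%g) (iota v) : R^o).
    by apply/funext => t; rewrite (expiZ c).
  have [_ ->] := mean_gradient_derivative Z_compact Z_kaehler UC_lie act_holomorphic B_bil mup_smooth
    mup_gradient nu (iota_p v) hc g 0.
  apply: (speed_average_gt0 Z_compact Z_kaehler UC_lie U_subgroup U_compact act_holomorphic U_omega
    B_bil p_sub p_curve ip_curve mup_smooth mup_gradient M_compact M_submanifold M_stable GV max_p nonconst
    nu_M nu0_smooth nu_nu0 (iota_p v)); first by move=> /iota0.
  exact: GM.
have F_Omega g : G g -> Omega (Fm g).
  move=> Gg; apply/OmegaP; split=> [|X pX X0]; first exact: Fm_p.
  have [x Mx lx] := mean_gradient_lt Z_compact Z_kaehler UC_lie U_subgroup U_compact act_holomorphic U_omega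
    B_bil p_sub p_curve ip_curve mup_smooth mup_gradient M_compact M_submanifold M_stable GV max_p nonconst
    nu_M nu0_smooth nu_nu0 GM pX X0 Gg.
  by exists (mup x) => //; exists x.
have Ad_p k X : K k -> p X -> p (Ad aUC k X) by exact: p_Ad.
(* [mean_gradient_limit] concerns the curve through 1. Writing exp(tX) k as k exp(t Ad(k^-1) X),
   equivariance of F and invariance of B under Ad(k) reduce to it. *)
have lim v k e c : K k -> (mup @` M) e -> c < B e (iota v) ->
    exists T : R, forall t, T <= t -> c < B (Fm (expi (t *: v) * k)%g) (iota v).
  move=> Kk [x Mx <-] lt1; have Kk' := KV _ Kk; set X := iota v; have pX : p X := iota_p v.
  set X1 := Ad aUC k^-1%g X; have pX1 : p X1 by exact: Ad_p.
  have XE : Ad aUC k X1 = X by rewrite /X1 (AdKV UC_lie).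
  have [c1 hc1 [c1G c1E]] := p_curve _ pX1.
  have Mx' : M (act k^-1%g x) by apply: M_stable => //; exact: KG.
  have lt2 : c < B (mup (act k^-1%g x)) X1.
    by rewrite mup_eq // (form_invariant B_form).
  have [T hT] := mean_gradient_limit Z_compact Z_kaehler UC_lie U_subgroup U_compact act_holomorphic U_omega
    B_bil ip_curve mup_smooth mup_gradient M_compact M_submanifold M_stable GV max_p nu_M nu0_smooth nu_nu0
    pX1 hc1 c1G G1 Mx' lt2.
  exists T => t Tt; have -> : (expi (t *: v) * k = k * c1 t)%g.
    rewrite /expi (lin_scale iota_lin) -/X -XE -(lin_scale (Ad_linear aUC k)).
    rewrite (exp_Ad UC_lie U_subgroup UC_cartan); last exact: (p_iu (p_scale t pX1)).
    by rewrite c1E mulgVK.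
  by rewrite Fm_eq // -XE (form_invariant B_form); exact: hT.
have K_cpt : compact K := K_compact G_compatible U_compact.
have Fcont : continuous (fun z : 'rV[R]_r * UC => Fm (expi z.1 * z.2)%g).
  move=> z; have s1 := [elaborate translate_smooth UC_lie Fm_smooth expi_smooth
    (smooth_at_fst (@vec_atlas R 'rV[R]_r) aUC z).1 (smooth_at_snd (@vec_atlas R 'rV[R]_r) aUC z).1].
  exact: smooth_at_cont s1.
have pos_iota v : iota v <> 0 -> 0 < B (iota v) (iota v) by exact: B_pos (iota_p v).
have F_proper y : Omega y -> exists C N, [/\ compact C, C `<=` G, open N /\ N y &
    forall g, G g -> N (Fm g) -> C g].
  move=> Oy; have [py Hy] := (OmegaP y).1 Oy.
  have Hy' v : v <> 0 -> exists2 e, (mup @` M) e & B y (iota v) < B e (iota v).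
    by move=> v0; apply: Hy => // /iota0.
  have [T [N [T0 oN NP]]] := mean_gradient_proper iota_lin iota0 B_bil pos_iota B_sym K_cpt Fcont
    (fun v k s1 t1 v0 Kk => mono k v s1 t1 v0 (KG _ Kk)) lim Hy'.
  pose Bi := pullback_form iota B.
  exists [set (expi z.1 * z.2)%g | z in [set v | Bi v v <= T ^+ 2] `*` K], N; split => //.
  - apply: continuous_compact.
      apply: continuous_subspaceT => z.
      have s1 := [elaborate (smooth_at_comp (smooth_at_fst (@vec_atlas R 'rV[R]_r) aUC z).1 (expi_smooth z.1)).1].
      exact: smooth_at_cont (smooth_mul UC_lie s1 (smooth_at_snd (@vec_atlas R 'rV[R]_r) aUC z).1).1.
    apply: compact_setX => //; apply: form_ball_compact; first exact: pullback_bilinear.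
    by move=> v v0; apply: pos_iota => /iota0.
  - by move=> _ [z [_ Kz] <-]; apply: GM => //; exact: KG.
  - move=> g Gg Ng; have [k [X [Kk pX gE]]] := polar_exists G_compatible Gg.
    (* k exp(X) = exp(Ad(k) X) k puts the polar decomposition in the order used for properness. *)
    have gE' : g = (expi (q (Ad aUC k X)) * k)%g.
      rewrite /expi qK; last exact: Ad_p.
      by rewrite (exp_Ad UC_lie U_subgroup UC_cartan _ (p_iu pX)) mulgVK.
    exists (q (Ad aUC k X), k) => //; split => //=; apply: (NP _ _ Kk).
    by rewrite -gE'.
have Omega_p : Omega `<=` p by move=> y [].
have Omega_cvx y z (t : R) : Omega y -> Omega z -> 0 <= t <= 1 -> Omega (y + t *: (z - y)).
  exact: (interior_hull_convex p_sub p_cl B_bil B_sym B_pos A_p A0).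
have F_zero k g : K k -> Fm g = 0 -> Fm (k * g)%g = 0.
  by move=> Kk F0; rewrite Fm_eq // F0 (lin_zero (Ad_linear aUC k)).
(* The component of F along v is strictly increasing on the ray, so it cannot vanish at both times 0
   and 1. *)
have F_ray g v : G g -> Fm g = 0 -> Fm (expi v * g)%g = 0 -> v = 0.
  move=> Gg F0 F1; apply: contrapT => v0.
  have := mono g v 0 1 v0 Gg ltr01.
  by rewrite scale0r scale1r expi0 mul1g F0 F1 ltxx.
have G_polar g : G g -> exists k v, K k /\ g = (k * expi v)%g.
  move=> Gg; have [k [X [Kk pX gE]]] := polar_exists G_compatible Gg.
  by exists k, (q X); split => //; rewrite /expi qK.
have onto := mean_gradient_onto UC_lie iota_lin q_lin qK B_bil Fm_smooth Fm_p expi_smooth expi0 F_pos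
  G_sub expi_G expiN Omega_p F_Omega Omega_cvx F_proper.
have fib := mean_gradient_fibration UC_lie iota_lin q_lin qK B_bil Fm_smooth Fm_p expi_smooth expi0 F_pos
  G_sub expi_G expiN Omega_p F_Omega Omega_cvx F_proper.
have fibre_K := fibre_diffeomorphic UC_lie iota_lin q_lin qK B_bil Fm_smooth Fm_p expi_smooth expi0 F_pos
  G_sub expi_G expiN Omega_p F_Omega Omega_cvx F_proper K_sub KG Omega0 F_zero F_ray G_polar.
have fibreE y : G `&` F @^-1` [set y] = G `&` Fm @^-1` [set y].
  by apply/seteqP; split => g [Gg] /=; rewrite FE.
split.
- by rewrite -onto; apply/seteqP; split => _ [g Gg <-]; exists g => //; rewrite FE.
- exact: smooth_fibration_eq FE fib.
- move=> y Oy /=; rewrite fibreE; have dy := fibre_K y Oy; have dy' := diffeomorphic_sym dy.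
  split => //; first exact: diffeomorphic_compact dy' K_cpt.
  exact: diffeomorphic_connected dy' (K_connected UC_lie U_subgroup UC_cartan G_compatible).
Qed.
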